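(* Let $1<p<\infty$, $d\ge1$, and let $M$ be a nonempty compact subset of $\mathbb{R}^d$. There is a constant $\lambda_p\ge1$ depending only on $p$ and a unital isomorphism $\eta_M:C(M)\to B(l^p)$ such that: (i) $\lambda_p^{-1}\|h\|\le\|\eta_M(h)\|\le\lambda_p\|h\|$ for all $h\in C(M)$; (ii) $\eta_M$ is $\lambda_p$-similar to $\eta_M\oplus\eta_M$; (iii) $\pi\circ\eta_M$ is an isomorphism; (iv) whenever $\psi:C(M)\to B(l^p)$ is a map such that $\pi\circ\psi$ is a bounded unital homomorphism, there exist an invertible operator $S:l^p\oplus l^p\to l^p$ and a map $\psi^{(-1)}:C(M)\to B(l^p)$ such that (a) $\pi\circ\psi^{(-1)}$ is a unital isomorphism (into) $C(M)\to B(l^p)/K(l^p)$, (b) $\|S\|\|S^{-1}\|\le 2^{12d}\|\pi\circ\psi\|^{12}\lambda_p$, and (c) $\eta_M(h)-S(\psi(h)\oplus\psi^{(-1)}(h))S^{-1}$ is compact for all $h\in C(M)$.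
   Context: $\pi:B(l^p)\to B(l^p)/K(l^p)$ is the quotient map; a map means a function with no assumed continuity or algebraic property. A homomorphism between Banach algebras is an isomorphism (into) if it is bounded above and below by constant multiples of the norm. Two maps $\rho_1:\Lambda\to B(\mathcal{Y}_1)$, $\rho_2:\Lambda\to B(\mathcal{Y}_2)$ are $\lambda$-similar if there is an invertible $S:\mathcal{Y}_1\to\mathcal{Y}_2$ with $\|S\|\|S^{-1}\|\le\lambda$ and $\rho_2(a)=S\rho_1(a)S^{-1}$ for all $a$. Direct sums are $l^p$-direct sums, and $(\rho_1\oplus\rho_2)(a)=\rho_1(a)\oplus\rho_2(a)$. *)

(* Defs.v *)
From Stdlib Require Import Reals Classical ClassicalEpsilon.
Open Scope R_scope.

Definition supR (E : R -> Prop) : R :=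
  match excluded_middle_informative (bound E /\ exists x, E x) with
  | left H => proj1_sig (completeness E (proj1 H) (proj2 H))
  | right _ => 0
  end.
Definition infR (E : R -> Prop) : R := - supR (fun r => E (- r)).

(* value of a convergent series (0 if it diverges) *)
Definition sumR (u : nat -> R) : R :=
  match excluded_middle_informative (exists l, infinite_sum u l) with
  | left H => proj1_sig (constructive_indefinite_description _ H)
  | right _ => 0
  end.

(* a^q for a >= 0 (with 0^q = 0) *)
Definition rpow (a q : R) : R := if Rle_dec a 0 then 0 else Rpower a q.

Record Cx := mkCx { cRe : R; cIm : R }.
Definition Cadd (z w : Cx) : Cx := mkCx (cRe z + cRe w) (cIm z + cIm w).
Definition Cmul (z w : Cx) : Cx :=
  mkCx (cRe z * cRe w - cIm z * cIm w) (cRe z * cIm w + cIm z * cRe w).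
Definition C0 : Cx := mkCx 0 0.
Definition C1 : Cx := mkCx 1 0.
Definition Cm1 : Cx := mkCx (-1) 0.
Definition Cnorm (z : Cx) : R := sqrt (cRe z ^ 2 + cIm z ^ 2).

Record NSpace := mkNS {
  car : Type;
  mem : car -> Prop;
  vadd : car -> car -> car;
  vscale : Cx -> car -> car;
  nrm : car -> R }.

Definition vsub (X : NSpace) (x y : car X) : car X := vadd X x (vscale X Cm1 y).

Definition seqC := nat -> Cx.
Definition lp (p : R) : NSpace :=
  mkNS seqC
    (fun x => exists l, infinite_sum (fun n => rpow (Cnorm (x n)) p) l)
    (fun x y n => Cadd (x n) (y n))
    (fun a x n => Cmul a (x n))
    (fun x => rpow (sumR (fun n => rpow (Cnorm (x n)) p)) (/ p)).

Definition lp2 (p : R) : NSpace :=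
  mkNS (seqC * seqC)%type
    (fun z => mem (lp p) (fst z) /\ mem (lp p) (snd z))
    (fun z w => (vadd (lp p) (fst z) (fst w), vadd (lp p) (snd z) (snd w)))
    (fun a z => (vscale (lp p) a (fst z), vscale (lp p) a (snd z)))
    (fun z => rpow (rpow (nrm (lp p) (fst z)) p + rpow (nrm (lp p) (snd z)) p) (/ p)).

Definition lin_on (X Y : NSpace) (T : car X -> car Y) : Prop :=
  forall a x y, mem X x -> mem X y ->
    T (vadd X (vscale X a x) y) = vadd Y (vscale Y a (T x)) (T y).

Definition bounded_op (X Y : NSpace) (T : car X -> car Y) : Prop :=
  (forall x, mem X x -> mem Y (T x)) /\ lin_on X Y T /\
  exists c, forall x, mem X x -> nrm Y (T x) <= c * nrm X x.

Definition opnorm (X Y : NSpace) (T : car X -> car Y) : R :=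
  supR (fun r => exists x, mem X x /\ nrm X x <= 1 /\ r = nrm Y (T x)).

Definition invertible_pair (X Y : NSpace) (S : car X -> car Y) (Si : car Y -> car X) : Prop :=
  bounded_op X Y S /\ bounded_op Y X Si /\
  (forall x, mem X x -> Si (S x) = x) /\ (forall y, mem Y y -> S (Si y) = y).

Definition compact_op (X Y : NSpace) (K : car X -> car Y) : Prop :=
  bounded_op X Y K /\
  forall u : nat -> car X, (forall k, mem X (u k) /\ nrm X (u k) <= 1) ->
    exists (phi : nat -> nat) (y : car Y),
      (forall k, (phi k < phi (S k))%nat) /\ mem Y y /\
      Un_cv (fun k => nrm Y (vsub Y (K (u (phi k))) y)) 0.

Definition Op := seqC -> seqC.
Definition Bp (p : R) (T : Op) : Prop := bounded_op (lp p) (lp p) T.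
Definition Kp (p : R) (T : Op) : Prop := compact_op (lp p) (lp p) T.
Definition opsub (p : R) (T U : Op) : Op := fun x => vsub (lp p) (T x) (U x).
Definition opadd (p : R) (T U : Op) : Op := fun x => vadd (lp p) (T x) (U x).
Definition opcomp (T U : Op) : Op := fun x => T (U x).
Definition opid : Op := fun x => x.
Definition op_eq (p : R) (T U : Op) : Prop := forall x, mem (lp p) x -> T x = U x.
Definition opsum (T U : Op) : seqC * seqC -> seqC * seqC := fun z => (T (fst z), U (snd z)).

Definition calknorm (p : R) (T : Op) : R :=
  infR (fun r => exists K, Kp p K /\ r = opnorm (lp p) (lp p) (opadd p T K)).

Definition Pt := nat -> R.  (* points of R^d: coordinates >= d are zero *)
Fixpoint fsum (n : nat) (f : nat -> R) : R :=
  match n with O => 0 | S k => fsum k f + f k end.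
Definition dist (d : nat) (x y : Pt) : R := sqrt (fsum d (fun i => (x i - y i) ^ 2)).

Definition in_Rd (d : nat) (M : Pt -> Prop) : Prop :=
  forall x, M x -> forall i, (d <= i)%nat -> x i = 0.

Definition seq_compact (d : nat) (M : Pt -> Prop) : Prop :=
  forall u : nat -> Pt, (forall k, M (u k)) ->
    exists (phi : nat -> nat) (x : Pt),
      (forall k, (phi k < phi (S k))%nat) /\ M x /\
      Un_cv (fun k => dist d (u (phi k)) x) 0.

Definition Fn (M : Pt -> Prop) := {x : Pt | M x} -> Cx.
Definition cont (d : nat) (M : Pt -> Prop) (h : Fn M) : Prop :=
  forall m eps, eps > 0 -> exists del, del > 0 /\
    forall m', dist d (proj1_sig m) (proj1_sig m') < del -> Cnorm (Cadd (h m) (Cmul Cm1 (h m'))) < eps.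
Definition supnorm (M : Pt -> Prop) (h : Fn M) : R :=
  supR (fun r => exists m, r = Cnorm (h m)).
Definition fadd M (g h : Fn M) : Fn M := fun m => Cadd (g m) (h m).
Definition fscale M (a : Cx) (h : Fn M) : Fn M := fun m => Cmul a (h m).
Definition fmul M (g h : Fn M) : Fn M := fun m => Cmul (g m) (h m).
Definition fone M : Fn M := fun _ => C1.

Definition unital_hom (p : R) (d : nat) (M : Pt -> Prop) (rho : Fn M -> Op) : Prop :=
  (forall h, cont d M h -> Bp p (rho h)) /\
  (forall a g h, cont d M g -> cont d M h ->
     op_eq p (rho (fadd M (fscale M a g) h))
             (opadd p (fun x => vscale (lp p) a (rho g x)) (rho h))) /\
  (forall g h, cont d M g -> cont d M h ->
     op_eq p (rho (fmul M g h)) (opcomp (rho g) (rho h))) /\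
  op_eq p (rho (fone M)) opid.

(* psi : C(M) -> B(l^p) is a map such that pi o psi is a unital homomorphism *)
Definition calk_unital_hom (p : R) (d : nat) (M : Pt -> Prop) (psi : Fn M -> Op) : Prop :=
  (forall h, cont d M h -> Bp p (psi h)) /\
  (forall a g h, cont d M g -> cont d M h ->
     Kp p (opsub p (psi (fadd M (fscale M a g) h))
                   (opadd p (fun x => vscale (lp p) a (psi g x)) (psi h)))) /\
  (forall g h, cont d M g -> cont d M h ->
     Kp p (opsub p (psi (fmul M g h)) (opcomp (psi g) (psi h)))) /\
  Kp p (opsub p (psi (fone M)) opid).

Definition calk_bounded (p : R) (d : nat) (M : Pt -> Prop) (psi : Fn M -> Op) : Prop :=
  exists c, forall h, cont d M h -> calknorm p (psi h) <= c * supnorm M h.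

(* pi o psi is bounded above and below (an isomorphism into) *)
Definition calk_bounded_below (p : R) (d : nat) (M : Pt -> Prop) (psi : Fn M -> Op) : Prop :=
  exists c1 c2, c1 > 0 /\ c2 > 0 /\ forall h, cont d M h ->
    c1 * supnorm M h <= calknorm p (psi h) /\ calknorm p (psi h) <= c2 * supnorm M h.

Definition calk_map_norm (p : R) (d : nat) (M : Pt -> Prop) (psi : Fn M -> Op) : R :=
  supR (fun r => exists h, cont d M h /\ supnorm M h <= 1 /\ r = calknorm p (psi h)).

Definition similar (lam : R) (d : nat) (M : Pt -> Prop) (X Y : NSpace)
    (rho1 : Fn M -> car X -> car X) (rho2 : Fn M -> car Y -> car Y) : Prop :=
  exists (S : car X -> car Y) (Si : car Y -> car X),
    invertible_pair X Y S Si /\ opnorm X Y S * opnorm Y X Si <= lam /\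
    forall h, cont d M h -> forall y, mem Y y -> rho2 h y = S (rho1 h (Si y)).

(* Main.v *)
(** Two things make the theorem work on l^p. First, on a block l^p({-1,1}^n) the Rademacher functions
    r_1, ..., r_n span a complemented subspace whose projection is bounded independently of n (Khintchine's
    inequality plus duality), so [h |-> sum_i h(m_i) r_i (x) r_i + h(m_0) (1 - P)] is a uniformly bounded
    unital representation of C(M); eta is the direct sum of infinitely many copies of such blocks, with points
    m_i adapted to finer and finer partitions of unity (g_i) with [sum g_i^2 = 1] and [sum g_i <= 2^d].
    Second, for psi multiplicative modulo compacts put [V x = sum_i r_i psi(g_i) x] and
    [W y = E (sum_i r_i psi(g_i) y)]. The random signs give [|V|, |W| <= 2^d |pi psi|] up to constants, since
    [sum_i +- g_i] has norm at most [2^d]; orthogonality gives [W V = psi(sum g_i^2) = 1]; and V, W intertwine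
    psi and eta up to the oscillation of h on the supports of the g_i. Gluing finer and finer partitions along
    cutoffs that asymptotically commute with psi turns all of this into identities modulo compact operators.
    Finally [[V, 1 - V W], [0, W]] is invertible with inverse [[W, 0], [1 - V W, V]], and it carries
    psi (+) psim to eta (+) eta modulo compacts, where [psim = (1 - V W) eta (1 - V W) + V eta W]. *)

From Stdlib Require Import Reals Lra Lia List Classical ClassicalEpsilon FunctionalExtensionality Cantor.
Require Import Defs.
Import ListNotations.
Open Scope R_scope.

(** * Real powers *)

(** [psi] is an arbitrary function: only its class modulo compacts is linear, multiplicative and
    bounded. Estimates on [psi] therefore hold only on tails [tl n], with [n] depending on the
    stage, and compactness is measured by tails throughout: for 1 < p < oo, [K] is compact iff [K]
    after [tl n] tends to 0 in norm, iff [tl n] after [K] does. The cutoffs must lie beyond these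
    [n] and almost commute with each psi(h); only countably many h can be handled in this way, so
    the squares g_i^2 of all partitions, whose span is dense in C(M), are treated first, and uniform
    limits give the rest. Partitions and points are fixed with M and only the cutoffs depend on
    [psi], so one eta serves every [psi]. The glued operators satisfy W V = 1 + R with R compact of
    norm at most 1/2; replacing W by (1 + R)^-1 W makes the identity exact, as the block matrix
    requires. With B = 2^(d+1) |pi psi| this gives |V| <= B, |W| <= 6 B and |S| |S^-1| of order B^4,
    which the twelfth power absorbs because |pi psi| >= 1. *)

Lemma rpow_pos a q : 0 < a -> rpow a q = Rpower a q.
Proof. intros; unfold rpow; destruct (Rle_dec a 0); [lra|reflexivity]. Qed.

Lemma rpow_0 q : rpow 0 q = 0.
Proof. unfold rpow; destruct (Rle_dec 0 0); [reflexivity|lra]. Qed.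

Lemma rpow_gt0 a q : 0 < a -> 0 < rpow a q.
Proof. intros; rewrite rpow_pos by assumption; apply exp_pos. Qed.

Lemma rpow_ge0 a q : 0 <= rpow a q.
Proof.
  unfold rpow; destruct (Rle_dec a 0); [lra|]. left; apply exp_pos.
Qed.

Lemma rpow_mul a b q : 0 <= a -> 0 <= b -> rpow (a * b) q = rpow a q * rpow b q.
Proof.
  intros [Ha|<-]; [|rewrite Rmult_0_l, rpow_0; intros; ring].
  intros [Hb|<-]; [|rewrite Rmult_0_r, rpow_0; ring].
  rewrite !rpow_pos by (try apply Rmult_lt_0_compat; assumption).
  symmetry; now apply Rpower_mult_distr.
Qed.

Lemma rpow_rpow a q r : rpow (rpow a q) r = rpow a (q * r).
Proof.
  destruct (Rle_dec a 0) as [H|H].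
  - unfold rpow at 2 3. destruct (Rle_dec a 0); [|lra]. apply rpow_0.
  - rewrite (rpow_pos a) by lra. rewrite rpow_pos by apply exp_pos.
    rewrite (rpow_pos a) by lra. apply Rpower_mult.
Qed.

Lemma rpow_1 a : 0 <= a -> rpow a 1 = a.
Proof.
  intros [H|<-]; [|apply rpow_0]. rewrite rpow_pos, Rpower_1; auto.
Qed.

Lemma rpow_one q : rpow 1 q = 1.
Proof. rewrite rpow_pos by lra. unfold Rpower. rewrite ln_1, Rmult_0_r. apply exp_0. Qed.

Lemma rpow_le a b q : 0 < q -> 0 <= a <= b -> rpow a q <= rpow b q.
Proof.
  intros Hq [[Ha|<-] Hab]; [|rewrite rpow_0; apply rpow_ge0].
  rewrite !rpow_pos by lra. apply Rle_Rpower_l; lra.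
Qed.

Lemma rpow_lt a b q : 0 < q -> 0 <= a < b -> rpow a q < rpow b q.
Proof.
  intros Hq [[Ha|<-] Hab]; [|rewrite rpow_0; now apply rpow_gt0].
  rewrite !rpow_pos by lra. apply Rlt_Rpower_l; lra.
Qed.

Lemma rpow_le_inv a b q : 0 < q -> 0 <= b -> rpow a q <= rpow b q -> a <= b.
Proof.
  intros Hq Hb H. apply Rnot_lt_le; intros Hlt.
  pose proof (rpow_lt b a q Hq (conj Hb Hlt)); lra.
Qed.

Lemma rpow_inv_r a q : q <> 0 -> 0 <= a -> rpow (rpow a q) (/ q) = a.
Proof. intros Hq Ha. rewrite rpow_rpow, Rinv_r by assumption. now apply rpow_1. Qed.

Lemma rpow_inv_l a q : q <> 0 -> 0 <= a -> rpow (rpow a (/ q)) q = a.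
Proof. intros Hq Ha. rewrite rpow_rpow, Rinv_l by assumption. now apply rpow_1. Qed.

Lemma rpow_plus a q r : 0 < a -> rpow a (q + r) = rpow a q * rpow a r.
Proof. intros; rewrite !rpow_pos by assumption. apply Rpower_plus. Qed.

Lemma rpow_2 a : 0 <= a -> rpow a 2 = a * a.
Proof.
  intros [H|<-]; [|rewrite rpow_0; ring].
  replace 2 with (1 + 1) by ring.
  rewrite rpow_plus, rpow_1 by lra. reflexivity.
Qed.

Lemma rpow_le_base a q : 1 <= q -> 0 <= a <= 1 -> rpow a q <= a.
Proof.
  intros Hq [[Ha|<-] H1]; [|rewrite rpow_0; lra].
  rewrite <- (rpow_1 a) at 2 by lra. rewrite !rpow_pos by lra.
  unfold Rpower. destruct H1 as [H1| ->].
  - assert (ln a < 0) by (rewrite <- ln_1; now apply ln_increasing).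
    destruct (Rle_lt_or_eq_dec 1 q Hq) as [H2| <-]; [|lra].
    left; apply exp_increasing; nra.
  - rewrite ln_1, !Rmult_0_r; lra.
Qed.

Lemma exp_ge_tangent x w : exp x >= exp w * (1 + (x - w)).
Proof.
  replace (exp x) with (exp w * exp (x - w)) by (rewrite <- exp_plus; f_equal; ring).
  apply Rle_ge, Rmult_le_compat_l; [left; apply exp_pos|].
  destruct (Req_dec (x - w) 0) as [->|H]; [rewrite exp_0; lra|].
  left; now apply exp_ineq1.
Qed.

(** Convexity of [exp]: the tangent bounds at [ln a + ln b], evaluated at [p * ln a] and [q * ln b]
    and weighted by [/ p] and [/ q], have linear terms that cancel. *)
Lemma young a b p q : 1 < p -> / p + / q = 1 -> 0 <= a -> 0 <= b ->
  a * b <= rpow a p / p + rpow b q / q.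
Proof.
  intros Hp Hpq Ha Hb.
  assert (Hip : 0 < / p < 1).
  { split; [apply Rinv_0_lt_compat; lra|].
    rewrite <- Rinv_1; apply Rinv_lt_contravar; lra. }
  assert (Hq : 0 < q).
  { apply Rnot_le_lt; intros [H|H].
    - apply Rinv_lt_0_compat in H; lra.
    - subst; rewrite Rinv_0 in Hpq; lra. }
  assert (Hiq : 0 < / q) by now apply Rinv_0_lt_compat.
  unfold Rdiv.
  pose proof (rpow_ge0 a p); pose proof (rpow_ge0 b q).
  destruct Ha as [Ha|<-]; [|rewrite Rmult_0_l, rpow_0; nra].
  destruct Hb as [Hb|<-]; [|rewrite Rmult_0_r, rpow_0; nra].
  rewrite !rpow_pos by assumption. unfold Rpower.
  rewrite <- (exp_ln a Ha) at 1. rewrite <- (exp_ln b Hb) at 1.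
  rewrite <- exp_plus.
  set (w := ln a + ln b).
  pose proof (exp_ge_tangent (p * ln a) w) as H1.
  pose proof (exp_ge_tangent (q * ln b) w) as H2.
  apply Rmult_ge_compat_r with (r := / p) in H1; [|lra].
  apply Rmult_ge_compat_r with (r := / q) in H2; [|lra].
  assert (exp w * (1 + (p * ln a - w)) * / p + exp w * (1 + (q * ln b - w)) * / q = exp w).
  { replace (exp w * (1 + (p * ln a - w)) * / p + exp w * (1 + (q * ln b - w)) * / q)
      with (exp w * ((1 - w) * (/ p + / q) + ln a * (p * / p) + ln b * (q * / q))) by ring.
    rewrite Hpq, !Rinv_r by lra. unfold w; ring. }
  lra.
Qed.

(** Young's inequality with second factor 1 and conjugate exponent p / (p - 1). *)
Lemma rpow_bernoulli a p : 1 < p -> 0 <= a -> 1 + p * (a - 1) <= rpow a p.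
Proof.
  intros Hp Ha.
  assert (Hq : / p + / (p / (p - 1)) = 1) by (field; lra).
  pose proof (young a 1 p _ Hp Hq Ha Rle_0_1) as H.
  rewrite rpow_one in H. apply Rmult_le_compat_l with (r := p) in H; [|lra].
  replace (p * (rpow a p / p + 1 / (p / (p - 1)))) with (rpow a p + (p - 1)) in H by (field; lra).
  lra.
Qed.

(** Convexity of t^p in tangent form at [m], which is what [jensen] sums; it is Bernoulli's
    inequality for [a / m], rescaled by m^p. *)
Lemma rpow_tangent a m p : 1 < p -> 0 <= a -> 0 < m ->
  rpow m p + p * (rpow m p / m) * (a - m) <= rpow a p.
Proof.
  intros Hp Ha Hm.
  assert (Ham : 0 <= a / m) by (apply Rmult_le_pos; [lra|left; now apply Rinv_0_lt_compat]).
  pose proof (rpow_bernoulli (a / m) p Hp Ham) as H.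
  replace a with (m * (a / m)) at 2 by (field; lra).
  rewrite rpow_mul by lra.
  apply Rmult_le_compat_l with (r := rpow m p) in H; [|apply rpow_ge0].
  replace (rpow m p + p * (rpow m p / m) * (a - m)) with (rpow m p * (1 + p * (a / m - 1)))
    by (field; lra). assumption.
Qed.

(** * Finite sums *)

Fixpoint lsum {A} (l : list A) (f : A -> R) : R :=
  match l with [] => 0 | a :: l' => f a + lsum l' f end.

Section Lsum.
Context {A : Type}.
Implicit Types (l : list A) (f g : A -> R).

Lemma lsum_ext l f g : (forall a, In a l -> f a = g a) -> lsum l f = lsum l g.
Proof.
  induction l as [|a l IH]; intros H; simpl; [reflexivity|].
  rewrite H by now left. f_equal. apply IH; intros; apply H; now right.
Qed.

Lemma lsum_le l f g : (forall a, In a l -> f a <= g a) -> lsum l f <= lsum l g.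
Proof.
  induction l as [|a l IH]; intros H; simpl; [lra|].
  apply Rplus_le_compat; [apply H; now left|]. apply IH; intros; apply H; now right.
Qed.

Lemma lsum_zero l : lsum l (fun _ => 0) = 0.
Proof. induction l; simpl; lra. Qed.

Lemma lsum_ge0 l f : (forall a, In a l -> 0 <= f a) -> 0 <= lsum l f.
Proof. intros H. rewrite <- (lsum_zero l). now apply lsum_le. Qed.

Lemma lsum_plus l f g : lsum l (fun a => f a + g a) = lsum l f + lsum l g.
Proof. induction l; simpl; lra. Qed.

Lemma lsum_scal l c f : lsum l (fun a => c * f a) = c * lsum l f.
Proof. induction l; simpl; lra. Qed.

Lemma lsum_const l c : lsum l (fun _ => c) = INR (length l) * c.
Proof.
  induction l as [|a l IH]; [simpl; lra|].
  change (c + lsum l (fun _ => c) = INR (S (length l)) * c).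
  rewrite S_INR, IH; ring.
Qed.

Lemma lsum_app l l' f : lsum (l ++ l') f = lsum l f + lsum l' f.
Proof. induction l; simpl; lra. Qed.


Lemma lsum_In l f a : (forall b, In b l -> 0 <= f b) -> In a l -> f a <= lsum l f.
Proof.
  induction l as [|b l IH]; simpl; [easy|]. intros H [->|Hin].
  - assert (0 <= lsum l f) by (apply lsum_ge0; intros; apply H; now right). lra.
  - assert (0 <= f b) by (apply H; now left).
    specialize (IH (fun c hc => H c (or_intror hc)) Hin). lra.
Qed.

Lemma lsum_incl l l' f : (forall b, In b l' -> 0 <= f b) -> NoDup l -> incl l l' ->
  lsum l f <= lsum l' f.
Proof.
  revert l'. induction l as [|a l IH]; intros l' Hf Hl Hi; simpl.
  - now apply lsum_ge0.
  - inversion Hl; subst.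
    destruct (in_split a l') as (l1 & l2 & ->); [apply Hi; now left|].
    assert (lsum l f <= lsum (l1 ++ l2) f).
    { apply IH; auto.
      - intros b Hb; apply Hf. rewrite in_app_iff in *. simpl; tauto.
      - intros b Hb. assert (Hb' : In b (l1 ++ a :: l2)) by (apply Hi; now right).
        rewrite in_app_iff in *. simpl in Hb'. destruct Hb' as [?|[->|?]]; tauto. }
    rewrite !lsum_app in *. simpl. lra.
Qed.

End Lsum.

Lemma lsum_swap {A B} (l : list A) (l' : list B) (f : A -> B -> R) :
  lsum l (fun a => lsum l' (f a)) = lsum l' (fun b => lsum l (fun a => f a b)).
Proof.
  induction l as [|a l IH]; simpl; [now rewrite lsum_zero|].
  now rewrite lsum_plus, IH.
Qed.

(** Entries of [l] outside [l'] contribute 0, and what remains of a duplicate-free list is included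
    in [l']. This bounds sums over arbitrary lists by the sum over a known finite support. *)
Lemma lsum_support {A} (l l' : list A) f : (forall b, 0 <= f b) ->
  (forall b, ~ In b l' -> f b = 0) -> NoDup l -> lsum l f <= lsum l' f.
Proof.
  intros Hf H0 Hl.
  set (l2 := filter (fun b => if excluded_middle_informative (In b l') then true else false) l).
  apply Rle_trans with (lsum l2 f).
  - right. unfold l2. clear Hl. induction l as [|b l IH]; simpl; [reflexivity|].
    rewrite IH. destruct excluded_middle_informative; simpl; [reflexivity|]. rewrite H0 by assumption. ring.
  - apply lsum_incl; auto; [now apply NoDup_filter|].
    intros b Hb. apply filter_In in Hb as [_ Hb]. now destruct excluded_middle_informative.
Qed.

Lemma lsum_map {A B} (h : A -> B) l f : lsum (map h l) f = lsum l (fun a => f (h a)).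
Proof. induction l; simpl; congruence. Qed.

Lemma lsum_prod {A B} (l : list A) (l' : list B) f :
  lsum (list_prod l l') f = lsum l (fun a => lsum l' (fun b => f (a, b))).
Proof.
  induction l as [|a l IH]; simpl; [reflexivity|].
  now rewrite lsum_app, lsum_map, IH.
Qed.

Lemma lsum_seq_S n f : lsum (seq 0 (S n)) f = lsum (seq 0 n) f + f n.
Proof. rewrite seq_S, lsum_app. simpl. ring. Qed.

Lemma lsum_half n : lsum (seq 0 n) (fun j => / 2 ^ S j) <= 1.
Proof.
  assert (H : lsum (seq 0 n) (fun j => / 2 ^ S j) = 1 - / 2 ^ n).
  { induction n as [|n IH]; [simpl; lra|]. rewrite lsum_seq_S, IH.
    simpl. assert (2 ^ n <> 0) by (apply pow_nonzero; lra). field; assumption. }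
  rewrite H. assert (0 < / 2 ^ n) by (apply Rinv_0_lt_compat, pow_lt; lra). lra.
Qed.

(** Sum the tangent lines at the weighted mean. Weights of total at most 1 are allowed because t^p
    vanishes at 0: the missing mass leaves the nonnegative term (p - 1) m^p (1 - [lsum l w]). *)
Lemma jensen {A} (l : list A) (w a : A -> R) p : 1 < p ->
  (forall i, In i l -> 0 <= w i) -> lsum l w <= 1 -> (forall i, In i l -> 0 <= a i) ->
  rpow (lsum l (fun i => w i * a i)) p <= lsum l (fun i => w i * rpow (a i) p).
Proof.
  intros Hp Hw H1 Ha. set (m := lsum l (fun i => w i * a i)).
  assert (Hm : 0 <= m) by (apply lsum_ge0; intros; apply Rmult_le_pos; auto).
  destruct Hm as [Hm|<-].
  2:{ rewrite rpow_0. apply lsum_ge0; intros; apply Rmult_le_pos; [auto|apply rpow_ge0]. }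
  apply Rle_trans with
    (lsum l (fun i => w i * (rpow m p + p * (rpow m p / m) * (a i - m)))).
  2:{ apply lsum_le; intros; apply Rmult_le_compat_l; auto using rpow_tangent. }
  assert (E : lsum l (fun i => w i * (rpow m p + p * (rpow m p / m) * (a i - m)))
     = (rpow m p - p * (rpow m p / m) * m) * lsum l w + p * (rpow m p / m) * m).
  { transitivity ((rpow m p - p * (rpow m p / m) * m) * lsum l w
       + p * (rpow m p / m) * lsum l (fun i => w i * a i)); [|reflexivity].
    rewrite <- !lsum_scal, <- lsum_plus. apply lsum_ext; intros; ring. }
  rewrite E. replace (p * (rpow m p / m) * m) with (p * rpow m p) by (field; lra).
  pose proof (rpow_ge0 m p).
  assert (0 <= (p - 1) * rpow m p * (1 - lsum l w)); [|nra].
  apply Rmult_le_pos; [apply Rmult_le_pos|]; lra.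
Qed.

(** Young's inequality applied termwise to [a i / S1] and [b i / S2]. The bounds [S1] and [S2] stand
    in for the norms, so no norm has to be computed. *)
Lemma hoelder {A} (l : list A) (a b : A -> R) p q S1 S2 : 1 < p -> / p + / q = 1 ->
  (forall i, In i l -> 0 <= a i) -> (forall i, In i l -> 0 <= b i) -> 0 <= S1 -> 0 <= S2 ->
  lsum l (fun i => rpow (a i) p) <= rpow S1 p ->
  lsum l (fun i => rpow (b i) q) <= rpow S2 q ->
  lsum l (fun i => a i * b i) <= S1 * S2.
Proof.
  intros Hp Hpq Ha Hb H1 H2 Sa Sb.
  assert (Hip : 0 < / p) by (apply Rinv_0_lt_compat; lra).
  assert (Hip1 : / p < 1) by (rewrite <- Rinv_1; apply Rinv_lt_contravar; lra).
  assert (Hiq : 0 < / q) by lra.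
  assert (Hq : 0 < q).
  { rewrite <- (Rinv_inv q). now apply Rinv_0_lt_compat. }
  (* A zero bound kills every term, which disposes of the case where one cannot divide by [S1] or
     [S2]. *)
  assert (Z : forall (c : A -> R) t, 0 < t -> (forall i, In i l -> 0 <= c i) ->
     lsum l (fun i => rpow (c i) t) <= 0 -> forall i, In i l -> c i = 0).
  { intros c t Ht Hc H i Hi. destruct (Hc i Hi) as [H0|]; [|auto].
    pose proof (lsum_In l (fun i => rpow (c i) t) i (fun _ _ => rpow_ge0 _ _) Hi).
    pose proof (rpow_gt0 _ t H0). simpl in *; lra. }
  destruct H1 as [H1|<-].
  2:{ rewrite rpow_0 in Sa. rewrite Rmult_0_l. right. rewrite <- (lsum_zero l).
      apply lsum_ext; intros i Hi. rewrite (Z a p) by (auto; lra); ring. }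
  destruct H2 as [H2|<-].
  2:{ rewrite rpow_0 in Sb. rewrite Rmult_0_r. right. rewrite <- (lsum_zero l).
      apply lsum_ext; intros i Hi. rewrite (Z b q) by (auto; lra); ring. }
  pose proof (rpow_gt0 S1 p H1) as P1. pose proof (rpow_gt0 S2 q H2) as P2.
  apply Rle_trans with (lsum l (fun i => S1 * S2 *
     (/ p * / rpow S1 p * rpow (a i) p + / q * / rpow S2 q * rpow (b i) q))).
  - apply lsum_le; intros i Hi.
    assert (Hai : 0 <= a i / S1) by (apply Rmult_le_pos; [auto|left; now apply Rinv_0_lt_compat]).
    assert (Hbi : 0 <= b i / S2) by (apply Rmult_le_pos; [auto|left; now apply Rinv_0_lt_compat]).
    pose proof (young _ _ p q Hp Hpq Hai Hbi) as Y.
    replace (rpow (a i) p) with (rpow S1 p * rpow (a i / S1) p).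
    2:{ rewrite <- rpow_mul by lra. f_equal; field; lra. }
    replace (rpow (b i) q) with (rpow S2 q * rpow (b i / S2) q).
    2:{ rewrite <- rpow_mul by lra. f_equal; field; lra. }
    replace (a i * b i) with (S1 * S2 * (a i / S1 * (b i / S2))) by (field; lra).
    apply Rmult_le_compat_l; [nra|].
    replace (/ p * / rpow S1 p * (rpow S1 p * rpow (a i / S1) p)) with (rpow (a i / S1) p / p)
      by (field; lra).
    replace (/ q * / rpow S2 q * (rpow S2 q * rpow (b i / S2) q)) with (rpow (b i / S2) q / q)
      by (field; lra).
    assumption.
  - rewrite lsum_scal, lsum_plus, !lsum_scal.
    rewrite <- (Rmult_1_r (S1 * S2)) at 2. apply Rmult_le_compat_l; [nra|].
    rewrite <- Hpq. apply Rplus_le_compat; rewrite Rmult_assoc;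
      rewrite <- (Rmult_1_r (/ _)) at 2; (apply Rmult_le_compat_l; [lra|]).
    + apply Rmult_le_reg_l with (rpow S1 p); auto. rewrite <- Rmult_assoc, Rinv_r by lra. lra.
    + apply Rmult_le_reg_l with (rpow S2 q); auto. rewrite <- Rmult_assoc, Rinv_r by lra. lra.
Qed.

(** * Complex numbers *)

Definition Copp (z : Cx) : Cx := mkCx (- cRe z) (- cIm z).
Definition Csub (z w : Cx) : Cx := Cadd z (Copp w).

Lemma Cx_eq z w : cRe z = cRe w -> cIm z = cIm w -> z = w.
Proof. destruct z, w; simpl; congruence. Qed.

Lemma Cx_ring_theory : ring_theory C0 C1 Cadd Cmul Csub Copp (@eq Cx).
Proof. split; intros; apply Cx_eq; simpl; ring. Qed.

Add Ring Cx_ring : Cx_ring_theory.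

Lemma Cm1_opp : Cm1 = Copp C1.
Proof. apply Cx_eq; simpl; ring. Qed.

Ltac cring := rewrite ?Cm1_opp; ring.

Definition RtoC (r : R) : Cx := mkCx r 0.

Lemma RtoC_mul a b : RtoC (a * b) = Cmul (RtoC a) (RtoC b).
Proof. apply Cx_eq; simpl; ring. Qed.
Lemma RtoC_add a b : RtoC (a + b) = Cadd (RtoC a) (RtoC b).
Proof. apply Cx_eq; simpl; ring. Qed.
Lemma RtoC_opp a : RtoC (- a) = Copp (RtoC a).
Proof. apply Cx_eq; simpl; ring. Qed.
Lemma RtoC_0 : RtoC 0 = C0. Proof. reflexivity. Qed.
Lemma RtoC_1 : RtoC 1 = C1. Proof. reflexivity. Qed.

Lemma Cnorm_ge0 z : 0 <= Cnorm z.
Proof. apply sqrt_pos. Qed.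

Lemma Cnorm_sq z : Cnorm z * Cnorm z = cRe z ^ 2 + cIm z ^ 2.
Proof. unfold Cnorm. apply sqrt_sqrt. nra. Qed.

Lemma Cnorm_C0 : Cnorm C0 = 0.
Proof. unfold Cnorm; simpl. rewrite !Rmult_0_l, Rplus_0_l. apply sqrt_0. Qed.

Lemma Cnorm_RtoC r : Cnorm (RtoC r) = Rabs r.
Proof.
  unfold Cnorm; simpl. rewrite <- sqrt_Rsqr_abs. f_equal. unfold Rsqr; ring.
Qed.

Lemma Cnorm_C1 : Cnorm C1 = 1.
Proof. rewrite <- RtoC_1, Cnorm_RtoC. apply Rabs_R1. Qed.

Lemma Cnorm_mul z w : Cnorm (Cmul z w) = Cnorm z * Cnorm w.
Proof.
  unfold Cnorm. rewrite <- sqrt_mult by nra. f_equal. simpl. ring.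
Qed.

Lemma Cnorm_opp z : Cnorm (Copp z) = Cnorm z.
Proof. unfold Cnorm; f_equal; simpl; ring. Qed.

Lemma Cnorm_Cm1 : Cnorm Cm1 = 1.
Proof. rewrite Cm1_opp, Cnorm_opp. apply Cnorm_C1. Qed.

Lemma Cnorm_add z w : Cnorm (Cadd z w) <= Cnorm z + Cnorm w.
Proof.
  pose proof (Cnorm_ge0 z); pose proof (Cnorm_ge0 w).
  pose proof (Cnorm_sq z) as Hz; pose proof (Cnorm_sq w) as Hw.
  apply Rsqr_incr_0_var; [|lra]. unfold Rsqr. rewrite Cnorm_sq. simpl.
  set (a := Cnorm z) in *. set (b := Cnorm w) in *.
  assert (cRe z * cRe w + cIm z * cIm w <= a * b); [|nra].
  apply Rsqr_incr_0_var; [|nra]. unfold Rsqr.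
  replace (a * b * (a * b)) with ((a * a) * (b * b)) by ring. rewrite Hz, Hw.
  pose proof (Rle_0_sqr (cRe z * cIm w - cIm z * cRe w)) as Q. unfold Rsqr in Q. nra.
Qed.

Lemma Cnorm_sub z w : Cnorm (Csub z w) <= Cnorm z + Cnorm w.
Proof. unfold Csub. rewrite <- (Cnorm_opp w). apply Cnorm_add. Qed.

Lemma Cnorm_sub_sym z w : Cnorm (Csub z w) = Cnorm (Csub w z).
Proof. rewrite <- Cnorm_opp. f_equal; ring. Qed.

Lemma Cnorm_eq0 z : Cnorm z = 0 -> z = C0.
Proof.
  intros H. pose proof (Cnorm_sq z) as E. rewrite H in E.
  apply Cx_eq; simpl; nra.
Qed.

Lemma Re_le_Cnorm z : Rabs (cRe z) <= Cnorm z.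
Proof.
  unfold Cnorm. rewrite <- sqrt_Rsqr_abs. apply sqrt_le_1; unfold Rsqr; nra.
Qed.

Lemma Im_le_Cnorm z : Rabs (cIm z) <= Cnorm z.
Proof.
  unfold Cnorm. rewrite <- sqrt_Rsqr_abs. apply sqrt_le_1; unfold Rsqr; nra.
Qed.

Lemma Cnorm_le_ReIm z : Cnorm z <= Rabs (cRe z) + Rabs (cIm z).
Proof.
  pose proof (Rabs_pos (cRe z)). pose proof (Rabs_pos (cIm z)).
  apply Rsqr_incr_0_var; [|lra]. unfold Rsqr. rewrite Cnorm_sq.
  rewrite <- (pow2_abs (cRe z)), <- (pow2_abs (cIm z)). nra.
Qed.

Definition Cconj (z : Cx) : Cx := mkCx (cRe z) (- cIm z).

Lemma Cnorm_conj z : Cnorm (Cconj z) = Cnorm z.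
Proof. unfold Cnorm; apply f_equal; simpl; ring. Qed.

(* The extremal test value in Hoelder's inequality; [0] when [z = 0]. *)
Definition dual_value (q : R) (z : Cx) : Cx :=
  Cmul (RtoC (rpow (Cnorm z) (q - 1) / Cnorm z)) (Cconj z).

Lemma Cnorm_dual_value q z : Cnorm (dual_value q z) = rpow (Cnorm z) (q - 1).
Proof.
  unfold dual_value. rewrite Cnorm_mul, Cnorm_RtoC, Cnorm_conj.
  destruct (Cnorm_ge0 z) as [H|<-]; [|rewrite rpow_0; ring].
  rewrite Rabs_right; [field; lra|]. left. apply Rdiv_lt_0_compat; [now apply rpow_gt0|assumption].
Qed.

Lemma mul_dual_value q z : Cmul (dual_value q z) z = RtoC (rpow (Cnorm z) q).
Proof.
  unfold dual_value.
  replace (Cmul (Cmul (RtoC (rpow (Cnorm z) (q - 1) / Cnorm z)) (Cconj z)) z)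
    with (RtoC (rpow (Cnorm z) (q - 1) / Cnorm z * (Cnorm z * Cnorm z))).
  2:{ rewrite Cnorm_sq. apply Cx_eq; simpl; ring. }
  f_equal. destruct (Cnorm_ge0 z) as [H|<-]; [|rewrite !rpow_0; unfold Rdiv; ring].
  replace q with ((q - 1) + 1) at 2 by ring. rewrite rpow_plus, rpow_1 by lra. field; lra.
Qed.

Fixpoint csum {A} (l : list A) (f : A -> Cx) : Cx :=
  match l with [] => C0 | a :: l' => Cadd (f a) (csum l' f) end.

Section Csum.
Context {A : Type}.
Implicit Types (l : list A) (f g : A -> Cx).

Lemma csum_ext l f g : (forall a, In a l -> f a = g a) -> csum l f = csum l g.
Proof.
  induction l as [|a l IH]; intros H; simpl; [reflexivity|].
  rewrite H by now left. f_equal. apply IH; intros; apply H; now right.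
Qed.

Lemma csum_zero l : csum l (fun _ => C0) = C0.
Proof. induction l as [|a l IH]; simpl; [reflexivity|]. rewrite IH; ring. Qed.

Lemma csum_plus l f g : csum l (fun a => Cadd (f a) (g a)) = Cadd (csum l f) (csum l g).
Proof. induction l as [|a l IH]; simpl; [ring|]. rewrite IH; ring. Qed.

Lemma csum_scal l c f : csum l (fun a => Cmul c (f a)) = Cmul c (csum l f).
Proof. induction l as [|a l IH]; simpl; [ring|]. rewrite IH; ring. Qed.


Lemma csum_app l l' f : csum (l ++ l') f = Cadd (csum l f) (csum l' f).
Proof. induction l as [|a l IH]; simpl; [ring|]. rewrite IH; ring. Qed.

Lemma Cnorm_csum l f : Cnorm (csum l f) <= lsum l (fun a => Cnorm (f a)).
Proof.
  induction l as [|a l IH]; simpl; [rewrite Cnorm_C0; lra|].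
  pose proof (Cnorm_add (f a) (csum l f)). lra.
Qed.

Lemma csum_RtoC l (f : A -> R) : csum l (fun a => RtoC (f a)) = RtoC (lsum l f).
Proof. induction l as [|a l IH]; simpl; [reflexivity|]. now rewrite IH, <- RtoC_add. Qed.

Lemma csum_single (eqA : forall a b : A, {a = b} + {a <> b}) l a f : NoDup l -> In a l ->
  (forall b, In b l -> b <> a -> f b = C0) -> csum l f = f a.
Proof.
  induction l as [|b l IH]; simpl; [easy|]. intros Hl Hin Hf. inversion Hl; subst.
  destruct (eqA b a) as [->|Hne].
  - rewrite (csum_ext l f (fun _ => C0)).
    + rewrite csum_zero; ring.
    + intros c Hc. apply Hf; [now right|]. intros ->; contradiction.
  - destruct Hin as [->|Hin]; [congruence|].
    rewrite Hf by auto. rewrite IH; auto. ring.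
Qed.

End Csum.

Lemma csum_swap {A B} (l : list A) (l' : list B) (f : A -> B -> Cx) :
  csum l (fun a => csum l' (f a)) = csum l' (fun b => csum l (fun a => f a b)).
Proof.
  induction l as [|a l IH]; simpl; [now rewrite csum_zero|].
  now rewrite csum_plus, IH.
Qed.

Lemma csum_seq_S n f : csum (seq 0 (S n)) f = Cadd (csum (seq 0 n) f) (f n).
Proof. rewrite seq_S, csum_app. simpl. ring. Qed.

(** * Vectors of l^p over an arbitrary index type *)

(** A type class, so that [1 < p] is supplied by instance search instead of being passed through
    every lemma. *)
Class Exponent (p : R) := exponent_gt1 : 1 < p.

(* [f] is meant to be nonnegative: [sB f s] says that its sum is at most [s]. *)
Definition sB {I} (f : I -> R) (s : R) : Prop := forall l, NoDup l -> lsum l f <= s.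

(* [lpB p x r] says that [x] lies in l^p with norm at most [r]. *)
Definition lpB (p : R) {I} (x : I -> Cx) (r : R) : Prop :=
  0 <= r /\ sB (fun i => rpow (Cnorm (x i)) p) (rpow r p).

Definition inlp (p : R) {I} (x : I -> Cx) : Prop := exists r, lpB p x r.

(** A supremum over duplicate-free lists makes sense over any index type without choosing an
    enumeration, so the same lemmas serve [nat], pairs and triples. Since [supR] defaults to 0 on
    unbounded sets, [tot] is informative only together with some [sB]. *)
Definition tot {I} (f : I -> R) : R := supR (fun s => exists l, NoDup l /\ s = lsum l f).
Definition nrmI (p : R) {I} (x : I -> Cx) : R :=
  rpow (tot (fun i => rpow (Cnorm (x i)) p)) (/ p).

Definition xadd {I} (x y : I -> Cx) : I -> Cx := fun i => Cadd (x i) (y i).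
Definition xscale {I} (a : Cx) (x : I -> Cx) : I -> Cx := fun i => Cmul a (x i).
Definition xsub {I} (x y : I -> Cx) : I -> Cx := xadd x (xscale Cm1 y).
Definition xzero {I} : I -> Cx := fun _ => C0.
Definition xsum {A I} (l : list A) (x : A -> I -> Cx) : I -> Cx :=
  fun i => csum l (fun a => x a i).
Definition mask {I} (w : I -> R) (x : I -> Cx) : I -> Cx := fun i => Cmul (RtoC (w i)) (x i).
Definition hd (n : nat) : (nat -> Cx) -> nat -> Cx :=
  mask (fun c => if (c <? n)%nat then 1 else 0).
Definition tl (n : nat) : (nat -> Cx) -> nat -> Cx :=
  mask (fun c => if (c <? n)%nat then 0 else 1).

Ltac xext := apply functional_extensionality; intro;
  unfold xsub, xadd, xscale, xzero, hd, tl, mask; try cring.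

Lemma supR_le (E : R -> Prop) b : 0 <= b -> (forall x, E x -> x <= b) -> supR E <= b.
Proof.
  intros Hb H. unfold supR. destruct excluded_middle_informative as [Hc|]; [|assumption].
  destruct completeness as [m [H1 H2]]; simpl. apply H2. exact H.
Qed.

Lemma supR_ub (E : R -> Prop) b x : (forall y, E y -> y <= b) -> E x -> x <= supR E.
Proof.
  intros H Hx. unfold supR. destruct excluded_middle_informative as [Hc|Hc].
  - destruct completeness as [m [H1 H2]]; simpl. now apply H1.
  - exfalso; apply Hc. split; [exists b; exact H|now exists x].
Qed.

(** * Unordered nonnegative sums and double sums *)

Section Sums.
Context {A : Type}.

Lemma sB_ge0 (f : A -> R) s : sB f s -> 0 <= s.
Proof. intros H. apply (H [] (NoDup_nil _)). Qed.

Lemma tot_ub (f : A -> R) s l : sB f s -> NoDup l -> lsum l f <= tot f.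
Proof.
  intros H Hl. apply supR_ub with s; [|now exists l].
  intros y (l' & Hl' & ->). now apply H.
Qed.

Lemma tot_sB (f : A -> R) s : sB f s -> sB f (tot f).
Proof. intros H l Hl. now apply tot_ub with s. Qed.

Lemma tot_le (f : A -> R) s : sB f s -> tot f <= s.
Proof.
  intros H. apply supR_le; [now apply (sB_ge0 f)|]. intros x (l & Hl & ->). now apply H.
Qed.

Lemma tot_ge0 (f : A -> R) s : sB f s -> 0 <= tot f.
Proof. intros H. apply (tot_ub f s [] H). constructor. Qed.

End Sums.

Section DoubleSums.
Context {A B : Type}.

(** A finite list of pairs lies in the product of its two projections, where the sum can be taken
    row by row. *)
Lemma sB_fubini (f : A * B -> R) g s : (forall ab, 0 <= f ab) ->
  (forall a, sB (fun b => f (a, b)) (g a)) -> sB g s -> sB f s.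
Proof.
  intros Hf H Hg l Hl.
  pose (la := nodup (fun x y => excluded_middle_informative (x = y)) (map fst l)).
  pose (lb := nodup (fun x y => excluded_middle_informative (x = y)) (map snd l)).
  apply Rle_trans with (lsum (list_prod la lb) f).
  - apply lsum_incl; auto. intros [a b] Hab. apply in_prod_iff. unfold la, lb.
    rewrite !nodup_In, !in_map_iff. split; eexists; split; eauto; reflexivity.
  - rewrite lsum_prod. apply Rle_trans with (lsum la g).
    + apply lsum_le; intros. apply H, NoDup_nodup.
    + apply Hg, NoDup_nodup.
Qed.

(** The converse of [sB_fubini]: the rowwise suprema still add up, because finite lists in different
    fibres are disjoint and can be concatenated. *)
Lemma sB_fibers (f : A * B -> R) s : sB f s ->
  (forall a, sB (fun b => f (a, b)) s) /\ sB (fun a => tot (fun b => f (a, b))) s.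
Proof.
  intros H.
  assert (Hf : forall a, sB (fun b => f (a, b)) s).
  { intros a l Hl. rewrite <- (lsum_map (fun b => (a, b)) l f). apply H.
    apply NoDup_map_NoDup_ForallPairs; [|assumption]. intros x y _ _ E; congruence. }
  split; [assumption|].
  intros l Hl.
  (* The induction removes one fibre at a time, so the bound must vary and must concern only lists
     lying over [l]. *)
  assert (G : forall s, (forall m, NoDup m -> (forall ab, In ab m -> In (fst ab) l) ->
      lsum m f <= s) -> lsum l (fun a => tot (fun b => f (a, b))) <= s).
  2:{ apply G; auto. }
  clear H. revert Hl; induction l as [|a l IH]; intros Hl t Ht; simpl.
  - apply (Ht []); [constructor|easy].
  - inversion Hl; subst.
    assert (tot (fun b => f (a, b)) <= t - lsum l (fun a => tot (fun b => f (a, b)))); [|lra].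
    assert (K : forall lb, NoDup lb ->
      lsum lb (fun b => f (a, b)) <= t - lsum l (fun a => tot (fun b => f (a, b)))).
    { intros lb Hlb.
      assert (lsum l (fun a => tot (fun b => f (a, b))) <= t - lsum lb (fun b => f (a, b))); [|lra].
      apply IH; [assumption|]. intros m Hm Hin.
      assert (lsum (map (fun b => (a, b)) lb ++ m) f <= t).
      { apply Ht.
        - apply NoDup_app; auto.
          + apply NoDup_map_NoDup_ForallPairs; [|assumption]. intros x y _ _ E; congruence.
          + intros [a' b'] Hi Hi'. apply in_map_iff in Hi as (b & E & _).
            apply Hin in Hi'. injection E; intros; subst. contradiction.
        - intros ab Hab. apply in_app_iff in Hab as [Hab|Hab]; [|right; auto].
          apply in_map_iff in Hab as (b & <- & _). now left. }
      rewrite lsum_app, lsum_map in H. lra. }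
    apply tot_le. exact K.
Qed.

End DoubleSums.

(** * Minkowski's inequality and completeness of l^p *)

Section Vectors.
Context {p : R} {hp : Exponent p} {I : Type}.
Implicit Types (x y : I -> Cx).

Let exponent_gt0 : 0 < p. Proof. unfold Exponent in hp; lra. Qed.
Let exponent_neq0 : p <> 0. Proof. unfold Exponent in hp; lra. Qed.

(** [(a + b) / (r + s)] is the convex combination of [a / r] and [b / s] with weights [r / (r + s)]
    and [s / (r + s)]; [jensen] on a two-element list does the rest. *)
Lemma minkowski_list (l : list I) x y r s : 0 <= r -> 0 <= s ->
  lsum l (fun i => rpow (Cnorm (x i)) p) <= rpow r p ->
  lsum l (fun i => rpow (Cnorm (y i)) p) <= rpow s p ->
  lsum l (fun i => rpow (Cnorm (Cadd (x i) (y i))) p) <= rpow (r + s) p.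
Proof.
  intros Hr Hs Hx Hy.
  assert (Z : forall x r, 0 = r -> lsum l (fun i => rpow (Cnorm (x i)) p) <= rpow r p ->
      forall i, In i l -> x i = C0).
  { intros z t <- H i Hi. rewrite rpow_0 in H. apply Cnorm_eq0.
    destruct (Cnorm_ge0 (z i)) as [H0|]; [|auto].
    pose proof (lsum_In l (fun i => rpow (Cnorm (z i)) p) i (fun _ _ => rpow_ge0 _ _) Hi).
    pose proof (rpow_gt0 _ p H0). simpl in *; lra. }
  destruct Hr as [Hr|Hr].
  2:{ replace (r + s) with s by lra. erewrite lsum_ext; [exact Hy|]. intros i Hi; simpl.
      rewrite (Z x r Hr Hx i Hi). do 2 f_equal. ring. }
  destruct Hs as [Hs|Hs].
  2:{ replace (r + s) with r by lra. erewrite lsum_ext; [exact Hx|]. intros i Hi; simpl.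
      rewrite (Z y s Hs Hy i Hi). do 2 f_equal. ring. }
  pose proof (rpow_gt0 r p Hr). pose proof (rpow_gt0 s p Hs).
  pose proof (rpow_gt0 (r + s) p ltac:(lra)).
  apply Rle_trans with (lsum l (fun i => rpow (r + s) p *
    (r / (r + s) * / rpow r p * rpow (Cnorm (x i)) p
      + s / (r + s) * / rpow s p * rpow (Cnorm (y i)) p))).
  - apply lsum_le; intros i _.
    apply Rle_trans with (rpow (Cnorm (x i) + Cnorm (y i)) p).
    { apply rpow_le; auto. split; [apply Cnorm_ge0|apply Cnorm_add]. }
    pose proof (Cnorm_ge0 (x i)) as Hxi. pose proof (Cnorm_ge0 (y i)) as Hyi.
    set (a := Cnorm (x i)) in *. set (b := Cnorm (y i)) in *.
    assert (Ha : 0 <= a / r) by (apply Rmult_le_pos; [lra|left; now apply Rinv_0_lt_compat]).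
    assert (Hb : 0 <= b / s) by (apply Rmult_le_pos; [lra|left; now apply Rinv_0_lt_compat]).
    assert (Hrs : 0 < / (r + s)) by (apply Rinv_0_lt_compat; lra).
    pose proof (jensen [true; false] (fun c : bool => if c then r / (r + s) else s / (r + s))
      (fun c : bool => if c then a / r else b / s) p hp) as J. simpl in J.
    replace (a + b) with ((r + s) * (r / (r + s) * (a / r) + (s / (r + s) * (b / s) + 0)))
      by (field; lra).
    rewrite rpow_mul.
    + apply Rmult_le_compat_l; [lra|].
      eapply Rle_trans; [apply J|].
      * intros [|] _; unfold Rdiv; nra.
      * right; field; lra.
      * intros [|] _; assumption.
      * replace (rpow a p) with (rpow r p * rpow (a / r) p).
        2:{ rewrite <- rpow_mul by lra. f_equal; field; lra. }
        replace (rpow b p) with (rpow s p * rpow (b / s) p).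
        2:{ rewrite <- rpow_mul by lra. f_equal; field; lra. }
        right; field; lra.
    + lra.
    + assert (0 <= r / (r + s)) by (unfold Rdiv; nra).
      assert (0 <= s / (r + s)) by (unfold Rdiv; nra). nra.
  - rewrite lsum_scal, lsum_plus, !lsum_scal.
    rewrite <- (Rmult_1_r (rpow (r + s) p)) at 2. apply Rmult_le_compat_l; [lra|].
    replace 1 with (r / (r + s) * / rpow r p * rpow r p + s / (r + s) * / rpow s p * rpow s p)
      by (field; lra).
    assert (0 < / (r + s)) by (apply Rinv_0_lt_compat; lra).
    apply Rplus_le_compat; (apply Rmult_le_compat_l; [|assumption]); unfold Rdiv;
      repeat apply Rmult_le_pos; try lra; left; apply Rinv_0_lt_compat; assumption.
Qed.

Lemma lpB_ge0 x r : lpB p x r -> 0 <= r.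
Proof. now intros []. Qed.

Lemma lpB_add x y r s : lpB p x r -> lpB p y s -> lpB p (xadd x y) (r + s).
Proof.
  intros [Hr Hx] [Hs Hy]; split; [lra|]. intros l Hl. apply minkowski_list; auto.
Qed.

Lemma lpB_dom x y r : lpB p x r -> (forall i, Cnorm (y i) <= Cnorm (x i)) -> lpB p y r.
Proof.
  intros [Hr Hx] H; split; [assumption|]. intros l Hl. eapply Rle_trans; [|apply (Hx l Hl)].
  apply lsum_le; intros. apply rpow_le; auto. split; [apply Cnorm_ge0|apply H].
Qed.

Lemma lpB_mono x r s : lpB p x r -> r <= s -> lpB p x s.
Proof.
  intros [Hr Hx] H; split; [lra|]. intros l Hl. eapply Rle_trans; [apply (Hx l Hl)|].
  apply rpow_le; auto.
Qed.

Lemma lpB_scale a x r : lpB p x r -> lpB p (xscale a x) (Cnorm a * r).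
Proof.
  intros [Hr Hx]. pose proof (Cnorm_ge0 a). split; [nra|]. intros l Hl.
  rewrite rpow_mul by assumption.
  rewrite (lsum_ext l _ (fun i => rpow (Cnorm a) p * rpow (Cnorm (x i)) p)).
  - rewrite lsum_scal. apply Rmult_le_compat_l; [apply rpow_ge0|now apply Hx].
  - intros i _. unfold xscale. rewrite Cnorm_mul, rpow_mul; auto using Cnorm_ge0.
Qed.

Lemma lpB_sub x y r s : lpB p x r -> lpB p y s -> lpB p (xsub x y) (r + s).
Proof.
  intros Hx Hy. apply lpB_add; [assumption|].
  rewrite <- (Rmult_1_l s), <- Cnorm_Cm1. now apply lpB_scale.
Qed.

Lemma lpB_zero r : 0 <= r -> lpB p (@xzero I) r.
Proof.
  intros Hr; split; [assumption|]. intros l Hl. unfold xzero. rewrite Cnorm_C0, rpow_0, lsum_zero.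
  apply rpow_ge0.
Qed.

Lemma lpB_coord x r i : lpB p x r -> Cnorm (x i) <= r.
Proof.
  intros [Hr Hx]. specialize (Hx [i]). simpl in Hx. rewrite Rplus_0_r in Hx.
  apply rpow_le_inv with p; auto. apply Hx. constructor; [easy|constructor].
Qed.

Lemma lpB_mask w x r : (forall i, Rabs (w i) <= 1) -> lpB p x r -> lpB p (mask w x) r.
Proof.
  intros Hw H. apply (lpB_dom x); [assumption|]. intros i. unfold mask.
  rewrite Cnorm_mul, Cnorm_RtoC. specialize (Hw i). pose proof (Cnorm_ge0 (x i)). nra.
Qed.

Lemma lpB_xsum {A} (l : list A) (x : A -> I -> Cx) r :
  (forall a, In a l -> lpB p (x a) (r a)) -> lpB p (xsum l x) (lsum l r).
Proof.
  induction l as [|a l IH]; intros H.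
  - apply (lpB_zero 0); lra.
  - simpl. apply (lpB_add (x a) (xsum l x)); [apply H; now left|].
    apply IH; intros; apply H; now right.
Qed.

Lemma nrmI_pow x r : lpB p x r ->
  rpow (nrmI p x) p = tot (fun i => rpow (Cnorm (x i)) p).
Proof.
  intros [Hr Hx]. unfold nrmI. apply rpow_inv_l; auto. eapply tot_ge0; eauto.
Qed.

Lemma lpB_nrmI x r : lpB p x r -> lpB p x (nrmI p x) /\ nrmI p x <= r.
Proof.
  intros H. split; [split|].
  - apply rpow_ge0.
  - rewrite (nrmI_pow x r H). eapply tot_sB; apply H.
  - apply rpow_le_inv with p; auto; [apply H|].
    rewrite (nrmI_pow x r H). apply tot_le, H.
Qed.

(** The limit is taken coordinatewise. The bound passes to it because on a finite list of
    coordinates the limit is uniformly close to some later [z k]. *)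
Lemma lpB_complete (z : nat -> I -> Cx) (e : nat -> R) :
  (forall eps, eps > 0 -> exists j, e j < eps) ->
  (forall j k, (j <= k)%nat -> lpB p (xsub (z k) (z j)) (e j)) ->
  exists x, forall j, lpB p (xsub x (z j)) (e j).
Proof.
  intros He Hz.
  assert (Hc : forall i j k, (j <= k)%nat -> Cnorm (Csub (z k i) (z j i)) <= e j).
  { intros i j k Hjk. pose proof (lpB_coord _ _ i (Hz j k Hjk)) as H.
    unfold xsub, xadd, xscale in H. replace (Csub (z k i) (z j i)) with
      (Cadd (z k i) (Cmul Cm1 (z j i))) by cring. assumption. }
  assert (Hcau : forall f : Cx -> R, (forall a b, f (Csub a b) = f a - f b) ->
     (forall a, Rabs (f a) <= Cnorm a) -> forall i, exists l, Un_cv (fun k => f (z k i)) l).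
  { intros f Hf1 Hf2 i. destruct (R_complete (fun k => f (z k i))) as [l Hl]; [|now exists l].
    intros eps Heps. destruct (He (eps / 2)) as [j Hj]; [lra|]. exists j. intros k m Hk Hm.
    unfold Rdist.
    replace (f (z k i) - f (z m i)) with ((f (z k i) - f (z j i)) - (f (z m i) - f (z j i))) by ring.
    eapply Rle_lt_trans; [apply Rabs_triang|]. rewrite Rabs_Ropp.
    pose proof (Hf2 (Csub (z k i) (z j i))) as F1. pose proof (Hf2 (Csub (z m i) (z j i))) as F2.
    rewrite Hf1 in F1, F2.
    pose proof (Hc i j k ltac:(lia)). pose proof (Hc i j m ltac:(lia)). lra. }
  assert (Hl : forall i, exists l : Cx,
     Un_cv (fun k => cRe (z k i)) (cRe l) /\ Un_cv (fun k => cIm (z k i)) (cIm l)).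
  { intros i. destruct (Hcau cRe) with i as [a Ha]; [intros; simpl; ring|apply Re_le_Cnorm|].
    destruct (Hcau cIm) with i as [b Hb]; [intros; simpl; ring|apply Im_le_Cnorm|].
    now exists (mkCx a b). }
  pose (x := fun i => proj1_sig (constructive_indefinite_description _ (Hl i))).
  assert (Hx : forall i, Un_cv (fun k => cRe (z k i)) (cRe (x i)) /\
     Un_cv (fun k => cIm (z k i)) (cIm (x i))).
  { intros i; unfold x. now destruct constructive_indefinite_description. }
  exists x. intros j.
  assert (Hej : 0 <= e j) by (apply (lpB_ge0 _ _ (Hz j j (le_n j)))).
  split; [assumption|]. intros l Hl'.
  set (t := lsum l (fun i => rpow (Cnorm (xsub x (z j) i)) p)).
  assert (Ht : 0 <= t) by (apply lsum_ge0; intros; apply rpow_ge0).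
  rewrite <- (rpow_inv_l t p) by auto. apply rpow_le; [auto|]. split; [apply rpow_ge0|].
  apply le_epsilon. intros eps Heps.
  (* [K] is the l^p norm of the constant 1 on [l], so a coordinatewise error of [del] costs
     [K * del <= eps]. *)
  set (K := rpow (INR (length l)) (/ p)).
  assert (HK : 0 <= K) by apply rpow_ge0.
  set (del := eps / (K + 1)).
  assert (Hdel : 0 < del) by (apply Rdiv_lt_0_compat; lra).
  assert (exists k, (j <= k)%nat /\ forall i, In i l -> Cnorm (xsub x (z k) i) <= del)
    as (k & Hjk & Hk).
  { clearbody del. clear Hl' t Ht K HK Heps.
    assert (forall l, exists k0, forall k, (k0 <= k)%nat -> forall i, In i l ->
       Cnorm (xsub x (z k) i) <= del) as G.
    { clear l. induction l as [|i l [k0 IH]]; [exists 0%nat; easy|].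
      destruct (Hx i) as [Ha Hb].
      destruct (Ha (del / 2)) as [ka Ka]; [lra|]. destruct (Hb (del / 2)) as [kb Kb]; [lra|].
      exists (max k0 (max ka kb)). intros k Hk i' [<-|Hi]; [|apply IH; auto; lia].
      eapply Rle_trans; [apply Cnorm_le_ReIm|].
      unfold xsub, xadd, xscale; simpl.
      specialize (Ka k ltac:(lia)). specialize (Kb k ltac:(lia)). unfold Rdist in *.
      rewrite Rabs_minus_sym in Ka, Kb.
      replace (cRe (x i) + (-1 * cRe (z k i) - 0 * cIm (z k i))) with (cRe (x i) - cRe (z k i)) by ring.
      replace (cIm (x i) + (-1 * cIm (z k i) + 0 * cRe (z k i))) with (cIm (x i) - cIm (z k i)) by ring.
      lra. }
    destruct (G l) as [k0 Hk0]. exists (max j k0). split; [lia|]. intros; apply Hk0; auto; lia. }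
  assert (E : forall i, xsub x (z j) i = Cadd (xsub x (z k) i) (xsub (z k) (z j) i)).
  { intros i; unfold xsub, xadd, xscale; cring. }
  assert (HS : t <= rpow (K * del + e j) p).
  { unfold t. rewrite (lsum_ext l _ (fun i => rpow (Cnorm (Cadd (xsub x (z k) i)
       (xsub (z k) (z j) i))) p)) by (intros; now rewrite E).
    apply minkowski_list; auto; [nra| |].
    - rewrite rpow_mul by lra. unfold K. rewrite rpow_inv_l by (auto using pos_INR).
      rewrite <- lsum_const. apply lsum_le; intros i Hi. apply rpow_le; auto.
      split; [apply Cnorm_ge0|auto].
    - now apply Hz. }
  apply Rle_trans with (K * del + e j).
  - rewrite <- (rpow_inv_r (K * del + e j) p) by (auto; nra).
    apply rpow_le; [now apply Rinv_0_lt_compat|]. split; assumption.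
  - assert (K * del <= eps); [|lra]. unfold del.
    apply Rmult_le_reg_r with (K + 1); [lra|]. field_simplify; [|lra]. nra.
Qed.

End Vectors.

Lemma lpB_inj {p I J} (h : I -> J) (x : J -> Cx) r :
  (forall i i', h i = h i' -> i = i') -> lpB p x r -> lpB p (fun i => x (h i)) r.
Proof.
  intros Hh [Hr Hx]; split; [assumption|]. intros l Hl.
  rewrite <- (lsum_map h l (fun j => rpow (Cnorm (x j)) p)). apply Hx.
  apply NoDup_map_NoDup_ForallPairs; [|assumption]. intros i j _ _; apply Hh.
Qed.

Section Fibers.
Context {p : R} {hp : Exponent p} {A B : Type}.
Let exponent_gt0 : 0 < p. Proof. unfold Exponent in hp; lra. Qed.

Lemma lpB_fubini (x : A * B -> Cx) (r : A -> R) s :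
  (forall a, lpB p (fun b => x (a, b)) (r a)) -> 0 <= s ->
  sB (fun a => rpow (r a) p) (rpow s p) -> lpB p x s.
Proof.
  intros H Hs Hr. split; [assumption|].
  apply sB_fubini with (fun a => rpow (r a) p); auto.
  - intros; apply rpow_ge0.
  - intros a; apply H.
Qed.

Lemma lpB_fibers (x : A * B -> Cx) s : lpB p x s ->
  (forall a, lpB p (fun b => x (a, b)) (nrmI p (fun b => x (a, b)))) /\
  sB (fun a => rpow (nrmI p (fun b => x (a, b))) p) (rpow s p).
Proof.
  intros [Hs H]. destruct (sB_fibers _ _ H) as [H1 H2].
  assert (H3 : forall a, lpB p (fun b => x (a, b)) s) by (intros a; split; [assumption|apply H1]).
  split.
  - intros a. eapply lpB_nrmI, H3.
  - intros l Hl. rewrite (lsum_ext l _ (fun a => tot (fun b => rpow (Cnorm (x (a, b))) p))).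
    + now apply H2.
    + intros a _. eapply nrmI_pow, H3.
Qed.

(* A row-wise estimate: [y b] is controlled by finitely many columns [x a]. *)
Lemma lpB_rows (x : A -> B -> Cx) (r : A -> R) s (y : B -> Cx) (la : B -> list A) :
  (forall a, lpB p (x a) (r a)) -> 0 <= s -> sB (fun a => rpow (r a) p) (rpow s p) ->
  (forall b, NoDup (la b)) ->
  (forall b, rpow (Cnorm (y b)) p <= lsum (la b) (fun a => rpow (Cnorm (x a b)) p)) ->
  lpB p y s.
Proof.
  intros H Hs Hr Hl Hy.
  assert (HF : lpB p (fun ba : B * A => x (snd ba) (fst ba)) s).
  { apply (lpB_inj (fun ba : B * A => (snd ba, fst ba)) (fun ab : A * B => x (fst ab) (snd ab))).
    - intros [] []; simpl; congruence.
    - now apply lpB_fubini with r. }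
  destruct HF as [_ HF]. destruct (sB_fibers _ _ HF) as [H1 H2].
  split; [assumption|]. intros l Hl'. eapply Rle_trans; [|apply (H2 l Hl')].
  apply lsum_le; intros b _. eapply Rle_trans; [apply Hy|].
  apply (tot_ub (fun a => rpow (Cnorm (x a b)) p) _ (la b) (H1 b)). apply Hl.
Qed.

End Fibers.

(** * Bounded operators *)

Definition lin (p : R) {I J} (T : (I -> Cx) -> J -> Cx) : Prop :=
  forall a x y, inlp p x -> inlp p y ->
    T (xadd (xscale a x) y) = xadd (xscale a (T x)) (T y).

Definition opb (p : R) {I J} (T : (I -> Cx) -> J -> Cx) (C : R) : Prop :=
  0 <= C /\ lin p T /\ forall x r, lpB p x r -> lpB p (T x) (C * r).

(** Tail form of compactness on the right, stable at once under composition on the left. For 1 < p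
    it agrees with [cptL] and with [Kp]; for p = 1 the functional summing all coordinates would
    violate it. *)
Definition cptR (p : R) {J} (T : (nat -> Cx) -> J -> Cx) : Prop := (exists C, opb p T C) /\
  forall eps, 0 < eps -> exists n, forall x r, lpB p x r -> lpB p (T (tl n x)) (eps * r).

(** Tail form of compactness on the left, stable at once under composition on the right. *)
Definition cptL (p : R) {I} (T : (I -> Cx) -> nat -> Cx) : Prop := (exists C, opb p T C) /\
  forall eps, 0 < eps -> exists n, forall x r, lpB p x r -> lpB p (tl n (T x)) (eps * r).

Section Operators.
Context {p : R} {hp : Exponent p}.

Lemma exponent_gt0 : 0 < p. Proof. unfold Exponent in hp; lra. Qed.
Lemma exponent_neq0 : p <> 0. Proof. unfold Exponent in hp; lra. Qed.

Lemma inlp_add {I} (x y : I -> Cx) : inlp p x -> inlp p y -> inlp p (xadd x y).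
Proof. intros [r Hr] [s Hs]. exists (r + s). now apply lpB_add. Qed.

Lemma inlp_scale {I} a (x : I -> Cx) : inlp p x -> inlp p (xscale a x).
Proof. intros [r Hr]. eexists. apply lpB_scale, Hr. Qed.

Lemma inlp_sub {I} (x y : I -> Cx) : inlp p x -> inlp p y -> inlp p (xsub x y).
Proof. intros. apply inlp_add; [|apply inlp_scale]; assumption. Qed.

Lemma inlp_zero {I} : inlp p (@xzero I).
Proof. exists 0. apply lpB_zero; lra. Qed.

Lemma inlp_mask {I} w (x : I -> Cx) : (forall i, Rabs (w i) <= 1) -> inlp p x -> inlp p (mask w x).
Proof. intros H [r Hr]. exists r. now apply lpB_mask. Qed.

Lemma inlp_xsum {A I} (l : list A) (x : A -> I -> Cx) :
  (forall a, In a l -> inlp p (x a)) -> inlp p (xsum l x).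
Proof.
  induction l as [|a l IH]; intros H; [apply inlp_zero|].
  apply (inlp_add (x a) (xsum l x)); [apply H; now left|]. apply IH; intros; apply H; now right.
Qed.

Section OneOperator.
Context {I J : Type} (T : (I -> Cx) -> J -> Cx).
Hypothesis HT : lin p T.

Lemma lin_zero : T xzero = xzero.
Proof.
  pose proof (HT C1 xzero xzero inlp_zero inlp_zero) as H.
  replace (xadd (xscale C1 xzero) xzero) with (@xzero I) in H by xext.
  apply functional_extensionality; intros j. apply (f_equal (fun f => f j)) in H.
  unfold xadd, xscale in H.
  replace (T xzero j) with (Csub (Cadd (Cmul C1 (T xzero j)) (T xzero j)) (T xzero j)) by ring.
  rewrite <- H. unfold xzero. ring.
Qed.

Lemma lin_scale a x : inlp p x -> T (xscale a x) = xscale a (T x).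
Proof.
  intros Hx. replace (xscale a x) with (xadd (xscale a x) xzero) by xext.
  rewrite HT, lin_zero by auto using inlp_zero. xext.
Qed.

Lemma lin_add x y : inlp p x -> inlp p y -> T (xadd x y) = xadd (T x) (T y).
Proof.
  intros Hx Hy. replace (xadd x y) with (xadd (xscale C1 x) y) by xext.
  rewrite HT by assumption. xext.
Qed.

Lemma lin_sub x y : inlp p x -> inlp p y -> T (xsub x y) = xsub (T x) (T y).
Proof.
  intros Hx Hy. unfold xsub. rewrite lin_add, lin_scale by auto using inlp_scale. reflexivity.
Qed.

Lemma lin_xsum {A} (l : list A) (x : A -> I -> Cx) : (forall a, In a l -> inlp p (x a)) ->
  T (xsum l x) = xsum l (fun a => T (x a)).
Proof.
  induction l as [|a l IH]; intros H; [apply lin_zero|].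
  assert (Hl : forall b, In b l -> inlp p (x b)) by (intros; apply H; now right).
  change (xsum (a :: l) x) with (xadd (x a) (xsum l x)).
  rewrite lin_add, IH; auto using inlp_xsum. apply H; now left.
Qed.

End OneOperator.

Lemma opb_inlp {I J} (T : (I -> Cx) -> J -> Cx) C x : opb p T C -> inlp p x -> inlp p (T x).
Proof. intros (_ & _ & H) [r Hr]. exists (C * r). auto. Qed.

Lemma opb_lin {I J} (T : (I -> Cx) -> J -> Cx) C : opb p T C -> lin p T.
Proof. now intros (_ & H & _). Qed.

Lemma opb_ge0 {I J} (T : (I -> Cx) -> J -> Cx) C : opb p T C -> 0 <= C.
Proof. now intros (H & _ & _). Qed.

Lemma opb_bd {I J} (T : (I -> Cx) -> J -> Cx) C x r : opb p T C -> lpB p x r -> lpB p (T x) (C * r).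
Proof. intros (_ & _ & H). apply H. Qed.

Lemma opb_bound {I J} (T : (I -> Cx) -> J -> Cx) C C' : opb p T C -> 0 <= C' ->
  (forall x r, lpB p x r -> lpB p (T x) (C' * r)) -> opb p T C'.
Proof. intros (H1 & H2 & H3) H H'. split; [assumption|split; assumption]. Qed.

Lemma opb_mono {I J} (T : (I -> Cx) -> J -> Cx) C C' : opb p T C -> C <= C' -> opb p T C'.
Proof.
  intros H HC. pose proof (opb_ge0 _ _ H). apply (opb_bound T C); auto; [lra|].
  intros x r Hx. eapply lpB_mono; [apply (opb_bd _ _ _ _ H Hx)|].
  apply Rmult_le_compat_r; [apply (lpB_ge0 _ _ Hx)|assumption].
Qed.

Lemma opb_ext {I J} (T U : (I -> Cx) -> J -> Cx) C :
  (forall x, inlp p x -> T x = U x) -> opb p T C -> opb p U C.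
Proof.
  intros E (H1 & H2 & H3). split; [assumption|]. split.
  - intros a x y Hx Hy. rewrite <- !E by auto using inlp_add, inlp_scale. auto.
  - intros x r Hx. rewrite <- E by (now exists r). auto.
Qed.

Lemma opb_comp {I J K} (T : (J -> Cx) -> K -> Cx) (U : (I -> Cx) -> J -> Cx) C D :
  opb p T C -> opb p U D -> opb p (fun x => T (U x)) (C * D).
Proof.
  intros HT HU. pose proof HT as (H1 & H2 & H3). pose proof HU as (H4 & H5 & H6).
  split; [now apply Rmult_le_pos|]. split.
  - intros a x y Hx Hy. rewrite H5 by assumption. apply H2; eapply opb_inlp; eauto.
  - intros x r Hx. rewrite Rmult_assoc. auto.
Qed.

Lemma opb_add {I J} (T U : (I -> Cx) -> J -> Cx) C D :
  opb p T C -> opb p U D -> opb p (fun x => xadd (T x) (U x)) (C + D).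
Proof.
  intros (H1 & H2 & H3) (H4 & H5 & H6). split; [lra|]. split.
  - intros a x y Hx Hy. rewrite H2, H5 by assumption. xext.
  - intros x r Hx. rewrite Rmult_plus_distr_r. apply lpB_add; auto.
Qed.

Lemma opb_scale {I J} (T : (I -> Cx) -> J -> Cx) a C :
  opb p T C -> opb p (fun x => xscale a (T x)) (Cnorm a * C).
Proof.
  intros (H1 & H2 & H3). split; [apply Rmult_le_pos; auto using Cnorm_ge0|]. split.
  - intros b x y Hx Hy. rewrite H2 by assumption. xext.
  - intros x r Hx. rewrite Rmult_assoc. apply lpB_scale; auto.
Qed.

Lemma opb_sub {I J} (T U : (I -> Cx) -> J -> Cx) C D :
  opb p T C -> opb p U D -> opb p (fun x => xsub (T x) (U x)) (C + D).
Proof.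
  intros HT HU. unfold xsub. apply (opb_add T (fun x => xscale Cm1 (U x))); [assumption|].
  rewrite <- (Rmult_1_l D), <- Cnorm_Cm1. now apply opb_scale.
Qed.

Lemma opb_zero {I J} C : 0 <= C -> opb p (fun _ : I -> Cx => @xzero J) C.
Proof.
  intros HC. split; [assumption|]. split.
  - intros a x y _ _. xext.
  - intros x r Hx. apply lpB_zero, Rmult_le_pos; [assumption|apply (lpB_ge0 _ _ Hx)].
Qed.

Lemma opb_id {I} : opb p (fun x : I -> Cx => x) 1.
Proof.
  split; [lra|]. split; [now intros a x y _ _|]. intros x r. now rewrite Rmult_1_l.
Qed.

Lemma opb_mask {I} w : (forall i : I, Rabs (w i) <= 1) -> opb p (mask w) 1.
Proof.
  intros Hw. split; [lra|]. split.
  - intros a x y _ _. xext.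
  - intros x r. rewrite Rmult_1_l. now apply lpB_mask.
Qed.

Lemma opb_hd n : opb p (hd n) 1.
Proof. apply opb_mask. intros c; destruct (c <? n)%nat; rewrite ?Rabs_R0, ?Rabs_R1; lra. Qed.

Lemma opb_tl n : opb p (tl n) 1.
Proof. apply opb_mask. intros c; destruct (c <? n)%nat; rewrite ?Rabs_R0, ?Rabs_R1; lra. Qed.

Lemma opb_xsum {A I J} (l : list A) (T : A -> (I -> Cx) -> J -> Cx) C :
  (forall a, In a l -> opb p (T a) (C a)) -> opb p (fun x => xsum l (fun a => T a x)) (lsum l C).
Proof.
  induction l as [|a l IH]; intros H; [apply opb_zero; simpl; lra|].
  apply (opb_add (T a) (fun x => xsum l (fun a => T a x))); [apply H; now left|].
  apply IH; intros; apply H; now right.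
Qed.

Lemma opb_pull {I J} (h : I -> J) : (forall i i', h i = h i' -> i = i') ->
  opb p (fun (x : J -> Cx) i => x (h i)) 1.
Proof.
  intros Hh. split; [lra|]. split; [intros a x y _ _; xext|].
  intros x r Hx. rewrite Rmult_1_l. now apply lpB_inj.
Qed.

Lemma hd_tl n x : xadd (hd n x) (tl n x) = x.
Proof.
  apply functional_extensionality; intros c. unfold xadd, hd, tl, mask.
  destruct (c <? n)%nat; rewrite RtoC_0, RtoC_1; ring.
Qed.

Lemma tl_tl m n x : (m <= n)%nat -> tl m (tl n x) = tl n x.
Proof.
  intros H. apply functional_extensionality; intros c. unfold tl, mask.
  destruct (Nat.ltb_spec c m), (Nat.ltb_spec c n); rewrite ?RtoC_0, ?RtoC_1; try ring. lia.
Qed.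

Lemma tl_tl' m n x : (m <= n)%nat -> tl n (tl m x) = tl n x.
Proof.
  intros H. apply functional_extensionality; intros c. unfold tl, mask.
  destruct (Nat.ltb_spec c m), (Nat.ltb_spec c n); rewrite ?RtoC_0, ?RtoC_1; try ring. lia.
Qed.

(** A finite list nearly exhausts [tot]; past its maximum, any further finite sum is at most the
    remaining eps^p. *)
Lemma lpB_tl_small x r eps : lpB p x r -> 0 < eps ->
  exists n, forall m, (n <= m)%nat -> lpB p (tl m x) eps.
Proof.
  intros [Hr Hx] He. set (f := fun i => rpow (Cnorm (x i)) p) in *.
  assert (Hd : 0 < rpow eps p) by now apply rpow_gt0.
  assert (exists l, NoDup l /\ tot f - rpow eps p < lsum l f) as (l & Hl & Hlt).
  { apply NNPP; intros H.
    assert (tot f <= Rmax 0 (tot f - rpow eps p)).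
    { apply supR_le; [apply Rmax_l|]. intros y (l & Hl & ->).
      apply Rnot_lt_le; intros Hy. apply H. exists l. split; [assumption|].
      eapply Rle_lt_trans; [apply Rmax_r|exact Hy]. }
    destruct (Rle_dec 0 (tot f - rpow eps p)) as [H1|H1].
    - rewrite Rmax_right in H0 by assumption. lra.
    - apply H. exists []. split; [constructor|]. simpl. lra. }
  exists (S (list_max l)). intros m Hm. split; [lra|]. intros l' Hl'.
  set (l2 := filter (fun c => negb (c <? m)%nat) l').
  assert (E : lsum l' (fun i => rpow (Cnorm (tl m x i)) p) = lsum l2 f).
  { unfold l2; clear. induction l' as [|c l' IH]; simpl; [reflexivity|].
    rewrite IH. unfold tl, mask at 1. destruct (c <? m)%nat; simpl.
    - rewrite RtoC_0. replace (Cmul C0 (x c)) with C0 by ring. rewrite Cnorm_C0, rpow_0. ring.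
    - rewrite RtoC_1. replace (Cmul C1 (x c)) with (x c) by ring. reflexivity. }
  rewrite E.
  assert (lsum (l ++ l2) f <= tot f).
  { eapply tot_ub; [exact Hx|]. apply NoDup_app; [assumption|now apply NoDup_filter|].
    intros c Hc Hc'. apply filter_In in Hc' as [_ Hc'].
    pose proof (proj1 (list_max_le l (list_max l)) (le_n _)) as Hmax.
    rewrite Forall_forall in Hmax. specialize (Hmax c Hc).
    destruct (Nat.ltb_spec c m); [discriminate|lia]. }
  rewrite lsum_app in H. lra.
Qed.

(** Finitely supported vectors are dense, so a bound on all heads of [x] passes to [x]. It serves
    where a formula is available for truncated vectors only. *)
Lemma opb_hd_bound {J} (T : (nat -> Cx) -> J -> Cx) C x r s : opb p T C -> lpB p x r ->
  (forall m, lpB p (T (hd m x)) s) -> lpB p (T x) s.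
Proof.
  intros HT Hx H.
  assert (Hs : 0 <= s) by apply (lpB_ge0 _ _ (H 0%nat)).
  assert (HTx : lpB p (T x) (C * r)) by (apply (opb_bd _ _ _ _ HT Hx)).
  apply lpB_mono with (nrmI p (T x)); [apply (lpB_nrmI _ _ HTx)|].
  apply le_epsilon; intros eps He.
  pose proof (opb_ge0 _ _ HT) as HC.
  destruct (lpB_tl_small x r (eps / (C + 1)) Hx) as [n Hn]; [apply Rdiv_lt_0_compat; lra|].
  specialize (Hn n (le_n _)).
  apply (lpB_nrmI (T x) (s + eps)). rewrite <- (hd_tl n x).
  assert (Hi : inlp p x) by now exists r.
  rewrite (lin_add _ (opb_lin _ _ HT)); [|apply (opb_inlp _ _ _ (opb_hd n) Hi)|now eexists; eauto].
  apply lpB_add; [apply H|].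
  eapply lpB_mono; [apply (opb_bd _ _ _ _ HT Hn)|].
  apply Rmult_le_reg_r with (C + 1); [lra|]. field_simplify; [|lra]. nra.
Qed.

(** * Compact operators through uniformly small tails *)

Definition delta (j : nat) : nat -> Cx := fun c => if (c =? j)%nat then C1 else C0.

Lemma lpB_delta j : lpB p (delta j) 1.
Proof.
  split; [lra|]. intros l Hl. rewrite rpow_one.
  apply Rle_trans with (lsum l (fun c => if (c =? j)%nat then 1 else 0)).
  - apply lsum_le; intros c _. unfold delta.
    destruct (c =? j)%nat; rewrite ?Cnorm_C0, ?Cnorm_C1, ?rpow_0, ?rpow_one; lra.
  - assert (G : lsum l (fun c => if (c =? j)%nat then 1 else 0) <= 1
       /\ (~ In j l -> lsum l (fun c => if (c =? j)%nat then 1 else 0) = 0)); [|apply G].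
    induction l as [|c l IH]; simpl; [lra|]. inversion Hl; subst.
    destruct (IH H2) as [H3 H4]. destruct (Nat.eqb_spec c j) as [->|].
    + rewrite H4 by assumption. split; [lra|tauto].
    + split; [lra|]. intros; rewrite H4 by tauto. lra.
Qed.

Lemma inlp_delta j : inlp p (delta j).
Proof. exists 1. apply lpB_delta. Qed.

Lemma hd_delta n x : hd n x = xsum (seq 0 n) (fun j => xscale (x j) (delta j)).
Proof.
  apply functional_extensionality; intros c. unfold hd, mask, xsum, xscale.
  destruct (Nat.ltb_spec c n) as [H|H].
  - rewrite (csum_single Nat.eq_dec _ c).
    + unfold delta. rewrite Nat.eqb_refl, RtoC_1. ring.
    + apply seq_NoDup.
    + apply in_seq; lia.
    + intros b _ Hb. unfold delta. destruct (Nat.eqb_spec c b); [congruence|ring].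
  - rewrite RtoC_0. rewrite (csum_ext _ _ (fun _ => C0)).
    + rewrite csum_zero; ring.
    + intros b Hb. apply in_seq in Hb. unfold delta. destruct (Nat.eqb_spec c b); [lia|ring].
Qed.

(* The values of a bounded functional on the unit vectors form a vector of l^q. *)
Lemma row_in_lq {J} (T : (nat -> Cx) -> J -> Cx) C c q : opb p T C -> / p + / q = 1 ->
  lpB q (fun j => T (delta j) c) C.
Proof.
  intros HT Hpq. pose proof hp as Hp. unfold Exponent in Hp.
  assert (Hip1 : / p < 1) by (rewrite <- Rinv_1; apply Rinv_lt_contravar; lra).
  assert (Hq : 0 < q).
  { rewrite <- (Rinv_inv q). apply Rinv_0_lt_compat. lra. }
  assert (Hqp : (q - 1) * p = q).
  { assert (q * p * (/ p + / q) = q * p) by (rewrite Hpq; ring).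
    rewrite Rmult_plus_distr_l in H.
    replace (q * p * / p) with q in H by (field; lra).
    replace (q * p * / q) with p in H by (field; lra). lra. }
  assert (Hq1 : 0 < q - 1) by nra.
  split; [apply (opb_ge0 _ _ HT)|]. intros l Hl.
  set (f := fun j => T (delta j) c).
  set (S0 := lsum l (fun j => rpow (Cnorm (f j)) q)).
  assert (HS : 0 <= S0) by (apply lsum_ge0; intros; apply rpow_ge0).
  destruct HS as [HS|HS]; [|change (S0 <= rpow C q); rewrite <- HS; apply rpow_ge0].
  (* The vector attaining equality in Hoelder's inequality: the coordinate [c] of [T x] is [S0],
     while |v_j|^p = |f_j|^q, by [Hqp], gives [x] the norm S0^(1/p). *)
  pose (v := fun j => dual_value q (f j)).
  set (x := xsum l (fun j => xscale (v j) (delta j))).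
  assert (Hx : lpB p x (rpow S0 (/ p))).
  { split; [apply rpow_ge0|]. rewrite rpow_inv_l by (auto using exponent_neq0; lra).
    assert (Hxc : forall d, In d l -> Cnorm (x d) = Cnorm (v d)).
    { intros d Hd. unfold x, xsum, xscale. rewrite (csum_single Nat.eq_dec _ d); auto.
      - unfold delta. rewrite Nat.eqb_refl. apply f_equal; ring.
      - intros b _ Hb. unfold delta. destruct (Nat.eqb_spec d b); [congruence|ring]. }
    assert (Hx0 : forall d, ~ In d l -> x d = C0).
    { intros d Hd. unfold x, xsum, xscale. rewrite (csum_ext _ _ (fun _ => C0)); [apply csum_zero|].
      intros b Hb. unfold delta. destruct (Nat.eqb_spec d b); [congruence|ring]. }
    intros l' Hl'. eapply Rle_trans; [apply (lsum_support l' l)|]; auto.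
    - intros; apply rpow_ge0.
    - intros d Hd. rewrite Hx0, Cnorm_C0 by assumption. apply rpow_0.
    - right. apply lsum_ext; intros d Hd.
      rewrite Hxc by assumption. unfold v. rewrite Cnorm_dual_value, rpow_rpow, Hqp. reflexivity. }
  pose proof (lpB_coord _ _ c (opb_bd _ _ _ _ HT Hx)) as H.
  assert (E : T x c = RtoC S0).
  { unfold x. rewrite (lin_xsum _ (opb_lin _ _ HT)) by auto using inlp_scale, inlp_delta.
    unfold xsum. unfold S0. rewrite <- csum_RtoC. apply csum_ext; intros j _.
    rewrite (lin_scale _ (opb_lin _ _ HT)) by apply inlp_delta. apply mul_dual_value. }
  rewrite E, Cnorm_RtoC, Rabs_right in H by lra.
  assert (H2 : rpow S0 (/ q) <= C).
  { assert (Hs : S0 = rpow S0 (/ p) * rpow S0 (/ q)).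
    { rewrite <- rpow_plus, Hpq, rpow_1; lra. }
    rewrite Hs in H at 1. pose proof (rpow_gt0 S0 (/ p) HS). nra. }
  change (S0 <= rpow C q). rewrite <- (rpow_inv_l S0 q) by lra.
  apply rpow_le; [assumption|]. split; [apply rpow_ge0|assumption].
Qed.

End Operators.

Section Compact.
Context {p : R} {hp : Exponent p}.

(** The row [c] of [T] lies in l^q with q finite because p > 1, so its tails are small there;
    Hoelder's inequality converts this into a small coordinate [c] on tail vectors. *)
Lemma row_tail_small {J} (T : (nat -> Cx) -> J -> Cx) C c eps : opb p T C -> 0 < eps ->
  exists n, forall m, (n <= m)%nat -> forall x r, lpB p x r -> Cnorm (T (tl m x) c) <= eps * r.
Proof.
  intros HT He. pose proof hp as Hp. unfold Exponent in Hp.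
  pose (q := p / (p - 1)).
  assert (Hpq : / p + / q = 1) by (unfold q; field; lra).
  assert (Hq : 1 < q).
  { unfold q. apply Rmult_lt_reg_r with (p - 1); [lra|].
    replace (p / (p - 1) * (p - 1)) with p by (field; lra). lra. }
  pose proof (row_in_lq T C c q HT Hpq) as Hf.
  set (f := fun j => T (delta j) c) in *.
  destruct (lpB_tl_small f C (eps) Hf He) as [n Hn].
  exists n. intros m Hm x r Hx.
  assert (Hr : 0 <= r) by apply (lpB_ge0 _ _ Hx).
  apply le_epsilon; intros e' He'.
  pose proof (opb_ge0 _ _ HT) as HC.
  (* The row describes [T] on finite combinations of unit vectors only; the part of [x] beyond [K]
     is paid for by [e']. *)
  destruct (lpB_tl_small x r (e' / (C + 1)) Hx) as [K HK]; [apply Rdiv_lt_0_compat; lra|].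
  specialize (HK K (le_n _)).
  assert (Hi : inlp p x) by now exists r.
  assert (Htl : forall k y, inlp p y -> inlp p (tl k y)) by (intros; eapply opb_inlp; [apply opb_tl|auto]).
  assert (Hhd : forall k y, inlp p y -> inlp p (hd k y)) by (intros; eapply opb_inlp; [apply opb_hd|auto]).
  rewrite <- (hd_tl K x) at 1.
  rewrite (lin_add _ (opb_lin _ _ (opb_tl m))), (lin_add _ (opb_lin _ _ HT)) by auto.
  unfold xadd. eapply Rle_trans; [apply Cnorm_add|]. apply Rplus_le_compat.
  - assert (E : T (tl m (hd K x)) c = csum (seq 0 K) (fun j => Cmul (tl m x j) (f j))).
    { replace (tl m (hd K x)) with (hd K (tl m x)) by xext.
      rewrite hd_delta, (lin_xsum _ (opb_lin _ _ HT)) by auto using inlp_scale, inlp_delta.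
      unfold xsum; apply csum_ext; intros j _.
      rewrite (lin_scale _ (opb_lin _ _ HT)) by apply inlp_delta. reflexivity. }
    rewrite E. eapply Rle_trans; [apply Cnorm_csum|].
    rewrite (lsum_ext _ _ (fun j => Cnorm (tl m f j) * Cnorm (x j))).
    2:{ intros j _. unfold tl, mask. rewrite !Cnorm_mul. ring. }
    pose proof (Hn m Hm) as [_ Hm2].
    rewrite Rmult_comm. rewrite (lsum_ext _ _ (fun j => Cnorm (x j) * Cnorm (tl m f j)))
      by (intros; ring).
    apply hoelder with p q; auto using Cnorm_ge0; try lra.
    + apply Hx, seq_NoDup.
    + apply Hm2, seq_NoDup.
  - pose proof (opb_bd _ _ _ _ (opb_tl m) HK) as H1.
    pose proof (lpB_coord _ _ c (opb_bd _ _ _ _ HT H1)) as H2.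
    eapply Rle_trans; [exact H2|].
    apply Rmult_le_reg_r with (C + 1); [lra|]. field_simplify; [|lra]. nra.
Qed.

(** Beyond output coordinate [n] the hypothesis applies; the first [n] coordinates are finitely many
    rows, each controlled by [row_tail_small]. *)
Lemma cptL_cptR (T : (nat -> Cx) -> nat -> Cx) : cptL p T -> cptR p T.
Proof.
  intros [[C HT] H]. split; [now exists C|]. intros eps He.
  destruct (H (eps / 2)) as [n Hn]; [lra|].
  assert (G : forall n, exists m, forall x r, lpB p x r ->
     lpB p (hd n (T (tl m x))) (eps / 2 * r)).
  { clear n Hn. intros n.
    set (e := eps / 2 / (INR n + 1)).
    pose proof (pos_INR n).
    assert (Hpos : 0 < e) by (apply Rdiv_lt_0_compat; lra).
    assert (exists m, forall c, (c < n)%nat -> forall x r, lpB p x r -> Cnorm (T (tl m x) c) <= e * r)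
      as [m Hm].
    { clearbody e. clear -HT Hpos hp.
      assert (exists m, forall m', (m <= m')%nat -> forall c, (c < n)%nat ->
        forall x r, lpB p x r -> Cnorm (T (tl m' x) c) <= e * r) as [m Hm].
      2:{ exists m. intros; now apply Hm. }
      induction n as [|n [m IH]]; [exists 0%nat; lia|].
      destruct (row_tail_small T C n e HT Hpos) as [k Hk].
      exists (max m k). intros m' Hm' c Hc x r Hx.
      destruct (Nat.eq_dec c n) as [->|]; [apply Hk|apply IH]; auto; lia. }
    exists m. intros x r Hx. rewrite hd_delta.
    apply lpB_mono with (lsum (seq 0 n) (fun _ => e * r)).
    - apply lpB_xsum. intros c Hc. apply in_seq in Hc.
      apply lpB_mono with (Cnorm (T (tl m x) c) * 1).
      + apply lpB_scale, lpB_delta.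
      + rewrite Rmult_1_r. apply Hm; [lia|assumption].
    - rewrite lsum_const, length_seq. pose proof (lpB_ge0 _ _ Hx).
      replace (eps / 2 * r) with ((INR n + 1) * e * r) by (unfold e; field; lra).
      rewrite <- Rmult_assoc. apply Rmult_le_compat_r; [assumption|]. nra. }
  destruct (G n) as [m Hm]. exists m. intros x r Hx.
  rewrite <- (hd_tl n (T (tl m x))). replace (eps * r) with (eps / 2 * r + eps / 2 * r) by field.
  apply lpB_add; [auto|]. apply Hn. rewrite <- (Rmult_1_l r). now apply (opb_bd _ _ _ _ (opb_tl m)).
Qed.

(** Beyond input coordinate [n] the hypothesis applies; the first [n] inputs give finitely many
    columns [T (delta j)], each a single l^p vector with small tails. *)
Lemma cptR_cptL (T : (nat -> Cx) -> nat -> Cx) : cptR p T -> cptL p T.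
Proof.
  intros [[C HT] H]. split; [now exists C|]. intros eps He.
  destruct (H (eps / 2)) as [n Hn]; [lra|].
  set (e := eps / 2 / (INR n + 1)).
  pose proof (pos_INR n).
  assert (Hpos : 0 < e) by (apply Rdiv_lt_0_compat; lra).
  assert (exists m, forall j, (j < n)%nat -> lpB p (tl m (T (delta j))) e) as [m Hm].
  { clearbody e. clear -HT Hpos hp.
    assert (exists m, forall m', (m <= m')%nat -> forall j, (j < n)%nat ->
      lpB p (tl m' (T (delta j))) e) as [m Hm].
    2:{ exists m. intros; now apply Hm. }
    induction n as [|n [m IH]]; [exists 0%nat; lia|].
    destruct (lpB_tl_small (p := p) (T (delta n)) (C * 1) e) as [k Hk]; auto.
    { apply (opb_bd _ _ _ _ HT), lpB_delta. }
    exists (max m k). intros m' Hm' c Hc.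
    destruct (Nat.eq_dec c n) as [->|]; [apply Hk|apply IH]; lia. }
  exists m. intros x r Hx. pose proof (lpB_ge0 _ _ Hx).
  assert (Hi : inlp p x) by now exists r.
  assert (Htl : forall k y, inlp p y -> inlp p (tl k y)) by (intros; eapply opb_inlp; [apply opb_tl|auto]).
  assert (Hhd : forall k y, inlp p y -> inlp p (hd k y)) by (intros; eapply opb_inlp; [apply opb_hd|auto]).
  assert (HTi : forall y, inlp p y -> inlp p (T y)) by (intros; eapply opb_inlp; eauto).
  rewrite <- (hd_tl n x).
  rewrite (lin_add _ (opb_lin _ _ HT)) by auto.
  rewrite (lin_add _ (opb_lin _ _ (opb_tl m))) by auto.
  replace (eps * r) with (eps / 2 * r + eps / 2 * r) by field. apply lpB_add.
  - rewrite hd_delta, (lin_xsum _ (opb_lin _ _ HT)) by auto using inlp_scale, inlp_delta.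
    rewrite (lin_xsum _ (opb_lin _ _ (opb_tl m))) by auto using inlp_scale, inlp_delta.
    apply lpB_mono with (lsum (seq 0 n) (fun _ => r * e)).
    + apply lpB_xsum. intros j Hj. apply in_seq in Hj.
      rewrite (lin_scale _ (opb_lin _ _ HT)) by apply inlp_delta.
      rewrite (lin_scale _ (opb_lin _ _ (opb_tl m))) by auto using inlp_delta.
      apply lpB_mono with (Cnorm (x j) * e); [apply lpB_scale, Hm; lia|].
      apply Rmult_le_compat_r; [lra|]. now apply lpB_coord.
    + rewrite lsum_const, length_seq.
      replace (eps / 2 * r) with (r * ((INR n + 1) * e)) by (unfold e; field; lra). nra.
  - rewrite <- (Rmult_1_l (_ * r)). apply (opb_bd _ _ _ _ (opb_tl m)). auto.
Qed.

Lemma cptR_ext {J} (T U : (nat -> Cx) -> J -> Cx) :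
  (forall x, inlp p x -> T x = U x) -> cptR p T -> cptR p U.
Proof.
  intros E [[C HT] H]. split; [exists C; eapply opb_ext; eauto|].
  intros eps He. destruct (H eps He) as [n Hn]. exists n. intros x r Hx.
  rewrite <- E; [auto|]. eapply opb_inlp; [apply opb_tl|now exists r].
Qed.

Lemma cptR_tail {J} (T : (nat -> Cx) -> J -> Cx) eps : cptR p T -> 0 < eps ->
  exists n, forall m, (n <= m)%nat -> opb p (fun x => T (tl m x)) eps.
Proof.
  intros [[C HT] H] He. destruct (H eps He) as [n Hn]. exists n. intros m Hm.
  apply (opb_bound _ (C * 1)); [apply opb_comp; [assumption|apply opb_tl]|lra|].
  intros x r Hx. rewrite <- (tl_tl n m x Hm). apply Hn.
  rewrite <- (Rmult_1_l r). apply (opb_bd _ _ _ _ (opb_tl m) Hx).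
Qed.

Lemma cptL_tail {I} (T : (I -> Cx) -> nat -> Cx) eps : cptL p T -> 0 < eps ->
  exists n, forall m, (n <= m)%nat -> opb p (fun x => tl m (T x)) eps.
Proof.
  intros [[C HT] H] He. destruct (H eps He) as [n Hn]. exists n. intros m Hm.
  apply (opb_bound _ (1 * C)); [apply opb_comp; [apply opb_tl|assumption]|lra|].
  intros x r Hx. rewrite <- (tl_tl' n m) by assumption.
  rewrite <- (Rmult_1_l (eps * r)). apply (opb_bd _ _ _ _ (opb_tl m)). auto.
Qed.

Lemma cptR_add {J} (T U : (nat -> Cx) -> J -> Cx) : cptR p T -> cptR p U ->
  cptR p (fun x => xadd (T x) (U x)).
Proof.
  intros HT HU. pose proof HT as [[C HC] _]. pose proof HU as [[D HD] _].
  split; [exists (C + D); now apply opb_add|]. intros eps He.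
  destruct (cptR_tail T (eps / 2) HT) as [n Hn]; [lra|].
  destruct (cptR_tail U (eps / 2) HU) as [m Hm]; [lra|].
  exists (max n m). intros x r Hx. replace (eps * r) with (eps / 2 * r + eps / 2 * r) by field.
  apply lpB_add; [refine (opb_bd _ _ _ _ (Hn _ _) Hx)|refine (opb_bd _ _ _ _ (Hm _ _) Hx)]; lia.
Qed.

Lemma cptR_compl {J K} (S : (J -> Cx) -> K -> Cx) (T : (nat -> Cx) -> J -> Cx) D :
  opb p S D -> cptR p T -> cptR p (fun x => S (T x)).
Proof.
  intros HS [[C HC] H]. split; [exists (D * C); now apply opb_comp|]. intros eps He.
  pose proof (opb_ge0 _ _ HS).
  destruct (H (eps / (D + 1))) as [n Hn]; [apply Rdiv_lt_0_compat; lra|]. exists n.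
  intros x r Hx. eapply lpB_mono; [apply (opb_bd _ _ _ _ HS (Hn x r Hx))|].
  rewrite <- Rmult_assoc. apply Rmult_le_compat_r; [apply (lpB_ge0 _ _ Hx)|].
  apply Rmult_le_reg_r with (D + 1); [lra|]. field_simplify; [|lra]. nra.
Qed.

Lemma cptR_scale {J} a (T : (nat -> Cx) -> J -> Cx) : cptR p T ->
  cptR p (fun x => xscale a (T x)).
Proof. intros H. exact (cptR_compl (xscale a) T _ (opb_scale _ a _ opb_id) H). Qed.

Lemma cptR_sub {J} (T U : (nat -> Cx) -> J -> Cx) : cptR p T -> cptR p U ->
  cptR p (fun x => xsub (T x) (U x)).
Proof. intros HT HU. unfold xsub. apply (cptR_add T (fun x => xscale Cm1 (U x))); auto using cptR_scale. Qed.

(** Right composition is immediate for [cptL], hence the detour through it. *)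
Lemma cptR_compr (T S : (nat -> Cx) -> nat -> Cx) D :
  opb p S D -> cptR p T -> cptR p (fun x => T (S x)).
Proof.
  intros HS HT. apply cptR_cptL in HT as [[C HC] H]. apply cptL_cptR.
  split; [exists (C * D); now apply opb_comp|]. intros eps He.
  pose proof (opb_ge0 _ _ HS).
  destruct (H (eps / (D + 1))) as [n Hn]; [apply Rdiv_lt_0_compat; lra|]. exists n.
  intros x r Hx. eapply lpB_mono; [apply Hn, (opb_bd _ _ _ _ HS Hx)|].
  rewrite <- Rmult_assoc. apply Rmult_le_compat_r; [apply (lpB_ge0 _ _ Hx)|].
  apply Rmult_le_reg_r with (D + 1); [lra|]. field_simplify; [|lra]. nra.
Qed.

Lemma cptR_zero {J} : cptR p (fun _ : nat -> Cx => @xzero J).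
Proof.
  split; [exists 0; apply opb_zero; lra|]. intros eps He. exists 0%nat. intros x r Hx.
  apply lpB_zero, Rmult_le_pos; [lra|apply (lpB_ge0 _ _ Hx)].
Qed.

Lemma cptR_limit {J} (T : (nat -> Cx) -> J -> Cx) C : opb p T C ->
  (forall eps, 0 < eps -> exists K, cptR p K /\ opb p (fun x => xsub (T x) (K x)) eps) ->
  cptR p T.
Proof.
  intros HT H. split; [now exists C|]. intros eps He.
  destruct (H (eps / 2)) as (K & HK & HTK); [lra|].
  destruct (cptR_tail K (eps / 2) HK) as [n Hn]; [lra|]. exists n. intros x r Hx.
  replace (T (tl n x)) with (xadd (xsub (T (tl n x)) (K (tl n x))) (K (tl n x))) by xext.
  replace (eps * r) with (eps / 2 * r + eps / 2 * r) by field.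
  assert (Hx' : lpB p (tl n x) r) by (rewrite <- (Rmult_1_l r); apply (opb_bd _ _ _ _ (opb_tl n) Hx)).
  apply lpB_add; [apply (opb_bd _ _ _ _ HTK Hx')|apply (opb_bd _ _ _ _ (Hn n (le_n _)) Hx)].
Qed.

Lemma cptR_maskR {J} (T : (nat -> Cx) -> J -> Cx) C w n : opb p T C ->
  (forall c, Rabs (w c) <= 1) -> (forall c, (n <= c)%nat -> w c = 0) ->
  cptR p (fun x => T (mask w x)).
Proof.
  intros HT Hw H0. split; [exists (C * 1); apply opb_comp; [assumption|now apply opb_mask]|].
  intros eps He. exists n. intros x r Hx.
  replace (mask w (tl n x)) with (@xzero nat).
  - rewrite (lin_zero _ (opb_lin _ _ HT)). apply lpB_zero, Rmult_le_pos; [lra|apply (lpB_ge0 _ _ Hx)].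
  - apply functional_extensionality; intros c. unfold tl, mask, xzero.
    destruct (Nat.ltb_spec c n); [|rewrite H0 by assumption]; rewrite RtoC_0; ring.
Qed.

Lemma cptR_maskL (T : (nat -> Cx) -> nat -> Cx) C w n : opb p T C ->
  (forall c, Rabs (w c) <= 1) -> (forall c, (n <= c)%nat -> w c = 0) ->
  cptR p (fun x => mask w (T x)).
Proof.
  intros HT Hw H0. apply (cptR_compr (mask w) T C HT).
  eapply (cptR_maskR (fun x => x)); eauto using opb_id.
Qed.

End Compact.

(** * The spaces and operators of the statement *)

Lemma lsum_sum_f (u : nat -> R) n : sum_f_R0 u n = lsum (seq 0 (S n)) u.
Proof.
  induction n as [|n IH]; [simpl; ring|]. rewrite lsum_seq_S, <- IH. reflexivity.
Qed.

Lemma sumR_eq u l : infinite_sum u l -> sumR u = l.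
Proof.
  intros H. unfold sumR. destruct excluded_middle_informative as [E|E].
  - destruct constructive_indefinite_description as [l' H']; simpl.
    eapply uniqueness_sum; eauto.
  - exfalso; apply E; now exists l.
Qed.

Lemma incl_seq_max l : incl l (seq 0 (S (list_max l))).
Proof.
  intros c Hc. apply in_seq.
  pose proof (proj1 (list_max_le l (list_max l)) (le_n _)) as Hmax.
  rewrite Forall_forall in Hmax. specialize (Hmax c Hc). lia.
Qed.

Lemma infinite_sum_sB (u : nat -> R) s : (forall c, 0 <= u c) -> infinite_sum u s -> sB u s.
Proof.
  intros Hu H l Hl.
  apply Rle_trans with (lsum (seq 0 (S (list_max l))) u).
  - apply lsum_incl; auto using incl_seq_max.
  - rewrite <- lsum_sum_f. apply sum_incr; auto.
Qed.

Lemma sB_infinite_sum (u : nat -> R) s : (forall c, 0 <= u c) -> sB u s ->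
  exists t, infinite_sum u t /\ t <= s.
Proof.
  intros Hu H.
  destruct (Un_cv_crit (sum_f_R0 u)) as [t Ht].
  - intros n. rewrite !lsum_sum_f, (lsum_seq_S (S n)). pose proof (Hu (S n)). lra.
  - exists s. intros x [n ->]. rewrite lsum_sum_f. apply H, seq_NoDup.
  - exists t. split; [exact Ht|].
    apply Rnot_lt_le; intros Hlt. destruct (Ht (t - s)) as [N HN]; [lra|].
    specialize (HN N (le_n _)). unfold Rdist in HN. apply Rabs_def2 in HN.
    assert (sum_f_R0 u N <= s) by (rewrite lsum_sum_f; apply H, seq_NoDup). lra.
Qed.

Definition unbounded_set (S0 : nat -> Prop) : Prop := forall N, exists k, (N <= k)%nat /\ S0 k.

(** Peel off the lowest interval of length [del]: either infinitely many indices fall into it, or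
    all late indices lie in the remaining [n] intervals. *)
Lemma pigeonhole (f : nat -> R) del n : 0 < del -> forall a S0, unbounded_set S0 ->
  (forall k, S0 k -> a <= f k <= a + INR n * del) ->
  exists S1, unbounded_set S1 /\ (forall k, S1 k -> S0 k) /\
    forall k k', S1 k -> S1 k' -> Rabs (f k - f k') <= del.
Proof.
  intros Hd. induction n as [|n IH]; intros a S0 Hinf Hf.
  - exists S0. split; [assumption|]. split; [auto|]. intros k k' Hk Hk'.
    apply Hf in Hk. apply Hf in Hk'. simpl in *. unfold Rabs; destruct Rcase_abs; lra.
  - destruct (classic (unbounded_set (fun k => S0 k /\ f k <= a + del))) as [H|H].
    + exists (fun k => S0 k /\ f k <= a + del). split; [assumption|]. split; [tauto|].
      intros k k' [Hk1 Hk2] [Hk1' Hk2']. apply Hf in Hk1. apply Hf in Hk1'.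
      unfold Rabs; destruct Rcase_abs; lra.
    + apply not_all_ex_not in H as [N HN].
      destruct (IH (a + del) (fun k => S0 k /\ (N <= k)%nat)) as (S1 & H1 & H2 & H3).
      * intros m. destruct (Hinf (max m N)) as (k & Hk & HS). exists k. repeat split; auto; lia.
      * intros k [Hk HNk]. rewrite S_INR in Hf. specialize (Hf k Hk). split; [|lra].
        apply Rnot_lt_le; intros Hlt. apply HN. exists k. repeat split; auto; lra.
      * exists S1. split; [assumption|]. split; [intros k Hk; now apply H2|assumption].
Qed.

Lemma pigeonhole_bounded (f : nat -> R) del C S0 : 0 < del -> unbounded_set S0 ->
  (forall k, Rabs (f k) <= C) ->
  exists S1, unbounded_set S1 /\ (forall k, S1 k -> S0 k) /\
    forall k k', S1 k -> S1 k' -> Rabs (f k - f k') <= del.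
Proof.
  intros Hd Hinf Hf. destruct (INR_unbounded (2 * C / del)) as [n Hn].
  apply (pigeonhole f del n Hd (- C)); [assumption|]. intros k _.
  specialize (Hf k). apply Rmult_gt_compat_r with (r := del) in Hn; [|lra].
  replace (2 * C / del * del) with (2 * C) in Hn by (field; lra).
  unfold Rabs in Hf. destruct Rcase_abs in Hf; lra.
Qed.

Lemma phi_ge (phi : nat -> nat) : (forall k, (phi k < phi (S k))%nat) -> forall k, (k <= phi k)%nat.
Proof. intros H. induction k; [lia|]. specialize (H k). lia. Qed.

Lemma infR_le (E : R -> Prop) r : (forall s, E s -> 0 <= s) -> E r -> infR E <= r.
Proof.
  intros H0 Hr. unfold infR.
  assert (- r <= supR (fun s => E (- s))); [|lra].
  apply (supR_ub _ 0); [|now rewrite Ropp_involutive].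
  intros s Hs. apply H0 in Hs. lra.
Qed.

Lemma infR_ge (E : R -> Prop) b : (exists r, E r) -> (forall s, E s -> b <= s) -> b <= infR E.
Proof.
  intros [r Hr] Hb. unfold infR.
  assert (supR (fun s => E (- s)) <= - b); [|lra].
  unfold supR. destruct excluded_middle_informative as [Hc|Hc].
  - destruct completeness as [m [H1 H2]]; simpl. apply H2. intros s Hs. apply Hb in Hs. lra.
  - exfalso; apply Hc. split.
    + exists (- b). intros s Hs. apply Hb in Hs. lra.
    + exists (- r). now rewrite Ropp_involutive.
Qed.

(* [essb p T c]: the essential norm of [T] is at most [c], read off tails on either side. *)
Definition essb (p : R) (T : Op) (c : R) : Prop := forall eps, 0 < eps -> exists n, forall m, (n <= m)%nat ->
  opb p (fun x => T (tl m x)) (c + eps) /\ opb p (fun x => tl m (T x)) (c + eps).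

Section Bridge.
Context {p : R} {hp : Exponent p}.

Let pp : 0 < p := exponent_gt0.
Let pn : p <> 0 := exponent_neq0.

Lemma mem_lpB x : mem (lp p) x -> lpB p x (nrm (lp p) x).
Proof.
  intros [s Hs]. simpl. rewrite (sumR_eq _ _ Hs).
  assert (HB : sB (fun n => rpow (Cnorm (x n)) p) s).
  { apply infinite_sum_sB; [|assumption]. intros; apply rpow_ge0. }
  split; [apply rpow_ge0|]. rewrite rpow_inv_l; auto. eapply sB_ge0; eauto.
Qed.

Lemma lpB_mem x r : lpB p x r -> mem (lp p) x /\ nrm (lp p) x <= r.
Proof.
  intros [Hr H].
  destruct (sB_infinite_sum (fun n => rpow (Cnorm (x n)) p) _ (fun _ => rpow_ge0 _ _) H) as (t & Ht & Hle).
  simpl. split; [now exists t|]. rewrite (sumR_eq _ _ Ht).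
  rewrite <- (rpow_inv_r r p) by auto. apply rpow_le; [now apply Rinv_0_lt_compat|].
  split; [|assumption].
  eapply sB_ge0, infinite_sum_sB; [|exact Ht]. intros; apply rpow_ge0.
Qed.

Lemma mem_inlp x : mem (lp p) x <-> inlp p x.
Proof.
  split; [intros H; eexists; apply mem_lpB, H|]. intros [r Hr]. apply (lpB_mem x r Hr).
Qed.

Lemma nrm_ge0 x : 0 <= nrm (lp p) x.
Proof. apply rpow_ge0. Qed.

Lemma Bp_opb T : Bp p T <-> exists C, opb p T C.
Proof.
  split.
  (* The constant in [bounded_op] carries no sign, whereas [opb] wants a nonnegative one. *)
  - intros (H1 & H2 & c & H3). exists (Rmax c 0).
    assert (H4 : forall x, inlp p x -> inlp p (T x)) by (intros x; rewrite <- !mem_inlp; auto).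
    split; [apply Rmax_r|]. split.
    + intros a x y Hx Hy. apply H2; now apply mem_inlp.
    + intros x r Hx. assert (Hm : mem (lp p) x) by (apply (lpB_mem x r Hx)).
      eapply lpB_mono; [apply mem_lpB; auto|].
      eapply Rle_trans; [now apply H3|].
      pose proof (nrm_ge0 x). pose proof (proj2 (lpB_mem x r Hx)).
      apply Rle_trans with (Rmax c 0 * nrm (lp p) x).
      * apply Rmult_le_compat_r; [assumption|apply Rmax_l].
      * apply Rmult_le_compat_l; [apply Rmax_r|assumption].
  - intros [C HT]. split; [|split].
    + intros x Hx. apply mem_inlp. eapply opb_inlp; [exact HT|now apply mem_inlp].
    + intros a x y Hx Hy. apply (opb_lin _ _ HT); now apply mem_inlp.
    + exists C. intros x Hx. apply lpB_mem, (opb_bd _ _ _ _ HT), mem_lpB, Hx.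
Qed.

(** Total boundedness in the form consumed by a diagonal argument. Coordinates from [n] on are
    uniformly small; real and imaginary parts of the first [n] are stabilised one after another by
    the pigeonhole principle. *)
Lemma cptL_subset (T : Op) (u : nat -> seqC) : cptL p T -> (forall k, lpB p (u k) 1) ->
  forall eps S0, 0 < eps -> unbounded_set S0 ->
  exists S1, unbounded_set S1 /\ (forall k, S1 k -> S0 k) /\
    forall k k', S1 k -> S1 k' -> lpB p (xsub (T (u k)) (T (u k'))) eps.
Proof.
  intros [[C HC] HT] Hu eps S0 He Hinf.
  destruct (HT (eps / 4)) as [n Hn]; [lra|].
  set (del := eps / 4 / (INR n + 1)). pose proof (pos_INR n).
  assert (Hd : 0 < del) by (apply Rdiv_lt_0_compat; lra).
  assert (exists S1, unbounded_set S1 /\ (forall k, S1 k -> S0 k) /\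
    forall k k', S1 k -> S1 k' -> forall c, (c < n)%nat ->
      Cnorm (xsub (T (u k)) (T (u k')) c) <= 2 * del) as (S1 & H1 & H2 & H3).
  { clearbody del. clear -HC Hu Hinf Hd hp.
    induction n as [|n (S1 & H1 & H2 & H3)].
    - exists S0. repeat split; auto. lia.
    - assert (Hb : forall k, Cnorm (T (u k) n) <= C * 1).
      { intros k. apply (lpB_coord (p := p)). apply (opb_bd _ _ _ _ HC), Hu. }
      destruct (pigeonhole_bounded (fun k => cRe (T (u k) n)) del (C * 1) S1) as (S2 & H4 & H5 & H6); auto.
      { intros k. eapply Rle_trans; [apply Re_le_Cnorm|apply Hb]. }
      destruct (pigeonhole_bounded (fun k => cIm (T (u k) n)) del (C * 1) S2) as (S3 & H7 & H8 & H9); auto.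
      { intros k. eapply Rle_trans; [apply Im_le_Cnorm|apply Hb]. }
      exists S3. split; [assumption|]. split; [auto|]. intros k k' Hk Hk' c Hc.
      destruct (Nat.eq_dec c n) as [->|]; [|apply H3; auto; lia].
      eapply Rle_trans; [apply Cnorm_le_ReIm|]. unfold xsub, xadd, xscale; simpl.
      specialize (H6 k k' (H8 _ Hk) (H8 _ Hk')). specialize (H9 k k' Hk Hk').
      match goal with |- Rabs ?a + Rabs ?b <= _ =>
        replace a with (cRe (T (u k) n) - cRe (T (u k') n)) by ring;
        replace b with (cIm (T (u k) n) - cIm (T (u k') n)) by ring end.
      lra. }
  exists S1. split; [assumption|]. split; [assumption|]. intros k k' Hk Hk'.
  rewrite <- (hd_tl n (xsub _ _)). replace eps with (eps / 2 + (eps / 4 + eps / 4)) by field.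
  apply lpB_add.
  - rewrite hd_delta. apply lpB_mono with (lsum (seq 0 n) (fun _ => 2 * del)).
    + apply lpB_xsum. intros c Hc. apply in_seq in Hc.
      eapply lpB_mono; [apply lpB_scale, lpB_delta|]. rewrite Rmult_1_r. apply H3; auto; lia.
    + rewrite lsum_const, length_seq.
      replace (eps / 2) with (2 * ((INR n + 1) * del)) by (unfold del; field; lra). nra.
  - rewrite (lin_sub (p := p) _ (opb_lin _ _ (opb_tl n)));
      try (eapply opb_inlp; [exact HC|eexists; apply Hu]).
    apply lpB_sub; (eapply lpB_mono; [apply Hn, Hu|lra]).
Qed.

(** Diagonal extraction: nested infinite index sets, on which the images differ by at most
    [/ (INR j + 1)], with [phi j] taken from the set number [j], give a Cauchy subsequence. *)
Lemma cptR_Kp T : cptR p T -> Kp p T.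
Proof.
  intros HR. pose proof (cptR_cptL T HR) as HL. pose proof HL as [[C HC] _].
  split; [apply Bp_opb; now exists C|]. intros u Hu0.
  assert (Hu : forall k, lpB p (u k) 1).
  { intros k. eapply lpB_mono; [apply mem_lpB, Hu0|apply Hu0]. }
  pose (eps := fun j : nat => / (INR j + 1)).
  assert (Heps : forall j, 0 < eps j).
  { intros j. apply Rinv_0_lt_compat. pose proof (pos_INR j); lra. }
  pose (next := fun j S0 (H : unbounded_set S0) =>
    constructive_indefinite_description _ (cptL_subset T u HL Hu (eps j) S0 (Heps j) H)).
  (* Each index set travels with the proof that it is infinite, which the next extraction
     consumes. *)
  pose (St := fix St j : {S0 | unbounded_set S0} := match j with
    | O => exist _ (proj1_sig (next O (fun _ => True) (fun N => ex_intro _ N (conj (le_n N) I))))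
             (proj1 (proj2_sig (next O (fun _ => True) (fun N => ex_intro _ N (conj (le_n N) I)))))
    | S j' => exist _ (proj1_sig (next (S j') _ (proj2_sig (St j'))))
             (proj1 (proj2_sig (next (S j') _ (proj2_sig (St j')))))
    end).
  pose (Q := fun j => proj1_sig (St j)).
  assert (HQ : forall j, unbounded_set (Q j)) by (intros; apply proj2_sig).
  assert (HQS : forall j k, Q (S j) k -> Q j k).
  { intros j. exact (proj1 (proj2 (proj2_sig (next (S j) _ _)))). }
  assert (HQe : forall j k k', Q j k -> Q j k' -> lpB p (xsub (T (u k)) (T (u k'))) (eps j)).
  { intros [|j]; [exact (proj2 (proj2 (proj2_sig (next O _ _))))|].
    exact (proj2 (proj2 (proj2_sig (next (S j) _ _)))). }
  assert (HQm : forall j k i, (i <= j)%nat -> Q j k -> Q i k).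
  { intros j k i Hij. induction Hij; auto. }
  pose (pk := fun j N => proj1_sig (constructive_indefinite_description _ (HQ j N))).
  assert (Hpk : forall j N, (N <= pk j N)%nat /\ Q j (pk j N)).
  { intros j N; unfold pk. now destruct constructive_indefinite_description. }
  pose (phi := fix phi j := match j with O => pk O O | S j' => pk (S j') (S (phi j')) end).
  assert (Hphi : forall j, Q j (phi j)) by (intros [|j]; apply Hpk).
  destruct (lpB_complete (p := p) (fun j => T (u (phi j))) eps) as [y Hy].
  - intros e He. destruct (INR_unbounded (/ e)) as [n Hn]. exists n. unfold eps.
    rewrite <- (Rinv_inv e). apply Rinv_lt_contravar; [|lra].
    pose proof (Rinv_0_lt_compat e He). nra.
  - intros j k Hjk. apply HQe; [apply (HQm k); auto|auto].
  - exists phi, y. split; [intros k; simpl; apply (Hpk (S k))|]. split.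
    + apply mem_inlp. replace y with (xadd (xsub y (T (u (phi O)))) (T (u (phi O)))) by xext.
      apply inlp_add; [eexists; apply Hy|]. eapply opb_inlp; [exact HC|eexists; apply Hu].
    + intros e He. destruct (INR_unbounded (/ e)) as [n Hn]. exists n. intros k Hk.
      unfold Rdist. rewrite Rminus_0_r, Rabs_right by (apply Rle_ge, nrm_ge0).
      eapply Rle_lt_trans.
      * apply (lpB_mem _ (1 * eps k)).
        replace (vsub (lp p) (T (u (phi k))) y) with (xscale Cm1 (xsub y (T (u (phi k))))).
        -- rewrite <- Cnorm_Cm1 at 1. apply lpB_scale, Hy.
        -- apply functional_extensionality; intro; unfold vsub; simpl.
           unfold xsub, xadd, xscale; cring.
      * rewrite Rmult_1_l. unfold eps. rewrite <- (Rinv_inv e). apply le_INR in Hk.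
        pose proof (Rinv_0_lt_compat e He). apply Rinv_lt_contravar; nra.
Qed.

(** If the tails of [T] stayed above [eps], unit vectors [u n] would have images with mass beyond
    [n]; a convergent subsequence of these images contradicts the small tails of its limit, because
    [phi k] is at least [k]. *)
Lemma Kp_cptR T : Kp p T -> cptR p T.
Proof.
  intros [HB HK]. apply cptL_cptR. pose proof HB as HB'. apply Bp_opb in HB' as [C HC].
  split; [now exists C|]. intros eps He. apply NNPP; intros Hno.
  assert (Hu : forall n, exists u, lpB p u 1 /\ ~ lpB p (tl n (T u)) eps).
  { intros n. apply NNPP; intros H. apply Hno. exists n. intros x r Hx.
    assert (Hi : inlp p x) by now exists r.
    destruct (lpB_ge0 _ _ Hx) as [Hr|Hr].
    - apply NNPP; intros Hn. apply H. exists (xscale (RtoC (/ r)) x). split.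
      + replace 1 with (Cnorm (RtoC (/ r)) * r); [now apply lpB_scale|].
        rewrite Cnorm_RtoC, Rabs_right; [field; lra|]. left. now apply Rinv_0_lt_compat.
      + intros HB2. apply Hn. apply (lpB_scale (RtoC r)) in HB2.
        rewrite Cnorm_RtoC, Rabs_right in HB2 by lra.
        rewrite (lin_scale _ (opb_lin _ _ HC)) in HB2 by assumption.
        rewrite Rmult_comm.
        replace (tl n (T x)) with (xscale (RtoC r) (tl n (xscale (RtoC (/ r)) (T x)))); [assumption|].
        apply functional_extensionality; intros c. unfold xscale, tl, mask.
        transitivity (Cmul (Cmul (RtoC r) (RtoC (/ r))) (Cmul (RtoC (if (c <? n)%nat then 0 else 1)) (T x c)));
          [ring|]. rewrite <- RtoC_mul, Rinv_r, RtoC_1 by lra. ring.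
    - subst r. rewrite Rmult_0_r.
      pose proof (opb_bd _ _ _ _ (opb_comp _ _ _ _ (opb_tl n) HC) Hx) as H0. now rewrite Rmult_0_r in H0. }
  pose (u := fun n => proj1_sig (constructive_indefinite_description _ (Hu n))).
  assert (Hu1 : forall n, lpB p (u n) 1 /\ ~ lpB p (tl n (T (u n))) eps).
  { intros n; unfold u. now destruct constructive_indefinite_description. }
  destruct (HK u) as (phi & y & Hphi & Hy & Hcv).
  { intros k. apply lpB_mem, Hu1. }
  destruct (lpB_tl_small y _ (eps / 2) (mem_lpB y Hy)) as [n0 Hn0]; [lra|].
  destruct (Hcv (eps / 2)) as [k0 Hk0]; [lra|].
  set (k := max n0 k0). specialize (Hk0 k ltac:(unfold k; lia)).
  unfold Rdist in Hk0. rewrite Rminus_0_r, Rabs_right in Hk0 by (apply Rle_ge, nrm_ge0).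
  pose proof (phi_ge phi Hphi k). destruct (Hu1 (phi k)) as [H1 H2]. apply H2.
  assert (Hm : mem (lp p) (vsub (lp p) (T (u (phi k))) y)).
  { apply mem_inlp. apply (inlp_sub (T (u (phi k))) y).
    - eapply opb_inlp; [exact HC|]. now exists 1.
    - now apply mem_inlp. }
  pose proof (mem_lpB _ Hm) as H3.
  replace (tl (phi k) (T (u (phi k)))) with
    (xadd (tl (phi k) (vsub (lp p) (T (u (phi k))) y)) (tl (phi k) y)).
  2:{ apply functional_extensionality; intros c. unfold xadd, tl, mask, vsub; simpl. cring. }
  replace eps with (eps / 2 + eps / 2) by field. apply lpB_add.
  - apply lpB_mono with (1 * nrm (lp p) (vsub (lp p) (T (u (phi k))) y)); [|lra].
    apply (opb_bd _ _ _ _ (opb_tl _) H3).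
  - apply Hn0. unfold k in H. unfold k. lia.
Qed.

(** * Operator norm and essential norm *)

Lemma opnorm_le T C : opb p T C -> opnorm (lp p) (lp p) T <= C.
Proof.
  intros HT. apply supR_le; [apply (opb_ge0 _ _ HT)|].
  intros s (x & Hx & H1 & ->). rewrite <- (Rmult_1_r C). apply lpB_mem.
  apply (opb_bd _ _ _ _ HT). eapply lpB_mono; [now apply mem_lpB|assumption].
Qed.

Lemma opb_opnorm T C : opb p T C -> opb p T (opnorm (lp p) (lp p) T).
Proof.
  intros HT.
  assert (Hub : forall s, (exists x, mem (lp p) x /\ nrm (lp p) x <= 1 /\ s = nrm (lp p) (T x)) -> s <= C).
  { intros s (x & Hx & H1 & ->). rewrite <- (Rmult_1_r C). apply lpB_mem.
    apply (opb_bd _ _ _ _ HT). eapply lpB_mono; [now apply mem_lpB|assumption]. }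
  assert (H0 : 0 <= opnorm (lp p) (lp p) T).
  { eapply Rle_trans; [apply (nrm_ge0 (T xzero))|]. apply (supR_ub _ C); [exact Hub|].
    exists xzero. destruct (lpB_mem xzero 1 (lpB_zero 1 Rle_0_1)) as [H1 H2]. auto. }
  apply (opb_bound T C _ HT H0). intros x r Hx.
  destruct (lpB_ge0 _ _ Hx) as [Hr|Hr].
  - assert (Hi : inlp p x) by now exists r.
    assert (Hs : lpB p (xscale (RtoC (/ r)) x) 1).
    { replace 1 with (Cnorm (RtoC (/ r)) * r); [now apply lpB_scale|].
      rewrite Cnorm_RtoC, Rabs_right; [field; lra|]. left. now apply Rinv_0_lt_compat. }
    destruct (lpB_mem _ _ Hs) as [Hm Hn].
    assert (HTs : lpB p (T (xscale (RtoC (/ r)) x)) (opnorm (lp p) (lp p) T)).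
    { assert (Hm2 : mem (lp p) (T (xscale (RtoC (/ r)) x))).
      { eapply lpB_mem, (opb_bd _ _ _ _ HT Hs). }
      eapply lpB_mono; [apply mem_lpB, Hm2|]. apply (supR_ub _ C); [exact Hub|]. eexists; eauto. }
    apply (lpB_scale (RtoC r)) in HTs. rewrite Cnorm_RtoC, Rabs_right in HTs by lra.
    rewrite (lin_scale _ (opb_lin _ _ HT)) in HTs by assumption. rewrite Rmult_comm.
    replace (T x) with (xscale (RtoC r) (xscale (RtoC (/ r)) (T x))); [assumption|].
    apply functional_extensionality; intros c. unfold xscale.
    transitivity (Cmul (Cmul (RtoC r) (RtoC (/ r))) (T x c)); [ring|].
    rewrite <- RtoC_mul, Rinv_r, RtoC_1 by lra. ring.
  - subst r. rewrite Rmult_0_r. pose proof (opb_bd _ _ _ _ HT Hx) as H1. now rewrite Rmult_0_r in H1.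
Qed.

Lemma opnorm_ge0 T C : opb p T C -> 0 <= opnorm (lp p) (lp p) T.
Proof. intros H. apply opb_opnorm in H. apply (opb_ge0 _ _ H). Qed.

Lemma opb_calk T : (exists C, opb p T C) -> forall s,
  (exists K, Kp p K /\ s = opnorm (lp p) (lp p) (opadd p T K)) -> 0 <= s.
Proof.
  intros [C HC] s (K & HK & ->). apply Kp_cptR in HK as [[D HD] _].
  eapply opnorm_ge0. apply (opb_add T K C D HC HD).
Qed.

Lemma calknorm_le T K c : (exists C, opb p T C) -> cptR p K ->
  opb p (fun x => xadd (T x) (K x)) c -> calknorm p T <= c.
Proof.
  intros HT HK H. eapply Rle_trans; [|apply (opnorm_le _ _ H)].
  apply infR_le; [now apply opb_calk|]. exists K. split; [now apply cptR_Kp|reflexivity].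
Qed.

Lemma calknorm_ge T b : (exists C, opb p T C) ->
  (forall K c, cptR p K -> opb p (fun x => xadd (T x) (K x)) c -> b <= c) -> b <= calknorm p T.
Proof.
  intros [C HT] H. apply infR_ge.
  - eexists. exists (fun _ => xzero). split; [apply cptR_Kp, cptR_zero|reflexivity].
  - intros s (K & HK & ->). apply Kp_cptR in HK. pose proof HK as [[D HD] _].
    apply (H K); [assumption|]. apply (opb_opnorm _ _ (opb_add T K C D HT HD)).
Qed.

Lemma calknorm_approx T eps : (exists C, opb p T C) -> 0 < eps ->
  exists K, cptR p K /\ opb p (fun x => xadd (T x) (K x)) (calknorm p T + eps).
Proof.
  intros HT He. apply NNPP; intros H.
  assert (calknorm p T + eps <= calknorm p T); [|lra].
  apply calknorm_ge; [assumption|]. intros K c HK Hc.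
  apply Rnot_lt_le; intros Hlt. apply H. exists K. split; [assumption|].
  eapply opb_mono; [exact Hc|lra].
Qed.

Lemma calknorm_ge0 T : (exists C, opb p T C) -> 0 <= calknorm p T.
Proof. intros HT. apply calknorm_ge; [assumption|]. intros K c _ H. apply (opb_ge0 _ _ H). Qed.

Lemma calknorm_opb T C : opb p T C -> calknorm p T <= C.
Proof.
  intros HT. apply (calknorm_le T (fun _ => xzero)); [now exists C|apply cptR_zero|].
  eapply opb_ext; [|exact HT]. intros x _. xext.
Qed.

(** Choose [K] almost realising the infimum; on far tails of either side [K] is negligible, so [T]
    inherits there the bound of its perturbation by [K]. *)
Lemma essb_calknorm T c : (exists C, opb p T C) -> calknorm p T <= c -> essb p T c.
Proof.
  intros HT Hc eps He. destruct (calknorm_approx T (eps / 2) HT) as (K & HK & HTK); [lra|].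
  destruct (cptR_tail K (eps / 2) HK) as [n1 Hn1]; [lra|].
  destruct (cptL_tail K (eps / 2) (cptR_cptL _ HK)) as [n2 Hn2]; [lra|].
  exists (max n1 n2). intros m Hm. destruct HT as [C HT]. destruct HK as [[D HD] _]. split.
  - apply (opb_mono _ ((calknorm p T + eps / 2) * 1 + eps / 2)); [|lra].
    eapply opb_ext.
    2:{ apply opb_sub; [apply (opb_comp _ _ _ _ HTK (opb_tl m))|apply (Hn1 m); lia]. }
    intros x _. xext.
  - apply (opb_mono _ (1 * (calknorm p T + eps / 2) + eps / 2)); [|lra].
    eapply opb_ext.
    2:{ apply opb_sub; [apply (opb_comp _ _ _ _ (opb_tl m) HTK)|apply (Hn2 m); lia]. }
    intros x _. xext.
Qed.

Lemma essb_cpt T U c : cptR p (fun x => xsub (T x) (U x)) -> essb p T c -> essb p U c.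
Proof.
  intros HK HT eps He. destruct (HT (eps / 2)) as [n0 Hn0]; [lra|].
  destruct (cptR_tail _ (eps / 2) HK) as [n1 Hn1]; [lra|].
  destruct (cptL_tail _ (eps / 2) (cptR_cptL _ HK)) as [n2 Hn2]; [lra|].
  exists (max n0 (max n1 n2)). intros m Hm.
  destruct (Hn0 m) as [H1 H2]; [lia|]. split; apply (opb_mono _ (c + eps / 2 + eps / 2)); try lra.
  - eapply opb_ext; [|apply (opb_sub _ _ _ _ H1 (Hn1 m ltac:(lia)))]. intros x _. xext.
  - eapply opb_ext; [|apply (opb_sub _ _ _ _ H2 (Hn2 m ltac:(lia)))]. intros x _. xext.
Qed.

End Bridge.

(** * Rademacher functions and Khintchine's inequality *)

(* The [i]-th Rademacher function on the [2 ^ n] sign patterns; it vanishes at [w >= 2 ^ n]. *)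
Definition rad (n i w : nat) : R :=
  if (w <? 2 ^ n)%nat then (if Nat.testbit w i then -1 else 1) else 0.

Definition patterns (n : nat) : list nat := seq 0 (2 ^ n).

Lemma rad_out n i w : ~ In w (patterns n) -> rad n i w = 0.
Proof.
  intros H. unfold rad. destruct (Nat.ltb_spec w (2 ^ n)); [|reflexivity].
  exfalso; apply H, in_seq; lia.
Qed.

Lemma Rabs_rad n i w : Rabs (rad n i w) <= 1.
Proof.
  unfold rad. destruct (w <? 2 ^ n)%nat; [destruct (Nat.testbit w i)|];
    unfold Rabs; destruct Rcase_abs; lra.
Qed.

Lemma lsum_seq_shift n f : lsum (seq 0 (S n)) f = f O + lsum (seq 0 n) (fun i => f (S i)).
Proof. simpl. rewrite <- seq_shift, lsum_map. reflexivity. Qed.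

Lemma lsum_double m F :
  lsum (seq 0 (2 * m)) F = lsum (seq 0 m) (fun w => F (2 * w)%nat + F (2 * w + 1)%nat).
Proof.
  induction m as [|m IH]; [reflexivity|].
  replace (2 * S m)%nat with (S (S (2 * m))) by lia. rewrite !lsum_seq_S, IH.
  replace (2 * m + 1)%nat with (S (2 * m)) by lia. ring.
Qed.

(** Peels off the lowest bit, the induction step of the Rademacher computations below: [2 * w] and
    [2 * w + 1] have signs 1 and -1 at index 0 and agree with [w] at shifted indices. *)
Lemma lsum_patterns n F : lsum (patterns (S n)) F =
  lsum (patterns n) (fun w => F (2 * w)%nat + F (2 * w + 1)%nat).
Proof. unfold patterns. rewrite Nat.pow_succ_r'. apply lsum_double. Qed.

Lemma lsum_patterns_const n c : lsum (patterns n) (fun _ => c) = 2 ^ n * c.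
Proof. rewrite lsum_const. unfold patterns. rewrite length_seq, pow_INR. reflexivity. Qed.

Section RadStep.
Variables (n w : nat).
Hypothesis Hw : In w (patterns n).

Let Hlt : (w < 2 ^ n)%nat. Proof. apply in_seq in Hw. lia. Qed.

Lemma rad_even_0 : rad (S n) 0 (2 * w) = 1.
Proof.
  unfold rad. rewrite Nat.pow_succ_r'. destruct (Nat.ltb_spec (2 * w) (2 * 2 ^ n)); [|lia].
  now rewrite Nat.testbit_even_0.
Qed.

Lemma rad_odd_0 : rad (S n) 0 (2 * w + 1) = -1.
Proof.
  unfold rad. rewrite Nat.pow_succ_r'. destruct (Nat.ltb_spec (2 * w + 1) (2 * 2 ^ n)); [|lia].
  now rewrite Nat.testbit_odd_0.
Qed.

Lemma rad_even_S i : rad (S n) (S i) (2 * w) = rad n i w.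
Proof.
  unfold rad. rewrite Nat.pow_succ_r'. destruct (Nat.ltb_spec (2 * w) (2 * 2 ^ n)); [|lia].
  destruct (Nat.ltb_spec w (2 ^ n)); [|lia]. now rewrite Nat.testbit_even_succ by lia.
Qed.

Lemma rad_odd_S i : rad (S n) (S i) (2 * w + 1) = rad n i w.
Proof.
  unfold rad. rewrite Nat.pow_succ_r'. destruct (Nat.ltb_spec (2 * w + 1) (2 * 2 ^ n)); [|lia].
  destruct (Nat.ltb_spec w (2 ^ n)); [|lia]. now rewrite Nat.testbit_odd_succ by lia.
Qed.

End RadStep.

Lemma rad_orthogonal n i j : (i < n)%nat -> (j < n)%nat ->
  lsum (patterns n) (fun w => rad n i w * rad n j w) = if (i =? j)%nat then 2 ^ n else 0.
Proof.
  revert i j. induction n as [|n IH]; intros i j Hi Hj; [lia|].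
  rewrite lsum_patterns.
  destruct i as [|i], j as [|j]; simpl (_ =? _)%nat.
  - rewrite (lsum_ext _ _ (fun _ => 2)).
    + rewrite lsum_patterns_const. simpl; ring.
    + intros w Hw. rewrite rad_even_0, rad_odd_0 by assumption. ring.
  - rewrite (lsum_ext _ _ (fun _ => 0)); [apply lsum_zero|].
    intros w Hw. rewrite rad_even_0, rad_odd_0, rad_even_S, rad_odd_S by assumption. ring.
  - rewrite (lsum_ext _ _ (fun _ => 0)); [apply lsum_zero|].
    intros w Hw. rewrite rad_even_0, rad_odd_0, rad_even_S, rad_odd_S by assumption. ring.
  - rewrite (lsum_ext _ _ (fun w => 2 * (rad n i w * rad n j w))).
    + rewrite lsum_scal, IH by lia. destruct (i =? j)%nat; simpl; ring.
    + intros w Hw. rewrite !rad_even_S, !rad_odd_S by assumption. ring.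
Qed.

(** From exp(-a) >= 1 - a and its mirror image the left side is at most 2 / (1 - a^2), and this is
    at most 2 (1 + 2 a^2) as long as a^2 <= 1/2. *)
Lemma cosh_bound a : a * a <= / 2 -> exp a + exp (- a) <= 2 * exp (2 * (a * a)).
Proof.
  intros Ha. assert (-1 < a < 1) by (split; nra).
  assert (H1 : exp a <= / (1 - a)).
  { rewrite <- (Ropp_involutive a) at 1. rewrite exp_Ropp.
    apply Rinv_le_contravar; [lra|]. pose proof (exp_ineq1_le (- a)). lra. }
  assert (H2 : exp (- a) <= / (1 + a)).
  { rewrite exp_Ropp. apply Rinv_le_contravar; [lra|]. apply exp_ineq1_le. }
  pose proof (exp_ineq1_le (2 * (a * a))).
  apply Rle_trans with (2 * (1 + 2 * (a * a))); [|lra].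
  apply Rle_trans with (/ (1 - a) + / (1 + a)); [lra|].
  replace (/ (1 - a) + / (1 + a)) with (2 * / (1 - a * a)) by (field; split; nra).
  apply Rmult_le_compat_l; [lra|]. apply Rmult_le_reg_r with (1 - a * a); [nra|].
  rewrite Rinv_l by nra. nra.
Qed.

(** Independence of the signs factors the exponential moment into hyperbolic cosines, each bounded
    by [cosh_bound]. *)
Lemma rad_mgf n : forall a : nat -> R, (forall i, (i < n)%nat -> a i * a i <= / 2) ->
  lsum (patterns n) (fun w => exp (lsum (seq 0 n) (fun i => a i * rad n i w)))
    <= 2 ^ n * exp (2 * lsum (seq 0 n) (fun i => a i * a i)).
Proof.
  induction n as [|n IH]; intros a Ha.
  - simpl. rewrite Rmult_0_r, exp_0. lra.
  - rewrite lsum_patterns, lsum_seq_shift.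
    apply Rle_trans with (2 * exp (2 * (a O * a O)) *
      lsum (patterns n) (fun w => exp (lsum (seq 0 n) (fun i => a (S i) * rad n i w)))).
    + rewrite <- lsum_scal. apply lsum_le; intros w Hw. rewrite !lsum_seq_shift.
      rewrite rad_even_0, rad_odd_0 by assumption.
      rewrite (lsum_ext _ (fun i => a (S i) * rad (S n) (S i) (2 * w))
        (fun i => a (S i) * rad n i w)) by (intros; now rewrite rad_even_S).
      rewrite (lsum_ext _ (fun i => a (S i) * rad (S n) (S i) (2 * w + 1))
        (fun i => a (S i) * rad n i w)) by (intros; now rewrite rad_odd_S).
      rewrite !exp_plus, <- Rmult_plus_distr_r.
      apply Rmult_le_compat_r; [left; apply exp_pos|].
      rewrite Rmult_1_r. replace (a O * -1) with (- a O) by ring.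
      apply cosh_bound, Ha; lia.
    + specialize (IH (fun i => a (S i)) (fun i Hi => Ha (S i) ltac:(lia))).
      rewrite Rmult_plus_distr_l, exp_plus. simpl (2 ^ S n).
      replace (2 * 2 ^ n * (exp (2 * (a O * a O)) * exp (2 * lsum (seq 0 n) (fun i => a (S i) * a (S i)))))
        with (2 * exp (2 * (a O * a O)) * (2 ^ n * exp (2 * lsum (seq 0 n) (fun i => a (S i) * a (S i)))))
        by ring.
      apply Rmult_le_compat_l; [|assumption]. pose proof (exp_pos (2 * (a O * a O))). lra.
Qed.

(** Rests on ln u <= u - 1 with u = t / q, and lets exponential moments control the q-th moment. *)
Lemma rpow_le_exp t q : 0 < q -> 0 <= t -> rpow t q <= rpow q q * exp t.
Proof.
  intros Hq [Ht|<-].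
  - replace t with (q * (t / q)) at 1 by (field; lra).
    assert (0 < t / q) by (apply Rdiv_lt_0_compat; lra).
    rewrite rpow_mul by lra. apply Rmult_le_compat_l; [apply rpow_ge0|].
    rewrite rpow_pos by assumption. unfold Rpower.
    apply Rle_trans with (exp (q * (t / q - 1))).
    + assert (Hl : ln (t / q) <= t / q - 1).
      { pose proof (exp_ineq1_le (ln (t / q))). rewrite exp_ln in H0 by assumption. lra. }
      destruct (Rmult_le_compat_l q _ _ (Rlt_le _ _ Hq) Hl) as [H1| ->]; [|lra].
      left; now apply exp_increasing.
    + replace (q * (t / q - 1)) with (t - q) by (field; lra). left. apply exp_increasing. lra.
  - rewrite rpow_0. apply Rmult_le_pos; [apply rpow_ge0|left; apply exp_pos].
Qed.

(** The factors come from the proof of [khintchine_real]: q^q from [rpow_le_exp], 2 exp(1/2) from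
    the exponential moments of the sum and of its negative, 2^q from the rescaling by [2 * s]. *)
Definition khin (q : R) : R := rpow q q * (2 * exp (/ 2)) * rpow 2 q.

Lemma khin_ge0 q : 0 <= khin q.
Proof.
  unfold khin. pose proof (rpow_ge0 q q). pose proof (rpow_ge0 2 q). pose proof (exp_pos (/ 2)).
  repeat apply Rmult_le_pos; lra.
Qed.

(** |X|^q is dominated by a multiple of exp(X) + exp(-X), and [rad_mgf] bounds both exponential
    moments. *)
Lemma khintchine_real q n (a : nat -> R) s : 0 < q -> 0 <= s ->
  lsum (seq 0 n) (fun i => a i * a i) <= s * s ->
  lsum (patterns n) (fun w => rpow (Rabs (lsum (seq 0 n) (fun i => a i * rad n i w))) q)
    <= 2 ^ n * khin q * rpow s q.
Proof.
  intros Hq Hs Ha.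
  assert (Hai : forall i, (i < n)%nat -> a i * a i <= s * s).
  { intros i Hi. eapply Rle_trans; [|exact Ha].
    apply (lsum_In _ (fun i => a i * a i)); [intros; nra|apply in_seq; lia]. }
  destruct Hs as [Hs|<-].
  2:{ rewrite (lsum_ext _ _ (fun _ => 0)).
      - rewrite lsum_zero, rpow_0. lra.
      - intros w _. rewrite (lsum_ext _ _ (fun _ => 0)).
        + rewrite lsum_zero, Rabs_R0. apply rpow_0.
        + intros i Hi. apply in_seq in Hi. specialize (Hai i ltac:(lia)).
          replace (a i) with 0 by nra. ring. }
  pose (b := fun i => a i / (2 * s)).
  assert (Hb : forall i, b i * b i = a i * a i * / (4 * (s * s))) by (intros; unfold b; field; lra).
  assert (Hs4 : 0 < / (4 * (s * s))) by (apply Rinv_0_lt_compat; nra).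
  assert (Hbs : lsum (seq 0 n) (fun i => b i * b i) <= / 4).
  { rewrite (lsum_ext _ _ (fun i => / (4 * (s * s)) * (a i * a i))) by (intros; rewrite Hb; ring).
    rewrite lsum_scal. apply Rle_trans with (/ (4 * (s * s)) * (s * s)).
    - apply Rmult_le_compat_l; lra.
    - right; field; lra. }
  assert (Hb2 : forall i, (i < n)%nat -> b i * b i <= / 2).
  { intros i Hi. apply Rle_trans with (/ 4); [|lra]. eapply Rle_trans; [|exact Hbs].
    apply (lsum_In _ (fun i => b i * b i)); [intros; nra|apply in_seq; lia]. }
  pose proof (rad_mgf n b Hb2) as M1.
  assert (Hb3 : forall i, (i < n)%nat -> - b i * - b i <= / 2).
  { intros i Hi. replace (- b i * - b i) with (b i * b i) by ring. auto. }
  pose proof (rad_mgf n (fun i => - b i) Hb3) as M2. cbv beta in M2.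
  assert (HE : exp (2 * lsum (seq 0 n) (fun i => b i * b i)) <= exp (/ 2)).
  { destruct Hbs as [H|H]; [left; apply exp_increasing; lra|right; f_equal; rewrite H; field]. }
  rewrite (lsum_ext (seq 0 n) (fun i => - b i * - b i) (fun i => b i * b i)) in M2 by (intros; ring).
  set (X := fun w => lsum (seq 0 n) (fun i => b i * rad n i w)).
  assert (HX : forall w, rpow (Rabs (lsum (seq 0 n) (fun i => a i * rad n i w))) q
     <= rpow s q * rpow 2 q * rpow q q * (exp (X w) + exp (lsum (seq 0 n) (fun i => - b i * rad n i w)))).
  { intros w. replace (lsum (seq 0 n) (fun i => a i * rad n i w)) with (s * 2 * X w).
    2:{ unfold X. rewrite <- lsum_scal. apply lsum_ext; intros; unfold b; field; lra. }
    replace (lsum (seq 0 n) (fun i => - b i * rad n i w)) with (- X w).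
    2:{ unfold X. transitivity (-1 * lsum (seq 0 n) (fun i => b i * rad n i w)); [ring|].
        rewrite <- lsum_scal. apply lsum_ext; intros; ring. }
    rewrite Rabs_mult, (Rabs_right (s * 2)) by lra.
    pose proof (Rabs_pos (X w)). rewrite !rpow_mul by lra.
    rewrite !Rmult_assoc. apply Rmult_le_compat_l; [apply rpow_ge0|].
    apply Rmult_le_compat_l; [apply rpow_ge0|].
    eapply Rle_trans; [apply rpow_le_exp; auto|].
    apply Rmult_le_compat_l; [apply rpow_ge0|].
    pose proof (exp_pos (X w)). pose proof (exp_pos (- X w)).
    unfold Rabs; destruct Rcase_abs; lra. }
  eapply Rle_trans; [apply lsum_le; intros w _; apply HX|].
  rewrite lsum_scal, lsum_plus.
  assert (Hpow : 0 < 2 ^ n) by (apply pow_lt; lra).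
  assert (HM : lsum (patterns n) (fun a0 => exp (X a0))
    + lsum (patterns n) (fun a0 => exp (lsum (seq 0 n) (fun i => - b i * rad n i a0)))
    <= 2 ^ n * (2 * exp (/ 2))).
  { apply Rmult_le_compat_l with (r := 2 ^ n) in HE; [|lra]. fold X in M1. unfold X at 1. lra. }
  unfold khin.
  apply Rle_trans with (rpow s q * rpow 2 q * rpow q q * (2 ^ n * (2 * exp (/ 2)))); [|right; ring].
  apply Rmult_le_compat_l; [|assumption]. pose proof (rpow_ge0 s q).
  pose proof (rpow_ge0 2 q). pose proof (rpow_ge0 q q). repeat apply Rmult_le_pos; auto.
Qed.

Definition Csq (z : Cx) : R := cRe z * cRe z + cIm z * cIm z.

Lemma Csq_Cnorm z : Csq z = Cnorm z * Cnorm z.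
Proof. rewrite Cnorm_sq. unfold Csq. ring. Qed.

Lemma csum_Re {A} (l : list A) f : cRe (csum l f) = lsum l (fun a => cRe (f a)).
Proof. induction l; simpl; congruence. Qed.
Lemma csum_Im {A} (l : list A) f : cIm (csum l f) = lsum l (fun a => cIm (f a)).
Proof. induction l; simpl; congruence. Qed.

(** The real inequality for real and imaginary parts, joined by Minkowski's inequality over the
    patterns; the equal bounds [K] for the two parts account for [rpow 2 q]. *)
Lemma khintchine q n (a : nat -> Cx) s : 1 < q -> 0 <= s ->
  lsum (seq 0 n) (fun i => Csq (a i)) <= s * s ->
  lsum (patterns n) (fun w => rpow (Cnorm (csum (seq 0 n) (fun i => Cmul (a i) (RtoC (rad n i w))))) q)
    <= 2 ^ n * (khin q * rpow 2 q) * rpow s q.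
Proof.
  intros Hq Hs Ha.
  assert (Hpow : 0 < 2 ^ n) by (apply pow_lt; lra).
  pose proof (khin_ge0 q) as Hk.
  assert (Hq0 : 0 < q) by lra. assert (Hqn : q <> 0) by lra.
  assert (H1 := khintchine_real q n (fun i => cRe (a i)) s Hq0 Hs).
  assert (H2 := khintchine_real q n (fun i => cIm (a i)) s Hq0 Hs).
  specialize (H1 ltac:(eapply Rle_trans; [|exact Ha]; apply lsum_le; intros; unfold Csq; nra)).
  specialize (H2 ltac:(eapply Rle_trans; [|exact Ha]; apply lsum_le; intros; unfold Csq; nra)).
  set (K := rpow (2 ^ n * khin q) (/ q) * s).
  assert (HK0 : 0 <= K) by (apply Rmult_le_pos; [apply rpow_ge0|assumption]).
  assert (HK : rpow K q = 2 ^ n * khin q * rpow s q).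
  { unfold K. rewrite rpow_mul by (auto using rpow_ge0). rewrite rpow_inv_l; auto. nra. }
  pose proof (minkowski_list (p := q) (hp := Hq) (patterns n)
    (fun w => RtoC (lsum (seq 0 n) (fun i => cRe (a i) * rad n i w)))
    (fun w => mkCx 0 (lsum (seq 0 n) (fun i => cIm (a i) * rad n i w))) K K HK0 HK0) as Mk.
  replace (K + K) with (2 * K) in Mk by ring. rewrite rpow_mul in Mk by lra. rewrite HK in Mk.
  replace (2 ^ n * (khin q * rpow 2 q) * rpow s q) with (rpow 2 q * (2 ^ n * khin q * rpow s q)) by ring.
  eapply Rle_trans; [|apply Mk].
  - right. apply lsum_ext; intros w _. f_equal. f_equal. apply Cx_eq; simpl.
    + rewrite csum_Re, Rplus_0_r. apply lsum_ext; intros; simpl; ring.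
    + rewrite csum_Im, Rplus_0_l. apply lsum_ext; intros; simpl; ring.
  - eapply Rle_trans; [right|exact H1]. apply lsum_ext; intros. now rewrite Cnorm_RtoC.
  - eapply Rle_trans; [right|exact H2]. apply lsum_ext; intros. f_equal.
    unfold Cnorm; simpl. rewrite <- sqrt_Rsqr_abs. f_equal. unfold Rsqr; ring.
Qed.

(** * Rademacher multipliers *)

Lemma bessel_real n (f : nat -> R) :
  2 ^ n * lsum (seq 0 n) (fun i => (/ 2 ^ n * lsum (patterns n) (fun w => rad n i w * f w)) ^ 2)
    <= lsum (patterns n) (fun w => f w * f w).
Proof.
  assert (Hpow : 0 < 2 ^ n) by (apply pow_lt; lra).
  set (b := fun i => / 2 ^ n * lsum (patterns n) (fun w => rad n i w * f w)).
  set (g := fun w => lsum (seq 0 n) (fun i => b i * rad n i w)).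
  assert (Hb : forall i, lsum (patterns n) (fun w => rad n i w * f w) = 2 ^ n * b i)
    by (intros; unfold b; field; lra).
  assert (E1 : lsum (patterns n) (fun w => f w * g w) = 2 ^ n * lsum (seq 0 n) (fun i => b i ^ 2)).
  { unfold g. rewrite (lsum_ext _ _ (fun w => lsum (seq 0 n) (fun i => b i * (rad n i w * f w)))).
    - rewrite lsum_swap, <- lsum_scal. apply lsum_ext; intros i _. rewrite lsum_scal, Hb. ring.
    - intros w _. rewrite <- lsum_scal. apply lsum_ext; intros; ring. }
  assert (E2 : lsum (patterns n) (fun w => g w * g w) = 2 ^ n * lsum (seq 0 n) (fun i => b i ^ 2)).
  { rewrite (lsum_ext _ _ (fun w => lsum (seq 0 n) (fun i => b i * (rad n i w * g w)))).
    - rewrite lsum_swap, <- lsum_scal. apply lsum_ext; intros i Hi. rewrite lsum_scal.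
      apply in_seq in Hi.
      assert (E : lsum (patterns n) (fun w => rad n i w * g w) = 2 ^ n * b i); [|rewrite E; ring].
      rewrite (lsum_ext _ _ (fun w => lsum (seq 0 n) (fun j => b j * (rad n i w * rad n j w)))).
      + rewrite lsum_swap.
        rewrite (lsum_ext _ _ (fun j => if (i =? j)%nat then 2 ^ n * b j else 0)).
        * clear -Hi. assert (G : forall m, lsum (seq 0 m) (fun j => if (i =? j)%nat then 2 ^ n * b j else 0)
            = if (i <? m)%nat then 2 ^ n * b i else 0).
          { induction m as [|m IH]; [reflexivity|]. rewrite lsum_seq_S, IH.
            destruct (Nat.eqb_spec i m), (Nat.ltb_spec i m), (Nat.ltb_spec i (S m)); try lia; subst; ring. }
          rewrite G. destruct (Nat.ltb_spec i n); [reflexivity|lia].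
        * intros j Hj. apply in_seq in Hj. rewrite lsum_scal, rad_orthogonal by lia.
          destruct (i =? j)%nat; ring.
      + intros w _. unfold g. rewrite <- lsum_scal. apply lsum_ext; intros; ring.
    - intros w _. unfold g at 1. rewrite Rmult_comm, <- lsum_scal. apply lsum_ext; intros; ring. }
  assert (H : 0 <= lsum (patterns n) (fun w => (f w - g w) * (f w - g w)))
    by (apply lsum_ge0; intros; apply Rle_0_sqr).
  rewrite (lsum_ext _ _ (fun w => (f w * f w + g w * g w) + -2 * (f w * g w))) in H by (intros; ring).
  rewrite lsum_plus, lsum_plus, lsum_scal, E1, E2 in H.
  change (2 ^ n * lsum (seq 0 n) (fun i => b i ^ 2) <= lsum (patterns n) (fun w => f w * f w)).
  lra.
Qed.

(* Rademacher coefficients without the factor [2 ^ -n]. *)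
Definition rcoef (n : nat) (f : nat -> Cx) (i : nat) : Cx :=
  csum (patterns n) (fun w => Cmul (RtoC (rad n i w)) (f w)).

(** The Rademacher multiplier: it scales the Rademacher function number i by [c i] and annihilates
    the orthogonal complement of their span. For [c] constantly 1 it is the Rademacher
    projection. *)
Definition rmult (n : nat) (c : nat -> Cx) (f : nat -> Cx) (w : nat) : Cx :=
  csum (seq 0 n) (fun i => Cmul (Cmul (c i) (RtoC (rad n i w))) (Cmul (RtoC (/ 2 ^ n)) (rcoef n f i))).

(** Khintchine bounds the L^q norm of the image by the l^2 norm of its coefficients, Bessel bounds
    that by the L^2 norm of [f], and on a probability space the L^2 norm is at most the L^q norm as
    q >= 2. *)
Lemma rmult_bound_ge2 q n c f k : 2 <= q -> 0 <= k ->
  (forall i, (i < n)%nat -> Cnorm (c i) <= k) ->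
  lsum (patterns n) (fun w => rpow (Cnorm (rmult n c f w)) q)
    <= khin q * rpow 2 q * rpow k q * lsum (patterns n) (fun w => rpow (Cnorm (f w)) q).
Proof.
  intros Hq Hk Hc.
  assert (Hpow : 0 < 2 ^ n) by (apply pow_lt; lra).
  assert (Hip : 0 < / 2 ^ n) by now apply Rinv_0_lt_compat.
  set (F2 := / 2 ^ n * lsum (patterns n) (fun w => Csq (f w))).
  assert (HF2 : 0 <= F2).
  { apply Rmult_le_pos; [lra|]. apply lsum_ge0; intros; unfold Csq; nra. }
  set (b := fun i => Cmul (RtoC (/ 2 ^ n)) (rcoef n f i)).
  assert (Hb : lsum (seq 0 n) (fun i => Csq (b i)) <= F2).
  { pose proof (bessel_real n (fun w => cRe (f w))) as B1.
    pose proof (bessel_real n (fun w => cIm (f w))) as B2.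
    apply Rmult_le_reg_l with (2 ^ n); [assumption|]. unfold F2.
    rewrite <- Rmult_assoc, Rinv_r, Rmult_1_l by lra. unfold Csq at 2. rewrite lsum_plus.
    eapply Rle_trans; [|apply Rplus_le_compat; [exact B1|exact B2]].
    rewrite <- Rmult_plus_distr_l, <- lsum_plus. right. f_equal. apply lsum_ext; intros i _.
    unfold b, Csq, rcoef. simpl. rewrite csum_Re, csum_Im.
    rewrite (lsum_ext _ (fun w => cRe (Cmul (RtoC (rad n i w)) (f w))) (fun w => rad n i w * cRe (f w)))
      by (intros; simpl; ring).
    rewrite (lsum_ext _ (fun w => cIm (Cmul (RtoC (rad n i w)) (f w))) (fun w => rad n i w * cIm (f w)))
      by (intros; simpl; ring).
    ring. }
  set (s := k * sqrt F2).
  assert (Hs : 0 <= s) by (apply Rmult_le_pos; [assumption|apply sqrt_pos]).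
  assert (Ha : lsum (seq 0 n) (fun i => Csq (Cmul (c i) (b i))) <= s * s).
  { apply Rle_trans with (lsum (seq 0 n) (fun i => k * k * Csq (b i))).
    - apply lsum_le; intros i Hi. apply in_seq in Hi. specialize (Hc i ltac:(lia)).
      rewrite !Csq_Cnorm, Cnorm_mul. pose proof (Cnorm_ge0 (c i)). pose proof (Cnorm_ge0 (b i)).
      assert (Cnorm (c i) * Cnorm (b i) <= k * Cnorm (b i)) by (apply Rmult_le_compat_r; lra).
      replace (k * k * (Cnorm (b i) * Cnorm (b i))) with ((k * Cnorm (b i)) * (k * Cnorm (b i))) by ring.
      apply Rmult_le_compat; auto; apply Rmult_le_pos; assumption.
    - rewrite lsum_scal. unfold s.
      replace (k * sqrt F2 * (k * sqrt F2)) with (k * k * (sqrt F2 * sqrt F2)) by ring.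
      rewrite sqrt_sqrt by assumption. apply Rmult_le_compat_l; nra. }
  pose proof (khintchine q n (fun i => Cmul (c i) (b i)) s ltac:(lra) Hs Ha) as K.
  apply Rle_trans with (2 ^ n * (khin q * rpow 2 q) * rpow s q).
  - eapply Rle_trans; [right|exact K]. apply lsum_ext; intros w _. f_equal. f_equal.
    apply csum_ext; intros i _. unfold b. ring.
  - assert (HJ : rpow (sqrt F2) q <= / 2 ^ n * lsum (patterns n) (fun w => rpow (Cnorm (f w)) q)).
    { replace (rpow (sqrt F2) q) with (rpow F2 (q / 2)).
      2:{ rewrite <- (sqrt_sqrt F2) at 1 by assumption.
          rewrite <- rpow_2 by apply sqrt_pos. rewrite rpow_rpow. f_equal. field. }
      assert (EF : F2 = lsum (patterns n) (fun w => / 2 ^ n * rpow (Cnorm (f w)) 2)).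
      { unfold F2. rewrite <- lsum_scal. apply lsum_ext; intros.
        now rewrite Csq_Cnorm, rpow_2 by apply Cnorm_ge0. }
      rewrite <- lsum_scal.
      assert (ER : forall w, rpow (Cnorm (f w)) q = rpow (rpow (Cnorm (f w)) 2) (q / 2)).
      { intros. rewrite rpow_rpow. f_equal. field. }
      rewrite (lsum_ext _ (fun w => / 2 ^ n * rpow (Cnorm (f w)) q)
        (fun w => / 2 ^ n * rpow (rpow (Cnorm (f w)) 2) (q / 2))) by (intros; now rewrite ER).
      (* [jensen] wants the exponent [q / 2] above 1, so q = 2 is treated apart; there the
         inequality is an equality. *)
      rewrite EF. destruct (Rle_lt_or_eq_dec 2 q Hq) as [Hlt|<-].
      - apply jensen; [lra|intros; lra| |intros; apply rpow_ge0].
        rewrite lsum_patterns_const. right; field; lra.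
      - replace (2 / 2) with 1 by field. right. rewrite rpow_1.
        + apply lsum_ext; intros. rewrite (rpow_1 (rpow _ _)); [reflexivity|apply rpow_ge0].
        + rewrite <- EF. assumption. }
    unfold s. rewrite rpow_mul by (auto using sqrt_pos).
    pose proof (khin_ge0 q). pose proof (rpow_ge0 2 q). pose proof (rpow_ge0 k q).
    apply Rle_trans with (2 ^ n * (khin q * rpow 2 q) * (rpow k q *
       (/ 2 ^ n * lsum (patterns n) (fun w => rpow (Cnorm (f w)) q)))).
    + apply Rmult_le_compat_l; [|apply Rmult_le_compat_l; assumption].
      apply Rmult_le_pos; [lra|]. apply Rmult_le_pos; assumption.
    + right. field. lra.
Qed.

(** Both sides are the same symmetric form in the Rademacher coefficients of [f] and [g]: the
    multiplier is its own transpose, which makes duality available. *)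
Lemma rmult_adjoint n c f g :
  csum (patterns n) (fun w => Cmul (rmult n c f w) (g w)) =
  csum (patterns n) (fun w => Cmul (f w) (rmult n c g w)).
Proof.
  assert (H : forall f g, csum (patterns n) (fun w => Cmul (rmult n c f w) (g w)) =
    csum (seq 0 n) (fun i => Cmul (Cmul (c i) (RtoC (/ 2 ^ n))) (Cmul (rcoef n f i) (rcoef n g i)))).
  { clear f g. intros f g. unfold rmult.
    rewrite (csum_ext _ _ (fun w => csum (seq 0 n) (fun i =>
      Cmul (Cmul (Cmul (c i) (RtoC (/ 2 ^ n))) (rcoef n f i)) (Cmul (RtoC (rad n i w)) (g w))))).
    - rewrite csum_swap. apply csum_ext; intros i _. rewrite csum_scal. fold (rcoef n g i). ring.
    - intros w _.
      transitivity (Cmul (g w) (csum (seq 0 n) (fun i => Cmul (Cmul (c i) (RtoC (rad n i w)))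
        (Cmul (RtoC (/ 2 ^ n)) (rcoef n f i))))); [ring|].
      rewrite <- csum_scal. apply csum_ext; intros; ring. }
  rewrite H. rewrite (csum_ext (patterns n) (fun w => Cmul (f w) (rmult n c g w))
     (fun w => Cmul (rmult n c g w) (f w))) by (intros; ring).
  rewrite H. apply csum_ext; intros; ring.
Qed.

(** Below 2 the constant is inherited from the conjugate exponent p / (p - 1), which exceeds 2. *)
Definition radK (p : R) : R :=
  if Rle_dec 2 p then rpow (khin p * rpow 2 p) (/ p)
  else rpow (khin (p / (p - 1)) * rpow 2 (p / (p - 1))) (/ (p / (p - 1))).

Lemma radK_ge0 p : 0 <= radK p.
Proof. unfold radK; destruct Rle_dec; apply rpow_ge0. Qed.

(** For p < 2 the image is tested against its own dual vector and the multiplier is moved onto the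
    latter, where the bound for the conjugate exponent applies. *)
Lemma rmult_bound p n c f k r : 1 < p -> 0 <= k -> 0 <= r ->
  (forall i, (i < n)%nat -> Cnorm (c i) <= k) ->
  lsum (patterns n) (fun w => rpow (Cnorm (f w)) p) <= rpow r p ->
  lsum (patterns n) (fun w => rpow (Cnorm (rmult n c f w)) p) <= rpow (radK p * k * r) p.
Proof.
  intros Hp Hk Hr Hc Hf.
  assert (Hgen : forall q, 1 < q -> 2 <= q -> forall f s, 0 <= s ->
    lsum (patterns n) (fun w => rpow (Cnorm (f w)) q) <= rpow s q ->
    lsum (patterns n) (fun w => rpow (Cnorm (rmult n c f w)) q)
      <= rpow (rpow (khin q * rpow 2 q) (/ q) * k * s) q).
  { clear f Hf. intros q Hq1 Hq f s Hs Hf.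
    eapply Rle_trans; [apply (rmult_bound_ge2 q n c f k Hq Hk Hc)|].
    pose proof (khin_ge0 q). pose proof (rpow_ge0 2 q). pose proof (rpow_ge0 k q).
    pose proof (rpow_ge0 (khin q * rpow 2 q) (/ q)).
    rewrite rpow_mul, rpow_mul by (try apply Rmult_le_pos; auto).
    rewrite rpow_inv_l by (try apply Rmult_le_pos; auto; lra).
    apply Rmult_le_compat_l; [|assumption].
    apply Rmult_le_pos; [apply Rmult_le_pos|]; assumption. }
  unfold radK. destruct (Rle_dec 2 p) as [H2|H2]; [now apply Hgen|].
  set (q := p / (p - 1)).
  assert (Hq : 1 < q /\ 2 <= q).
  { unfold q. split; [apply Rmult_lt_reg_r with (p - 1)|apply Rmult_le_reg_r with (p - 1)]; try lra;
      unfold Rdiv; rewrite Rmult_assoc, Rinv_l; lra. }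
  destruct Hq as [Hq1 Hq2].
  assert (Hpq : / p + / q = 1) by (unfold q; field; lra).
  set (D := rpow (khin q * rpow 2 q) (/ q)).
  assert (HD : 0 <= D) by apply rpow_ge0.
  set (S0 := lsum (patterns n) (fun w => rpow (Cnorm (rmult n c f w)) p)).
  assert (HS : 0 <= S0) by (apply lsum_ge0; intros; apply rpow_ge0).
  destruct HS as [HS|<-]; [|apply rpow_ge0].
  pose (g := fun w => dual_value p (rmult n c f w)).
  assert (Hg : lsum (patterns n) (fun w => rpow (Cnorm (g w)) q) = S0).
  { apply lsum_ext; intros w _. unfold g. rewrite Cnorm_dual_value, rpow_rpow. f_equal.
    unfold q; field; lra. }
  assert (Hg' : lsum (patterns n) (fun w => rpow (Cnorm (g w)) q) <= rpow (rpow S0 (/ q)) q).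
  { rewrite Hg. right. symmetry. apply rpow_inv_l; lra. }
  pose proof (Hgen q Hq1 Hq2 g _ (rpow_ge0 _ _) Hg') as HPg. fold D in HPg.
  assert (HSD : S0 <= r * (D * k * rpow S0 (/ q))).
  { assert (E : RtoC S0 = csum (patterns n) (fun w => Cmul (f w) (rmult n c g w))).
    { rewrite <- rmult_adjoint. unfold S0. rewrite <- csum_RtoC. apply csum_ext; intros w _.
      rewrite <- mul_dual_value. unfold g. ring. }
    rewrite <- (Rabs_right S0) at 1 by lra. rewrite <- Cnorm_RtoC, E.
    eapply Rle_trans; [apply Cnorm_csum|].
    rewrite (lsum_ext _ _ (fun w => Cnorm (f w) * Cnorm (rmult n c g w))) by (intros; apply Cnorm_mul).
    apply hoelder with p q; auto using Cnorm_ge0.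
    pose proof (rpow_ge0 S0 (/ q)). repeat apply Rmult_le_pos; auto. }
  assert (Hs : S0 = rpow S0 (/ p) * rpow S0 (/ q)).
  { rewrite <- rpow_plus, Hpq, rpow_1; lra. }
  assert (H3 : rpow S0 (/ p) <= D * k * r).
  { pose proof (rpow_gt0 S0 (/ q) HS). apply Rmult_le_reg_r with (rpow S0 (/ q)); [assumption|].
    rewrite <- Hs. eapply Rle_trans; [exact HSD|]. right; ring. }
  change (S0 <= rpow (D * k * r) p).
  rewrite <- (rpow_inv_l S0 p) by lra. apply rpow_le; [lra|]. split; [apply rpow_ge0|assumption].
Qed.

Lemma rmult_out n c f w : ~ In w (patterns n) -> rmult n c f w = C0.
Proof.
  intros Hw. unfold rmult. rewrite (csum_ext _ _ (fun _ => C0)); [apply csum_zero|].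
  intros i _. rewrite rad_out by assumption. rewrite RtoC_0. ring.
Qed.

Lemma lpB_rmult {p : R} {hp : Exponent p} n c f k r : 0 <= k ->
  (forall i, (i < n)%nat -> Cnorm (c i) <= k) ->
  lpB p f r -> lpB p (rmult n c f) (radK p * k * r).
Proof.
  intros Hk Hc [Hr Hf]. pose proof (radK_ge0 p). split; [repeat apply Rmult_le_pos; auto|].
  intros l Hl. eapply Rle_trans; [apply (lsum_support l (patterns n))|]; auto.
  - intros; apply rpow_ge0.
  - intros w Hw. rewrite rmult_out, Cnorm_C0 by assumption. apply rpow_0.
  - apply rmult_bound; auto. apply Hf, seq_NoDup.
Qed.

(** * The model representation *)

(* Coordinates of the model space: stage [k], sign pattern [w], multiplicity index [c]. *)
Definition I3 : Type := (nat * nat * nat)%type.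

Definition enc (t : I3) : nat := to_nat (to_nat (fst t), snd t).
Definition dec (n : nat) : I3 := (of_nat (fst (of_nat n)), snd (of_nat n)).

Lemma dec_enc t : dec (enc t) = t.
Proof.
  unfold dec, enc. rewrite cancel_of_to. cbn [fst snd]. rewrite cancel_of_to. now destruct t.
Qed.

Lemma enc_dec n : enc (dec n) = n.
Proof.
  unfold dec, enc. cbn [fst snd]. rewrite cancel_to_of, <- surjective_pairing. apply cancel_to_of.
Qed.

Lemma enc_inj t t' : enc t = enc t' -> t = t'.
Proof. intros H. now rewrite <- (dec_enc t), H, dec_enc. Qed.

Lemma dec_inj n n' : dec n = dec n' -> n = n'.
Proof. intros H. now rewrite <- (enc_dec n), H, enc_dec. Qed.

(** Codes dominate the stage and, in [enc_ge_c], the copy index: truncating at [m] leaves only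
    stages below [m], and vectors living on copy [n] lie in the tail from [n] on. *)
Lemma enc_ge_k k w c : (k <= enc (k, w, c))%nat.
Proof.
  unfold enc; cbn [fst snd]. pose proof (to_nat_non_decreasing k w).
  pose proof (to_nat_non_decreasing (to_nat (k, w)) c). lia.
Qed.

Lemma enc_ge_c k w c : (c <= enc (k, w, c))%nat.
Proof. unfold enc; cbn [fst snd]. pose proof (to_nat_non_decreasing (to_nat (k, w)) c). lia. Qed.

Definition push (x : nat -> Cx) : I3 -> Cx := fun t => x (enc t).
Definition pull (y : I3 -> Cx) : nat -> Cx := fun n => y (dec n).

Lemma push_pull y : push (pull y) = y.
Proof. apply functional_extensionality; intros t. unfold push, pull. now rewrite dec_enc. Qed.

Lemma pull_push x : pull (push x) = x.
Proof. apply functional_extensionality; intros t. unfold push, pull. now rewrite enc_dec. Qed.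

Lemma rcoef_lin n s f g i :
  rcoef n (fun w => Cadd (Cmul s (f w)) (g w)) i = Cadd (Cmul s (rcoef n f i)) (rcoef n g i).
Proof.
  unfold rcoef. rewrite <- csum_scal, <- csum_plus. apply csum_ext; intros; ring.
Qed.

Lemma rmult_lin n c s f g w :
  rmult n c (fun w => Cadd (Cmul s (f w)) (g w)) w = Cadd (Cmul s (rmult n c f w)) (rmult n c g w).
Proof.
  unfold rmult. rewrite <- csum_scal, <- csum_plus. apply csum_ext; intros. rewrite rcoef_lin. ring.
Qed.

(* [f] is an expansion along Rademacher functions with coefficients [b]. *)
Lemma rcoef_rad_sum n (b : nat -> Cx) j : (j < n)%nat ->
  rcoef n (fun w => csum (seq 0 n) (fun i => Cmul (RtoC (rad n i w)) (b i))) j =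
  Cmul (RtoC (2 ^ n)) (b j).
Proof.
  intros Hj. unfold rcoef.
  rewrite (csum_ext _ _ (fun w => csum (seq 0 n) (fun i => Cmul (b i) (RtoC (rad n j w * rad n i w))))).
  2:{ intros w _. rewrite <- csum_scal. apply csum_ext; intros; rewrite RtoC_mul; ring. }
  rewrite csum_swap, (csum_single Nat.eq_dec _ j).
  - rewrite csum_scal, csum_RtoC, rad_orthogonal, Nat.eqb_refl by assumption. ring.
  - apply seq_NoDup.
  - apply in_seq; lia.
  - intros i Hi Hne. apply in_seq in Hi.
    rewrite csum_scal, csum_RtoC, rad_orthogonal by lia.
    destruct (Nat.eqb_spec j i); [congruence|]. rewrite RtoC_0; ring.
Qed.

Lemma pow2_inv n : Cmul (RtoC (2 ^ n)) (RtoC (/ 2 ^ n)) = C1.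
Proof.
  rewrite <- RtoC_mul, Rinv_r; [reflexivity|]. apply pow_nonzero; lra.
Qed.

Lemma rcoef_rmult n c f j : (j < n)%nat -> rcoef n (rmult n c f) j = Cmul (c j) (rcoef n f j).
Proof.
  intros Hj. transitivity (Cmul (RtoC (2 ^ n)) (Cmul (c j) (Cmul (RtoC (/ 2 ^ n)) (rcoef n f j)))).
  - rewrite <- (rcoef_rad_sum n (fun i => Cmul (c i) (Cmul (RtoC (/ 2 ^ n)) (rcoef n f i)))) by assumption.
    unfold rcoef at 1 2. apply csum_ext; intros w _. f_equal. unfold rmult. apply csum_ext; intros; ring.
  - transitivity (Cmul (Cmul (RtoC (2 ^ n)) (RtoC (/ 2 ^ n))) (Cmul (c j) (rcoef n f j))); [ring|].
    rewrite pow2_inv. ring.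
Qed.

Section Eta.
Variable N : nat -> nat.

(** In the application [a k i] is h at the point number [i] of stage [k], and [a0] is h at the base
    point. Writing the operator as [a0] plus a multiplier with symbol [a k i - a0] gives it the
    value [a0] on the complement of the Rademacher span. *)
Definition etaI (a : nat -> nat -> Cx) (a0 : Cx) (y : I3 -> Cx) : I3 -> Cx := fun t =>
  let '(k, w, c) := t in
  Cadd (Cmul a0 (y (k, w, c)))
    (rmult (N k) (fun i => Csub (a k i) a0) (fun w' => y (k, w', c)) w).

Definition etaop (a : nat -> nat -> Cx) (a0 : Cx) (x : nat -> Cx) : nat -> Cx :=
  pull (etaI a a0 (push x)).

Lemma etaI_linear a a0 s x y :
  etaI a a0 (xadd (xscale s x) y) = xadd (xscale s (etaI a a0 x)) (etaI a a0 y).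
Proof.
  apply functional_extensionality; intros [[k w] c]. unfold etaI, xadd, xscale.
  rewrite rmult_lin. ring.
Qed.

Lemma rcoef_etaI a a0 y k c i : (i < N k)%nat ->
  rcoef (N k) (fun w => etaI a a0 y (k, w, c)) i =
  Cmul (a k i) (rcoef (N k) (fun w => y (k, w, c)) i).
Proof.
  intros Hi. unfold etaI. rewrite rcoef_lin.
  rewrite (rcoef_rmult (N k) (fun i => Csub (a k i) a0) (fun w' => y (k, w', c)) i Hi). ring.
Qed.

(** Multiplicativity is exact: by [rcoef_etaI] the Rademacher coefficients of the inner image are
    just multiplied by [b k i]. *)
Lemma etaI_mul a a0 b b0 y : etaI a a0 (etaI b b0 y) =
  etaI (fun k i => Cmul (a k i) (b k i)) (Cmul a0 b0) y.
Proof.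
  apply functional_extensionality; intros [[k w] c].
  unfold etaI at 1.
  assert (E : rmult (N k) (fun i => Csub (a k i) a0) (fun w' => etaI b b0 y (k, w', c)) w =
    rmult (N k) (fun i => Cmul (Csub (a k i) a0) (b k i)) (fun w' => y (k, w', c)) w).
  { unfold rmult. apply csum_ext; intros i Hi. apply in_seq in Hi.
    rewrite rcoef_etaI by lia. ring. }
  rewrite E. unfold etaI.
  assert (E2 : rmult (N k) (fun i => Csub (Cmul (a k i) (b k i)) (Cmul a0 b0)) (fun w' => y (k, w', c)) w
    = Cadd (rmult (N k) (fun i => Cmul (Csub (a k i) a0) (b k i)) (fun w' => y (k, w', c)) w)
       (Cmul a0 (rmult (N k) (fun i => Csub (b k i) b0) (fun w' => y (k, w', c)) w))).
  { unfold rmult. rewrite <- csum_scal, <- csum_plus. apply csum_ext; intros; ring. }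
  rewrite E2. ring.
Qed.

Lemma etaI_add s a a0 b b0 y :
  etaI (fun k i => Cadd (Cmul s (a k i)) (b k i)) (Cadd (Cmul s a0) b0) y =
  xadd (xscale s (etaI a a0 y)) (etaI b b0 y).
Proof.
  apply functional_extensionality; intros [[k w] c]. unfold etaI, xadd, xscale.
  assert (E : rmult (N k) (fun i => Csub (Cadd (Cmul s (a k i)) (b k i)) (Cadd (Cmul s a0) b0))
       (fun w' => y (k, w', c)) w
    = Cadd (Cmul s (rmult (N k) (fun i => Csub (a k i) a0) (fun w' => y (k, w', c)) w))
        (rmult (N k) (fun i => Csub (b k i) b0) (fun w' => y (k, w', c)) w)).
  { unfold rmult. rewrite <- csum_scal, <- csum_plus. apply csum_ext; intros; ring. }
  rewrite E. ring.
Qed.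

Lemma etaI_one y : etaI (fun _ _ => C1) C1 y = y.
Proof.
  apply functional_extensionality; intros [[k w] c]. unfold etaI.
  replace (rmult (N k) _ _ w) with C0; [ring|]. unfold rmult.
  rewrite (csum_ext _ _ (fun _ => C0)); [now rewrite csum_zero|]. intros; ring.
Qed.

(** The symbol [a k i - a0] is at most [2 * kap], whence [1 + 2 * radK p]. The bound holds on each
    fibre over a pair of stage and copy, and [lpB_fubini] adds the fibres up. *)
Lemma etaI_opb {p : R} {hp : Exponent p} a a0 kap : 0 <= kap -> Cnorm a0 <= kap ->
  (forall k i, (i < N k)%nat -> Cnorm (a k i) <= kap) ->
  opb p (etaI a a0) ((1 + 2 * radK p) * kap).
Proof.
  intros Hk H0 Ha. pose proof (radK_ge0 p) as HK.
  split; [apply Rmult_le_pos; lra|]. split; [intros s x y _ _; apply etaI_linear|].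
  intros y r Hy.
  assert (Hr : 0 <= r) by apply (lpB_ge0 _ _ Hy).
  replace ((1 + 2 * radK p) * kap * r) with (kap * r + radK p * (2 * kap) * r) by ring.
  pose (z := fun t : I3 => let '(k, w, c) := t in
    rmult (N k) (fun i => Csub (a k i) a0) (fun w' => y (k, w', c)) w).
  replace (etaI a a0 y) with (xadd (xscale a0 y) z)
    by (apply functional_extensionality; intros [[k w] c]; reflexivity).
  apply lpB_add.
  { eapply lpB_mono; [apply lpB_scale, Hy|]. apply Rmult_le_compat_r; assumption. }
  (* Reordering brings the pattern [w] last, so that the fibres are the functions on which [rmult]
     acts. *)
  pose (s1 := fun t : nat * nat * nat => let '(k, c, w) := t in (k, w, c)).
  assert (Hs1 : forall t t', s1 t = s1 t' -> t = t').
  { intros [[? ?] ?] [[? ?] ?]; simpl; congruence. }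
  assert (Hy' : lpB p (fun t => y (s1 t)) r) by now apply lpB_inj.
  destruct (lpB_fibers _ _ Hy') as [F1 F2].
  set (rho := fun a => nrmI p (fun b => y (s1 (a, b)))) in F1, F2.
  assert (Hz : lpB p (fun t => z (s1 t)) (radK p * (2 * kap) * r)).
  { apply lpB_fubini with (fun a => radK p * (2 * kap) * rho a).
    - intros [k c]. simpl. apply lpB_rmult; [lra| |apply (F1 (k, c))].
      intros i Hi. eapply Rle_trans; [apply Cnorm_sub|]. specialize (Ha k i Hi). lra.
    - repeat apply Rmult_le_pos; auto; lra.
    - intros l Hl. rewrite rpow_mul by (auto; apply Rmult_le_pos; lra).
      rewrite (lsum_ext _ _ (fun a => rpow (radK p * (2 * kap)) p * rpow (rho a) p)).
      + rewrite lsum_scal. apply Rmult_le_compat_l; [apply rpow_ge0|now apply F2].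
      + intros b _. apply rpow_mul; [apply Rmult_le_pos; lra|apply rpow_ge0]. }
  replace z with (fun t : I3 => z (s1 (let '(k, w, c) := t in (k, c, w)))).
  - apply (lpB_inj (fun t : I3 => let '(k, w, c) := t in (k, c, w)) (fun t => z (s1 t))); [|exact Hz].
    intros [[? ?] ?] [[? ?] ?]; congruence.
  - apply functional_extensionality; intros [[k w] c]. reflexivity.
Qed.

End Eta.

Section Model.
Context {p : R} {hp : Exponent p}.

Lemma opb_push : opb p push 1.
Proof. apply (opb_pull enc). apply enc_inj. Qed.

Lemma opb_pull3 : opb p pull 1.
Proof. apply (opb_pull dec). apply dec_inj. Qed.

Lemma etaop_opb N a a0 kap : 0 <= kap -> Cnorm a0 <= kap ->
  (forall k i, (i < N k)%nat -> Cnorm (a k i) <= kap) ->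
  opb p (etaop N a a0) ((1 + 2 * radK p) * kap).
Proof.
  intros H1 H2 H3. rewrite <- (Rmult_1_r (_ * kap)), <- (Rmult_1_l (_ * kap * 1)).
  apply (opb_comp pull (fun x => etaI N a a0 (push x))); [apply opb_pull3|].
  apply (opb_comp (etaI N a a0) push); [now apply etaI_opb|apply opb_push].
Qed.

(** The Rademacher function number [i] of stage [k], placed on copy [c]. Its eigenvalue does not
    depend on [c], which leaves room to push it to infinity. *)
Definition eigvec (N : nat -> nat) (k i c : nat) : I3 -> Cx := fun t =>
  let '(k', w, c') := t in
  if andb (k' =? k)%nat (c' =? c)%nat then RtoC (rad (N k) i w) else C0.

Lemma etaI_eigvec N a a0 k i c : (i < N k)%nat ->
  etaI N a a0 (eigvec N k i c) = xscale (a k i) (eigvec N k i c).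
Proof.
  intros Hi. apply functional_extensionality; intros [[k' w] c']. unfold etaI, xscale.
  unfold eigvec at 1 3.
  destruct (Nat.eqb_spec k' k) as [->|Hk]; [destruct (Nat.eqb_spec c' c) as [->|Hc]|]; simpl.
  - assert (E : forall j, (j < N k)%nat -> rcoef (N k) (fun w' => eigvec N k i c (k, w', c)) j =
      Cmul (RtoC (2 ^ N k)) (if (j =? i)%nat then C1 else C0)).
    { intros j Hj. rewrite <- (rcoef_rad_sum (N k) (fun j => if (j =? i)%nat then C1 else C0)) by assumption.
      unfold rcoef. apply csum_ext; intros w' _. f_equal. unfold eigvec. rewrite !Nat.eqb_refl. simpl.
      rewrite (csum_single Nat.eq_dec _ i).
      - rewrite Nat.eqb_refl. ring.
      - apply seq_NoDup.
      - apply in_seq; lia.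
      - intros b _ Hb. destruct (Nat.eqb_spec b i); [congruence|ring]. }
    unfold rmult. rewrite (csum_single Nat.eq_dec _ i).
    + rewrite E, Nat.eqb_refl by assumption.
      transitivity (Cadd (Cmul a0 (RtoC (rad (N k) i w))) (Cmul (Csub (a k i) a0)
        (Cmul (Cmul (RtoC (2 ^ N k)) (RtoC (/ 2 ^ N k))) (RtoC (rad (N k) i w))))); [ring|].
      rewrite pow2_inv. ring.
    + apply seq_NoDup.
    + apply in_seq; lia.
    + intros b Hb Hne. apply in_seq in Hb. rewrite E by lia.
      destruct (Nat.eqb_spec b i); [congruence|ring].
  - replace (rmult _ _ _ w) with C0; [ring|]. unfold rmult.
    rewrite (csum_ext _ _ (fun _ => C0)); [now rewrite csum_zero|]. intros j _.
    replace (rcoef (N k) _ j) with C0; [ring|]. unfold rcoef.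
    rewrite (csum_ext _ _ (fun _ => C0)); [now rewrite csum_zero|]. intros w' _.
    unfold eigvec. destruct (Nat.eqb_spec c' c); [congruence|]. rewrite Bool.andb_false_r. ring.
  - replace (rmult _ _ _ w) with C0; [ring|]. unfold rmult.
    rewrite (csum_ext _ _ (fun _ => C0)); [now rewrite csum_zero|]. intros j _.
    replace (rcoef (N k') _ j) with C0; [ring|]. unfold rcoef.
    rewrite (csum_ext _ _ (fun _ => C0)); [now rewrite csum_zero|]. intros w' _.
    unfold eigvec. destruct (Nat.eqb_spec k' k); [congruence|]. simpl. ring.
Qed.

Lemma rad_sq n i w : In w (patterns n) -> rpow (Cnorm (RtoC (rad n i w))) p = 1.
Proof.
  intros Hw. apply in_seq in Hw. rewrite Cnorm_RtoC. unfold rad.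
  destruct (Nat.ltb_spec w (2 ^ n)); [|lia].
  replace (Rabs (if Nat.testbit w i then -1 else 1)) with 1; [apply rpow_one|].
  destruct (Nat.testbit w i); unfold Rabs; destruct Rcase_abs; lra.
Qed.

Lemma lpB_eigvec N k i c : lpB p (eigvec N k i c) (rpow (2 ^ N k) (/ p)).
Proof.
  pose proof exponent_gt0. pose proof exponent_neq0. assert (0 < 2 ^ N k) by (apply pow_lt; lra).
  split; [apply rpow_ge0|]. rewrite rpow_inv_l by (auto; lra).
  intros l Hl. eapply Rle_trans; [apply (lsum_support l (map (fun w => (k, w, c)) (patterns (N k))))|]; auto.
  - intros; apply rpow_ge0.
  - intros [[k' w] c'] Hn. unfold eigvec. destruct (Nat.eqb_spec k' k) as [->|]; [|simpl; now rewrite Cnorm_C0, rpow_0].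
    destruct (Nat.eqb_spec c' c) as [->|]; [|simpl; now rewrite Cnorm_C0, rpow_0]. simpl.
    rewrite rad_out; [now rewrite RtoC_0, Cnorm_C0, rpow_0|]. intros Hin. apply Hn.
    apply in_map_iff. now exists w.
  - rewrite lsum_map. right.
    transitivity (lsum (patterns (N k)) (fun _ => 1)); [|rewrite lsum_patterns_const; ring].
    apply lsum_ext; intros w Hw. unfold eigvec. rewrite !Nat.eqb_refl. simpl. now apply rad_sq.
Qed.

Lemma lpB_eigvec_inv N k i c a r : lpB p (xscale a (eigvec N k i c)) r ->
  Cnorm a * rpow (2 ^ N k) (/ p) <= r.
Proof.
  pose proof exponent_gt0. pose proof exponent_neq0. assert (0 < 2 ^ N k) by (apply pow_lt; lra).
  intros [Hr HB]. specialize (HB (map (fun w => (k, w, c)) (patterns (N k)))).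
  apply rpow_le_inv with p; auto.
  rewrite rpow_mul, rpow_inv_l by (auto using Cnorm_ge0, rpow_ge0; lra).
  eapply Rle_trans; [|apply HB].
  - rewrite lsum_map. right. rewrite Rmult_comm, <- lsum_patterns_const. apply lsum_ext; intros w Hw.
    unfold xscale, eigvec. rewrite !Nat.eqb_refl. simpl.
    rewrite Cnorm_mul, rpow_mul by apply Cnorm_ge0. rewrite rad_sq by assumption. ring.
  - apply NoDup_map_NoDup_ForallPairs; [|apply seq_NoDup]. intros x y _ _ E; congruence.
Qed.

(* The eigenvectors escape to infinity, so a compact perturbation does not see them. *)
Lemma etaop_calknorm_ge N a a0 k i D : opb p (etaop N a a0) D -> (i < N k)%nat ->
  Cnorm (a k i) <= calknorm p (etaop N a a0).
Proof.
  intros HD Hi. apply calknorm_ge; [now exists D|]. intros K C HK HC.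
  apply le_epsilon; intros eps He.
  destruct (cptR_tail K eps HK He) as [n Hn]. specialize (Hn n (le_n _)).
  (* On copy [n] all codes are at least [n], hence [tl n u = u] and the tail bound for [K] applies
     to [u]. *)
  set (u := pull (eigvec N k i n)). set (rho := rpow (2 ^ N k) (/ p)).
  assert (Hrho : 0 < rho) by (apply rpow_gt0, pow_lt; lra).
  assert (Hu : lpB p u rho).
  { rewrite <- (Rmult_1_l rho). apply (opb_bd _ _ _ _ opb_pull3), lpB_eigvec. }
  assert (Htl : tl n u = u).
  { apply functional_extensionality; intros m. unfold tl, mask.
    destruct (Nat.ltb_spec m n); [|rewrite RtoC_1; ring].
    unfold u, pull. destruct (dec m) as [[k' w] c'] eqn:E. unfold eigvec.
    destruct (Nat.eqb_spec c' n) as [->|]; [|rewrite Bool.andb_false_r; ring].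
    assert (enc (k', w, n) = m) by (rewrite <- E; apply enc_dec).
    pose proof (enc_ge_c k' w n). lia. }
  assert (H1 : lpB p (xsub (xadd (etaop N a a0 u) (K u)) (K (tl n u))) ((C + eps) * rho)).
  { rewrite Rmult_plus_distr_r. apply lpB_sub; [apply (opb_bd _ _ _ _ HC Hu)|apply (opb_bd _ _ _ _ Hn Hu)]. }
  rewrite Htl in H1.
  assert (E : push (xsub (xadd (etaop N a a0 u) (K u)) (K u)) = xscale (a k i) (eigvec N k i n)).
  { rewrite <- (etaI_eigvec N a a0) by assumption.
    apply functional_extensionality; intros t. unfold push, xsub, xadd, xscale, etaop.
    unfold pull. rewrite dec_enc. unfold u. rewrite push_pull. cring. }
  pose proof (opb_bd _ _ _ _ opb_push H1) as H2. rewrite Rmult_1_l, E in H2.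
  apply lpB_eigvec_inv in H2. fold rho in H2. apply Rmult_le_reg_r with rho; assumption.
Qed.

(** Even and odd copies realise l^p as its own double: [half b] reads the copies [2 * c + b] and
    [spread b] writes them. The decomposition respects the model representation, which acts alike on
    all copies. *)
Definition half (b : nat) (x : nat -> Cx) : nat -> Cx := fun n =>
  let '(k, w, c) := dec n in x (enc (k, w, 2 * c + b)%nat).

Definition spread (b : nat) (x : nat -> Cx) : nat -> Cx := fun n =>
  let '(k, w, c) := dec n in
  if (c mod 2 =? b)%nat then x (enc (k, w, c / 2)%nat) else C0.

(** Coordinates where [g] is undefined contribute 0, and injectivity keeps the remaining ones
    distinct; this is the bound behind [spread]. *)
Lemma lpB_ext0 {I J} (g : I -> option J) (x : J -> Cx) r :
  (forall i i' j, g i = Some j -> g i' = Some j -> i = i') -> lpB p x r ->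
  lpB p (fun i => match g i with Some j => x j | None => C0 end) r.
Proof.
  intros Hg [Hr HB]. split; [assumption|]. intros l Hl.
  assert (exists l', NoDup l' /\ (forall j, In j l' -> exists i, In i l /\ g i = Some j) /\
    lsum l (fun i => rpow (Cnorm (match g i with Some j => x j | None => C0 end)) p)
      = lsum l' (fun j => rpow (Cnorm (x j)) p)) as (l' & H1 & _ & ->); [|now apply HB].
  induction l as [|i l IH]; [exists []; split; [constructor|split; [easy|reflexivity]]|].
  inversion Hl; subst. destruct (IH H2) as (l' & H3 & H4 & H5).
  destruct (g i) as [j|] eqn:E.
  - exists (j :: l'). split; [constructor; auto|split].
    + intros Hin. destruct (H4 j Hin) as (i' & Hi' & E'). now rewrite (Hg i i' j E E') in H1.
    + intros j' [<-|Hj']; [exists i; simpl; auto|]. destruct (H4 j' Hj') as (i' & ? & ?). exists i'. simpl; auto.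
    + simpl. now rewrite E, H5.
  - exists l'. split; [assumption|split].
    + intros j' Hj'. destruct (H4 j' Hj') as (i' & ? & ?). exists i'. simpl; auto.
    + simpl. rewrite E, Cnorm_C0, rpow_0, H5. ring.
Qed.

Lemma opb_half b : opb p (half b) 1.
Proof.
  split; [lra|]. split.
  - intros a x y _ _. apply functional_extensionality; intros n. unfold half, xadd, xscale.
    now destruct (dec n) as [[k w] c].
  - intros x r Hx. rewrite Rmult_1_l.
    apply (lpB_dom (fun n => x (enc (fst (dec n), 2 * snd (dec n) + b)%nat))).
    + apply (lpB_inj (fun n => enc (fst (dec n), 2 * snd (dec n) + b)%nat)); [|assumption].
      intros n n' H. apply enc_inj in H. apply dec_inj. destruct (dec n), (dec n'). simpl in H.
      injection H; intros. f_equal; [assumption|lia].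
    + intros n. unfold half. destruct (dec n) as [[k w] c]. simpl. lra.
Qed.

Lemma opb_spread b : (b < 2)%nat -> opb p (spread b) 1.
Proof.
  intros Hb. split; [lra|]. split.
  - intros a x y _ _. apply functional_extensionality; intros n. unfold spread, xadd, xscale.
    destruct (dec n) as [[k w] c]. destruct (c mod 2 =? b)%nat; [reflexivity|ring].
  - intros x r Hx. rewrite Rmult_1_l.
    pose (g := fun n => if (snd (dec n) mod 2 =? b)%nat
       then Some (enc (fst (dec n), snd (dec n) / 2)%nat) else None).
    apply (lpB_dom (fun n => match g n with Some j => x j | None => C0 end)).
    + apply lpB_ext0; [|assumption]. intros n n' j. unfold g.
      destruct (Nat.eqb_spec (snd (dec n) mod 2) b); [|discriminate].
      destruct (Nat.eqb_spec (snd (dec n') mod 2) b); [|discriminate].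
      intros E E'. apply dec_inj. rewrite <- E in E'. injection E' as E'.
      apply enc_inj in E'.
      pose proof (Nat.div_mod_eq (snd (dec n)) 2). pose proof (Nat.div_mod_eq (snd (dec n')) 2).
      pose proof (f_equal fst E') as E1. assert (E2 : (snd (dec n') / 2 = snd (dec n) / 2)%nat) by exact (f_equal snd E').
      apply injective_projections; [exact (eq_sym E1)|lia].
    + intros n. unfold spread, g. destruct (dec n) as [[k w] c]. cbn [fst snd].
      destruct (c mod 2 =? b)%nat; lra.
Qed.

Lemma half_spread b x : (b < 2)%nat -> half b (spread b x) = x.
Proof.
  intros Hb. apply functional_extensionality; intros n. unfold half, spread.
  destruct (dec n) as [[k w] c] eqn:E. rewrite dec_enc.
  replace ((2 * c + b) mod 2)%nat with b.
  2:{ rewrite Nat.add_comm, Nat.mul_comm, Nat.Div0.mod_add. symmetry. now apply Nat.mod_small. }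
  rewrite Nat.eqb_refl. replace ((2 * c + b) / 2)%nat with c.
  - rewrite <- E. now rewrite enc_dec.
  - rewrite Nat.add_comm, Nat.mul_comm, Nat.div_add by lia. rewrite Nat.div_small by assumption. lia.
Qed.

Lemma half_spread_ne b b' x : (b < 2)%nat -> b <> b' -> half b (spread b' x) = xzero.
Proof.
  intros Hb Hne. apply functional_extensionality; intros n. unfold half, spread, xzero.
  destruct (dec n) as [[k w] c] eqn:E. rewrite dec_enc.
  replace ((2 * c + b) mod 2)%nat with b.
  2:{ rewrite Nat.add_comm, Nat.mul_comm, Nat.Div0.mod_add. symmetry. now apply Nat.mod_small. }
  destruct (Nat.eqb_spec b b'); [congruence|reflexivity].
Qed.

Lemma spread_half x : xadd (spread 0 (half 0 x)) (spread 1 (half 1 x)) = x.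
Proof.
  apply functional_extensionality; intros n. unfold xadd, half, spread.
  destruct (dec n) as [[k w] c] eqn:E. rewrite dec_enc.
  assert (En : n = enc (k, w, c)) by (rewrite <- E; symmetry; apply enc_dec).
  pose proof (Nat.div_mod_eq c 2) as Hc. pose proof (Nat.mod_upper_bound c 2 ltac:(lia)).
  destruct (Nat.eqb_spec (c mod 2) 0) as [H0|H0].
  - rewrite H0. simpl (0 =? 1)%nat. replace (2 * (c / 2) + 0)%nat with c by lia. rewrite <- En. ring.
  - assert (H1 : (c mod 2 = 1)%nat) by lia. rewrite H1. simpl (1 =? 1)%nat.
    replace (2 * (c / 2) + 1)%nat with c by lia. rewrite <- En. ring.
Qed.

Lemma half_etaop N a a0 b x : half b (etaop N a a0 x) = etaop N a a0 (half b x).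
Proof.
  apply functional_extensionality; intros n. unfold half at 1, etaop, pull.
  destruct (dec n) as [[k w] c] eqn:E. rewrite dec_enc. unfold etaI, push, half.
  rewrite dec_enc. f_equal. f_equal. apply functional_extensionality; intros w'. now rewrite dec_enc.
Qed.

End Model.

(** * Slowly varying cutoffs *)

Definition comm (w : nat -> R) (A : Op) : Op := fun x => xsub (mask w (A x)) (A (mask w x)).

Lemma telescope_sB (g : nat -> R) : (forall j, g j <= g (S j)) -> (forall j, 0 <= g j <= 1) ->
  sB (fun j => g (S j) - g j) 1.
Proof.
  intros Hm Hb l Hl.
  apply Rle_trans with (lsum (seq 0 (S (list_max l))) (fun j => g (S j) - g j)).
  - apply lsum_incl; auto using incl_seq_max. intros j _. specialize (Hm j). lra.
  - assert (E : forall m, lsum (seq 0 m) (fun j => g (S j) - g j) = g m - g O).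
    { induction m as [|m IH]; [simpl; ring|]. rewrite lsum_seq_S, IH. ring. }
    rewrite E. pose proof (Hb O). pose proof (Hb (S (list_max l))). lra.
Qed.

Section Cutoffs.
Context {p : R} {hp : Exponent p}.

(** As p >= 1, v^p <= v for v in [0, 1], so the p-th powers of the weights at each coordinate still
    add up to at most 1. *)
Lemma lpB_split {A I} (v : A -> I -> R) (x : I -> Cx) r : (forall a i, 0 <= v a i) ->
  (forall i, sB (fun a => v a i) 1) -> lpB p x r ->
  lpB p (fun ai : A * I => mask (v (fst ai)) x (snd ai)) r.
Proof.
  intros Hv H1 [Hr Hx]. pose proof hp as Hp. unfold Exponent in Hp.
  assert (G : lpB p (fun ia : I * A => mask (v (snd ia)) x (fst ia)) r).
  { split; [assumption|]. apply sB_fubini with (fun i => rpow (Cnorm (x i)) p); auto.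
    - intros; apply rpow_ge0.
    - intros i l Hl. cbn [fst snd].
      assert (Hv1 : forall a, In a l -> v a i <= 1).
      { intros a Ha. eapply Rle_trans; [|apply (H1 i l Hl)].
        now apply (lsum_In l (fun a => v a i)). }
      apply Rle_trans with (lsum l (fun a => rpow (Cnorm (x i)) p * v a i)).
      + apply lsum_le; intros a Ha. unfold mask. rewrite Cnorm_mul, Cnorm_RtoC, Rabs_right by (apply Rle_ge, Hv).
        rewrite rpow_mul by auto using Cnorm_ge0. rewrite Rmult_comm.
        apply Rmult_le_compat_l; [apply rpow_ge0|]. apply rpow_le_base; [lra|]. auto.
      + rewrite lsum_scal. rewrite <- (Rmult_1_r (rpow (Cnorm (x i)) p)) at 2.
        apply Rmult_le_compat_l; [apply rpow_ge0|]. now apply H1. }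
  apply (lpB_inj (fun ai : A * I => (snd ai, fst ai)) _ r) in G; [exact G|].
  intros [] []; simpl; congruence.
Qed.

Lemma opb_comm w A C : (forall c, Rabs (w c) <= 1) -> opb p A C -> opb p (comm w A) (1 * C + C * 1).
Proof.
  intros Hw HA. pose proof (opb_mask (p := p) w Hw) as HM.
  apply opb_sub; apply opb_comp; assumption.
Qed.

Definition band (a b : nat) : (nat -> Cx) -> nat -> Cx :=
  mask (fun c => (if (c <? b)%nat then 1 else 0) - (if (c <? a)%nat then 1 else 0)).

(** With P = [hd b], P A - A P = P A (1 - P) - (1 - P) A P. The far corners are small by assumption,
    so only the bands next to [b] on either side contribute. *)
Lemma comm_hd_bound A C e x r a b d : opb p A C -> (a <= b <= d)%nat -> lpB p x r ->
  lpB p (hd b (A (tl d x))) (e * r) -> lpB p (tl b (A (hd a x))) (e * r) ->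
  lpB p (xsub (hd b (A x)) (A (hd b x)))
    (2 * e * r + C * (nrmI p (band b d x) + nrmI p (band a b x))).
Proof.
  intros HA Hab Hx H1 H2.
  assert (Hi : inlp p x) by now exists r.
  assert (Hband : forall a b, lpB p (band a b x) r).
  { intros a' b'. apply lpB_mask; [|assumption]. intros c.
    destruct (c <? b')%nat, (c <? a')%nat; unfold Rabs; destruct Rcase_abs; lra. }
  assert (HB : forall a b, lpB p (A (band a b x)) (C * nrmI p (band a b x))).
  { intros. apply (opb_bd _ _ _ _ HA). eapply lpB_nrmI, Hband. }
  assert (Hih : forall n, inlp p (hd n x)) by (intros; eapply opb_inlp; [apply opb_hd|auto]).
  assert (Hit : forall n, inlp p (tl n x)) by (intros; eapply opb_inlp; [apply opb_tl|auto]).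
  assert (Hib : forall a b, inlp p (band a b x)) by (intros; eexists; apply Hband).
  assert (Et : tl b x = xadd (band b d x) (tl d x)).
  { apply functional_extensionality; intros c. unfold xadd, band, tl, mask.
    destruct (Nat.ltb_spec c b), (Nat.ltb_spec c d); try lia;
      rewrite ?Rminus_diag, ?Rminus_0_r, ?RtoC_0, ?RtoC_1; ring. }
  assert (Eh : hd b x = xadd (hd a x) (band a b x)).
  { apply functional_extensionality; intros c. unfold xadd, band, hd, mask.
    destruct (Nat.ltb_spec c a), (Nat.ltb_spec c b); try lia;
      rewrite ?Rminus_diag, ?Rminus_0_r, ?RtoC_0, ?RtoC_1; ring. }
  assert (E : xsub (hd b (A x)) (A (hd b x)) = xsub (hd b (A (tl b x))) (tl b (A (hd b x)))).
  { rewrite <- (hd_tl b x) at 1. rewrite (lin_add _ (opb_lin _ _ HA)) by auto.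
    rewrite <- (hd_tl b (A (hd b x))) at 2. xext. }
  rewrite E. clear E. rewrite Et, Eh. rewrite !(lin_add _ (opb_lin _ _ HA)) by auto.
  replace (xsub (hd b (xadd (A (band b d x)) (A (tl d x)))) (tl b (xadd (A (hd a x)) (A (band a b x)))))
    with (xsub (xadd (hd b (A (band b d x))) (hd b (A (tl d x))))
            (xadd (tl b (A (hd a x))) (tl b (A (band a b x))))) by xext.
  replace (2 * e * r + C * (nrmI p (band b d x) + nrmI p (band a b x)))
    with ((1 * (C * nrmI p (band b d x)) + e * r) + (e * r + 1 * (C * nrmI p (band a b x)))) by ring.
  apply lpB_sub; apply lpB_add; auto.
  - apply (opb_bd _ _ _ _ (opb_hd b)), HB.
  - apply (opb_bd _ _ _ _ (opb_tl b)), HB.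
Qed.

(* Averaging head projections far apart makes the commutator small, because a bounded operator
   is almost block tridiagonal for a sufficiently sparse sequence of projections. *)
Lemma quasicentral_cutoff (A : nat -> Op) m eps n : (forall s, exists C, opb p (A s) C) -> 0 < eps ->
  exists w n', (forall c, 0 <= w c <= 1) /\ (forall c, (c < n)%nat -> w c = 1) /\
    (forall c, (n' <= c)%nat -> w c = 0) /\ forall s, (s <= m)%nat -> opb p (comm w (A s)) eps.
Proof.
  intros HA He. pose proof (@exponent_gt0 p hp) as Hp0. pose proof (@exponent_neq0 p hp) as Hpn.
  assert (exists C, 0 <= C /\ forall s, (s <= m)%nat -> opb p (A s) C) as (C & HC0 & HC).
  { induction m as [|m (C & HC0 & HC)].
    - destruct (HA O) as [C HC]. exists C. split; [apply (opb_ge0 _ _ HC)|]. intros s Hs.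
      now replace s with O by lia.
    - destruct (HA (S m)) as [D HD]. pose proof (opb_ge0 _ _ HD). exists (C + D). split; [lra|].
      intros s Hs. destruct (Nat.eq_dec s (S m)) as [->|].
      + eapply opb_mono; [exact HD|lra].
      + eapply opb_mono; [apply HC; lia|lra]. }
  (* [hd b] composed with [A s] on either side is compact, so a far enough [d] makes both corners
     small, for the finitely many operators at once. *)
  assert (Hnx : forall b, exists d, (b <= d)%nat /\ forall s, (s <= m)%nat ->
    opb p (fun x => hd b (A s (tl d x))) (eps / 4) /\ opb p (fun x => tl d (A s (hd b x))) (eps / 4)).
  { intros b.
    assert (Hone : forall s, exists d0, forall d, (d0 <= d)%nat ->
      opb p (fun x => hd b (A s (tl d x))) (eps / 4) /\ opb p (fun x => tl d (A s (hd b x))) (eps / 4)).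
    { intros s. destruct (HA s) as [D HD].
      assert (Hw1 : forall c, Rabs (if (c <? b)%nat then 1 else 0) <= 1).
      { intros c; destruct (c <? b)%nat; rewrite ?Rabs_R0, ?Rabs_R1; lra. }
      assert (Hw2 : forall c, (b <= c)%nat -> (if (c <? b)%nat then 1 else 0) = 0).
      { intros c Hc. destruct (Nat.ltb_spec c b); [lia|reflexivity]. }
      destruct (cptR_tail _ (eps / 4) (cptR_maskL (A s) D _ b HD Hw1 Hw2)) as [d1 H1]; [lra|].
      destruct (cptL_tail _ (eps / 4) (cptR_cptL _ (cptR_maskR (A s) D _ b HD Hw1 Hw2))) as [d2 H2]; [lra|].
      exists (max d1 d2). intros d Hd. split; [apply H1|apply H2]; lia. }
    clear HC. induction m as [|m' (d & Hd & IH)].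
    - destruct (Hone O) as [d0 H]. exists (max b d0). split; [lia|]. intros s Hs.
      replace s with O by lia. apply H; lia.
    - assert (G : forall m', exists d0, forall d, (d0 <= d)%nat -> forall s, (s <= m')%nat ->
        opb p (fun x => hd b (A s (tl d x))) (eps / 4) /\ opb p (fun x => tl d (A s (hd b x))) (eps / 4)).
      { clear -Hone. induction m' as [|m' [d0 IH]].
        - destruct (Hone O) as [d0 H]. exists d0. intros d Hd s Hs. replace s with O by lia. now apply H.
        - destruct (Hone (S m')) as [d1 H1]. exists (max d0 d1). intros d Hd s Hs.
          destruct (Nat.eq_dec s (S m')) as [->|]; [apply H1|apply IH]; lia. }
      destruct (G (S m')) as [d0 H]. exists (max b d0). split; [lia|]. intros; apply H; lia. }
  pose (nx := fun b => proj1_sig (constructive_indefinite_description _ (Hnx b))).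
  assert (Hn : forall b, (b <= nx b)%nat /\ forall s, (s <= m)%nat ->
    opb p (fun x => hd b (A s (tl (nx b) x))) (eps / 4) /\
    opb p (fun x => tl (nx b) (A s (hd b x))) (eps / 4)).
  { intros b; unfold nx. now destruct constructive_indefinite_description. }
  clearbody nx. clear Hnx.
  pose (ns := fix ns j := match j with O => n | S j' => nx (ns j') end).
  assert (Hns : forall j, (ns j <= ns (S j))%nat) by (intros; apply Hn).
  assert (Hnn : forall j i, (i <= j)%nat -> (ns i <= ns j)%nat).
  { intros j i Hij. induction Hij; [lia|]. specialize (Hns m0). lia. }
  set (del := eps / (4 * (C + 1))).
  assert (Hdel : 0 < del) by (apply Rdiv_lt_0_compat; lra).
  (* The bands are disjoint, so the p-th powers of their norms add up to at most r^p, and by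
     convexity the p-th power of their mean is at most r^p / [L0]. Taking [L0] above del^-p brings
     the mean below [del * r]. *)
  destruct (INR_unbounded (/ rpow del p)) as [L0 HL0].
  pose proof (rpow_gt0 del p Hdel) as Hdp.
  assert (HL : 0 < INR L0) by (pose proof (Rinv_0_lt_compat _ Hdp); lra).
  set (L := INR L0) in *.
  assert (HiL : 0 < / L) by now apply Rinv_0_lt_compat.
  pose (ind := fun b c => if (c <? b)%nat then 1 else 0).
  assert (Hind : forall b c, 0 <= ind b c <= 1) by (intros; unfold ind; destruct (c <? b)%nat; lra).
  pose (w := fun c => / L * lsum (seq 0 L0) (fun j => ind (ns (S j)) c)).
  assert (Hw : forall c, 0 <= w c <= 1).
  { intros c. unfold w. split.
    - apply Rmult_le_pos; [lra|]. apply lsum_ge0; intros; apply Hind.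
    - apply Rmult_le_reg_l with L; [assumption|]. rewrite <- Rmult_assoc, Rinv_r, Rmult_1_l by lra.
      replace (L * 1) with (lsum (seq 0 L0) (fun _ => 1)) by (rewrite lsum_const, length_seq; reflexivity).
      apply lsum_le; intros; apply Hind. }
  exists w, (ns L0). split; [assumption|]. split; [|split].
  - intros c Hc. unfold w. rewrite (lsum_ext _ _ (fun _ => 1)).
    + rewrite lsum_const, length_seq. fold L. field. lra.
    + intros j _. unfold ind. pose proof (Hnn (S j) O ltac:(lia)) as H. change (ns O) with n in H.
      destruct (Nat.ltb_spec c (ns (S j))); [reflexivity|lia].
  - intros c Hc. unfold w. rewrite (lsum_ext _ _ (fun _ => 0)); [rewrite lsum_zero; ring|].
    intros j Hj. apply in_seq in Hj. unfold ind.
    pose proof (Hnn L0 (S j) ltac:(lia)). destruct (Nat.ltb_spec c (ns (S j))); [lia|reflexivity].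
  - intros s Hs. pose proof (HC s Hs) as HAs.
    assert (Hwa : forall c, Rabs (w c) <= 1).
    { intros c. specialize (Hw c). rewrite Rabs_right; lra. }
    apply (opb_bound _ _ eps (opb_comm w (A s) C Hwa HAs)); [lra|]. intros x r Hx.
    assert (Hi : inlp p x) by now exists r.
    assert (Hr : 0 <= r) by apply (lpB_ge0 _ _ Hx).
    assert (Hih : forall b, inlp p (hd b x)) by (intros; eapply opb_inlp; [apply opb_hd|auto]).
    assert (Em : forall y, mask w y = xscale (RtoC (/ L)) (xsum (seq 0 L0) (fun j => hd (ns (S j)) y))).
    { intros y. apply functional_extensionality; intros c. unfold mask at 1, xscale, xsum, hd, mask, w.
      rewrite RtoC_mul, <- csum_RtoC. change (Cmul (Cmul (RtoC (/ L))
         (csum (seq 0 L0) (fun j => RtoC (ind (ns (S j)) c)))) (y c) =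
         Cmul (RtoC (/ L)) (csum (seq 0 L0) (fun j => Cmul (RtoC (ind (ns (S j)) c)) (y c)))).
      rewrite (csum_ext _ (fun j => Cmul (RtoC (ind (ns (S j)) c)) (y c))
        (fun j => Cmul (y c) (RtoC (ind (ns (S j)) c)))) by (intros; ring).
      rewrite csum_scal. ring. }
    unfold comm. rewrite !Em, (lin_scale _ (opb_lin _ _ HAs)) by (apply inlp_xsum; auto).
    rewrite (lin_xsum _ (opb_lin _ _ HAs)) by auto.
    replace (xsub (xscale (RtoC (/ L)) (xsum (seq 0 L0) (fun j => hd (ns (S j)) (A s x))))
        (xscale (RtoC (/ L)) (xsum (seq 0 L0) (fun a => A s (hd (ns (S a)) x)))))
      with (xscale (RtoC (/ L)) (xsum (seq 0 L0)
        (fun j => xsub (hd (ns (S j)) (A s x)) (A s (hd (ns (S j)) x))))).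
    2:{ apply functional_extensionality; intros c. unfold xsub, xadd, xscale, xsum.
        rewrite csum_plus, csum_scal. cring. }
    pose (rho := fun j => nrmI p (band (ns j) (ns (S j)) x)).
    assert (Hrho : forall j, 0 <= rho j) by (intros; apply rpow_ge0).
    assert (Hsum : sB (fun j => rpow (rho j) p) (rpow r p)).
    { pose (v := fun j c => ind (ns (S j)) c - ind (ns j) c).
      assert (Hmono : forall c j, ind (ns j) c <= ind (ns (S j)) c).
      { intros c j. unfold ind. specialize (Hns j).
        destruct (Nat.ltb_spec c (ns j)), (Nat.ltb_spec c (ns (S j))); lra || lia. }
      assert (HS : lpB p (fun ai : nat * nat => mask (v (fst ai)) x (snd ai)) r).
      { apply lpB_split; auto.
        - intros j c. unfold v. specialize (Hmono c j). lra.
        - intros c. apply (telescope_sB (fun j => ind (ns j) c)); auto. }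
      exact (proj2 (lpB_fibers _ _ HS)). }
    assert (Havg : forall k, / L * lsum (seq 0 L0) (fun j => rho (k + j)%nat) <= del * r).
    { intros k. apply rpow_le_inv with p; [assumption|apply Rmult_le_pos; lra|].
      rewrite <- lsum_scal. eapply Rle_trans.
      - apply (jensen (seq 0 L0) (fun _ => / L)); [exact hp|intros; lra| |intros; apply Hrho].
        rewrite lsum_const, length_seq. fold L. right; field; lra.
      - rewrite lsum_scal, rpow_mul by lra.
        apply Rmult_le_compat; [lra|apply lsum_ge0; intros; apply rpow_ge0| |].
        + rewrite <- (Rinv_inv (rpow del p)).
          apply Rinv_le_contravar; [now apply Rinv_0_lt_compat|lra].
        + rewrite <- (lsum_map (fun j => (k + j)%nat) (seq 0 L0) (fun j => rpow (rho j) p)).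
          apply Hsum. apply NoDup_map_NoDup_ForallPairs; [|apply seq_NoDup]. intros ? ? _ _; lia. }
    apply lpB_mono with (/ L * lsum (seq 0 L0) (fun j => 2 * (eps / 4) * r + C * (rho (1 + j)%nat + rho (0 + j)%nat))).
    + eapply lpB_mono; [apply lpB_scale|rewrite Cnorm_RtoC, Rabs_right by lra; apply Rle_refl].
      apply lpB_xsum. intros j _. apply (comm_hd_bound (A s) C (eps / 4) x r (ns j) (ns (S j)) (ns (S (S j)))); auto.
      * apply (opb_bd _ _ _ _ (proj1 (proj2 (Hn (ns (S j))) s Hs)) Hx).
      * apply (opb_bd _ _ _ _ (proj2 (proj2 (Hn (ns j)) s Hs)) Hx).
    + rewrite lsum_plus, lsum_const, length_seq, lsum_scal, lsum_plus. fold L.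
      pose proof (Havg 1%nat) as H1. pose proof (Havg 0%nat) as H0.
      apply Rmult_le_compat_l with (r := C) in H1; [|assumption].
      apply Rmult_le_compat_l with (r := C) in H0; [|assumption].
      replace (/ L * (L * (2 * (eps / 4) * r) + C *
        (lsum (seq 0 L0) (fun a => rho (1 + a)%nat) + lsum (seq 0 L0) (fun a => rho (0 + a)%nat))))
        with (eps / 2 * r + (C * (/ L * lsum (seq 0 L0) (fun j => rho (1 + j)%nat))
           + C * (/ L * lsum (seq 0 L0) (fun j => rho (0 + j)%nat)))) by (field; lra).
      assert (HCd : C * del <= eps / 4).
      { unfold del. apply Rmult_le_reg_r with (4 * (C + 1)); [lra|]. field_simplify; [|lra]. nra. }
      apply Rmult_le_compat_r with (r := r) in HCd; [|assumption]. lra.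
Qed.

(** Consecutive cutoffs interlock: each is 1 wherever the previous one is nonzero. The clause
    [k <= S (n k)] makes [phi k c] equal to 1 once [k] is at least [c + 2], so that sums over stages
    are finite at each coordinate. The first two cutoffs vanish, which starts the telescoping sums
    at 0. *)
Lemma cutoff_sequence (A : nat -> Op) (eps : nat -> R) (N0 : nat -> nat) :
  (forall s, exists C, opb p (A s) C) -> (forall k, 0 < eps k) -> N0 O = O -> N0 1%nat = O ->
  exists (phi : nat -> nat -> R) (n : nat -> nat),
    (forall k c, 0 <= phi k c <= 1) /\
    (forall k c, (c < n k)%nat -> phi k c = 1) /\
    (forall k c, (n (S k) <= c)%nat -> phi k c = 0) /\
    (forall k, (N0 k <= n k)%nat) /\ (forall k, (k <= S (n k))%nat) /\
    (forall c, phi O c = 0) /\ (forall c, phi 1%nat c = 0) /\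
    (forall k s, (s <= k)%nat -> opb p (comm (phi k) (A s)) (eps k)).
Proof.
  intros HA He HN0 HN1.
  pose (q := fun k n => constructive_indefinite_description _
    (quasicentral_cutoff A k (eps k) n HA (He k))).
  pose (q2 := fun k n => constructive_indefinite_description _ (proj2_sig (q k n))).
  pose (ns := fix ns k := match k with
    | O => O | S O => O
    | S (S O as k') => max (N0 2%nat) 1
    | S (S (S _) as k') => max (proj1_sig (q2 k' (ns k'))) (max (N0 (S k')) k') end).
  pose (phi := fun k => if (k <? 2)%nat then (fun _ => 0) else proj1_sig (q k (ns k))).
  exists phi, ns.
  assert (Hq : forall k, (2 <= k)%nat -> phi k = proj1_sig (q k (ns k))).
  { intros k Hk. unfold phi. destruct (Nat.ltb_spec k 2); [lia|reflexivity]. }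
  assert (Hp : forall k, (2 <= k)%nat -> (forall c, 0 <= phi k c <= 1) /\
     (forall c, (c < ns k)%nat -> phi k c = 1) /\
     (forall c, (proj1_sig (q2 k (ns k)) <= c)%nat -> phi k c = 0) /\
     forall s, (s <= k)%nat -> opb p (comm (phi k) (A s)) (eps k)).
  { intros k Hk. rewrite (Hq k Hk). exact (proj2_sig (q2 k (ns k))). }
  assert (Hsmall : forall k, (k < 2)%nat -> phi k = fun _ => 0).
  { intros k Hk. unfold phi. destruct (Nat.ltb_spec k 2); [reflexivity|lia]. }
  assert (Hns : forall k, (2 <= k)%nat -> ns (S k) = max (proj1_sig (q2 k (ns k))) (max (N0 (S k)) k)).
  { intros [|[|k]] Hk; try lia. reflexivity. }
  split; [|split; [|split; [|split; [|split; [|split; [|split]]]]]].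
  - intros k c. destruct (Nat.lt_ge_cases k 2) as [Hk|Hk]; [rewrite Hsmall by assumption; lra|].
    now apply Hp.
  - intros k c Hc. destruct (Nat.lt_ge_cases k 2) as [Hk|Hk]; [|now apply Hp].
    destruct k as [|[|]]; simpl in Hc; lia.
  - intros k c Hc. destruct (Nat.lt_ge_cases k 2) as [Hk|Hk]; [now rewrite Hsmall by assumption|].
    apply Hp; [assumption|]. rewrite Hns in Hc by assumption. lia.
  - intros [|[|[|k]]]; [rewrite HN0|rewrite HN1| |]; simpl (ns 0%nat); simpl (ns 1%nat); try lia.
    + change (ns 2%nat) with (max (N0 2%nat) 1). lia.
    + rewrite Hns; lia.
  - intros [|[|[|k]]]; try lia.
    + change (ns 2%nat) with (max (N0 2%nat) 1). lia.
    + rewrite Hns; lia.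
  - intros c. now rewrite Hsmall by lia.
  - intros c. now rewrite Hsmall by lia.
  - intros k s Hs. destruct (Nat.lt_ge_cases k 2) as [Hk|Hk]; [|now apply Hp].
    rewrite Hsmall by assumption. destruct (HA s) as [C HC].
    apply (opb_ext (fun _ => xzero)); [|apply opb_zero; pose proof (He k); lra].
    intros x _. unfold comm. replace (mask (fun _ => 0) x) with (@xzero nat).
    + rewrite (lin_zero _ (opb_lin _ _ HC)). xext. rewrite RtoC_0. cring.
    + apply functional_extensionality; intros c. unfold xzero, mask. rewrite RtoC_0. ring.
Qed.

End Cutoffs.

(** * Dilating an approximate representation to the model *)

Lemma csum_seq_extend (f : nat -> Cx) a b : (a <= b)%nat -> (forall k, (a <= k)%nat -> f k = C0) ->
  csum (seq 0 b) f = csum (seq 0 a) f.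
Proof.
  intros Hab H. induction Hab as [|b Hab IH]; [reflexivity|].
  rewrite csum_seq_S, IH, H by assumption. ring.
Qed.

Lemma quarter_small eps : 0 < eps -> exists k0, forall k, (k0 <= k)%nat -> (/ 4) ^ k <= eps * / 2 ^ S k.
Proof.
  intros He. destruct (pow_lt_1_zero (/ 2)) with (y := eps / 2) as [k0 Hk0];
    [rewrite Rabs_right; lra|lra|].
  exists k0. intros k Hk. specialize (Hk0 k Hk).
  rewrite Rabs_right in Hk0 by (apply Rle_ge, pow_le; lra).
  replace (/ 4) with (/ 2 * / 2) by lra. rewrite Rpow_mult_distr.
  assert (0 < (/ 2) ^ k) by (apply pow_lt; lra).
  replace (eps * / 2 ^ S k) with (eps / 2 * (/ 2) ^ k).
  - apply Rmult_le_compat_r; lra.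
  - rewrite pow_inv. simpl. assert (2 ^ k <> 0) by (apply pow_nonzero; lra). field. assumption.
Qed.

Section Scaling.
Context {p : R} {hp : Exponent p}.

(* Normalising factors of the embedding [s_emb] and of the projection [s_prj]. *)
Definition s_emb (n : nat) : R := rpow (2 ^ n) (- / p).
Definition s_prj (n : nat) : R := rpow (2 ^ n) (/ p - 1).

Let pw n : 0 < 2 ^ n. Proof. apply pow_lt; lra. Qed.

Lemma s_emb_pow n : 2 ^ n * rpow (s_emb n) p = 1.
Proof.
  unfold s_emb. rewrite rpow_rpow. replace (- / p * p) with (-1) by (field; apply exponent_neq0).
  rewrite <- (rpow_1 (2 ^ n)) at 1 by (left; apply pw).
  rewrite <- rpow_plus by apply pw. rewrite Rplus_opp_r.
  rewrite rpow_pos by apply pw. apply Rpower_O, pw.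
Qed.

Lemma s_prj_pow n : rpow (2 ^ n * s_prj n) p = 2 ^ n.
Proof.
  unfold s_prj. rewrite <- (rpow_1 (2 ^ n)) at 1 by (left; apply pw).
  rewrite <- rpow_plus by apply pw. replace (1 + (/ p - 1)) with (/ p) by ring.
  apply rpow_inv_l; [apply exponent_neq0|left; apply pw].
Qed.

Lemma s_emb_prj n : s_prj n * (s_emb n * 2 ^ n) = 1.
Proof.
  unfold s_prj, s_emb. rewrite <- (rpow_1 (2 ^ n)) at 3 by (left; apply pw).
  rewrite <- !rpow_plus by apply pw. replace (/ p - 1 + (- / p + 1)) with 0 by ring.
  rewrite rpow_pos by apply pw. apply Rpower_O, pw.
Qed.

Lemma s_emb_ge0 n : 0 <= s_emb n. Proof. apply rpow_ge0. Qed.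
Lemma s_prj_ge0 n : 0 <= s_prj n. Proof. apply rpow_ge0. Qed.

(** The factor [s_prj n] is 2^n to the power 1/p - 1. By [jensen] with uniform weights it is exactly
    what lets a sum over 2^n patterns be bounded by the joint l^p norm of its terms. *)
Lemma lpB_average n (g : nat -> nat -> Cx) (rho : nat -> R) sig :
  (forall w, In w (patterns n) -> lpB p (g w) (rho w)) -> 0 <= sig ->
  lsum (patterns n) (fun w => rpow (rho w) p) <= rpow sig p ->
  lpB p (fun c => Cmul (RtoC (s_prj n)) (csum (patterns n) (fun w => g w c))) sig.
Proof.
  intros Hg Hs Hr. pose proof (@exponent_gt0 p hp) as Hp0.
  pose (x := fun w => if in_dec Nat.eq_dec w (patterns n) then g w else xzero).
  pose (r := fun w => if in_dec Nat.eq_dec w (patterns n) then rho w else 0).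
  apply (lpB_rows x r sig _ (fun _ => patterns n)); auto.
  - intros w. unfold x, r. destruct in_dec; [auto|apply lpB_zero; lra].
  - intros l Hl. eapply Rle_trans; [apply (lsum_support l (patterns n))|]; auto.
    + intros; apply rpow_ge0.
    + intros w Hw. unfold r. destruct in_dec; [contradiction|apply rpow_0].
    + eapply Rle_trans; [right|exact Hr]. apply lsum_ext; intros w Hw. unfold r.
      destruct in_dec; [reflexivity|contradiction].
  - intros _. apply seq_NoDup.
  - intros c. rewrite (lsum_ext _ _ (fun w => rpow (Cnorm (g w c)) p)).
    2:{ intros w Hw. unfold x. destruct in_dec; [reflexivity|contradiction]. }
    pose proof (s_prj_ge0 n) as H0.
    rewrite Cnorm_mul, Cnorm_RtoC, Rabs_right by lra.
    apply Rle_trans with (rpow (lsum (patterns n) (fun w => / 2 ^ n * (2 ^ n * s_prj n * Cnorm (g w c)))) p).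
    + apply rpow_le; [assumption|]. split; [apply Rmult_le_pos; auto using Cnorm_ge0|].
      rewrite (lsum_ext _ _ (fun w => s_prj n * Cnorm (g w c))).
      * rewrite lsum_scal. apply Rmult_le_compat_l; [assumption|apply Cnorm_csum].
      * intros w _. pose proof (pw n). field. lra.
    + assert (0 < / 2 ^ n) by (apply Rinv_0_lt_compat, pw).
      eapply Rle_trans; [apply jensen; [exact hp|intros; lra| |]|].
      * rewrite lsum_patterns_const. pose proof (pw n). right; field; lra.
      * intros w _. pose proof (pw n). repeat apply Rmult_le_pos; auto using Cnorm_ge0; lra.
      * right. apply lsum_ext; intros w _. rewrite rpow_mul, s_prj_pow.
        -- pose proof (pw n). field. lra.
        -- pose proof (pw n). apply Rmult_le_pos; lra.
        -- apply Cnorm_ge0.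
Qed.

(* A locally finite sum of vectors. *)
Lemma lpB_local (x : nat -> nat -> Cx) y D : (forall m, lpB p (xsum (seq 0 m) x) D) ->
  (forall k c, (c + 2 <= k)%nat -> x k c = C0) ->
  (forall c, y c = csum (seq 0 (c + 2)) (fun k => x k c)) -> lpB p y D.
Proof.
  intros H H0 Hy. split; [apply (lpB_ge0 _ _ (H O))|]. intros l Hl.
  rewrite (lsum_ext _ _ (fun c => rpow (Cnorm (xsum (seq 0 (list_max l + 2)) x c)) p)).
  - now apply (proj2 (H (list_max l + 2)%nat)).
  - intros c Hc. rewrite Hy. f_equal. f_equal. symmetry. unfold xsum.
    apply (csum_seq_extend (fun k => x k c)); auto.
    pose proof (incl_seq_max l c Hc) as Hin. apply in_seq in Hin. lia.
Qed.

End Scaling.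

Section Stages.
Context {p : R} {hp : Exponent p}.
Variables (N : nat -> nat) (T : nat -> nat -> Op) (B : R) (N0 : nat -> nat).
Variables (A : nat -> Op) (a : nat -> nat -> nat -> Cx) (a0 : nat -> Cx) (th : nat -> nat -> R).

Definition signed_sum (X : nat -> nat -> Op) (k w : nat) : Op := fun z =>
  xsum (seq 0 (N k)) (fun i => xscale (RtoC (rad (N k) i w)) (X k i z)).

(** In the application [T k i] is psi(g_i) at stage [k], [A s] is psi(h_s) for a dense family h_s,
    and [a s k i] is h_s(m_i). Modulo compacts both defects are then psi(g_i (h_s - h_s(m_i))),
    small because h_s oscillates little on the support of g_i. *)
Definition defectR (s k i : nat) : Op := fun x => xsub (T k i (A s x)) (xscale (a s k i) (T k i x)).
Definition defectL (s k i : nat) : Op := fun x => xsub (A s (T k i x)) (xscale (a s k i) (T k i x)).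
Definition square_sum (k : nat) : Op := fun x => xsum (seq 0 (N k)) (fun i => T k i (T k i x)).

Hypothesis HT : forall k i, exists C, opb p (T k i) C.
Hypothesis HA : forall s, exists C, opb p (A s) C.
Hypothesis HN0 : N0 O = O.
Hypothesis HN1 : N0 1%nat = O.
Hypothesis HB : 0 <= B.
Hypothesis HBT : forall k w, In w (patterns (N k)) ->
  opb p (fun x => signed_sum T k w (tl (N0 k) x)) B /\
  opb p (fun x => tl (N0 k) (signed_sum T k w x)) B.
Hypothesis Hsq : forall k, opb p (fun x => xsub (square_sum k (tl (N0 k) x)) (tl (N0 k) x)) ((/ 4) ^ S k).
Hypothesis Hth : forall s eps, 0 < eps -> exists k0, forall k, (k0 <= k)%nat -> th s k <= eps.
Hypothesis HdR : forall s k w, (s <= k)%nat -> In w (patterns (N k)) ->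
  opb p (fun x => signed_sum (defectR s) k w (tl (N0 k) x)) (th s k).
Hypothesis HdL : forall s k w, (s <= k)%nat -> In w (patterns (N k)) ->
  opb p (fun x => tl (N0 k) (signed_sum (defectL s) k w x)) (th s k).
Hypothesis Ha : forall s, exists kap, 0 <= kap /\ Cnorm (a0 s) <= kap /\
  forall k i, (i < N k)%nat -> Cnorm (a s k i) <= kap.

Definition Fcoef (k : nat) (y : I3 -> Cx) (i : nat) : nat -> Cx :=
  fun c => rcoef (N k) (fun w => y (k, w, c)) i.

Definition Wstage (X : nat -> nat -> Op) (k : nat) (y : I3 -> Cx) : nat -> Cx :=
  xscale (RtoC (s_prj (p := p) (N k))) (xsum (seq 0 (N k)) (fun i => X k i (Fcoef k y i))).

(** The sum over stages stops at [c + 2] because the weights in use vanish at [c] for all later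
    stages; no convergence question arises. *)
Definition Wsum (v : nat -> nat -> R) (X : nat -> nat -> Op) (y : I3 -> Cx) : nat -> Cx :=
  fun c => csum (seq 0 (c + 2)) (fun k => mask (v k) (Wstage X k y) c).

Definition Vsum (X : nat -> nat -> Op) (z : nat -> nat -> Cx) : I3 -> Cx := fun t =>
  let '(k, w, c) := t in Cmul (RtoC (s_emb (p := p) (N k))) (signed_sum X k w (z k) c).

Let p0 : 0 < p := exponent_gt0.

Lemma signed_sum_out X k w z : ~ In w (patterns (N k)) -> signed_sum X k w z = xzero.
Proof.
  intros Hw. apply functional_extensionality; intros c. unfold signed_sum, xsum, xscale, xzero.
  rewrite (csum_ext _ _ (fun _ => C0)); [apply csum_zero|]. intros i _.
  rewrite rad_out by assumption. rewrite RtoC_0. ring.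
Qed.

(** Thanks to [s_emb], the 2^n patterns of a stage, each of norm at most [b k], have joint norm at
    most [b k]; the stages then add up in l^p. *)
Lemma lpB_Vsum X z b s : (forall k, 0 <= b k) ->
  (forall k w, In w (patterns (N k)) -> lpB p (signed_sum X k w (z k)) (b k)) -> 0 <= s ->
  sB (fun k => rpow (b k) p) (rpow s p) -> lpB p (Vsum X z) s.
Proof.
  intros Hb H Hs HS. pose proof (@exponent_neq0 p hp).
  pose (r := fun kw : nat * nat => let '(k, w) := kw in
    if in_dec Nat.eq_dec w (patterns (N k)) then s_emb (p := p) (N k) * b k else 0).
  apply (lpB_fubini (A := nat * nat) (B := nat) (Vsum X z) r); auto.
  - intros [k w]. unfold Vsum, r. destruct in_dec as [Hw|Hw].
    + apply lpB_mono with (Cnorm (RtoC (s_emb (p := p) (N k))) * b k).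
      * apply (lpB_scale (RtoC (s_emb (p := p) (N k))) (signed_sum X k w (z k))). auto.
      * rewrite Cnorm_RtoC, Rabs_right by (apply Rle_ge, s_emb_ge0). lra.
    + rewrite signed_sum_out by assumption.
      apply (lpB_dom xzero); [apply lpB_zero; lra|]. intros c. unfold xzero.
      rewrite Cnorm_mul, Cnorm_C0. lra.
  - apply sB_fubini with (fun k => rpow (b k) p); auto.
    + intros; apply rpow_ge0.
    + intros k l Hl. eapply Rle_trans; [apply (lsum_support l (patterns (N k)))|]; auto.
      * intros; apply rpow_ge0.
      * intros w Hw. unfold r. destruct in_dec; [contradiction|apply rpow_0].
      * rewrite (lsum_ext _ _ (fun _ => rpow (s_emb (p := p) (N k)) p * rpow (b k) p)).
        -- rewrite lsum_patterns_const, <- Rmult_assoc, s_emb_pow. lra.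
        -- intros w Hw. unfold r. destruct in_dec; [|contradiction].
           apply rpow_mul; auto using s_emb_ge0.
Qed.

Definition fibre (y : I3 -> Cx) (k w : nat) : nat -> Cx := fun c => y (k, w, c).

Lemma inlp_fibre y k w : inlp p y -> inlp p (fibre y k w).
Proof.
  intros [r Hr]. exists r. apply (lpB_inj (fun c => (k, w, c)) y); [|assumption]. congruence.
Qed.

Lemma Fcoef_xsum y k i : Fcoef k y i =
  xsum (patterns (N k)) (fun w => xscale (RtoC (rad (N k) i w)) (fibre y k w)).
Proof. reflexivity. Qed.

Lemma inlp_Fcoef y k i : inlp p y -> inlp p (Fcoef k y i).
Proof.
  intros Hy. rewrite Fcoef_xsum. apply inlp_xsum; intros. apply inlp_scale, inlp_fibre, Hy.
Qed.

Lemma Wstage_signed X k y : (forall i, exists C, opb p (X k i) C) -> inlp p y ->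
  Wstage X k y = xscale (RtoC (s_prj (p := p) (N k)))
    (xsum (patterns (N k)) (fun w => signed_sum X k w (fibre y k w))).
Proof.
  intros HX Hy. unfold Wstage. f_equal. apply functional_extensionality; intros c. unfold xsum.
  transitivity (csum (seq 0 (N k)) (fun i => csum (patterns (N k)) (fun w =>
     Cmul (RtoC (rad (N k) i w)) (X k i (fibre y k w) c)))).
  - apply csum_ext; intros i _. destruct (HX i) as [C HC]. rewrite Fcoef_xsum.
    rewrite (lin_xsum _ (opb_lin _ _ HC)) by (intros; apply inlp_scale, inlp_fibre, Hy).
    apply csum_ext; intros w _.
    now rewrite (lin_scale _ (opb_lin _ _ HC)) by apply inlp_fibre, Hy.
  - rewrite csum_swap. reflexivity.
Qed.

(** At each coordinate the weights [v k c / 3] have total at most 1, so [jensen] bounds the p-th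
    power of the sum over stages by a sum of p-th powers; rescaling costs the factor 3. The index
    [k0] discards early stages in the tail estimates. *)
Lemma lpB_Wsum v X y b k0 r : (forall k i, exists C, opb p (X k i) C) -> 0 <= b ->
  (forall k c, 0 <= v k c) -> (forall c m, lsum (seq 0 m) (fun k => v k c) <= 3) ->
  (forall k c, v k c <> 0 -> (N0 k <= c)%nat /\ (k0 <= k)%nat) ->
  (forall k w, (k0 <= k)%nat -> In w (patterns (N k)) ->
     forall z rho, lpB p z rho -> lpB p (tl (N0 k) (signed_sum X k w z)) (b * rho)) ->
  lpB p y r -> lpB p (Wsum v X y) (3 * b * r).
Proof.
  intros HX Hb Hv1 Hv3 Hv H Hy. pose proof (@exponent_neq0 p hp) as Hpn.
  assert (Hr : 0 <= r) by apply (lpB_ge0 _ _ Hy).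
  assert (Hyi : inlp p y) by now exists r.
  destruct (lpB_fibers (A := nat * nat) (B := nat) y r Hy) as [F1 F2].
  set (rho := fun kw : nat * nat => nrmI p (fun c => y (kw, c))) in F1, F2.
  destruct (sB_fibers (A := nat) (B := nat) _ _ F2) as [F3 F4].
  (* [sig k] is the l^p norm of the part of [y] at stage [k]. *)
  set (sig := fun k => rpow (tot (fun w => rpow (rho (k, w)) p)) (/ p)).
  assert (Hsig : forall k, rpow (sig k) p = tot (fun w => rpow (rho (k, w)) p)).
  { intros k. unfold sig. apply rpow_inv_l; [assumption|]. eapply tot_ge0. apply F3. }
  assert (Hsig0 : forall k, 0 <= sig k) by (intros; apply rpow_ge0).
  pose (x := fun k => if (k0 <=? k)%nat then xscale (RtoC 3) (tl (N0 k) (Wstage X k y)) else xzero).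
  apply (lpB_rows x (fun k => 3 * b * sig k) _ _ (fun c => seq 0 (c + 2))).
  - intros k. unfold x. destruct (Nat.leb_spec k0 k) as [Hk|Hk].
    2:{ apply lpB_zero. specialize (Hsig0 k). nra. }
    rewrite Rmult_assoc. rewrite <- (Rabs_right 3) at 2 by lra. rewrite <- Cnorm_RtoC. apply lpB_scale.
    rewrite Wstage_signed by auto.
    replace (tl (N0 k) (xscale (RtoC (s_prj (p := p) (N k)))
        (xsum (patterns (N k)) (fun w => signed_sum X k w (fibre y k w)))))
      with (fun c => Cmul (RtoC (s_prj (p := p) (N k))) (csum (patterns (N k))
        (fun w => tl (N0 k) (signed_sum X k w (fibre y k w)) c))).
    2:{ apply functional_extensionality; intros c. unfold tl, mask, xscale, xsum.
        rewrite csum_scal. ring. }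
    apply (lpB_average _ _ (fun w => b * rho (k, w))).
    + intros w Hw. apply H; auto. apply (F1 (k, w)).
    + specialize (Hsig0 k). nra.
    + rewrite rpow_mul by auto. rewrite Hsig.
      rewrite (lsum_ext _ _ (fun w => rpow b p * rpow (rho (k, w)) p)).
      * rewrite lsum_scal. apply Rmult_le_compat_l; [apply rpow_ge0|].
        apply (tot_ub (fun w => rpow (rho (k, w)) p) _ _ (F3 k)). apply seq_NoDup.
      * intros w _. apply rpow_mul; [assumption|apply rpow_ge0].
  - nra.
  - intros l Hl. rewrite rpow_mul by lra.
    rewrite (lsum_ext _ _ (fun k => rpow (3 * b) p * tot (fun w => rpow (rho (k, w)) p))).
    + rewrite lsum_scal. apply Rmult_le_compat_l; [apply rpow_ge0|]. now apply F4.
    + intros k _. rewrite rpow_mul by (auto; lra). now rewrite Hsig.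
  - intros c. apply seq_NoDup.
  - intros c.
    apply Rle_trans with (rpow (lsum (seq 0 (c + 2)) (fun k => v k c / 3 * Cnorm (x k c))) p).
    + apply rpow_le; [assumption|]. split; [apply Cnorm_ge0|].
      eapply Rle_trans; [apply Cnorm_csum|]. apply lsum_le; intros k _.
      unfold mask. rewrite Cnorm_mul, Cnorm_RtoC, Rabs_right by (apply Rle_ge, Hv1).
      destruct (Req_dec (v k c) 0) as [->|Hne]; [lra|]. destruct (Hv k c Hne) as [Hc Hk].
      unfold x. destruct (Nat.leb_spec k0 k); [|lia]. unfold xscale, tl, mask.
      destruct (Nat.ltb_spec c (N0 k)); [lia|]. rewrite !Cnorm_mul, !Cnorm_RtoC, Rabs_R1.
      rewrite (Rabs_right 3) by lra. right; field.
    + eapply Rle_trans; [apply jensen; [exact hp| | |intros; apply Cnorm_ge0]|].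
      * intros k _. specialize (Hv1 k c). lra.
      * rewrite (lsum_ext _ _ (fun k => / 3 * v k c)) by (intros; field). rewrite lsum_scal.
        specialize (Hv3 c (c + 2)%nat). lra.
      * apply lsum_le; intros k Hk. rewrite <- (Rmult_1_l (rpow _ p)) at 2.
        apply Rmult_le_compat_r; [apply rpow_ge0|].
        pose proof (lsum_In (seq 0 (c + 2)) (fun k => v k c) k (fun k _ => Hv1 k c) Hk).
        specialize (Hv3 c (c + 2)%nat). simpl in *. lra.
Qed.

Lemma signed_sum_opb X k : (forall k i, exists C, opb p (X k i) C) ->
  exists b, 0 <= b /\ forall w, opb p (signed_sum X k w) b.
Proof.
  intros HX. assert (HC : exists C : nat -> R, forall i, opb p (X k i) (C i)).
  { exists (fun i => proj1_sig (constructive_indefinite_description _ (HX k i))).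
    intros i. apply proj2_sig. }
  destruct HC as [C HC]. exists (lsum (seq 0 (N k)) C). split.
  - apply lsum_ge0; intros i _. apply (opb_ge0 _ _ (HC i)).
  - intros w. apply opb_xsum. intros i _. pose proof (opb_ge0 _ _ (HC i)).
    eapply opb_mono; [apply opb_scale, HC|]. rewrite Cnorm_RtoC.
    pose proof (Rabs_rad (N k) i w). pose proof (Rabs_pos (rad (N k) i w)). nra.
Qed.

(** Crude bounds with no uniformity in the stage. They serve where the argument is not confined to
    the tail on which [B] is valid, and the commutators of the cutoffs are made small against
    them. *)
Lemma stage_bounds : exists beta : nat -> R, (forall k, 0 <= beta k) /\
  forall k w, opb p (signed_sum T k w) (beta k).
Proof.
  pose (c := fun k => constructive_indefinite_description _ (signed_sum_opb T k HT)).
  exists (fun k => proj1_sig (c k)).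
  split; intros k; [exact (proj1 (proj2_sig (c k)))|exact (proj2 (proj2_sig (c k)))].
Qed.

Lemma lpB_Wstage beta k y r : 0 <= beta -> (forall w, opb p (signed_sum T k w) beta) ->
  lpB p y r -> lpB p (Wstage T k y) (beta * r).
Proof.
  intros Hbeta Hb Hy. assert (Hr : 0 <= r) by apply (lpB_ge0 _ _ Hy).
  rewrite Wstage_signed by (auto; now exists r).
  assert (Hy' : lpB p (fun wc : nat * nat => y (k, fst wc, snd wc)) r).
  { apply (lpB_inj (fun wc : nat * nat => (k, fst wc, snd wc)) y); [|assumption].
    intros [] []; simpl; congruence. }
  destruct (lpB_fibers _ _ Hy') as [F1 F2].
  apply (lpB_average _ _ (fun w => beta * nrmI p (fibre y k w))).
  - intros w _. apply (opb_bd _ _ _ _ (Hb w)). apply (F1 w).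
  - apply Rmult_le_pos; assumption.
  - rewrite rpow_mul by assumption.
    rewrite (lsum_ext _ _ (fun w => rpow beta p * rpow (nrmI p (fibre y k w)) p))
      by (intros; apply rpow_mul; [assumption|apply rpow_ge0]).
    rewrite lsum_scal. apply Rmult_le_compat_l; [apply rpow_ge0|]. apply F2, seq_NoDup.
Qed.

(** * Gluing the stages along the cutoffs *)

Section WithCutoffs.
Variables (phi : nat -> nat -> R) (n : nat -> nat) (beta : nat -> R).
Hypothesis Hbeta0 : forall k, 0 <= beta k.
Hypothesis Hbeta : forall k w, opb p (signed_sum T k w) (beta k).
Hypothesis Hphi : forall k c, 0 <= phi k c <= 1.
Hypothesis Hphi1 : forall k c, (c < n k)%nat -> phi k c = 1.
Hypothesis Hphi0 : forall k c, (n (S k) <= c)%nat -> phi k c = 0.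
Hypothesis HnN : forall k, (N0 k <= n k)%nat.
Hypothesis Hnk : forall k, (k <= S (n k))%nat.
Hypothesis Hphi00 : forall c, phi O c = 0.
Hypothesis Hphi01 : forall c, phi 1%nat c = 0.
Hypothesis Hcomm : forall k j s, (s <= k)%nat -> (k <= j)%nat ->
  opb p (comm (phi j) (A s)) ((/ 4) ^ k / (2 * (1 + beta k))).

(** The weights [ee k] form a partition of unity in [k]. The wider [ee' k] equals 1 on the support
    of [ee k], so the output of stage [k] can be localised by [ee' k], while the total of the [ee']
    stays at most 3. *)
Definition ee (k c : nat) : R := phi (S (S k)) c - phi (S k) c.
Definition ee' (k c : nat) : R := phi (S (S (S k))) c - phi k c.

(** At each coordinate either the later cutoff is already 1 or the earlier one is already 0. *)
Lemma phi_mono k c : phi k c <= phi (S k) c.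
Proof.
  destruct (Nat.lt_ge_cases c (n (S k))) as [H|H].
  - rewrite (Hphi1 (S k)) by assumption. apply Hphi.
  - rewrite (Hphi0 k) by assumption. apply Hphi.
Qed.

Lemma phi_large k c : (c + 2 <= k)%nat -> phi k c = 1.
Proof. intros H. apply Hphi1. specialize (Hnk k). lia. Qed.

Lemma ee_ge0 k c : 0 <= ee k c.
Proof. unfold ee. pose proof (phi_mono (S k) c). lra. Qed.

Lemma ee'_ge0 k c : 0 <= ee' k c.
Proof.
  unfold ee'. pose proof (phi_mono k c). pose proof (phi_mono (S k) c).
  pose proof (phi_mono (S (S k)) c). lra.
Qed.

Lemma ee_abs k c : Rabs (ee k c) <= 1.
Proof.
  rewrite Rabs_right by (apply Rle_ge, ee_ge0). unfold ee.
  pose proof (Hphi (S (S k)) c). pose proof (Hphi (S k) c). lra.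
Qed.

Lemma ee'_abs k c : Rabs (ee' k c) <= 1.
Proof.
  rewrite Rabs_right by (apply Rle_ge, ee'_ge0). unfold ee'.
  pose proof (Hphi (S (S (S k))) c). pose proof (Hphi k c). lra.
Qed.

Lemma ee'_out k c : (c + 2 <= k)%nat -> ee' k c = 0.
Proof. intros H. unfold ee'. rewrite !phi_large by lia. ring. Qed.

Lemma ee_sB c : sB (fun k => ee k c) 1.
Proof. apply (telescope_sB (fun k => phi (S k) c)); intros; auto using phi_mono. Qed.

Lemma ee_total c : lsum (seq 0 (c + 2)) (fun k => ee k c) = 1.
Proof.
  assert (E : forall m, lsum (seq 0 m) (fun k => ee k c) = phi (S m) c - phi 1%nat c).
  { induction m as [|m IH]; [simpl; ring|]. rewrite lsum_seq_S, IH. unfold ee. ring. }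
  rewrite E, Hphi01, phi_large by lia. ring.
Qed.

Lemma ee'_sum c m : lsum (seq 0 m) (fun k => ee' k c) <= 3.
Proof.
  assert (E : lsum (seq 0 m) (fun k => ee' k c) = phi m c + phi (S m) c + phi (S (S m)) c
     - (phi O c + phi 1%nat c + phi 2%nat c)).
  { induction m as [|m IH]; [simpl; ring|]. rewrite lsum_seq_S, IH. unfold ee'. ring. }
  rewrite E. pose proof (Hphi m c). pose proof (Hphi (S m) c). pose proof (Hphi (S (S m)) c).
  pose proof (Hphi 0 c). pose proof (Hphi 1 c). pose proof (Hphi 2 c). lra.
Qed.

Lemma phi_one_up k c : phi k c = 1 -> phi (S k) c = 1.
Proof. intros H. pose proof (phi_mono k c). pose proof (Hphi (S k) c). lra. Qed.

Lemma ee_support k c : ee k c <> 0 -> (N0 k <= c)%nat.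
Proof.
  intros H. apply Nat.nlt_ge. intros Hc. apply H. unfold ee.
  assert (E : phi k c = 1) by (apply Hphi1; specialize (HnN k); lia).
  pose proof (phi_one_up _ _ E) as E1. pose proof (phi_one_up _ _ E1) as E2. lra.
Qed.

Lemma ee'_support k c : ee' k c <> 0 -> (N0 k <= c)%nat.
Proof.
  intros H. apply Nat.nlt_ge. intros Hc. apply H. unfold ee'.
  assert (E : phi k c = 1) by (apply Hphi1; specialize (HnN k); lia).
  pose proof (phi_one_up _ _ E) as E1. pose proof (phi_one_up _ _ E1) as E2.
  pose proof (phi_one_up _ _ E2) as E3. lra.
Qed.

(** [ee k] lives on n(k+1) <= c < n(k+3), where phi(k+3) is 1 and phi(k) is 0. *)
Lemma ee'_ee k c : ee' k c * ee k c = ee k c.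
Proof.
  destruct (Req_dec (ee k c) 0) as [->|Hne]; [ring|].
  assert (H3 : phi (S (S (S k))) c = 1).
  { apply Hphi1. apply Nat.nle_gt. intros H. apply Hne. unfold ee.
    pose proof (Hphi0 _ _ H) as E. pose proof (phi_mono (S k) c). pose proof (Hphi (S k) c). lra. }
  assert (H0 : phi k c = 0).
  { destruct k as [|k]; [apply Hphi00|]. apply Hphi0. apply Nat.nlt_ge. intros H. apply Hne. unfold ee.
    pose proof (Hphi1 _ _ H) as E. pose proof (phi_one_up _ _ E). lra. }
  unfold ee'. rewrite H3, H0. ring.
Qed.

Lemma ee_fin k : exists M, forall c, (M <= c)%nat -> ee k c = 0.
Proof.
  exists (max (n (S (S k))) (n (S (S (S k))))). intros c Hc. unfold ee. rewrite !Hphi0 by lia. ring.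
Qed.

Lemma ee'_fin k : exists M, forall c, (M <= c)%nat -> ee' k c = 0.
Proof.
  exists (max (n (S k)) (n (S (S (S (S k)))))). intros c Hc. unfold ee'. rewrite !Hphi0 by lia. ring.
Qed.

Lemma fin_uniform (v : nat -> nat -> R) k0 : (forall k, exists M, forall c, (M <= c)%nat -> v k c = 0) ->
  exists M, forall k c, (k < k0)%nat -> (M <= c)%nat -> v k c = 0.
Proof.
  intros H. induction k0 as [|k0 [M IH]]; [exists O; lia|]. destruct (H k0) as [M' HM'].
  exists (max M M'). intros k c Hk Hc. destruct (Nat.eq_dec k k0) as [->|]; [apply HM'|apply IH]; lia.
Qed.

Lemma mask_ee_tl k x : tl (N0 k) (mask (ee k) x) = mask (ee k) x.
Proof.
  apply functional_extensionality; intros c. unfold tl, mask.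
  destruct (Nat.ltb_spec c (N0 k)) as [H|H]; [|rewrite RtoC_1; ring].
  destruct (Req_dec (ee k c) 0) as [->|Hne]; [rewrite RtoC_0; ring|].
  apply ee_support in Hne. lia.
Qed.

Lemma comm_minus w1 w2 As C x : opb p As C -> (forall c, Rabs (w1 c) <= 1) -> (forall c, Rabs (w2 c) <= 1) ->
  inlp p x -> comm (fun c => w1 c - w2 c) As x = xsub (comm w1 As x) (comm w2 As x).
Proof.
  intros HAs H1 H2 Hx. unfold comm.
  assert (E : forall y, mask (fun c => w1 c - w2 c) y = xsub (mask w1 y) (mask w2 y)).
  { intros y. apply functional_extensionality; intros c. unfold mask, xsub, xadd, xscale, Rminus.
    rewrite RtoC_add, RtoC_opp. cring. }
  rewrite !E, (lin_sub _ (opb_lin _ _ HAs)) by (apply inlp_mask; assumption). xext.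
Qed.

Lemma phi_abs k c : Rabs (phi k c) <= 1.
Proof. pose proof (Hphi k c). rewrite Rabs_right; lra. Qed.

Lemma comm_diff_small k j j' s : (s <= k)%nat -> (k <= j)%nat -> (k <= j')%nat ->
  opb p (comm (fun c => phi j c - phi j' c) (A s)) ((/ 4) ^ k / (1 + beta k)).
Proof.
  intros Hs Hj Hj'. destruct (HA s) as [C HC]. pose proof (Hbeta0 k).
  replace ((/ 4) ^ k / (1 + beta k)) with
    ((/ 4) ^ k / (2 * (1 + beta k)) + (/ 4) ^ k / (2 * (1 + beta k))) by (field; lra).
  eapply opb_ext; [|apply (opb_sub _ _ _ _ (Hcomm k j s Hs Hj) (Hcomm k j' s Hs Hj'))].
  intros x Hx. symmetry. eapply comm_minus; eauto using phi_abs.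
Qed.

Lemma comm_cpt w As C M : opb p As C -> (forall c, Rabs (w c) <= 1) ->
  (forall c, (M <= c)%nat -> w c = 0) -> cptR p (comm w As).
Proof.
  intros HAs Hw HM. apply cptR_sub; [eapply cptR_maskL|eapply cptR_maskR]; eauto.
Qed.

(** Late stages are small outright because 4^-k falls below eps 2^-(k+1); the finitely many early
    commutators are compact, so far tails make them small. Dividing by [1 + beta k] prepares for
    multiplication by the crude stage bound. *)
Lemma comm_tails (v : nat -> nat -> R) s :
  (forall k, (s <= k)%nat -> opb p (comm (v k) (A s)) ((/ 4) ^ k / (1 + beta k))) ->
  (forall k c, Rabs (v k c) <= 1) -> (forall k, exists M, forall c, (M <= c)%nat -> v k c = 0) ->
  forall eps, 0 < eps -> exists m0, forall m, (m0 <= m)%nat -> forall k,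
    opb p (fun x => comm (v k) (A s) (tl m x)) (eps * / 2 ^ S k / (1 + beta k)) /\
    opb p (fun x => tl m (comm (v k) (A s) x)) (eps * / 2 ^ S k / (1 + beta k)).
Proof.
  intros Hsm Hv Hfin eps He.
  destruct (quarter_small eps He) as [k1 Hk1]. set (k0 := max s k1).
  assert (Hpos : forall k, 0 < eps * / 2 ^ S k / (1 + beta k)).
  { intros k. pose proof (Hbeta0 k). apply Rdiv_lt_0_compat; [|lra].
    apply Rmult_lt_0_compat; [assumption|]. apply Rinv_0_lt_compat, pow_lt; lra. }
  assert (Hlow : forall k1, exists m0, forall m, (m0 <= m)%nat -> forall k, (k < k1)%nat ->
    opb p (fun x => comm (v k) (A s) (tl m x)) (eps * / 2 ^ S k / (1 + beta k)) /\
    opb p (fun x => tl m (comm (v k) (A s) x)) (eps * / 2 ^ S k / (1 + beta k))).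
  { clear k1 k0 Hk1. induction k1 as [|k1 [m0 IH]]; [exists O; lia|].
    destruct (Hfin k1) as [M HM]. destruct (HA s) as [C HC].
    pose proof (comm_cpt (v k1) (A s) C M HC (Hv k1) HM) as Hcpt.
    destruct (cptR_tail _ _ Hcpt (Hpos k1)) as [m1 H1].
    destruct (cptL_tail _ _ (cptR_cptL _ Hcpt) (Hpos k1)) as [m2 H2].
    exists (max m0 (max m1 m2)). intros m Hm k Hk.
    destruct (Nat.eq_dec k k1) as [->|]; [split; [apply H1|apply H2]; lia|apply IH; lia]. }
  destruct (Hlow k0) as [m0 Hm0]. exists m0. intros m Hm k.
  destruct (Nat.lt_ge_cases k k0) as [Hk|Hk]; [now apply Hm0|].
  assert (Hle : (/ 4) ^ k / (1 + beta k) <= eps * / 2 ^ S k / (1 + beta k)).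
  { pose proof (Hbeta0 k). apply Rmult_le_compat_r; [left; apply Rinv_0_lt_compat; lra|].
    apply Hk1. unfold k0 in Hk. lia. }
  assert (Hsk : (s <= k)%nat) by (unfold k0 in Hk; lia).
  split; (eapply opb_mono; [|exact Hle]).
  - rewrite <- (Rmult_1_r (_ / _)). apply (opb_comp (comm (v k) (A s)) (tl m)); [auto|apply opb_tl].
  - rewrite <- (Rmult_1_l (_ / _)). apply (opb_comp (tl m) (comm (v k) (A s))); [apply opb_tl|auto].
Qed.

(** Stage [k] receives only the slice [mask (ee k) x], which lies beyond [N0 k], where the bound [B]
    is valid. *)
Definition VV (x : nat -> Cx) : I3 -> Cx := Vsum T (fun k => mask (ee k) x).
Definition WW (y : I3 -> Cx) : nat -> Cx := Wsum ee' T y.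

Lemma lin_T k i : lin p (T k i).
Proof. destruct (HT k i) as [C HC]. apply (opb_lin _ _ HC). Qed.

Lemma inlp_T k i x : inlp p x -> inlp p (T k i x).
Proof. destruct (HT k i) as [C HC]. apply (opb_inlp _ _ _ HC). Qed.

Lemma inlp_A s x : inlp p x -> inlp p (A s x).
Proof. destruct (HA s) as [C HC]. apply (opb_inlp _ _ _ HC). Qed.

Lemma lin_A s : lin p (A s).
Proof. destruct (HA s) as [C HC]. apply (opb_lin _ _ HC). Qed.

Lemma inlp_ee k x : inlp p x -> inlp p (mask (ee k) x).
Proof. apply inlp_mask. intros; apply ee_abs. Qed.

Lemma inlp_ee' k x : inlp p x -> inlp p (mask (ee' k) x).
Proof. apply inlp_mask. intros; apply ee'_abs. Qed.

Lemma ee_split x r : lpB p x r ->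
  (forall k, lpB p (mask (ee k) x) (nrmI p (mask (ee k) x))) /\
  sB (fun k => rpow (nrmI p (mask (ee k) x)) p) (rpow r p).
Proof.
  intros Hx. exact (lpB_fibers _ _ (lpB_split (fun k c => ee k c) x r ee_ge0 ee_sB Hx)).
Qed.

Lemma VV_opb : opb p VV B.
Proof.
  split; [assumption|]. split.
  - intros s x y Hx Hy. apply functional_extensionality; intros [[k w] c].
    unfold VV, Vsum, xadd, xscale. destruct (Hbeta k w) as (_ & Hl & _).
    replace (mask (ee k) (fun i => Cadd (Cmul s (x i)) (y i)))
      with (xadd (xscale s (mask (ee k) x)) (mask (ee k) y)) by xext.
    rewrite Hl by (apply inlp_ee; assumption). unfold xadd, xscale. ring.
  - intros x r Hx. destruct (ee_split x r Hx) as [F1 F2].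
    assert (Hr : 0 <= r) by apply (lpB_ge0 _ _ Hx).
    apply (lpB_Vsum T _ (fun k => B * nrmI p (mask (ee k) x))).
    + intros k. apply Rmult_le_pos; [assumption|apply rpow_ge0].
    + intros k w Hw. rewrite <- (mask_ee_tl k x) at 1.
      apply (opb_bd _ _ _ _ (proj1 (HBT k w Hw)) (F1 k)).
    + apply Rmult_le_pos; assumption.
    + intros l Hl. rewrite rpow_mul by assumption.
      rewrite (lsum_ext _ _ (fun k => rpow B p * rpow (nrmI p (mask (ee k) x)) p))
        by (intros; apply rpow_mul; [assumption|apply rpow_ge0]).
      rewrite lsum_scal. apply Rmult_le_compat_l; [apply rpow_ge0|auto].
Qed.

Lemma Fcoef_lin k s y z i : Fcoef k (xadd (xscale s y) z) i = xadd (xscale s (Fcoef k y i)) (Fcoef k z i).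
Proof.
  apply functional_extensionality; intros c. unfold Fcoef, xadd, xscale. apply rcoef_lin.
Qed.

Lemma Wstage_lin X k s y z : (forall i, lin p (X k i)) -> inlp p y -> inlp p z ->
  Wstage X k (xadd (xscale s y) z) = xadd (xscale s (Wstage X k y)) (Wstage X k z).
Proof.
  intros HX Hy Hz. apply functional_extensionality; intros c. unfold Wstage, xsum, xadd at 2, xscale at 1 3 4.
  rewrite (csum_ext _ (fun i => X k i (Fcoef k (xadd (xscale s y) z) i) c)
    (fun i => Cadd (Cmul s (X k i (Fcoef k y i) c)) (X k i (Fcoef k z i) c))).
  - rewrite csum_plus, csum_scal. unfold xscale. ring.
  - intros i _. rewrite Fcoef_lin, HX by (apply inlp_Fcoef; assumption). reflexivity.
Qed.

Lemma WW_opb : opb p WW (3 * B).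
Proof.
  split; [lra|]. split.
  - intros s y z Hy Hz. apply functional_extensionality; intros c. unfold WW, Wsum, xadd at 2, xscale at 2.
    rewrite <- csum_scal, <- csum_plus. apply csum_ext; intros k _. unfold mask.
    rewrite Wstage_lin by (auto using lin_T). unfold xadd, xscale. ring.
  - intros y r Hy. apply (lpB_Wsum ee' T y B O r); auto using ee'_ge0, ee'_sum.
    + intros k c H. split; [now apply ee'_support|lia].
    + intros k w _ Hw z rho Hz. apply (opb_bd _ _ _ _ (proj2 (HBT k w Hw)) Hz).
Qed.

Lemma Fcoef_VV k i x : (i < N k)%nat -> inlp p x ->
  Fcoef k (VV x) i = xscale (RtoC (s_emb (p := p) (N k) * 2 ^ N k)) (T k i (mask (ee k) x)).
Proof.
  intros Hi Hx. apply functional_extensionality; intros c. unfold Fcoef, VV, Vsum.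
  transitivity (rcoef (N k) (fun w => csum (seq 0 (N k)) (fun j => Cmul (RtoC (rad (N k) j w))
     (Cmul (RtoC (s_emb (p := p) (N k))) (T k j (mask (ee k) x) c)))) i).
  - f_equal. apply functional_extensionality; intros w. unfold signed_sum, xsum, xscale.
    rewrite <- csum_scal. apply csum_ext; intros; ring.
  - rewrite (rcoef_rad_sum (N k) (fun j => Cmul (RtoC (s_emb (p := p) (N k))) (T k j (mask (ee k) x) c)))
      by assumption.
    unfold xscale. rewrite RtoC_mul. ring.
Qed.

(** Orthogonality of the Rademacher functions removes the cross terms and the two normalising
    factors cancel, leaving the sum of squares. *)
Lemma Wstage_VV k x : inlp p x -> Wstage T k (VV x) = square_sum k (mask (ee k) x).
Proof.
  intros Hx. apply functional_extensionality; intros c. unfold Wstage, square_sum, xscale, xsum.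
  rewrite <- csum_scal. apply csum_ext; intros i Hi. apply in_seq in Hi.
  rewrite Fcoef_VV by (auto; lia). rewrite (lin_scale _ (lin_T k i)) by auto using inlp_T, inlp_ee.
  unfold xscale. transitivity (Cmul (Cmul (RtoC (s_prj (p := p) (N k)))
     (RtoC (s_emb (p := p) (N k) * 2 ^ N k))) (T k i (T k i (mask (ee k) x)) c)); [ring|].
  rewrite <- RtoC_mul, s_emb_prj, RtoC_1. ring.
Qed.

Definition rem_term (k : nat) (x : nat -> Cx) : nat -> Cx :=
  mask (ee' k) (xsub (square_sum k (mask (ee k) x)) (mask (ee k) x)).

(** As the [ee k] sum to 1 and [ee' k] is 1 on the support of [ee k], the identity is itself the sum
    over [k] of [ee' k] applied to the slices. The remainder is thus localised stage by stage. *)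
Lemma WV_remainder x c : inlp p x ->
  xsub (WW (VV x)) x c = csum (seq 0 (c + 2)) (fun k => rem_term k x c).
Proof.
  intros Hx.
  assert (E : x c = csum (seq 0 (c + 2)) (fun k => Cmul (x c) (RtoC (ee k c)))).
  { rewrite csum_scal, csum_RtoC, ee_total, RtoC_1. ring. }
  unfold xsub, xadd, xscale. rewrite E at 1. unfold WW, Wsum.
  rewrite <- csum_scal, <- csum_plus. apply csum_ext; intros k _.
  rewrite Wstage_VV by assumption. unfold rem_term, mask, xsub, xadd, xscale.
  rewrite <- (ee'_ee k c) at 1. rewrite RtoC_mul. cring.
Qed.

Lemma lpB_remainder x (d : nat -> R) D : inlp p x ->
  (forall k, lpB p (rem_term k x) (d k)) -> (forall m, lsum (seq 0 m) d <= D) ->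
  lpB p (xsub (WW (VV x)) x) D.
Proof.
  intros Hx Hd HD. apply (lpB_local (fun k => rem_term k x)).
  - intros m. eapply lpB_mono; [apply lpB_xsum; intros; apply Hd|apply HD].
  - intros k c Hc. unfold rem_term, mask. rewrite ee'_out by assumption. rewrite RtoC_0. ring.
  - intros c. now apply WV_remainder.
Qed.

Lemma rem_term_bound k x r : lpB p x r -> lpB p (rem_term k x) ((/ 4) ^ S k * r).
Proof.
  intros Hx. apply lpB_mask; [intros; apply ee'_abs|]. rewrite <- (mask_ee_tl k x).
  apply (opb_bd _ _ _ _ (Hsq k)). apply lpB_mask; [intros; apply ee_abs|assumption].
Qed.

Lemma lsum_geom_bound m (d : nat -> R) D : 0 <= D -> (forall k, d k <= D * / 2 ^ S k) -> lsum (seq 0 m) d <= D.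
Proof.
  intros HD Hd. eapply Rle_trans; [apply lsum_le; intros k _; apply Hd|].
  rewrite lsum_scal. pose proof (lsum_half m). nra.
Qed.

(** The remainder of stage [k] is at most 4^-(k+1), and these numbers sum to less than 1/2. *)
Lemma WV_small : opb p (fun x => xsub (WW (VV x)) x) (/ 2).
Proof.
  apply (opb_bound _ (3 * B * B + 1)); [|lra|].
  - apply (opb_sub (fun x => WW (VV x)) (fun x => x)); [|apply opb_id].
    apply opb_comp; [apply WW_opb|apply VV_opb].
  - intros x r Hx. assert (Hr : 0 <= r) by apply (lpB_ge0 _ _ Hx).
    apply (lpB_remainder x (fun k => (/ 4) ^ S k * r)); [now exists r|intros; now apply rem_term_bound|].
    intros m. apply lsum_geom_bound; [lra|]. intros k.
    replace (/ 2 * r * / 2 ^ S k) with (/ 2 * / 2 ^ S k * r) by ring.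
    apply Rmult_le_compat_r; [assumption|].
    replace (/ 4) with (/ 2 * / 2) by lra. rewrite Rpow_mult_distr, <- pow_inv.
    apply Rmult_le_compat_r; [apply pow_le; lra|]. simpl.
    assert ((/ 2) ^ k <= 1 ^ k) by (apply pow_incr; lra). rewrite pow1 in H. lra.
Qed.

Lemma mask_tl_zero v m x : (forall c, (m <= c)%nat -> v c = 0) -> mask v (tl m x) = xzero.
Proof.
  intros H. apply functional_extensionality; intros c. unfold mask, tl, mask, xzero.
  destruct (Nat.ltb_spec c m) as [Hc|Hc]; [|rewrite H by assumption]; rewrite RtoC_0; ring.
Qed.

Lemma opb_sq k : exists C, opb p (square_sum k) C.
Proof.
  unfold square_sum. assert (HC : exists C : nat -> R, forall i, opb p (T k i) (C i)).
  { exists (fun i => proj1_sig (constructive_indefinite_description _ (HT k i))).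
    intros i. apply proj2_sig. }
  destruct HC as [C HC]. eexists. apply opb_xsum. intros i _. apply opb_comp; apply HC.
Qed.

(** Far tails miss the slices of the first [k0] stages, and the remainders of the later ones sum to
    at most [eps]. *)
Lemma WV_cpt : cptR p (fun x => xsub (WW (VV x)) x).
Proof.
  split; [eexists; apply WV_small|]. intros eps He.
  destruct (quarter_small eps He) as [k0 Hk0].
  destruct (fin_uniform ee k0 ee_fin) as [M HM]. exists M. intros x r Hx.
  assert (Hr : 0 <= r) by apply (lpB_ge0 _ _ Hx).
  assert (Hx' : lpB p (tl M x) r).
  { rewrite <- (Rmult_1_l r). apply (opb_bd _ _ _ _ (opb_tl M) Hx). }
  apply (lpB_remainder (tl M x) (fun k => if (k <? k0)%nat then 0 else (/ 4) ^ S k * r)).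
  - now exists r.
  - intros k. destruct (Nat.ltb_spec k k0) as [Hk|Hk]; [|now apply rem_term_bound].
    unfold rem_term. rewrite (mask_tl_zero (ee k)) by (intros; now apply HM).
    destruct (opb_sq k) as [C HC]. rewrite (lin_zero _ (opb_lin _ _ HC)).
    apply (lpB_dom xzero); [apply lpB_zero; lra|]. intros c.
    unfold mask, xsub, xadd, xscale, xzero. right. f_equal. cring.
  - intros m. apply lsum_geom_bound; [apply Rmult_le_pos; lra|]. intros k.
    assert (0 < / 2 ^ S k) by (apply Rinv_0_lt_compat, pow_lt; lra).
    destruct (Nat.ltb_spec k k0) as [Hk|Hk]; [repeat apply Rmult_le_pos; lra|].
    replace (eps * r * / 2 ^ S k) with (eps * / 2 ^ S k * r) by ring.
    apply Rmult_le_compat_r; [assumption|]. eapply Rle_trans; [|apply (Hk0 k Hk)].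
    simpl. assert (0 < (/ 4) ^ k) by (apply pow_lt; lra). lra.
Qed.

Lemma etaI_VV s x k w c : inlp p x -> etaI N (a s) (a0 s) (VV x) (k, w, c) =
  Cmul (RtoC (s_emb (p := p) (N k)))
    (csum (seq 0 (N k)) (fun i => Cmul (RtoC (rad (N k) i w)) (Cmul (a s k i) (T k i (mask (ee k) x) c)))).
Proof.
  intros Hx. unfold etaI, rmult.
  rewrite (csum_ext _ _ (fun i => Cmul (RtoC (s_emb (p := p) (N k))) (Cmul (RtoC (rad (N k) i w))
    (Cmul (Csub (a s k i) (a0 s)) (T k i (mask (ee k) x) c))))).
  - unfold VV, Vsum, signed_sum, xsum, xscale. rewrite csum_scal.
    transitivity (Cmul (RtoC (s_emb (p := p) (N k))) (Cadd
      (Cmul (a0 s) (csum (seq 0 (N k)) (fun i => Cmul (RtoC (rad (N k) i w)) (T k i (mask (ee k) x) c))))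
      (csum (seq 0 (N k)) (fun i => Cmul (RtoC (rad (N k) i w))
        (Cmul (Csub (a s k i) (a0 s)) (T k i (mask (ee k) x) c)))))); [ring|].
    f_equal. rewrite <- csum_scal, <- csum_plus. apply csum_ext; intros; ring.
  - intros i Hi. apply in_seq in Hi. fold (Fcoef k (VV x) i c).
    rewrite Fcoef_VV by (auto; lia). unfold xscale. rewrite RtoC_mul.
    transitivity (Cmul (Cmul (RtoC (2 ^ N k)) (RtoC (/ 2 ^ N k))) (Cmul (RtoC (s_emb (p := p) (N k)))
      (Cmul (RtoC (rad (N k) i w)) (Cmul (Csub (a s k i) (a0 s)) (T k i (mask (ee k) x) c))))); [ring|].
    rewrite pow2_inv. ring.
Qed.

(** The error has two sources: the cutoffs do not commute with [A s], and [T k i] does not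
    intertwine exactly. *)
Lemma VA_defect s x : inlp p x ->
  xsub (VV (A s x)) (etaI N (a s) (a0 s) (VV x)) =
  xadd (Vsum T (fun k => comm (ee k) (A s) x)) (Vsum (defectR s) (fun k => mask (ee k) x)).
Proof.
  intros Hx. apply functional_extensionality; intros [[k w] c].
  unfold xsub, xadd, xscale at 1. rewrite etaI_VV by assumption.
  unfold VV, Vsum, signed_sum, xsum, xscale.
  match goal with |- Cadd (Cmul ?s ?u) (Cmul Cm1 (Cmul ?s ?v)) = Cadd (Cmul ?s ?u') (Cmul ?s ?v') =>
    assert (E : Cadd u (Cmul Cm1 v) = Cadd u' v') end.
  { rewrite <- csum_scal, <- !csum_plus. apply csum_ext; intros i _.
    unfold comm, defectR.
    rewrite (lin_sub _ (lin_T k i)) by auto using inlp_ee, inlp_A.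
    unfold xsub, xadd, xscale. cring. }
  match goal with |- Cadd (Cmul ?s ?u) (Cmul Cm1 (Cmul ?s ?v)) = _ =>
    transitivity (Cmul s (Cadd u (Cmul Cm1 v))); [cring|] end.
  rewrite E. ring.
Qed.

Lemma opb_defectR s k i : exists C, opb p (defectR s k i) C.
Proof.
  destruct (HT k i) as [C HC]. destruct (HA s) as [D HD]. eexists.
  apply opb_sub; [apply opb_comp; eassumption|apply opb_scale; eassumption].
Qed.

Lemma opb_defectL s k i : exists C, opb p (defectL s k i) C.
Proof.
  destruct (HT k i) as [C HC]. destruct (HA s) as [D HD]. eexists.
  apply opb_sub; [apply opb_comp; eassumption|apply opb_scale; eassumption].
Qed.

Lemma etaI_opb_s s : exists C, opb p (etaI N (a s) (a0 s)) C.
Proof. destruct (Ha s) as (kap & H1 & H2 & H3). eexists. apply etaI_opb; eauto. Qed.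

Lemma ee_comm_small s k : (s <= k)%nat -> opb p (comm (ee k) (A s)) ((/ 4) ^ k / (1 + beta k)).
Proof. intros Hs. apply comm_diff_small; lia. Qed.

Lemma ee'_comm_small s k : (s <= k)%nat -> opb p (comm (ee' k) (A s)) ((/ 4) ^ k / (1 + beta k)).
Proof. intros Hs. apply comm_diff_small; lia. Qed.

Lemma half_pow_sB b e r : 0 <= e -> 0 <= r -> (forall k, 0 <= b k) ->
  (forall k, b k <= e * / 2 ^ S k * r) -> sB (fun k => rpow (b k) p) (rpow (e * r) p).
Proof.
  intros He Hr Hb0 Hb l Hl.
  apply Rle_trans with (lsum l (fun k => rpow (e * r) p * / 2 ^ S k)).
  - apply lsum_le; intros k _. assert (0 < 2 ^ S k) by (apply pow_lt; lra).
    assert (Hi : 0 < / 2 ^ S k) by now apply Rinv_0_lt_compat.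
    apply Rle_trans with (rpow (e * r * / 2 ^ S k) p).
    + apply rpow_le; [assumption|]. split; [auto|]. specialize (Hb k).
      replace (e * r * / 2 ^ S k) with (e * / 2 ^ S k * r) by ring. assumption.
    + rewrite rpow_mul by (try lra; apply Rmult_le_pos; assumption).
      apply Rmult_le_compat_l; [apply rpow_ge0|]. apply rpow_le_base.
      * pose proof hp as Hp; unfold Exponent in Hp; lra.
      * split; [lra|]. rewrite <- Rinv_1. apply Rinv_le_contravar; [lra|].
        apply pow_R1_Rle. lra.
  - rewrite lsum_scal. rewrite <- (Rmult_1_r (rpow (e * r) p)) at 2.
    apply Rmult_le_compat_l; [apply rpow_ge0|].
    eapply Rle_trans; [|apply (lsum_half (S (list_max l)))].
    apply lsum_incl; auto using incl_seq_max. intros; left. apply Rinv_0_lt_compat, pow_lt; lra.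
Qed.

(** The [beta k] on the left is the norm bound of an unrestricted signed sum at stage [k]; the
    division by [1 + beta k] was built into the cutoffs to offset it. *)
Lemma ratio_le e k r : 0 <= e -> 0 <= r -> beta k * (e * / 2 ^ S k / (1 + beta k) * r) <= e * / 2 ^ S k * r.
Proof.
  intros He Hr. assert (0 < / 2 ^ S k) by (apply Rinv_0_lt_compat, pow_lt; lra).
  pose proof (Hbeta0 k).
  replace (beta k * (e * / 2 ^ S k / (1 + beta k) * r)) with (e * / 2 ^ S k * r * (beta k / (1 + beta k)))
    by (field; split; [apply pow_nonzero|]; lra).
  rewrite <- Rmult_1_r. apply Rmult_le_compat_l; [repeat apply Rmult_le_pos; lra|].
  apply Rmult_le_reg_r with (1 + beta k); [lra|]. unfold Rdiv. rewrite Rmult_assoc, Rinv_l; lra.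
Qed.

(** On far tails the early slices vanish; later defects are at most [eps / 2] by [Hth], and
    [comm_tails] makes the commutators small with geometric decay in the stage. *)
Lemma VA_cpt s : cptR p (fun x => xsub (VV (A s x)) (etaI N (a s) (a0 s) (VV x))).
Proof.
  destruct (HA s) as [C HC]. destruct (etaI_opb_s s) as [D HD].
  split.
  { eexists. apply opb_sub; apply opb_comp; try apply VV_opb; eassumption. }
  intros eps He.
  destruct (comm_tails ee s (ee_comm_small s)
    (fun k c => ee_abs k c) ee_fin (eps / 2)) as [m0 Hm0]; [lra|].
  destruct (Hth s (eps / 2)) as [k1 Hk1]; [lra|]. set (k0 := max s k1).
  destruct (fin_uniform ee k0 ee_fin) as [M HM].
  exists (max m0 M). set (m := max m0 M). intros x r Hx.
  assert (Hr : 0 <= r) by apply (lpB_ge0 _ _ Hx).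
  assert (Hx' : lpB p (tl m x) r).
  { rewrite <- (Rmult_1_l r). apply (opb_bd _ _ _ _ (opb_tl m) Hx). }
  rewrite VA_defect by now exists r.
  replace (eps * r) with (eps / 2 * r + eps / 2 * r) by field. apply lpB_add.
  - apply (lpB_Vsum T _ (fun k => beta k * (eps / 2 * / 2 ^ S k / (1 + beta k) * r))).
    + intros k. pose proof (Hbeta0 k). assert (0 < / 2 ^ S k) by (apply Rinv_0_lt_compat, pow_lt; lra).
      apply Rmult_le_pos; [assumption|]. apply Rmult_le_pos; [|assumption].
      apply Rmult_le_pos; [apply Rmult_le_pos; lra|]. left; apply Rinv_0_lt_compat; lra.
    + intros k w _. apply (opb_bd _ _ _ _ (Hbeta k w)).
      apply (opb_bd _ _ _ _ (proj1 (Hm0 m ltac:(unfold m; lia) k)) Hx).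
    + apply Rmult_le_pos; lra.
    + apply half_pow_sB; auto; [lra| |].
      * intros k. pose proof (Hbeta0 k). assert (0 < / 2 ^ S k) by (apply Rinv_0_lt_compat, pow_lt; lra).
        apply Rmult_le_pos; [assumption|]. apply Rmult_le_pos; [|assumption].
        apply Rmult_le_pos; [apply Rmult_le_pos; lra|]. left; apply Rinv_0_lt_compat; lra.
      * intros k. apply ratio_le; lra.
  - destruct (ee_split _ _ Hx') as [F1 F2].
    apply (lpB_Vsum (defectR s) _ (fun k => eps / 2 * nrmI p (mask (ee k) (tl m x)))).
    + intros k. apply Rmult_le_pos; [lra|apply rpow_ge0].
    + intros k w Hw. destruct (Nat.lt_ge_cases k k0) as [Hk|Hk].
      * rewrite mask_tl_zero by (intros; apply HM; [assumption|unfold m in *; lia]).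
        destruct (signed_sum_opb (defectR s) k (opb_defectR s)) as (E & _ & HE).
        rewrite (lin_zero _ (opb_lin _ _ (HE w))). apply lpB_zero.
        apply Rmult_le_pos; [lra|apply rpow_ge0].
      * rewrite <- (mask_ee_tl k (tl m x)) at 1.
        eapply lpB_mono; [apply (opb_bd _ _ _ _ (HdR s k w ltac:(unfold k0 in Hk; lia) Hw) (F1 k))|].
        apply Rmult_le_compat_r; [apply rpow_ge0|]. apply Hk1. unfold k0 in Hk. lia.
    + apply Rmult_le_pos; lra.
    + intros l Hl. rewrite rpow_mul by lra.
      rewrite (lsum_ext _ _ (fun k => rpow (eps / 2) p * rpow (nrmI p (mask (ee k) (tl m x))) p))
        by (intros; apply rpow_mul; [lra|apply rpow_ge0]).
      rewrite lsum_scal. apply Rmult_le_compat_l; [apply rpow_ge0|auto].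
Qed.

Lemma Fcoef_etaI s y k i : (i < N k)%nat ->
  Fcoef k (etaI N (a s) (a0 s) y) i = xscale (a s k i) (Fcoef k y i).
Proof.
  intros Hi. apply functional_extensionality; intros c. unfold Fcoef, xscale.
  now apply (rcoef_etaI N (a s) (a0 s) y k c i).
Qed.

Lemma AW_stage s k y : inlp p y ->
  xsub (A s (mask (ee' k) (Wstage T k y))) (mask (ee' k) (Wstage T k (etaI N (a s) (a0 s) y))) =
  xsub (mask (ee' k) (Wstage (defectL s) k y)) (comm (ee' k) (A s) (Wstage T k y)).
Proof.
  intros Hy.
  assert (Hw : inlp p (Wstage T k y)).
  { unfold Wstage. apply inlp_scale, inlp_xsum. intros; apply inlp_T, inlp_Fcoef, Hy. }
  assert (E : xsub (A s (Wstage T k y)) (Wstage T k (etaI N (a s) (a0 s) y)) = Wstage (defectL s) k y).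
  { unfold Wstage. rewrite (lin_scale _ (lin_A s)) by (apply inlp_xsum; intros; apply inlp_T, inlp_Fcoef, Hy).
    rewrite (lin_xsum _ (lin_A s)) by (intros; apply inlp_T, inlp_Fcoef, Hy).
    apply functional_extensionality; intros c. unfold xsub at 1, xadd, xscale, xsum.
    rewrite (csum_ext _ (fun i => T k i (Fcoef k (etaI N (a s) (a0 s) y) i) c)
      (fun i => Cmul (a s k i) (T k i (Fcoef k y i) c))).
    - match goal with |- Cadd (Cmul ?s ?u) (Cmul Cm1 (Cmul ?s ?v)) = Cmul ?s ?u' =>
        assert (E : Cadd u (Cmul Cm1 v) = u');
        [|transitivity (Cmul s (Cadd u (Cmul Cm1 v))); [cring|now rewrite E]] end.
      rewrite <- csum_scal, <- csum_plus. apply csum_ext; intros i _. reflexivity.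
    - intros i Hi. apply in_seq in Hi. rewrite Fcoef_etaI by lia.
      now rewrite (lin_scale _ (lin_T k i)) by (apply inlp_Fcoef, Hy). }
  rewrite <- E. unfold comm. xext.
Qed.

(** An operator cannot be moved inside a sum defined coordinate by coordinate; when [y] has finitely
    many stages, [Wsum] is a genuine finite sum of vectors, through which linearity passes. *)
Lemma Wsum_finite X y m : (forall k i, lin p (X k i)) ->
  (forall k w c, (m <= k)%nat -> y (k, w, c) = C0) ->
  Wsum ee' X y = xsum (seq 0 m) (fun k => mask (ee' k) (Wstage X k y)).
Proof.
  intros HX Hy. apply functional_extensionality; intros c. unfold Wsum, xsum.
  rewrite <- (csum_seq_extend (fun k => mask (ee' k) (Wstage X k y) c) (c + 2) (max (c + 2) m)); [|lia|].
  - apply csum_seq_extend; [lia|]. intros k Hk.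
    assert (E : forall i, Fcoef k y i = xzero).
    { intros i. apply functional_extensionality; intros d. unfold Fcoef, rcoef, xzero.
      rewrite (csum_ext _ _ (fun _ => C0)); [apply csum_zero|]. intros w _. rewrite Hy by assumption. ring. }
    unfold mask, Wstage, xscale, xsum. rewrite (csum_ext _ _ (fun _ => C0)); [rewrite csum_zero; ring|].
    intros i _. now rewrite E, (lin_zero _ (HX k i)).
  - intros k Hk. unfold mask. rewrite ee'_out by assumption. rewrite RtoC_0. ring.
Qed.

(** The index [m0] depends neither on [y] nor on [m]; this uniformity lets [opb_hd_bound] extend the
    estimate from finitely many stages to all vectors. *)
Lemma AW_tail s eps : 0 < eps -> exists m0, forall y m r, lpB p y r ->
  (forall k w c, (m <= k)%nat -> y (k, w, c) = C0) ->
  lpB p (tl m0 (xsub (A s (WW y)) (WW (etaI N (a s) (a0 s) y)))) (eps * r).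
Proof.
  intros He. destruct (HA s) as [C HC]. destruct (etaI_opb_s s) as [D HD].
  destruct (comm_tails ee' s (ee'_comm_small s)
    (fun k c => ee'_abs k c) ee'_fin (eps / 2)) as [m0 Hm0]; [lra|].
  destruct (Hth s (eps / 6)) as [k1 Hk1]; [lra|]. set (k0 := max s k1).
  destruct (fin_uniform ee' k0 ee'_fin) as [M HM].
  exists (max m0 M). set (q := max m0 M). intros y m r Hy Hfin.
  assert (Hr : 0 <= r) by apply (lpB_ge0 _ _ Hy).
  assert (Hyi : inlp p y) by now exists r.
  assert (Hwi : forall k z, inlp p z -> inlp p (Wstage T k z)).
  { intros k z Hz. unfold Wstage. apply inlp_scale, inlp_xsum. intros; apply inlp_T, inlp_Fcoef, Hz. }
  assert (Hfin' : forall k w c, (m <= k)%nat -> etaI N (a s) (a0 s) y (k, w, c) = C0).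
  { intros k w c Hk. unfold etaI, rmult. rewrite Hfin by assumption.
    rewrite (csum_ext _ _ (fun _ => C0)); [rewrite csum_zero; ring|]. intros i _.
    replace (rcoef (N k) (fun w' => y (k, w', c)) i) with C0; [ring|].
    unfold rcoef. rewrite (csum_ext _ _ (fun _ => C0)); [now rewrite csum_zero|].
    intros w' _. rewrite Hfin by assumption. ring. }
  assert (HLl : forall k i, lin p (defectL s k i)).
  { intros k i. destruct (opb_defectL s k i) as [E HE]. apply (opb_lin _ _ HE). }
  assert (E : xsub (A s (WW y)) (WW (etaI N (a s) (a0 s) y)) =
    xsub (Wsum ee' (defectL s) y) (xsum (seq 0 m) (fun k => comm (ee' k) (A s) (Wstage T k y)))).
  { unfold WW. rewrite (Wsum_finite T y m lin_T Hfin), (Wsum_finite T _ m lin_T Hfin'),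
      (Wsum_finite (defectL s) y m HLl Hfin).
    rewrite (lin_xsum _ (lin_A s)) by auto using inlp_ee'.
    apply functional_extensionality; intros c. unfold xsub, xadd, xscale, xsum.
    rewrite <- !csum_scal, <- !csum_plus. apply csum_ext; intros k _.
    exact (f_equal (fun f => f c) (AW_stage s k y Hyi)). }
  rewrite E.
  (* Cutting at [q] removes the weights of all stages before [k0], so only stages with defect at
     most [eps / 6] remain; the overlap factor 3 turns this into [eps / 2]. *)
  replace (tl q (xsub (Wsum ee' (defectL s) y) (xsum (seq 0 m) (fun k => comm (ee' k) (A s) (Wstage T k y)))))
    with (xsub (Wsum (fun k c => (if (c <? q)%nat then 0 else 1) * ee' k c) (defectL s) y)
            (xsum (seq 0 m) (fun k => tl q (comm (ee' k) (A s) (Wstage T k y))))).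
  2:{ replace (Wsum (fun k c => (if (c <? q)%nat then 0 else 1) * ee' k c) (defectL s) y)
        with (tl q (Wsum ee' (defectL s) y)).
      - replace (xsum (seq 0 m) (fun k => tl q (comm (ee' k) (A s) (Wstage T k y))))
          with (tl q (xsum (seq 0 m) (fun k => comm (ee' k) (A s) (Wstage T k y)))); [xext|].
        apply functional_extensionality; intros c. unfold tl, mask at 1, xsum.
        rewrite <- csum_scal. reflexivity.
      - apply functional_extensionality; intros c. unfold tl, mask at 1, Wsum.
        rewrite <- csum_scal. apply csum_ext; intros k _. unfold mask. rewrite RtoC_mul. ring. }
  replace (eps * r) with (3 * (eps / 6) * r + eps / 2 * r) by field.
  apply lpB_sub.
  - apply (lpB_Wsum _ (defectL s) y (eps / 6) k0 r); auto using opb_defectL.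
    + lra.
    + intros k c. pose proof (ee'_ge0 k c). destruct (c <? q)%nat; lra.
    + intros c j. eapply Rle_trans; [|apply (ee'_sum c j)]. apply lsum_le; intros k _.
      pose proof (ee'_ge0 k c). destruct (c <? q)%nat; lra.
    + intros k c Hne. destruct (Nat.ltb_spec c q) as [Hc|Hc]; [exfalso; apply Hne; ring|].
      assert (Hne' : ee' k c <> 0) by (intros E0; apply Hne; rewrite E0; ring).
      split; [now apply ee'_support|]. apply Nat.nlt_ge; intros Hk. apply Hne'. apply HM; [assumption|].
      unfold q in Hc. lia.
    + intros k w Hk Hw z rho Hz.
      eapply lpB_mono; [apply (opb_bd _ _ _ _ (HdL s k w ltac:(unfold k0 in Hk; lia) Hw) Hz)|].
      apply Rmult_le_compat_r; [apply (lpB_ge0 _ _ Hz)|]. apply Hk1. unfold k0 in Hk. lia.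
  - apply lpB_mono with (lsum (seq 0 m) (fun k => eps / 2 * / 2 ^ S k / (1 + beta k) * (beta k * r))).
    + apply lpB_xsum. intros k _. apply (opb_bd _ _ _ _ (proj2 (Hm0 q ltac:(unfold q; lia) k))).
      apply (lpB_Wstage (beta k)); auto.
    + apply lsum_geom_bound; [apply Rmult_le_pos; lra|]. intros k.
      pose proof (ratio_le (eps / 2) k r ltac:(lra) Hr). lra.
Qed.

End WithCutoffs.

Theorem dilation : exists V W : Op,
  opb p V B /\ opb p W (3 * B) /\
  opb p (fun x => xsub (W (V x)) x) (/ 2) /\ cptR p (fun x => xsub (W (V x)) x) /\
  forall s, cptR p (fun x => xsub (V (A s x)) (etaop N (a s) (a0 s) (V x))) /\
    cptR p (fun x => xsub (A s (W x)) (W (etaop N (a s) (a0 s) x))).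
Proof.
  destruct stage_bounds as (beta & Hb0 & Hb).
  (* The commutators at stage [k] are estimated through cutoffs [phi j] with [j] at least [k];
     cumulative sums make the commutator of [phi j] small against every earlier [beta k]
     simultaneously. *)
  pose (bs := fun k => lsum (seq 0 (S k)) beta).
  assert (Hbs : forall k j, (k <= j)%nat -> beta k <= bs j).
  { intros k j Hkj. apply (lsum_In (seq 0 (S j)) beta); [auto|apply in_seq; lia]. }
  pose (eps := fun k => (/ 4) ^ k / (2 * (1 + bs k))).
  assert (Hbs0 : forall k, 0 <= bs k) by (intros; apply lsum_ge0; auto).
  assert (He : forall k, 0 < eps k).
  { intros k. specialize (Hbs0 k). apply Rdiv_lt_0_compat; [apply pow_lt|]; lra. }
  destruct (cutoff_sequence A eps N0 HA He HN0 HN1)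
    as (phi & n & H1 & H2 & H3 & H4 & H5 & H6 & H7 & H8).
  assert (Hc : forall k j s, (s <= k)%nat -> (k <= j)%nat ->
    opb p (comm (phi j) (A s)) ((/ 4) ^ k / (2 * (1 + beta k)))).
  { intros k j s Hs Hj. eapply opb_mono; [apply H8; lia|]. unfold eps.
    pose proof (Hbs k j Hj). specialize (Hb0 k).
    apply Rmult_le_compat.
    - apply pow_le; lra.
    - left; apply Rinv_0_lt_compat. specialize (Hbs0 j). lra.
    - rewrite !pow_inv. apply Rinv_le_contravar; [apply pow_lt; lra|]. apply Rle_pow; [lra|assumption].
    - apply Rinv_le_contravar; lra. }
  pose proof (VV_opb phi n beta Hb H1 H2 H3 H4) as OV.
  pose proof (WW_opb phi n H1 H2 H3 H4) as OW.
  exists (fun x => pull (VV phi x)), (fun x => WW phi (push x)).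
  assert (EWV : forall x, WW phi (push (pull (VV phi x))) = WW phi (VV phi x))
    by (intros; now rewrite push_pull).
  split; [|split; [|split; [|split]]].
  - rewrite <- (Rmult_1_l B). apply (opb_comp pull (VV phi)); [apply opb_pull3|assumption].
  - rewrite <- (Rmult_1_r (3 * B)). apply (opb_comp (WW phi) push); [assumption|apply opb_push].
  - eapply opb_ext; [|eapply WV_small; eauto]. intros x _. simpl. now rewrite push_pull.
  - eapply cptR_ext; [|eapply WV_cpt; eauto]. intros x _. simpl. now rewrite push_pull.
  - intros s. split.
    + pose proof (VA_cpt phi n beta Hb0 Hb H1 H2 H3 H4 Hc s) as HV.
      eapply cptR_ext; [|exact (cptR_compl pull _ 1 opb_pull3 HV)].
      intros x _. unfold etaop. rewrite push_pull. reflexivity.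
    + destruct (HA s) as [C HC]. destruct (Ha s) as (kap & K1 & K2 & K3).
      pose proof (etaop_opb (p := p) N (a s) (a0 s) kap K1 K2 K3) as OE.
      assert (OD : opb p (fun x => xsub (A s (WW phi (push x))) (WW phi (push (etaop N (a s) (a0 s) x))))
        (C * (3 * B * 1) + 3 * B * 1 * ((1 + 2 * radK p) * kap))).
      { apply opb_sub.
        - apply (opb_comp (A s) (fun x => WW phi (push x))); [assumption|].
          apply (opb_comp (WW phi) push); [assumption|apply opb_push].
        - apply (opb_comp (fun x => WW phi (push x)) (etaop N (a s) (a0 s))); [|assumption].
          apply (opb_comp (WW phi) push); [assumption|apply opb_push]. }
      apply cptL_cptR. split; [eexists; exact OD|]. intros e Hepos.
      destruct (AW_tail phi n beta Hb0 Hb H1 H2 H3 H4 H5 Hc s e Hepos) as [m0 Hm0].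
      exists m0. intros x r Hx.
      (* Truncating to codes below [m] leaves finitely many stages, by [enc_ge_k], and there
         [AW_tail] applies. *)
      apply (opb_hd_bound _ _ x r _ (opb_comp (tl m0) _ _ _ (opb_tl m0) OD) Hx).
      intros m. unfold etaop. rewrite push_pull.
      apply (Hm0 (push (hd m x)) m r).
      * rewrite <- (Rmult_1_l r). apply (opb_bd _ _ _ _ opb_push).
        rewrite <- (Rmult_1_l r). apply (opb_bd _ _ _ _ (opb_hd m) Hx).
      * intros k w c Hk. unfold push, hd, mask. pose proof (enc_ge_k k w c).
        destruct (Nat.ltb_spec (enc (k, w, c)) m); [lia|]. rewrite RtoC_0. ring.
Qed.

End Stages.

(** * Continuous functions on a compact set *)

Lemma fsum_lsum n f : fsum n f = lsum (seq 0 n) f.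
Proof. induction n as [|n IH]; [reflexivity|]. rewrite lsum_seq_S, <- IH. reflexivity. Qed.

Lemma dist_ge0 d x y : 0 <= dist d x y.
Proof. apply sqrt_pos. Qed.

Lemma dist_sym d x y : dist d x y = dist d y x.
Proof.
  unfold dist. f_equal. rewrite !fsum_lsum. apply lsum_ext; intros; ring.
Qed.

Lemma coord_le_dist d x y i : (i < d)%nat -> Rabs (x i - y i) <= dist d x y.
Proof.
  intros Hi. unfold dist. rewrite <- sqrt_Rsqr_abs, fsum_lsum. unfold Rsqr.
  assert (H : (x i - y i) * (x i - y i) <= lsum (seq 0 d) (fun i => (x i - y i) ^ 2)).
  { replace ((x i - y i) * (x i - y i)) with ((x i - y i) ^ 2) by ring.
    apply (lsum_In (seq 0 d) (fun i => (x i - y i) ^ 2)); [intros; apply pow2_ge_0|apply in_seq; lia]. }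
  apply sqrt_le_1_alt, H.
Qed.

Lemma dist_le_coord d x y e : 0 <= e -> (forall i, (i < d)%nat -> Rabs (x i - y i) <= e) ->
  dist d x y <= INR d * e.
Proof.
  intros He H. pose proof (pos_INR d). unfold dist. rewrite fsum_lsum.
  rewrite <- (sqrt_Rsqr (INR d * e)) by nra. unfold Rsqr. apply sqrt_le_1.
  - apply lsum_ge0; intros; apply pow2_ge_0.
  - nra.
  - apply Rle_trans with (lsum (seq 0 d) (fun _ => e * e)).
    + apply lsum_le; intros i Hi. apply in_seq in Hi. specialize (H i ltac:(lia)).
      rewrite <- pow2_abs. pose proof (Rabs_pos (x i - y i)). nra.
    + rewrite lsum_const, length_seq. destruct d as [|d]; [simpl; lra|].
      rewrite S_INR in *. pose proof (pos_INR d). nra.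
Qed.

(** Comparing coordinates gives the triangle inequality up to the factor [INR d], which only affects
    radii. *)
Lemma dist_triangle_weak d x y z : dist d x z <= INR d * (dist d x y + dist d y z).
Proof.
  apply dist_le_coord.
  - pose proof (dist_ge0 d x y). pose proof (dist_ge0 d y z). lra.
  - intros i Hi. replace (x i - z i) with ((x i - y i) + (y i - z i)) by ring.
    eapply Rle_trans; [apply Rabs_triang|]. apply Rplus_le_compat; now apply coord_le_dist.
Qed.

Lemma Csub_m1 a b : Cadd a (Cmul Cm1 b) = Csub a b.
Proof. cring. Qed.

Section Functions.
Variables (d : nat) (M : Pt -> Prop).
Hypothesis Hcpt : seq_compact d M.

Implicit Types (g h : Fn M).

Lemma cont_alt h : cont d M h <-> forall m eps, eps > 0 -> exists del, del > 0 /\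
    forall m', dist d (proj1_sig m) (proj1_sig m') < del -> Cnorm (Csub (h m) (h m')) < eps.
Proof.
  split; intros H m eps He; destruct (H m eps He) as (del & H1 & H2); exists del; split; auto;
    intros m' Hm'; specialize (H2 m' Hm'); now rewrite Csub_m1 in *.
Qed.

Lemma subsequence (u : nat -> {x : Pt | M x}) : exists (phi : nat -> nat) (m : {x : Pt | M x}),
  (forall k, (k <= phi k)%nat) /\ Un_cv (fun k => dist d (proj1_sig (u (phi k))) (proj1_sig m)) 0.
Proof.
  destruct (Hcpt (fun k => proj1_sig (u k)) (fun k => proj2_sig (u k))) as (phi & x & H1 & H2 & H3).
  exists phi, (exist _ x H2). split; [now apply phi_ge|exact H3].
Qed.

Lemma cv_dist (u : nat -> {x : Pt | M x}) (m : {x : Pt | M x}) eps : Un_cv (fun k => dist d (proj1_sig (u k)) (proj1_sig m)) 0 ->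
  0 < eps -> exists k0, forall k, (k0 <= k)%nat -> dist d (proj1_sig (u k)) (proj1_sig m) < eps.
Proof.
  intros H He. destruct (H eps He) as [k0 Hk0]. exists k0. intros k Hk. specialize (Hk0 k Hk).
  unfold Rdist in Hk0. rewrite Rminus_0_r, Rabs_right in Hk0; [assumption|]. apply Rle_ge, dist_ge0.
Qed.

Lemma cont_bounded h : cont d M h -> exists C, 0 < C /\ forall m, Cnorm (h m) <= C.
Proof.
  intros Hh. apply NNPP; intros Hn.
  assert (Hu : forall k : nat, exists m, INR k + 1 < Cnorm (h m)).
  { intros k. apply NNPP; intros H. apply Hn. exists (INR k + 1). pose proof (pos_INR k).
    split; [lra|]. intros m. apply Rnot_lt_le; intros Hlt. apply H. now exists m. }
  pose (u := fun k => proj1_sig (constructive_indefinite_description _ (Hu k))).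
  assert (Hu' : forall k, INR k + 1 < Cnorm (h (u k))).
  { intros k. exact (proj2_sig (constructive_indefinite_description _ (Hu k))). }
  destruct (subsequence u) as (phi & m & Hphi & Hcv).
  destruct (proj1 (cont_alt h) Hh m 1 ltac:(lra)) as (del & Hdel & Hc).
  destruct (cv_dist (fun k => u (phi k)) m del Hcv Hdel) as [k0 Hk0].
  destruct (INR_unbounded (Cnorm (h m))) as [k1 Hk1].
  set (k := max k0 k1). specialize (Hk0 k ltac:(unfold k; lia)).
  rewrite dist_sym in Hk0. specialize (Hc _ Hk0). specialize (Hu' (phi k)).
  assert (INR k1 <= INR (phi k)) by (apply le_INR; specialize (Hphi k); unfold k in *; lia).
  assert (Cnorm (h (u (phi k))) <= Cnorm (h m) + Cnorm (Csub (h m) (h (u (phi k))))).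
  { rewrite <- (Cnorm_opp (Csub _ _)). eapply Rle_trans; [|apply Cnorm_add]. right. f_equal. ring. }
  lra.
Qed.

(** Otherwise there would be pairs at distance at most [/ (INR k + 1)] whose values differ by more
    than [eps]; a limit point of their first members contradicts continuity there. *)
Lemma cont_uniform h : (1 <= d)%nat -> cont d M h -> forall eps, 0 < eps -> exists del, 0 < del /\
  forall m m', dist d (proj1_sig m) (proj1_sig m') <= del -> Cnorm (Csub (h m) (h m')) <= eps.
Proof.
  intros Hd Hh eps He. apply NNPP; intros Hn.
  assert (Hu : forall k : nat, exists mm : {x : Pt | M x} * {x : Pt | M x},
    dist d (proj1_sig (fst mm)) (proj1_sig (snd mm)) <= / (INR k + 1) /\
    eps < Cnorm (Csub (h (fst mm)) (h (snd mm)))).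
  { intros k. apply NNPP; intros H. apply Hn. pose proof (pos_INR k).
    exists (/ (INR k + 1)). split; [apply Rinv_0_lt_compat; lra|].
    intros m m' Hm. apply Rnot_lt_le; intros Hlt. apply H. now exists (m, m'). }
  pose (u := fun k => proj1_sig (constructive_indefinite_description _ (Hu k))).
  assert (Hu' : forall k, dist d (proj1_sig (fst (u k))) (proj1_sig (snd (u k))) <= / (INR k + 1) /\
    eps < Cnorm (Csub (h (fst (u k))) (h (snd (u k))))).
  { intros k. exact (proj2_sig (constructive_indefinite_description _ (Hu k))). }
  clearbody u. clear Hu.
  destruct (subsequence (fun k => fst (u k))) as (phi & m & Hphi & Hcv).
  destruct (proj1 (cont_alt h) Hh m (eps / 2) ltac:(lra)) as (del & Hdel & Hc).
  assert (HD : 1 <= INR d) by (apply (le_INR 1); assumption).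
  (* The weak triangle inequality costs [INR d], hence this radius for both legs. *)
  assert (Hq : 0 < del / (2 * INR d)) by (apply Rdiv_lt_0_compat; lra).
  destruct (cv_dist (fun k => fst (u (phi k))) m _ Hcv Hq) as [k0 Hk0].
  destruct (INR_unbounded (/ (del / (2 * INR d)))) as [k1 Hk1].
  set (k := max k0 k1). specialize (Hk0 k ltac:(unfold k; lia)).
  destruct (Hu' (phi k)) as [H1 H2].
  assert (Hpk : INR k1 <= INR (phi k)) by (apply le_INR; specialize (Hphi k); unfold k in *; lia).
  assert (H3 : / (INR (phi k) + 1) < del / (2 * INR d)).
  { rewrite <- (Rinv_inv (del / (2 * INR d))).
    pose proof (Rinv_0_lt_compat _ Hq). apply Rinv_lt_contravar; nra. }
  assert (Hs : del / (2 * INR d) <= del).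
  { apply Rmult_le_reg_r with (2 * INR d); [lra|]. unfold Rdiv.
    rewrite Rmult_assoc, Rinv_l by lra. nra. }
  assert (H4 : Cnorm (Csub (h m) (h (fst (u (phi k))))) < eps / 2).
  { apply Hc. rewrite dist_sym. lra. }
  assert (H5 : Cnorm (Csub (h m) (h (snd (u (phi k))))) < eps / 2).
  { apply Hc. eapply Rle_lt_trans; [apply (dist_triangle_weak d _ (proj1_sig (fst (u (phi k)))))|].
    rewrite (dist_sym d (proj1_sig m)).
    apply Rlt_le_trans with (INR d * (del / (2 * INR d) + del / (2 * INR d))).
    - apply Rmult_lt_compat_l; lra.
    - right; field; lra. }
  assert (Cnorm (Csub (h (fst (u (phi k)))) (h (snd (u (phi k))))) <=
    Cnorm (Csub (h m) (h (snd (u (phi k))))) + Cnorm (Csub (h m) (h (fst (u (phi k)))))).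
  { eapply Rle_trans; [|apply Cnorm_sub]. right; f_equal; ring. }
  lra.
Qed.

Lemma cont_lin a g h : cont d M g -> cont d M h -> cont d M (fadd M (fscale M a g) h).
Proof.
  intros Hg Hh. apply cont_alt. intros m eps He. pose proof (Cnorm_ge0 a).
  destruct (proj1 (cont_alt g) Hg m (eps / (2 * (Cnorm a + 1)))) as (d1 & H1 & H2);
    [apply Rdiv_lt_0_compat; lra|].
  destruct (proj1 (cont_alt h) Hh m (eps / 2)) as (d2 & H3 & H4); [lra|].
  exists (Rmin d1 d2). split; [apply Rmin_glb_lt; assumption|]. intros m' Hm'.
  assert (Hm1 : dist d (proj1_sig m) (proj1_sig m') < d1) by (eapply Rlt_le_trans; [exact Hm'|apply Rmin_l]).
  assert (Hm2 : dist d (proj1_sig m) (proj1_sig m') < d2) by (eapply Rlt_le_trans; [exact Hm'|apply Rmin_r]).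
  specialize (H2 m' Hm1). specialize (H4 m' Hm2). unfold fadd, fscale.
  replace (Csub (Cadd (Cmul a (g m)) (h m)) (Cadd (Cmul a (g m')) (h m')))
    with (Cadd (Cmul a (Csub (g m) (g m'))) (Csub (h m) (h m'))) by ring.
  eapply Rle_lt_trans; [apply Cnorm_add|]. rewrite Cnorm_mul.
  assert (Cnorm a * Cnorm (Csub (g m) (g m')) <= eps / 2); [|lra].
  apply Rle_trans with (Cnorm a * (eps / (2 * (Cnorm a + 1)))).
  - apply Rmult_le_compat_l; lra.
  - apply Rmult_le_reg_r with (2 * (Cnorm a + 1)); [lra|]. field_simplify; [|lra]. nra.
Qed.

Lemma cont_const a : cont d M (fun _ => a).
Proof.
  apply cont_alt. intros m eps He. exists 1. split; [lra|]. intros m' _.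
  replace (Csub a a) with C0 by ring. rewrite Cnorm_C0. lra.
Qed.

Lemma cont_mul g h : cont d M g -> cont d M h -> cont d M (fmul M g h).
Proof.
  intros Hg Hh. destruct (cont_bounded g Hg) as (C & HC & HgC). destruct (cont_bounded h Hh) as (D & HD & HhD).
  apply cont_alt. intros m eps He.
  destruct (proj1 (cont_alt g) Hg m (eps / (2 * D))) as (d1 & H1 & H2); [apply Rdiv_lt_0_compat; lra|].
  destruct (proj1 (cont_alt h) Hh m (eps / (2 * C))) as (d2 & H3 & H4); [apply Rdiv_lt_0_compat; lra|].
  exists (Rmin d1 d2). split; [apply Rmin_glb_lt; assumption|]. intros m' Hm'.
  assert (Hm1 : dist d (proj1_sig m) (proj1_sig m') < d1) by (eapply Rlt_le_trans; [exact Hm'|apply Rmin_l]).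
  assert (Hm2 : dist d (proj1_sig m) (proj1_sig m') < d2) by (eapply Rlt_le_trans; [exact Hm'|apply Rmin_r]).
  specialize (H2 m' Hm1). specialize (H4 m' Hm2). unfold fmul.
  replace (Csub (Cmul (g m) (h m)) (Cmul (g m') (h m')))
    with (Cadd (Cmul (g m) (Csub (h m) (h m'))) (Cmul (h m') (Csub (g m) (g m')))) by ring.
  eapply Rle_lt_trans; [apply Cnorm_add|]. rewrite !Cnorm_mul.
  assert (Cnorm (g m) * Cnorm (Csub (h m) (h m')) <= C * Cnorm (Csub (h m) (h m')))
    by (apply Rmult_le_compat_r; [apply Cnorm_ge0|apply HgC]).
  assert (Cnorm (h m') * Cnorm (Csub (g m) (g m')) <= D * Cnorm (Csub (g m) (g m')))
    by (apply Rmult_le_compat_r; [apply Cnorm_ge0|apply HhD]).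
  assert (C * Cnorm (Csub (h m) (h m')) < C * (eps / (2 * C))) by (apply Rmult_lt_compat_l; lra).
  assert (D * Cnorm (Csub (g m) (g m')) < D * (eps / (2 * D))) by (apply Rmult_lt_compat_l; lra).
  replace (C * (eps / (2 * C))) with (eps / 2) in * by (field; lra).
  replace (D * (eps / (2 * D))) with (eps / 2) in * by (field; lra). lra.
Qed.

Lemma supnorm_ub h m : cont d M h -> Cnorm (h m) <= supnorm M h.
Proof.
  intros Hh. destruct (cont_bounded h Hh) as (C & _ & HC).
  apply (supR_ub _ C); [|now exists m]. intros y [m' ->]. apply HC.
Qed.

Lemma supnorm_le h C : 0 <= C -> (forall m, Cnorm (h m) <= C) -> supnorm M h <= C.
Proof. intros H0 H. apply supR_le; [assumption|]. intros y [m ->]. apply H. Qed.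

Lemma supnorm_ge0 h : (exists x, M x) -> cont d M h -> 0 <= supnorm M h.
Proof.
  intros [x Hx] Hh. eapply Rle_trans; [apply Cnorm_ge0|apply (supnorm_ub h (exist _ x Hx) Hh)].
Qed.

(* The partition consists of products of square roots of tent functions on a grid. *)
Definition tent (t : R) : R := Rmax 0 (1 - Rabs t).

Lemma tent_bounds t : 0 <= tent t <= 1.
Proof.
  unfold tent. split; [apply Rmax_l|]. apply Rmax_lub; [lra|]. pose proof (Rabs_pos t). lra.
Qed.

Lemma tent_zero t : 1 <= Rabs t -> tent t = 0.
Proof. intros H. unfold tent. rewrite Rmax_left; lra. Qed.

Lemma tent_lip s t : Rabs (tent s - tent t) <= Rabs (s - t).
Proof.
  unfold tent, Rmax. repeat destruct Rle_dec; unfold Rabs in *; repeat destruct Rcase_abs; lra.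
Qed.

Definition st (t : R) : R := sqrt (tent t).

Lemma st_bounds t : 0 <= st t <= 1.
Proof.
  unfold st. pose proof (tent_bounds t). split; [apply sqrt_pos|]. rewrite <- sqrt_1.
  apply sqrt_le_1; lra.
Qed.

Lemma st_sq t : st t * st t = tent t.
Proof. apply sqrt_sqrt, tent_bounds. Qed.

Lemma st_zero t : 1 <= Rabs t -> st t = 0.
Proof. intros H. unfold st. rewrite tent_zero by assumption. apply sqrt_0. Qed.

(** The square root of a tent is not Lipschitz; this modulus is what still makes the partition
    functions continuous. *)
Lemma sqrt_mod a b : 0 <= a -> 0 <= b -> Rabs (sqrt a - sqrt b) <= sqrt (Rabs (a - b)).
Proof.
  assert (G : forall a b, 0 <= b <= a -> sqrt a - sqrt b <= sqrt (a - b)).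
  { clear. intros a b H. pose proof (sqrt_pos a). pose proof (sqrt_pos b). pose proof (sqrt_pos (a - b)).
    assert (sqrt a <= sqrt b + sqrt (a - b)); [|lra].
    apply Rsqr_incr_0_var; [|lra]. unfold Rsqr. rewrite sqrt_sqrt by lra.
    pose proof (sqrt_sqrt b ltac:(lra)). pose proof (sqrt_sqrt (a - b) ltac:(lra)). nra. }
  intros Ha Hb. destruct (Rle_dec b a) as [H|H].
  - rewrite (Rabs_right (a - b)) by lra. assert (sqrt b <= sqrt a) by (apply sqrt_le_1; lra).
    rewrite Rabs_right by lra. apply G; lra.
  - rewrite (Rabs_left (a - b)) by lra. assert (sqrt a <= sqrt b) by (apply sqrt_le_1; lra).
    rewrite Rabs_left1 by lra. replace (- (sqrt a - sqrt b)) with (sqrt b - sqrt a) by ring.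
    replace (- (a - b)) with (b - a) by ring. apply G; lra.
Qed.

Lemma st_mod s t : Rabs (st s - st t) <= sqrt (Rabs (s - t)).
Proof.
  unfold st. pose proof (tent_bounds s). pose proof (tent_bounds t).
  eapply Rle_trans; [apply sqrt_mod; lra|].
  apply sqrt_le_1; auto using Rabs_pos. apply tent_lip.
Qed.

Lemma tent_partition m s : 0 <= s <= INR m -> lsum (seq 0 (S m)) (fun j => tent (s - INR j)) = 1.
Proof.
  intros [H0 Hm].
  (* Closed form of the partial sums: a ramp truncated to [0, 1], equal to 1 as long as
     [s <= INR m]. *)
  assert (G : forall m, lsum (seq 0 (S m)) (fun j => tent (s - INR j)) = Rmin 1 (Rmax 0 (INR m + 1 - s))).
  { clear m Hm. induction m as [|m IH].
    - simpl. unfold tent, Rmin, Rmax. repeat destruct Rle_dec; unfold Rabs in *; destruct Rcase_abs; lra.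
    - rewrite lsum_seq_S, IH, S_INR. unfold tent, Rmin, Rmax.
      repeat destruct Rle_dec; unfold Rabs in *; destruct Rcase_abs; lra. }
  rewrite G. rewrite Rmax_right, Rmin_left; lra.
Qed.

(** At most two neighbouring translates overlap. The induction tracks how the bound drops to 1 and
    then to 0 as [s] moves past the last nodes. *)
Lemma st_overlap m s : lsum (seq 0 m) (fun j => st (s - INR j)) <= 2.
Proof.
  assert (G : lsum (seq 0 m) (fun j => st (s - INR j)) <= 2 /\
     (INR m - 1 <= s -> lsum (seq 0 m) (fun j => st (s - INR j)) <= 1) /\
     (INR m <= s -> lsum (seq 0 m) (fun j => st (s - INR j)) <= 0)).
  { induction m as [|m (H1 & H2 & H3)]; [simpl; lra|]. rewrite lsum_seq_S, S_INR.
    pose proof (st_bounds (s - INR m)).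
    assert (Hz : s <= INR m - 1 -> st (s - INR m) = 0).
    { intros Hs. apply st_zero. unfold Rabs; destruct Rcase_abs; lra. }
    assert (Hz' : INR m + 1 <= s -> st (s - INR m) = 0).
    { intros Hs. apply st_zero. unfold Rabs; destruct Rcase_abs; lra. }
    split; [|split].
    - destruct (Rle_dec (INR m - 1) s) as [Hs|Hs]; [specialize (H2 Hs); lra|]. rewrite Hz; lra.
    - intros Hs. specialize (H3 ltac:(lra)). lra.
    - intros Hs. specialize (H3 ltac:(lra)). rewrite Hz'; lra. }
  apply G.
Qed.

(** Coordinates are scaled by [K] and shifted by [J], so that the nodes 0, ..., 2J cover the
    interval [-J, J] of scaled coordinates. *)
Fixpoint grid (K J l : nat) : list (Pt -> R) :=
  match l with
  | O => [fun _ => 1]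
  | S l' => flat_map (fun f => map (fun j x => f x * st (INR K * x l' + INR J - INR j))
              (seq 0 (S (2 * J)))) (grid K J l')
  end.

Lemma lsum_flat_map {A B} (u : A -> list B) l f : lsum (flat_map u l) f = lsum l (fun a => lsum (u a) f).
Proof. induction l as [|a l IH]; simpl; [reflexivity|]. now rewrite lsum_app, IH. Qed.

Lemma grid_sq K J l x : (forall i, (i < l)%nat -> INR K * Rabs (x i) <= INR J) ->
  lsum (grid K J l) (fun f => f x * f x) = 1.
Proof.
  induction l as [|l IH]; intros H; [simpl; ring|].
  unfold grid; fold grid. rewrite lsum_flat_map.
  rewrite (lsum_ext _ _ (fun f => f x * f x)); [apply IH; intros; apply H; lia|].
  intros f _. rewrite lsum_map.
  rewrite (lsum_ext _ _ (fun j => f x * f x * tent (INR K * x l + INR J - INR j))).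
  - rewrite lsum_scal, tent_partition; [ring|]. specialize (H l ltac:(lia)).
    pose proof (pos_INR K). rewrite mult_INR. simpl (INR 2).
    assert (- Rabs (x l) <= x l <= Rabs (x l)) by (unfold Rabs; destruct Rcase_abs; lra). nra.
  - intros j _. rewrite <- st_sq. ring.
Qed.

Lemma grid_range K J l f x : In f (grid K J l) -> 0 <= f x <= 1.
Proof.
  revert f. induction l as [|l IH]; intros f Hf.
  - destruct Hf as [<-|[]]. lra.
  - apply in_flat_map in Hf as (g & Hg & Hf). apply in_map_iff in Hf as (j & <- & _).
    specialize (IH g Hg). pose proof (st_bounds (INR K * x l + INR J - INR j)). nra.
Qed.

(** Each coordinate contributes the overlap factor 2; this is where the powers of 2^d in the final
    bound originate. *)
Lemma grid_sum K J l x : lsum (grid K J l) (fun f => f x) <= 2 ^ l.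
Proof.
  induction l as [|l IH]; [simpl; lra|].
  unfold grid; fold grid. rewrite lsum_flat_map.
  apply Rle_trans with (lsum (grid K J l) (fun f => 2 * f x)); [|rewrite lsum_scal; simpl; lra].
  apply lsum_le; intros f Hf. rewrite lsum_map, lsum_scal.
  pose proof (grid_range K J l f x Hf). pose proof (st_overlap (S (2 * J)) (INR K * x l + INR J)). nra.
Qed.

Lemma grid_support K J l f x y : In f (grid K J l) -> f x <> 0 -> f y <> 0 ->
  forall i, (i < l)%nat -> INR K * Rabs (x i - y i) <= 2.
Proof.
  revert f. induction l as [|l IH]; intros f Hf Hx Hy i Hi; [lia|].
  apply in_flat_map in Hf as (g & Hg & Hf). apply in_map_iff in Hf as (j & <- & _).
  destruct (Nat.eq_dec i l) as [->|].
  - assert (G : forall z, st (INR K * z + INR J - INR j) <> 0 -> Rabs (INR K * z + INR J - INR j) < 1).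
    { intros z Hz. apply Rnot_le_lt; intros H. apply Hz, st_zero, H. }
    assert (Hx' : st (INR K * x l + INR J - INR j) <> 0) by (intros E; apply Hx; rewrite E; ring).
    assert (Hy' : st (INR K * y l + INR J - INR j) <> 0) by (intros E; apply Hy; rewrite E; ring).
    apply G in Hx', Hy'. pose proof (pos_INR K).
    replace (INR K * Rabs (x l - y l)) with
      (Rabs ((INR K * x l + INR J - INR j) + - (INR K * y l + INR J - INR j))).
    + eapply Rle_trans; [apply Rabs_triang|]. rewrite Rabs_Ropp. lra.
    + rewrite <- (Rabs_right (INR K)) at 3 by lra. rewrite <- Rabs_mult. f_equal. ring.
  - apply (IH g); auto; [| |lia]; intros E; [apply Hx|apply Hy]; rewrite E; ring.
Qed.

Lemma grid_mod K J l f x y : In f (grid K J l) ->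
  Rabs (f x - f y) <= lsum (seq 0 l) (fun i => sqrt (INR K * Rabs (x i - y i))).
Proof.
  revert f. induction l as [|l IH]; intros f Hf.
  - destruct Hf as [<-|[]]. simpl. rewrite Rminus_diag, Rabs_R0. lra.
  - apply in_flat_map in Hf as (g & Hg & Hf). apply in_map_iff in Hf as (j & <- & _).
    rewrite lsum_seq_S. specialize (IH g Hg).
    pose proof (grid_range K J l g y Hg) as Hgy.
    pose proof (st_bounds (INR K * x l + INR J - INR j)) as Hs.
    pose proof (st_mod (INR K * x l + INR J - INR j) (INR K * y l + INR J - INR j)) as Hm.
    replace (INR K * x l + INR J - INR j - (INR K * y l + INR J - INR j)) with (INR K * (x l - y l)) in Hm by ring.
    rewrite Rabs_mult, (Rabs_right (INR K)) in Hm by (apply Rle_ge, pos_INR).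
    set (s := st (INR K * x l + INR J - INR j)) in *. set (t := st (INR K * y l + INR J - INR j)) in *.
    replace (g x * s - g y * t) with ((g x - g y) * s + g y * (s - t)) by ring.
    eapply Rle_trans; [apply Rabs_triang|]. rewrite !Rabs_mult.
    rewrite (Rabs_right s), (Rabs_right (g y)) by lra.
    pose proof (Rabs_pos (g x - g y)). pose proof (Rabs_pos (s - t)). nra.
Qed.

Lemma lsum_nth {A} (l : list A) d0 f : lsum l f = lsum (seq 0 (length l)) (fun i => f (nth i l d0)).
Proof.
  induction l as [|a l IH]; [reflexivity|]. rewrite (lsum_seq_shift (length l)). simpl. now rewrite IH.
Qed.

Lemma M_bounded : exists J : nat, forall m : {x : Pt | M x}, forall i, (i < d)%nat -> Rabs (proj1_sig m i) <= INR J.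
Proof.
  assert (G : forall l, (l <= d)%nat -> exists J : nat, forall m : {x : Pt | M x}, forall i, (i < l)%nat ->
    Rabs (proj1_sig m i) <= INR J).
  { induction l as [|l IH]; intros Hl; [exists O; lia|]. destruct (IH ltac:(lia)) as [J HJ].
    destruct (cont_bounded (fun m => RtoC (proj1_sig m l))) as (C & HC & HCm).
    { apply cont_alt. intros m eps He. exists eps. split; [assumption|]. intros m' Hm'.
      replace (Csub (RtoC (proj1_sig m l)) (RtoC (proj1_sig m' l)))
        with (RtoC (proj1_sig m l - proj1_sig m' l)) by (apply Cx_eq; simpl; ring).
      rewrite Cnorm_RtoC. eapply Rle_lt_trans; [apply (coord_le_dist d (proj1_sig m) (proj1_sig m') l); lia|exact Hm']. }
    destruct (INR_unbounded C) as [J' HJ']. exists (max J J'). intros m i Hi.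
    destruct (Nat.eq_dec i l) as [->|].
    - specialize (HCm m). rewrite Cnorm_RtoC in HCm.
      assert (INR J' <= INR (max J J')) by (apply le_INR; lia). lra.
    - specialize (HJ m i ltac:(lia)). assert (INR J <= INR (max J J')) by (apply le_INR; lia). lra. }
  now apply G.
Qed.

Lemma partition_of_unity (x0 : {x : Pt | M x}) del : (1 <= d)%nat -> 0 < del ->
  exists (n : nat) (g : nat -> {x : Pt | M x} -> R) (ctr : nat -> {x : Pt | M x}),
    (forall i, cont d M (fun m => RtoC (g i m))) /\ (forall i m, 0 <= g i m) /\
    (forall m, lsum (seq 0 n) (fun i => g i m * g i m) = 1) /\
    (forall m, lsum (seq 0 n) (fun i => g i m) <= 2 ^ d) /\
    (forall i m, g i m <> 0 -> dist d (proj1_sig (ctr i)) (proj1_sig m) <= del).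
Proof.
  intros Hd Hdel. destruct M_bounded as [R0 HR0].
  assert (HD : 1 <= INR d) by (apply (le_INR 1); assumption).
  (* Supports have width at most [2 / INR K] in every coordinate, hence diameter at most
     [2 * INR d / INR K], which is below [del]. *)
  destruct (INR_unbounded (2 * INR d / del)) as [K HK].
  assert (HK0 : 0 < INR K).
  { assert (0 < 2 * INR d / del) by (apply Rdiv_lt_0_compat; lra). lra. }
  set (J := (K * R0)%nat). set (L := grid K J d). set (n := length L).
  set (gg := fun i => nth i L (fun _ => 0)).
  assert (Hin : forall i, In (gg i) L \/ forall x, gg i x = 0).
  { intros i. unfold gg. destruct (Nat.lt_ge_cases i (length L)) as [H|H].
    - left. now apply nth_In.
    - right. intros x. now rewrite nth_overflow. }
  pose (g := fun i (m : {x : Pt | M x}) => gg i (proj1_sig m)).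
  (* Centres must be points of [M]; a function vanishing identically on [M] gets [x0]. *)
  pose (ctr := fun i => match excluded_middle_informative (exists m, g i m <> 0) with
    | left H => proj1_sig (constructive_indefinite_description _ H) | right _ => x0 end).
  assert (Hctr : forall i, (exists m, g i m <> 0) -> g i (ctr i) <> 0).
  { intros i H. unfold ctr. destruct excluded_middle_informative as [H'|]; [|contradiction].
    now destruct constructive_indefinite_description. }
  exists n, g, ctr. repeat apply conj.
  - intros i. destruct (Hin i) as [Hi|Hi].
    2:{ replace (fun m => RtoC (g i m)) with (fun _ : {x : Pt | M x} => RtoC 0); [apply cont_const|].
        apply functional_extensionality; intros m. unfold g. now rewrite Hi. }
    apply cont_alt. intros m eps He.
    set (e := eps / (INR d + 1)). assert (Hepos : 0 < e) by (apply Rdiv_lt_0_compat; lra).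
    exists (e * e / INR K). split; [apply Rdiv_lt_0_compat; nra|]. intros m' Hm'.
    replace (Csub (RtoC (g i m)) (RtoC (g i m'))) with (RtoC (g i m - g i m')) by (apply Cx_eq; simpl; ring).
    rewrite Cnorm_RtoC. eapply Rle_lt_trans; [apply (grid_mod K J d _ _ _ Hi)|].
    apply Rle_lt_trans with (lsum (seq 0 d) (fun _ => e)).
    + apply lsum_le; intros l Hl. apply in_seq in Hl.
      pose proof (coord_le_dist d (proj1_sig m) (proj1_sig m') l ltac:(lia)) as Hc.
      rewrite <- (sqrt_Rsqr e) by lra. unfold Rsqr.
      pose proof (Rabs_pos (proj1_sig m l - proj1_sig m' l)).
      apply sqrt_le_1_alt.
      replace (e * e) with (INR K * (e * e / INR K)) by (field; lra).
      apply Rmult_le_compat_l; lra.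
    + rewrite lsum_const, length_seq. unfold e.
      apply Rmult_lt_reg_r with (INR d + 1); [lra|]. field_simplify; [|lra]. nra.
  - intros i m. destruct (Hin i) as [Hi|Hi]; [apply (grid_range K J d _ _ Hi)|].
    unfold g. rewrite Hi. lra.
  - intros m. unfold g, gg, n. rewrite <- (lsum_nth L (fun _ => 0) (fun f => f (proj1_sig m) * f (proj1_sig m))).
    apply grid_sq. intros i Hi. specialize (HR0 m i Hi). unfold J. rewrite mult_INR.
    apply Rmult_le_compat_l; lra.
  - intros m. unfold g, gg, n. rewrite <- (lsum_nth L (fun _ => 0) (fun f => f (proj1_sig m))).
    apply grid_sum.
  - intros i m Hne. destruct (Hin i) as [Hi|Hi]; [|exfalso; apply Hne, Hi].
    pose proof (Hctr i (ex_intro _ m Hne)) as Hc.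
    eapply Rle_trans; [apply (dist_le_coord d _ _ (2 / INR K))|].
    + left. apply Rdiv_lt_0_compat; lra.
    + intros l Hl. pose proof (grid_support K J d _ _ _ Hi Hc Hne l Hl) as HS.
      apply Rmult_le_reg_l with (INR K); [assumption|]. eapply Rle_trans; [exact HS|].
      right; field; lra.
    + apply Rmult_le_reg_r with (INR K); [assumption|].
      replace (INR d * (2 / INR K) * INR K) with (2 * INR d) by (field; lra).
      apply Rmult_gt_compat_r with (r := del) in HK; [|assumption].
      replace (2 * INR d / del * del) with (2 * INR d) in HK by (field; lra). lra.
Qed.

(** The recursion adds terms in exactly the form for which linearity of [psi] and of [etaf] is
    stated. *)
Fixpoint flin (n : nat) (c : nat -> Cx) (f : nat -> Fn M) : Fn M :=
  match n with O => fun _ => C0 | S n' => fadd M (fscale M (c n') (f n')) (flin n' c f) end.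

Lemma flin_val n c f m : flin n c f m = csum (seq 0 n) (fun i => Cmul (c i) (f i m)).
Proof.
  induction n as [|n IH]; [reflexivity|]. rewrite csum_seq_S, <- IH. unfold flin at 1; fold flin.
  unfold fadd, fscale. ring.
Qed.

Lemma cont_flin n c f : (forall i, (i < n)%nat -> cont d M (f i)) -> cont d M (flin n c f).
Proof.
  induction n as [|n IH]; intros H; [apply cont_const|]. apply cont_lin; [apply H; lia|].
  apply IH; intros; apply H; lia.
Qed.

End Functions.

(** * Homomorphisms into the Calkin algebra *)

Definition eqc (p : R) (T U : Op) : Prop := cptR p (fun x => xsub (T x) (U x)).

Definition eventually (P : nat -> Prop) : Prop := exists n, forall m, (n <= m)%nat -> P m.

Lemma eventually_and P Q : eventually P -> eventually Q -> eventually (fun m => P m /\ Q m).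
Proof.
  intros [n Hn] [n' Hn']. exists (max n n'). intros m Hm. split; [apply Hn|apply Hn']; lia.
Qed.

Lemma eventually_fin (P : nat -> nat -> Prop) k : (forall i, (i < k)%nat -> eventually (P i)) ->
  eventually (fun m => forall i, (i < k)%nat -> P i m).
Proof.
  induction k as [|k IH]; intros H; [exists O; lia|].
  destruct IH as [n Hn]; [intros; apply H; lia|]. destruct (H k ltac:(lia)) as [n' Hn'].
  exists (max n n'). intros m Hm i Hi. destruct (Nat.eq_dec i k) as [->|]; [apply Hn'|apply Hn]; lia.
Qed.

Section Calkin.
Context {p : R} {hp : Exponent p}.

Lemma eqc_refl T : eqc p T T.
Proof.
  unfold eqc. apply (cptR_ext (fun _ => xzero)); [|apply cptR_zero].
  intros x _. xext.
Qed.

Lemma eqc_sym T U : eqc p T U -> eqc p U T.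
Proof.
  intros H. apply (cptR_ext (fun x => xscale Cm1 (xsub (T x) (U x)))); [|now apply cptR_scale].
  intros x _. xext.
Qed.

Lemma eqc_trans T U X : eqc p T U -> eqc p U X -> eqc p T X.
Proof.
  intros H1 H2. eapply cptR_ext; [|apply (cptR_add _ _ H1 H2)]. intros x _. xext.
Qed.

Lemma essb_scale T a c : essb p T c -> essb p (fun x => xscale a (T x)) (Cnorm a * c).
Proof.
  intros H eps He. pose proof (Cnorm_ge0 a).
  destruct (H (eps / (Cnorm a + 1))) as [n Hn]; [apply Rdiv_lt_0_compat; lra|].
  exists n. intros m Hm. destruct (Hn m Hm) as [H1 H2].
  assert (Hle : Cnorm a * (c + eps / (Cnorm a + 1)) <= Cnorm a * c + eps).
  { rewrite Rmult_plus_distr_l. apply Rplus_le_compat_l.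
    apply Rmult_le_reg_r with (Cnorm a + 1); [lra|]. field_simplify; [|lra]. nra. }
  split; (eapply opb_mono; [|exact Hle]).
  - exact (opb_scale _ a _ H1).
  - eapply opb_ext; [|exact (opb_scale _ a _ H2)]. intros x _. xext.
Qed.

Lemma essb_eventually T c b : essb p T c -> c < b -> eventually (fun m =>
  opb p (fun x => T (tl m x)) b /\ opb p (fun x => tl m (T x)) b).
Proof.
  intros H Hcb. destruct (H (b - c)) as [n Hn]; [lra|]. exists n. intros m Hm.
  replace b with (c + (b - c)) by ring. now apply Hn.
Qed.

Lemma lpB_all_zero {I} (w : I -> Cx) : (forall e, 0 < e -> lpB p w e) -> w = xzero.
Proof.
  intros H. apply functional_extensionality; intros i. apply Cnorm_eq0.
  apply Rle_antisym; [|apply Cnorm_ge0]. apply le_epsilon; intros e He. rewrite Rplus_0_l.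
  apply (lpB_coord _ _ i (H e He)).
Qed.

(** Inverts 1 + K: the iteration z' = x - K z is Cauchy with ratio 1/2, and |z| <= 2 |z + K z| gives
    uniqueness, hence the linearity of [Z] and its bound 2. *)
Lemma neumann (K : Op) : opb p K (/ 2) -> exists Z : Op, opb p Z 2 /\
  (forall x, inlp p x -> Z (xadd x (K x)) = x) /\ (forall x, inlp p x -> xadd (Z x) (K (Z x)) = x).
Proof.
  intros HK. pose proof (opb_lin _ _ HK) as Kl.
  assert (HKi : forall x, inlp p x -> inlp p (K x)) by (intros; eapply opb_inlp; eauto).
  assert (Hpow : forall j, 0 < 2 ^ j) by (intros; apply pow_lt; lra).
  assert (Hex : forall x, inlp p x -> exists z, inlp p z /\ xadd z (K z) = x).
  { intros x [r Hx]. assert (Hr : 0 <= r) by apply (lpB_ge0 _ _ Hx).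
    assert (Hi : inlp p x) by now exists r.
    pose (z := fix z j := match j with O => x | S j' => xsub x (K (z j')) end).
    assert (Hzi : forall j, inlp p (z j)) by (induction j; simpl; auto using inlp_sub).
    assert (Hstep : forall j, lpB p (xsub (z (S j)) (z j)) (r / 2 ^ S j)).
    { induction j as [|j IH].
      - simpl z. replace (xsub (xsub x (K x)) x) with (xscale Cm1 (K x)) by xext.
        replace (r / 2 ^ 1) with (Cnorm Cm1 * (/ 2 * r)) by (rewrite Cnorm_Cm1; simpl; field).
        apply lpB_scale, (opb_bd _ _ _ _ HK Hx).
      - replace (xsub (z (S (S j))) (z (S j))) with (xscale Cm1 (K (xsub (z (S j)) (z j)))).
        + replace (r / 2 ^ S (S j)) with (Cnorm Cm1 * (/ 2 * (r / 2 ^ S j))).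
          * apply lpB_scale, (opb_bd _ _ _ _ HK IH).
          * rewrite Cnorm_Cm1. specialize (Hpow j). simpl. field. lra.
        + rewrite (lin_sub _ Kl) by apply Hzi.
          change (z (S (S j))) with (xsub x (K (z (S j)))).
          change (xsub (xsub x (K (z (S j)))) (z (S j))) with
            (xsub (xsub x (K (z (S j)))) (xsub x (K (z j)))). xext. }
    assert (Hcau : forall j k, (j <= k)%nat -> lpB p (xsub (z k) (z j)) (r / 2 ^ j)).
    { intros j k Hjk.
      assert (G : lpB p (xsub (z k) (z j)) (r / 2 ^ j - r / 2 ^ k)).
      { induction Hjk as [|k Hjk IH].
        - rewrite Rminus_diag. replace (xsub (z j) (z j)) with (@xzero nat) by xext. apply lpB_zero; lra.
        - replace (xsub (z (S k)) (z j)) with (xadd (xsub (z k) (z j)) (xsub (z (S k)) (z k))) by xext.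
          replace (r / 2 ^ j - r / 2 ^ S k) with ((r / 2 ^ j - r / 2 ^ k) + r / 2 ^ S k).
          + apply lpB_add; auto.
          + pose proof (Hpow j). pose proof (Hpow k). simpl. field. lra. }
      eapply lpB_mono; [exact G|].
      assert (0 <= r / 2 ^ k) by (apply Rmult_le_pos; [assumption|left; apply Rinv_0_lt_compat, Hpow]). lra. }
    assert (Hlim : forall eps, eps > 0 -> exists j, r / 2 ^ j < eps).
    { intros eps He. destruct (pow_lt_1_zero (/ 2)) with (y := eps / (r + 1)) as [j Hj];
        [rewrite Rabs_right; lra|apply Rdiv_lt_0_compat; lra|].
      exists j. specialize (Hj j (le_n _)). rewrite pow_inv, Rabs_right in Hj
        by (apply Rle_ge; left; apply Rinv_0_lt_compat, Hpow).
      unfold Rdiv. apply Rmult_lt_compat_l with (r := r + 1) in Hj; [|lra].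
      replace ((r + 1) * (eps / (r + 1))) with eps in Hj by (field; lra).
      pose proof (Rinv_0_lt_compat _ (Hpow j)). lra. }
    destruct (lpB_complete z (fun j => r / 2 ^ j) Hlim Hcau) as [y Hy]. exists y.
    assert (Hyi : inlp p y).
    { replace y with (xadd (xsub y (z O)) (z O)) by xext. apply inlp_add; [eexists; apply Hy|apply Hzi]. }
    split; [assumption|].
    assert (E : xsub (xadd y (K y)) x = xzero).
    { apply lpB_all_zero. intros e He. destruct (Hlim e He) as [j Hj].
      replace (xsub (xadd y (K y)) x) with (xadd (xsub y (z (S j))) (K (xsub y (z j)))).
      - apply lpB_mono with (r / 2 ^ S j + / 2 * (r / 2 ^ j)).
        + apply lpB_add; [apply Hy|apply (opb_bd _ _ _ _ HK (Hy j))].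
        + replace (r / 2 ^ S j + / 2 * (r / 2 ^ j)) with (r / 2 ^ j); [lra|].
          specialize (Hpow j). simpl. field. lra.
      - rewrite (lin_sub _ Kl) by auto. simpl z. xext. }
    replace (xadd y (K y)) with (xadd (xsub (xadd y (K y)) x) x) by xext. rewrite E. xext. }
  assert (Hbd : forall z r, inlp p z -> lpB p (xadd z (K z)) r -> lpB p z (2 * r)).
  { intros z r [s Hs] Hr. destruct (lpB_nrmI z s Hs) as [H1 _].
    assert (H2 : lpB p z (r + / 2 * nrmI p z)).
    { replace z with (xsub (xadd z (K z)) (K z)) at 1 by xext.
      apply lpB_sub; [assumption|apply (opb_bd _ _ _ _ HK H1)]. }
    destruct (lpB_nrmI z _ H2) as [_ H3]. eapply lpB_mono; [exact H1|lra]. }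
  assert (Huniq : forall z z', inlp p z -> inlp p z' -> xadd z (K z) = xadd z' (K z') -> z = z').
  { intros z z' Hz Hz' E.
    assert (D : xsub z z' = xzero).
    { apply lpB_all_zero. intros e He. replace e with (2 * (e / 2)) by field.
      apply Hbd; [now apply inlp_sub|].
      replace (xadd (xsub z z') (K (xsub z z'))) with (@xzero nat); [apply lpB_zero; lra|].
      rewrite (lin_sub _ Kl) by assumption.
      replace (xadd (xsub z z') (xsub (K z) (K z'))) with (xsub (xadd z (K z)) (xadd z' (K z'))) by xext.
      rewrite E. xext. }
    replace z with (xadd (xsub z z') z') by xext. rewrite D. xext. }
  pose (Z := fun x => match excluded_middle_informative (inlp p x) with
    | left H => proj1_sig (constructive_indefinite_description _ (Hex x H)) | right _ => xzero end).
  assert (HZ : forall x, inlp p x -> inlp p (Z x) /\ xadd (Z x) (K (Z x)) = x).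
  { intros x Hx. unfold Z. destruct excluded_middle_informative; [|contradiction].
    now destruct constructive_indefinite_description. }
  exists Z. split; [|split].
  - split; [lra|]. split.
    + intros a x y Hx Hy. destruct (HZ x Hx) as [X1 X2]. destruct (HZ y Hy) as [Y1 Y2].
      assert (Hxy : inlp p (xadd (xscale a x) y)) by auto using inlp_add, inlp_scale.
      destruct (HZ _ Hxy) as [P1 P2].
      apply Huniq; auto using inlp_add, inlp_scale. rewrite P2, Kl by assumption.
      rewrite <- X2 at 1. rewrite <- Y2 at 1. xext.
    + intros x r Hx. destruct (HZ x ltac:(now exists r)) as [X1 X2].
      apply Hbd; [assumption|]. now rewrite X2.
  - intros x Hx. assert (Hy : inlp p (xadd x (K x))) by auto using inlp_add.
    destruct (HZ _ Hy) as [P1 P2]. now apply Huniq.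
  - intros x Hx. now apply HZ.
Qed.

(** * Estimates for [psi] on tails, and its dilation *)

Section Psi.
Variables (d : nat) (M : Pt -> Prop) (psi : Fn M -> Op).
Hypothesis Hd : (1 <= d)%nat.
Hypothesis Hcpt : seq_compact d M.
Variable x0 : {x : Pt | M x}.
Hypothesis Hpsi : calk_unital_hom p d M psi.
Hypothesis Hbd : calk_bounded p d M psi.

Let Nn : R := calk_map_norm p d M psi.

Lemma psi_opb h : cont d M h -> exists C, opb p (psi h) C.
Proof. intros Hh. apply Bp_opb. now apply Hpsi. Qed.

Lemma psi_lin a g h : cont d M g -> cont d M h ->
  eqc p (psi (fadd M (fscale M a g) h)) (fun x => xadd (xscale a (psi g x)) (psi h x)).
Proof. intros Hg Hh. apply (Kp_cptR (p := p)). now apply Hpsi. Qed.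

Lemma psi_mul g h : cont d M g -> cont d M h ->
  eqc p (psi (fmul M g h)) (fun x => psi g (psi h x)).
Proof. intros Hg Hh. apply (Kp_cptR (p := p)). now apply Hpsi. Qed.

Lemma psi_one : eqc p (psi (fone M)) (fun x => x).
Proof. apply (Kp_cptR (p := p)). apply Hpsi. Qed.

(** [psi] need not send 0 to 0; linearity modulo compacts, applied to 0 = 0 + 0, shows that its
    value there is compact. *)
Lemma psi_zero : cptR p (psi (fun _ => C0)).
Proof.
  pose proof (psi_lin C1 (fun _ => C0) (fun _ => C0) (cont_const d M C0) (cont_const d M C0)) as H.
  replace (fadd M (fscale M C1 (fun _ => C0)) (fun _ => C0)) with (fun _ : {x : Pt | M x} => C0) in H.
  - eapply cptR_ext; [|apply (cptR_scale Cm1), H]. intros x _. xext.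
  - apply functional_extensionality; intros m. unfold fadd, fscale. ring.
Qed.

Lemma psi_flin n c f X : (forall i, (i < n)%nat -> cont d M (f i)) ->
  (forall i, (i < n)%nat -> eqc p (X i) (psi (f i))) ->
  eqc p (fun x => xsum (seq 0 n) (fun i => xscale (c i) (X i x))) (psi (flin M n c f)).
Proof.
  induction n as [|n IH]; intros Hf HX.
  - eapply cptR_ext; [|apply (cptR_scale Cm1), psi_zero]. intros x _. unfold xsum. simpl. xext.
  - assert (Hf' : forall i, (i < n)%nat -> cont d M (f i)) by (intros; apply Hf; lia).
    pose proof (IH Hf' ltac:(intros; apply HX; lia)) as H1.
    pose proof (HX n ltac:(lia)) as H2.
    pose proof (psi_lin (c n) (f n) (flin M n c f) (Hf n ltac:(lia)) (cont_flin d M n c f Hf')) as H3.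
    eapply cptR_ext; [|apply (cptR_sub _ _ (cptR_add _ _ H1 (cptR_scale (c n) _ H2)) H3)].
    intros x _. apply functional_extensionality; intros j.
    unfold xsub, xadd, xscale, xsum. rewrite csum_seq_S. unfold flin; fold (flin M). cring.
Qed.

Lemma map_norm_ub u : cont d M u -> supnorm M u <= 1 -> calknorm p (psi u) <= Nn.
Proof.
  intros Hu H1. destruct Hbd as [c Hc].
  apply (supR_ub _ (Rmax c 0)); [|exists u; auto].
  intros y (v & Hv & Hv1 & ->). eapply Rle_trans; [now apply Hc|].
  assert (0 <= supnorm M v) by (apply (supnorm_ge0 d); [assumption|now exists (proj1_sig x0); apply proj2_sig|assumption]).
  pose proof (Rmax_l c 0). pose proof (Rmax_r c 0). nra.
Qed.

(** [psi (fone M)] is the identity modulo compacts, and far unit vectors show that no compact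
    perturbation of the identity has norm below 1. Raising the power of this norm therefore only
    weakens an upper bound. *)
Lemma map_norm_ge1 : 1 <= Nn.
Proof.
  assert (H1 : cont d M (fone M)) by apply cont_const.
  apply Rle_trans with (calknorm p (psi (fone M))).
  - apply calknorm_ge; [now apply psi_opb|]. intros K c HK Hc.
    apply le_epsilon; intros eps He.
    assert (HK' : cptR p (fun x => xadd (xsub (psi (fone M) x) x) (K x))) by (apply cptR_add; [apply psi_one|assumption]).
    destruct (cptR_tail _ eps HK' He) as [n Hn]. specialize (Hn n (le_n _)).
    assert (Htl : tl n (delta n) = delta n).
    { apply functional_extensionality; intros j. unfold tl, mask, delta.
      destruct (Nat.ltb_spec j n), (Nat.eqb_spec j n); try lia; rewrite ?RtoC_0, ?RtoC_1; ring. }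
    pose proof (opb_bd _ _ _ _ Hc (lpB_delta n)) as L1.
    pose proof (opb_bd _ _ _ _ Hn (lpB_delta n)) as L2. cbv beta in L2. rewrite Htl in L2.
    pose proof (lpB_coord _ _ n (lpB_sub _ _ _ _ L1 L2)) as L3.
    replace (xsub (xadd (psi (fone M) (delta n)) (K (delta n)))
      (xadd (xsub (psi (fone M) (delta n)) (delta n)) (K (delta n)))) with (delta n) in L3 by xext.
    unfold delta in L3. rewrite Nat.eqb_refl, Cnorm_C1 in L3. lra.
  - apply map_norm_ub; [assumption|]. apply supnorm_le; [lra|]. intros m. unfold fone. rewrite Cnorm_C1. lra.
Qed.

(** Normalise [f] by [C], apply the norm of the map, and scale back; homogeneity holds only modulo
    compacts, to which [essb] is insensitive. *)
Lemma psi_essb f C : cont d M f -> 0 < C -> (forall m, Cnorm (f m) <= C) -> essb p (psi f) (Nn * C).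
Proof.
  intros Hf HC Hm.
  set (u := fadd M (fscale M (RtoC (/ C)) f) (fun _ => C0)).
  assert (Hu : cont d M u) by (apply cont_lin; [assumption|apply cont_const]).
  assert (HiC : 0 < / C) by now apply Rinv_0_lt_compat.
  assert (Hu1 : supnorm M u <= 1).
  { apply supnorm_le; [lra|]. intros m. unfold u, fadd, fscale.
    replace (Cadd (Cmul (RtoC (/ C)) (f m)) C0) with (Cmul (RtoC (/ C)) (f m)) by ring.
    rewrite Cnorm_mul, Cnorm_RtoC, Rabs_right by lra.
    apply Rmult_le_reg_l with C; [assumption|]. rewrite <- Rmult_assoc, Rinv_r by lra.
    specialize (Hm m). lra. }
  pose proof (essb_calknorm (psi u) Nn (psi_opb u Hu) (map_norm_ub u Hu Hu1)) as He.
  apply (essb_scale _ (RtoC C)) in He. rewrite Cnorm_RtoC, Rabs_right in He by lra.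
  rewrite Rmult_comm. eapply essb_cpt; [|exact He].
  pose proof (psi_lin (RtoC C) u (fun _ => C0) Hu (cont_const d M C0)) as HL.
  replace (fadd M (fscale M (RtoC C) u) (fun _ => C0)) with f in HL.
  - eapply cptR_ext; [|apply (cptR_sub _ _ (cptR_scale Cm1 _ HL) psi_zero)]. intros x _. xext.
  - apply functional_extensionality; intros m. unfold u, fadd, fscale.
    transitivity (Cmul (Cmul (RtoC C) (RtoC (/ C))) (f m)).
    + rewrite <- RtoC_mul, Rinv_r, RtoC_1 by lra. ring.
    + ring.
Qed.

Variables (N : nat -> nat) (g : nat -> nat -> {x : Pt | M x} -> R) (ctr : nat -> nat -> {x : Pt | M x}).
Variable del : nat -> R.
Hypothesis HN : forall k, (k < 2)%nat -> N k = 1%nat.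
Hypothesis Hgc : forall k i, cont d M (fun m => RtoC (g k i m)).
Hypothesis Hg0 : forall k i m, 0 <= g k i m.
Hypothesis Hg1 : forall k m, (2 <= k)%nat -> lsum (seq 0 (N k)) (fun i => g k i m * g k i m) = 1.
Hypothesis Hg2 : forall k m, (2 <= k)%nat -> lsum (seq 0 (N k)) (fun i => g k i m) <= 2 ^ d.
Hypothesis Hg3 : forall k i m, (2 <= k)%nat -> g k i m <> 0 ->
  dist d (proj1_sig (ctr k i)) (proj1_sig m) <= del k.
Hypothesis Hdel : forall eps, 0 < eps -> exists k0, forall k, (k0 <= k)%nat -> del k <= eps.

Let G k i : Fn M := fun m => RtoC (g k i m).
(** Stages 0 and 1 are the identity: their weights [ee'] reach coordinate 0, whereas estimates on
    [psi] hold only on tails. As [N k] is 1 there, the sum of squares is exactly the identity. *)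
Definition stageT (k i : nat) : Op := if (k <? 2)%nat then opid else psi (fun m => RtoC (g k i m)).

(* A sequence with dense linear span in C(M). *)
Definition hseq (s : nat) : Fn M :=
  fmul M (fun m => RtoC (g (fst (of_nat s) + 2) (snd (of_nat s)) m))
         (fun m => RtoC (g (fst (of_nat s) + 2) (snd (of_nat s)) m)).

(** The modulus of continuity of [h] at the scale [del k] of the partition of stage [k]. *)
Definition osc (h : Fn M) (k : nat) : R :=
  supR (fun r => exists m m', dist d (proj1_sig m) (proj1_sig m') <= del k /\ r = Cnorm (Csub (h m) (h m'))).

Lemma cont_hseq s : cont d M (hseq s).
Proof. apply cont_mul; auto. Qed.

Lemma osc_ub h k m m' : cont d M h -> dist d (proj1_sig m) (proj1_sig m') <= del k ->
  Cnorm (Csub (h m) (h m')) <= osc h k.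
Proof.
  intros Hh Hm. destruct (cont_bounded d M Hcpt h Hh) as (C & HC & HCm).
  apply (supR_ub _ (C + C)); [|exists m, m'; auto].
  intros y (v & v' & _ & ->). eapply Rle_trans; [apply Cnorm_sub|]. apply Rplus_le_compat; apply HCm.
Qed.

Lemma osc_small h eps : cont d M h -> 0 < eps -> exists k0, forall k, (k0 <= k)%nat -> osc h k <= eps.
Proof.
  intros Hh He. destruct (cont_uniform d M Hcpt h Hd Hh eps He) as (e & He0 & Hu).
  destruct (Hdel e He0) as [k0 Hk0]. exists k0. intros k Hk. apply supR_le; [lra|].
  intros y (m & m' & Hm & ->). apply Hu. eapply Rle_trans; [exact Hm|now apply Hk0].
Qed.

Lemma osc_ge0 h k : 0 <= osc h k.
Proof.
  unfold osc, supR. destruct excluded_middle_informative as [[Hb (y & Hy)]|]; [|lra].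
  destruct completeness as [b [H1 H2]]; simpl.
  eapply Rle_trans; [|apply H1, Hy]. destruct Hy as (m & m' & _ & ->). apply Cnorm_ge0.
Qed.

(** The squares g_i^2 sum to 1 and live near their centres, so h is close to their combination with
    coefficients h(m_i). This is the density of the span of the [hseq]. *)
Lemma approx_osc h k : cont d M h -> (2 <= k)%nat -> forall m,
  Cnorm (Csub (h m) (flin M (N k) (fun i => h (ctr k i)) (fun i => fmul M (G k i) (G k i)) m)) <= osc h k.
Proof.
  intros Hh Hk m. rewrite flin_val.
  assert (E : h m = csum (seq 0 (N k)) (fun i => Cmul (h m) (RtoC (g k i m * g k i m)))).
  { rewrite csum_scal, csum_RtoC, Hg1 by assumption. rewrite RtoC_1. ring. }
  replace (Csub (h m) (csum (seq 0 (N k)) (fun i => Cmul (h (ctr k i)) (fmul M (G k i) (G k i) m))))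
    with (csum (seq 0 (N k)) (fun i => Cmul (Csub (h m) (h (ctr k i))) (RtoC (g k i m * g k i m)))).
  - eapply Rle_trans; [apply Cnorm_csum|].
    rewrite <- (Rmult_1_r (osc h k)), <- (Hg1 k m Hk), <- lsum_scal. apply lsum_le; intros i _.
    rewrite Cnorm_mul, Cnorm_RtoC, Rabs_right by (specialize (Hg0 k i m); nra).
    destruct (Req_dec (g k i m) 0) as [->|Hne]; [lra|].
    apply Rmult_le_compat_r; [specialize (Hg0 k i m); nra|].
    rewrite Cnorm_sub_sym. apply osc_ub; [assumption|]. now apply Hg3.
  - transitivity (Cadd (csum (seq 0 (N k)) (fun i => Cmul (h m) (RtoC (g k i m * g k i m))))
      (Cmul Cm1 (csum (seq 0 (N k)) (fun i => Cmul (h (ctr k i)) (fmul M (G k i) (G k i) m))))); [|rewrite <- E; cring].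
    rewrite <- csum_scal, <- csum_plus. apply csum_ext; intros i _. unfold fmul, G. rewrite RtoC_mul. cring.
Qed.

(** The essential norm of the signed sums is at most [Nn * 2 ^ d]; the factor 2 provides the strict
    inequality by which [essb_eventually] yields an honest operator bound on tails. *)
Let B : R := 2 * 2 ^ d * Nn.
Let pd : 1 <= 2 ^ d. Proof. apply pow_R1_Rle. lra. Qed.
Let A s := psi (hseq s).
Let a s k i := hseq s (ctr k i).

Lemma stageT_opb k i : exists C, opb p (stageT k i) C.
Proof. unfold stageT. destruct (k <? 2)%nat; [exists 1; apply opb_id|apply psi_opb, Hgc]. Qed.

Lemma stageT_psi k i : (2 <= k)%nat -> stageT k i = psi (G k i).
Proof. intros Hk. unfold stageT. destruct (Nat.ltb_spec k 2); [lia|reflexivity]. Qed.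

Lemma weighted_bound k w (u : nat -> {x : Pt | M x} -> Cx) (e : R) m : (2 <= k)%nat -> 0 <= e ->
  (forall i, g k i m <> 0 -> Cnorm (u i m) <= e) ->
  Cnorm (csum (seq 0 (N k)) (fun i => Cmul (RtoC (rad (N k) i w)) (Cmul (u i m) (RtoC (g k i m))))) <= 2 ^ d * e.
Proof.
  intros Hk He Hu. eapply Rle_trans; [apply Cnorm_csum|].
  apply Rle_trans with (lsum (seq 0 (N k)) (fun i => e * g k i m)).
  - apply lsum_le; intros i _. rewrite !Cnorm_mul, !Cnorm_RtoC, (Rabs_right (g k i m)) by (apply Rle_ge, Hg0).
    pose proof (Rabs_rad (N k) i w). pose proof (Rabs_pos (rad (N k) i w)). specialize (Hg0 k i m).
    destruct (Req_dec (g k i m) 0) as [->|Hne]; [right; ring|]. specialize (Hu i Hne).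
    pose proof (Cnorm_ge0 (u i m)).
    assert (Cnorm (u i m) * g k i m <= e * g k i m) by (apply Rmult_le_compat_r; lra).
    assert (0 <= Cnorm (u i m) * g k i m) by nra. nra.
  - rewrite lsum_scal, Rmult_comm. apply Rmult_le_compat_r; auto.
Qed.

(** Modulo compacts the signed sum is [psi] of one function, whose modulus is at most [e] times the
    sum of the g_i, hence at most [2 ^ d * e] whatever the signs. The number of functions in the
    partition does not enter. *)
Lemma psi_bounded_sum k w X f (u : nat -> {x : Pt | M x} -> Cx) e : (2 <= k)%nat -> 0 < e ->
  (forall i, cont d M (f i)) -> (forall i m, f i m = Cmul (u i m) (RtoC (g k i m))) ->
  (forall i m, g k i m <> 0 -> Cnorm (u i m) <= e) ->
  (forall i, eqc p (X k i) (psi (f i))) ->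
  essb p (signed_sum N X k w) (Nn * (2 ^ d * e)).
Proof.
  intros Hk He Hf Hfu Hu HX.
  eapply essb_cpt; [apply eqc_sym, (psi_flin (N k) (fun i => RtoC (rad (N k) i w)) f (X k)); auto|].
  apply psi_essb; [apply cont_flin; auto|nra|]. intros m. rewrite flin_val.
  rewrite (csum_ext _ _ (fun i => Cmul (RtoC (rad (N k) i w)) (Cmul (u i m) (RtoC (g k i m)))))
    by (intros; now rewrite Hfu).
  apply weighted_bound; auto; lra.
Qed.

Lemma stage_signed_essb k w : (2 <= k)%nat -> essb p (signed_sum N stageT k w) (Nn * (2 ^ d * 1)).
Proof.
  intros Hk. apply (psi_bounded_sum k w stageT (G k) (fun _ _ => C1)); auto.
  - lra.
  - intros i. apply Hgc.
  - intros i m. unfold G. ring.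
  - intros i m _. rewrite Cnorm_C1. lra.
  - intros i. rewrite stageT_psi by assumption. apply eqc_refl.
Qed.

Let defect_fn s k i : Fn M := fadd M (fscale M (Copp (a s k i)) (G k i)) (fmul M (G k i) (hseq s)).

Lemma cont_defect_fn s k i : cont d M (defect_fn s k i).
Proof. apply cont_lin; [apply Hgc|apply cont_mul; [assumption|apply Hgc|apply cont_hseq]]. Qed.

Lemma defectR_psi s k i : (2 <= k)%nat -> eqc p (defectR stageT A a s k i) (psi (defect_fn s k i)).
Proof.
  intros Hk. unfold defectR, eqc. rewrite stageT_psi by assumption.
  pose proof (psi_lin (Copp (a s k i)) (G k i) (fmul M (G k i) (hseq s)) (Hgc k i)
     (cont_mul d M Hcpt _ _ (Hgc k i) (cont_hseq s))) as H1.
  pose proof (psi_mul (G k i) (hseq s) (Hgc k i) (cont_hseq s)) as H2.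
  eapply cptR_ext; [|apply (cptR_scale Cm1 _ (cptR_add _ _ H1 H2))].
  intros x _. unfold A, defect_fn. xext.
Qed.

Lemma defectL_psi s k i : (2 <= k)%nat -> eqc p (defectL stageT A a s k i) (psi (defect_fn s k i)).
Proof.
  intros Hk. unfold defectL, eqc. rewrite stageT_psi by assumption.
  pose proof (psi_lin (Copp (a s k i)) (G k i) (fmul M (G k i) (hseq s)) (Hgc k i)
     (cont_mul d M Hcpt _ _ (Hgc k i) (cont_hseq s))) as H1.
  pose proof (psi_mul (hseq s) (G k i) (cont_hseq s) (Hgc k i)) as H2.
  replace (fmul M (hseq s) (G k i)) with (fmul M (G k i) (hseq s)) in H2
    by (apply functional_extensionality; intros m; unfold fmul; ring).
  eapply cptR_ext; [|apply (cptR_scale Cm1 _ (cptR_add _ _ H1 H2))].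
  intros x _. unfold A, defect_fn. xext.
Qed.

(** The summand [/ (INR k + 1)] keeps the value positive, as [psi_essb] asks, and still tends to
    0. *)
Let thr s k := osc (hseq s) k + / (INR k + 1).

Lemma thr_pos s k : 0 < thr s k.
Proof.
  unfold thr. pose proof (osc_ge0 (hseq s) k). pose proof (pos_INR k).
  assert (0 < / (INR k + 1)) by (apply Rinv_0_lt_compat; lra). lra.
Qed.

Lemma defect_essb X s k w : (2 <= k)%nat ->
  (forall i, eqc p (X k i) (psi (defect_fn s k i))) ->
  essb p (signed_sum N X k w) (Nn * (2 ^ d * thr s k)).
Proof.
  intros Hk HX.
  apply (psi_bounded_sum k w X (defect_fn s k) (fun i m => Csub (hseq s m) (a s k i))); auto.
  - apply thr_pos.
  - intros i. apply cont_defect_fn.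
  - intros i m. unfold defect_fn, fadd, fscale, fmul, G. ring.
  - intros i m Hne. unfold a, thr. rewrite Cnorm_sub_sym.
    pose proof (pos_INR k). assert (0 < / (INR k + 1)) by (apply Rinv_0_lt_compat; lra).
    eapply Rle_trans; [apply (osc_ub (hseq s) k); [apply cont_hseq|now apply Hg3]|]. lra.
Qed.

Lemma square_sum_cpt k : (2 <= k)%nat -> eqc p (square_sum N stageT k) (fun x => x).
Proof.
  intros Hk. eapply eqc_trans; [|apply psi_one].
  pose proof (psi_flin (N k) (fun _ => C1) (fun i => fmul M (G k i) (G k i))
    (fun i x => stageT k i (stageT k i x))) as H.
  replace (fone M) with (flin M (N k) (fun _ => C1) (fun i => fmul M (G k i) (G k i))).
  - eapply cptR_ext; [|apply H].
    + intros x _. apply functional_extensionality; intros c. unfold square_sum, xsub, xadd, xscale, xsum.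
      f_equal. apply csum_ext; intros. ring.
    + intros i _. apply cont_mul; auto; apply Hgc.
    + intros i _. rewrite stageT_psi by assumption. apply eqc_sym, psi_mul; apply Hgc.
  - apply functional_extensionality; intros m. rewrite flin_val.
    rewrite (csum_ext _ _ (fun i => RtoC (g k i m * g k i m))).
    + rewrite csum_RtoC, Hg1 by assumption. reflexivity.
    + intros i _. unfold fmul, G. rewrite RtoC_mul. ring.
Qed.

Lemma opb_defectR' s k i : exists C, opb p (defectR stageT A a s k i) C.
Proof.
  destruct (stageT_opb k i) as [C HC]. destruct (psi_opb (hseq s) (cont_hseq s)) as [D HD]. eexists.
  apply opb_sub; [apply opb_comp; eassumption|apply opb_scale; eassumption].
Qed.

Lemma opb_defectL' s k i : exists C, opb p (defectL stageT A a s k i) C.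
Proof.
  destruct (stageT_opb k i) as [C HC]. destruct (psi_opb (hseq s) (cont_hseq s)) as [D HD]. eexists.
  apply opb_sub; [apply opb_comp; eassumption|apply opb_scale; eassumption].
Qed.

(** In the two identity stages nothing is small; a finite bound is enough there, since the defects
    must be small only eventually. *)
Lemma early_stage_bound s k : exists C, 0 <= C /\ forall w,
  opb p (fun x => signed_sum N (defectR stageT A a s) k w (tl O x)) C /\
  opb p (fun x => tl O (signed_sum N (defectL stageT A a s) k w x)) C.
Proof.
  destruct (signed_sum_opb N (defectR stageT A a s) k (opb_defectR' s)) as (b1 & H1 & H2).
  destruct (signed_sum_opb N (defectL stageT A a s) k (opb_defectL' s)) as (b2 & H3 & H4).
  exists (b1 + b2). split; [lra|]. intros w. split.
  - apply (opb_mono _ (b1 * 1)); [|lra]. apply opb_comp; [apply H2|apply opb_tl].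
  - apply (opb_mono _ (1 * b2)); [|lra]. apply (opb_comp (tl O)); [apply opb_tl|apply H4].
Qed.

Theorem psi_dilation : exists V W : Op,
  opb p V B /\ opb p W (3 * B) /\
  opb p (fun x => xsub (W (V x)) x) (/ 2) /\ cptR p (fun x => xsub (W (V x)) x) /\
  forall s, let E := etaop N (fun k i => hseq s (ctr k i)) (hseq s x0) in
    cptR p (fun x => xsub (V (psi (hseq s) x)) (E (V x))) /\
    cptR p (fun x => xsub (psi (hseq s) (W x)) (W (E x))).
Proof.
  pose proof map_norm_ge1 as HN1.
  pose (eb := fun s k => proj1_sig (constructive_indefinite_description _ (early_stage_bound s k))).
  assert (Heb : forall s k, 0 <= eb s k /\ forall w,
    opb p (fun x => signed_sum N (defectR stageT A a s) k w (tl O x)) (eb s k) /\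
    opb p (fun x => tl O (signed_sum N (defectL stageT A a s) k w x)) (eb s k)).
  { intros s k. exact (proj2_sig (constructive_indefinite_description _ (early_stage_bound s k))). }
  clearbody eb.
  (* Exceeds the essential norm of the defects by [/ (INR k + 1)], so that the bound is attained on
     some tail. *)
  pose (th := fun s k => if (k <? 2)%nat then eb s k else Nn * (2 ^ d * thr s k) + / (INR k + 1)).
  assert (Hik : forall k, 0 < / (INR k + 1)).
  { intros k. pose proof (pos_INR k). apply Rinv_0_lt_compat; lra. }
  assert (Hth : forall s eps, 0 < eps -> exists k0, forall k, (k0 <= k)%nat -> th s k <= eps).
  { intros s eps He. assert (HND : 0 < Nn * 2 ^ d) by nra.
    assert (He1 : 0 < eps / 2 / (Nn * 2 ^ d) / 2).
    { repeat apply Rdiv_lt_0_compat; lra. }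
    destruct (osc_small (hseq s) _ (cont_hseq s) He1) as [k1 Hk1].
    set (e2 := Rmin (eps / 2 / (Nn * 2 ^ d) / 2) (eps / 2)).
    assert (He2 : 0 < e2) by (apply Rmin_glb_lt; lra).
    destruct (INR_unbounded (/ e2)) as [k2 Hk2].
    exists (max 2 (max k1 k2)). intros k Hk. unfold th. destruct (Nat.ltb_spec k 2); [lia|].
    assert (HI : / (INR k + 1) <= e2).
    { rewrite <- (Rinv_inv e2). pose proof (Rinv_0_lt_compat _ He2).
      assert (INR k2 <= INR k) by (apply le_INR; lia). apply Rinv_le_contravar; lra. }
    pose proof (Rmin_l (eps / 2 / (Nn * 2 ^ d) / 2) (eps / 2)) as M1.
    pose proof (Rmin_r (eps / 2 / (Nn * 2 ^ d) / 2) (eps / 2)) as M2. fold e2 in M1, M2.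
    specialize (Hk1 k ltac:(lia)).
    assert (thr s k <= eps / 2 / (Nn * 2 ^ d)) by (unfold thr; lra).
    rewrite <- Rmult_assoc.
    assert (Nn * 2 ^ d * thr s k <= Nn * 2 ^ d * (eps / 2 / (Nn * 2 ^ d))) by (apply Rmult_le_compat_l; lra).
    replace (Nn * 2 ^ d * (eps / 2 / (Nn * 2 ^ d))) with (eps / 2) in * by (field; lra).
    lra. }
  (* One tail index has to serve all 2^(N k) sign patterns and all [s <= k] at once; these are
     finitely many conditions, each holding eventually. *)
  assert (HP : forall k, exists n0, ((k < 2)%nat -> n0 = O) /\
    (forall w, In w (patterns (N k)) ->
      opb p (fun x => signed_sum N stageT k w (tl n0 x)) B /\
      opb p (fun x => tl n0 (signed_sum N stageT k w x)) B) /\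
    opb p (fun x => xsub (square_sum N stageT k (tl n0 x)) (tl n0 x)) ((/ 4) ^ S k) /\
    (forall s w, (s <= k)%nat -> In w (patterns (N k)) ->
      opb p (fun x => signed_sum N (defectR stageT A a s) k w (tl n0 x)) (th s k) /\
      opb p (fun x => tl n0 (signed_sum N (defectL stageT A a s) k w x)) (th s k))).
  { intros k. destruct (Nat.lt_ge_cases k 2) as [Hk|Hk].
    - exists O. split; [reflexivity|].
      assert (HS : forall x, square_sum N stageT k x = x).
      { intros x. apply functional_extensionality; intros c. unfold square_sum, xsum. rewrite (HN k Hk).
        unfold stageT. destruct (Nat.ltb_spec k 2); [|lia]. simpl. unfold opid. ring. }
      assert (HB1 : forall w, opb p (signed_sum N stageT k w) 1).
      { intros w. apply (opb_ext (fun x => xscale (RtoC (rad 1 0 w)) x)).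
        - intros x _. apply functional_extensionality; intros c. unfold signed_sum, xsum. rewrite (HN k Hk).
          unfold stageT. destruct (Nat.ltb_spec k 2); [|lia]. simpl. unfold opid, xscale. ring.
        - eapply opb_mono; [apply opb_scale, opb_id|]. rewrite Cnorm_RtoC, Rmult_1_r. apply Rabs_rad. }
      assert (HB2 : 1 <= B) by (unfold B; nra).
      split; [|split].
      + intros w _. split.
        * apply (opb_mono _ (1 * 1)); [|lra]. apply opb_comp; [apply HB1|apply opb_tl].
        * apply (opb_mono _ (1 * 1)); [|lra]. apply (opb_comp (tl O)); [apply opb_tl|apply HB1].
      + apply (opb_ext (fun _ => xzero)); [|apply opb_zero, pow_le; lra]. intros x _. rewrite HS. xext.
      + intros s w _ _. unfold th. destruct (Nat.ltb_spec k 2); [|lia]. apply Heb.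
    - assert (E1 : eventually (fun m => forall w, (w < 2 ^ N k)%nat ->
        opb p (fun x => signed_sum N stageT k w (tl m x)) B /\
        opb p (fun x => tl m (signed_sum N stageT k w x)) B)).
      { apply (eventually_fin (fun w m => opb p (fun x => signed_sum N stageT k w (tl m x)) B /\
          opb p (fun x => tl m (signed_sum N stageT k w x)) B)).
        intros w _. eapply essb_eventually; [now apply stage_signed_essb|]. unfold B. nra. }
      assert (E2 : eventually (fun m =>
        opb p (fun x => xsub (square_sum N stageT k (tl m x)) (tl m x)) ((/ 4) ^ S k))).
      { destruct (cptR_tail _ ((/ 4) ^ S k) (square_sum_cpt k Hk)) as [n1 Hn1]; [apply pow_lt; lra|].
        exists n1. exact Hn1. }
      assert (E3 : eventually (fun m => forall s, (s < S k)%nat -> forall w, (w < 2 ^ N k)%nat ->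
        (opb p (fun x => signed_sum N (defectR stageT A a s) k w (tl m x)) (th s k) /\
         opb p (fun x => tl m (signed_sum N (defectR stageT A a s) k w x)) (th s k)) /\
        (opb p (fun x => signed_sum N (defectL stageT A a s) k w (tl m x)) (th s k) /\
         opb p (fun x => tl m (signed_sum N (defectL stageT A a s) k w x)) (th s k)))).
      { apply eventually_fin. intros s _. apply eventually_fin. intros w _.
        assert (Hlt : Nn * (2 ^ d * thr s k) < th s k).
        { unfold th. destruct (Nat.ltb_spec k 2); [lia|]. specialize (Hik k). lra. }
        apply eventually_and; (eapply essb_eventually; [|exact Hlt]); apply defect_essb; auto;
          intros i; [now apply defectR_psi|now apply defectL_psi]. }
      destruct (eventually_and _ _ E1 (eventually_and _ _ E2 E3)) as [n0 Hn0].
      destruct (Hn0 n0 (le_n _)) as (F1 & F2 & F3). exists n0. split; [lia|]. split; [|split].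
      + intros w Hw. apply in_seq in Hw. apply F1; lia.
      + exact F2.
      + intros s w Hs Hw. apply in_seq in Hw. destruct (F3 s ltac:(lia) w ltac:(lia)) as [[? _] [_ ?]]. auto. }
  pose (N0 := fun k => proj1_sig (constructive_indefinite_description _ (HP k))).
  assert (HN0 : forall k, ((k < 2)%nat -> N0 k = O) /\
    (forall w, In w (patterns (N k)) ->
      opb p (fun x => signed_sum N stageT k w (tl (N0 k) x)) B /\
      opb p (fun x => tl (N0 k) (signed_sum N stageT k w x)) B) /\
    opb p (fun x => xsub (square_sum N stageT k (tl (N0 k) x)) (tl (N0 k) x)) ((/ 4) ^ S k) /\
    (forall s w, (s <= k)%nat -> In w (patterns (N k)) ->
      opb p (fun x => signed_sum N (defectR stageT A a s) k w (tl (N0 k) x)) (th s k) /\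
      opb p (fun x => tl (N0 k) (signed_sum N (defectL stageT A a s) k w x)) (th s k))).
  { intros k. exact (proj2_sig (constructive_indefinite_description _ (HP k))). }
  clearbody N0. clear HP.
  apply (dilation N stageT B N0 A a (fun s => hseq s x0) th).
  - apply stageT_opb.
  - intros s. apply psi_opb, cont_hseq.
  - apply HN0; lia.
  - apply HN0; lia.
  - unfold B. nra.
  - intros k. apply HN0.
  - intros k. apply HN0.
  - exact Hth.
  - intros s k w Hs Hw. now apply HN0.
  - intros s k w Hs Hw. now apply HN0.
  - intros s. destruct (cont_bounded d M Hcpt (hseq s) (cont_hseq s)) as (C & HC & HCm).
    exists C. split; [lra|]. split; [apply HCm|]. intros k i _. apply HCm.
Qed.

Definition etaf (h : Fn M) : Op := etaop N (fun k i => h (ctr k i)) (h x0).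

Lemma etaf_lin c f h x : etaf (fadd M (fscale M c f) h) x = xadd (xscale c (etaf f x)) (etaf h x).
Proof.
  unfold etaf, etaop.
  change (fun k i => fadd M (fscale M c f) h (ctr k i))
    with (fun k i => Cadd (Cmul c (f (ctr k i))) (h (ctr k i))).
  change (fadd M (fscale M c f) h x0) with (Cadd (Cmul c (f x0)) (h x0)).
  rewrite (etaI_add N c (fun k i => f (ctr k i)) (f x0) (fun k i => h (ctr k i)) (h x0)). reflexivity.
Qed.

Lemma etaf_opb h C : 0 <= C -> (forall m, Cnorm (h m) <= C) -> opb p (etaf h) ((1 + 2 * radK p) * C).
Proof. intros HC H. apply etaop_opb; auto. Qed.

(** * Extending the intertwining relations to all of C(M) *)

Section Intertwining.
Variables (V W : Op) (C : R).
Hypothesis HV : opb p V C.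
Hypothesis HW : opb p W C.

Definition good (h : Fn M) : Prop :=
  cptR p (fun x => xsub (V (psi h x)) (etaf h (V x))) /\
  cptR p (fun x => xsub (psi h (W x)) (W (etaf h x))).

Let Vl := opb_lin _ _ HV.
Let Wl := opb_lin _ _ HW.

Lemma etaf_inlp h x : cont d M h -> inlp p x -> inlp p (etaf h x).
Proof.
  intros Hh. destruct (cont_bounded d M Hcpt h Hh) as (D & HD & HDm).
  apply (opb_inlp _ ((1 + 2 * radK p) * D)). apply etaf_opb; [lra|assumption].
Qed.

Lemma psi_inlp h x : cont d M h -> inlp p x -> inlp p (psi h x).
Proof. intros Hh. destruct (psi_opb h Hh) as [D HD]. now apply (opb_inlp _ D). Qed.

Lemma good_lin c f h : cont d M f -> cont d M h -> good f -> good h -> good (fadd M (fscale M c f) h).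
Proof.
  intros Hf Hh [F1 F2] [H1 H2].
  pose proof (psi_lin c f h Hf Hh) as HL.
  assert (Hu : cont d M (fadd M (fscale M c f) h)) by now apply cont_lin.
  assert (HVi : forall x, inlp p x -> inlp p (V x)) by (intros; eapply opb_inlp; eauto).
  assert (HWi : forall x, inlp p x -> inlp p (W x)) by (intros; eapply opb_inlp; eauto).
  split.
  - eapply cptR_ext; [|apply (cptR_add _ _ (cptR_compl V _ C HV HL) (cptR_add _ _ (cptR_scale c _ F1) H1))].
    intros x Hx. cbv beta. rewrite etaf_lin.
    rewrite (lin_sub _ Vl), (lin_add _ Vl), (lin_scale _ Vl)
      by auto using inlp_add, inlp_scale, psi_inlp. xext.
  - eapply cptR_ext; [|apply (cptR_add _ _ (cptR_compr _ W C HW HL) (cptR_add _ _ (cptR_scale c _ F2) H2))].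
    intros x Hx. cbv beta. rewrite etaf_lin.
    rewrite (lin_add _ Wl), (lin_scale _ Wl) by auto using inlp_scale, etaf_inlp. xext.
Qed.

Lemma good_zero : good (fun _ => C0).
Proof.
  assert (Hz : forall x, etaf (fun _ => C0) x = xzero).
  { intros x. pose proof (etaf_lin C0 (fun _ => C0) (fun _ => C0) x) as H.
    replace (fadd M (fscale M C0 (fun _ => C0)) (fun _ => C0)) with (fun _ : {x : Pt | M x} => C0) in H
      by (apply functional_extensionality; intros m; unfold fadd, fscale; ring).
    pose proof (etaf_lin Cm1 (fun _ => C0) (fun _ => C0) x) as H'.
    replace (fadd M (fscale M Cm1 (fun _ => C0)) (fun _ => C0)) with (fun _ : {x : Pt | M x} => C0) in H'
      by (apply functional_extensionality; intros m; unfold fadd, fscale; ring).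
    rewrite H'. xext. }
  split.
  - eapply cptR_ext; [|apply (cptR_compl V _ C HV psi_zero)]. intros x _. rewrite Hz. xext.
  - eapply cptR_ext; [|apply (cptR_compr _ W C HW psi_zero)]. intros x _. rewrite Hz, (lin_zero _ Wl). xext.
Qed.

Lemma good_flin n c f : (forall i, (i < n)%nat -> cont d M (f i)) -> (forall i, (i < n)%nat -> good (f i)) ->
  good (flin M n c f).
Proof.
  induction n as [|n IH]; intros Hf H; [apply good_zero|].
  apply good_lin; [apply Hf; lia|apply cont_flin; intros; apply Hf; lia|apply H; lia|].
  apply IH; intros; [apply Hf|apply H]; lia.
Qed.

(** Write h = f + u with u uniformly small. The operator [psi u] has small essential norm but
    perhaps large norm, so it is split by [hd n] and [tl n]: the head part is compact and the tail
    part is small in norm. *)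
Lemma good_limit h : cont d M h ->
  (forall e, 0 < e -> exists f, cont d M f /\ good f /\ forall m, Cnorm (Csub (h m) (f m)) <= e) -> good h.
Proof.
  intros Hh Happ. pose proof map_norm_ge1 as HN1. pose proof (radK_ge0 p) as HK.
  pose proof (opb_ge0 _ _ HV) as HC.
  destruct (cont_bounded d M Hcpt h Hh) as (D & HD & HDm).
  pose proof (etaf_opb h D ltac:(lra) HDm) as OE. destruct (psi_opb h Hh) as [D' HD'].
  assert (HVi : forall x, inlp p x -> inlp p (V x)) by (intros; eapply opb_inlp; eauto).
  assert (HWi : forall x, inlp p x -> inlp p (W x)) by (intros; eapply opb_inlp; eauto).
  assert (Hhi : forall n x, inlp p x -> inlp p (hd n x)) by (intros; eapply opb_inlp; [apply opb_hd|auto]).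
  assert (Hti : forall n x, inlp p x -> inlp p (tl n x)) by (intros; eapply opb_inlp; [apply opb_tl|auto]).
  assert (Hsplit : forall eps, 0 < eps -> exists f u n e, cont d M f /\ good f /\ cont d M u /\
    h = fadd M (fscale M C1 f) u /\ 0 < e /\ (forall m, Cnorm (u m) <= e) /\
    opb p (fun x => psi u (tl n x)) (Nn * e + e) /\
    C * (Nn * e + e) + (1 + 2 * radK p) * e * C <= eps).
  { intros eps He. set (q := C * (Nn + 1) + (1 + 2 * radK p) * C).
    assert (Hq : 0 <= q) by (unfold q; nra).
    set (e := eps / (q + 1)). assert (He0 : 0 < e) by (apply Rdiv_lt_0_compat; lra).
    destruct (Happ e He0) as (f & Hf & Hgf & Hfe).
    set (u := fadd M (fscale M Cm1 f) h).
    assert (Hu : cont d M u) by now apply cont_lin.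
    assert (Hue : forall m, Cnorm (u m) <= e).
    { intros m. eapply Rle_trans; [|apply (Hfe m)]. right. f_equal. unfold u, fadd, fscale. cring. }
    destruct (psi_essb u e Hu He0 Hue e He0) as [n Hn]. destruct (Hn n (le_n _)) as [Hn1 _].
    exists f, u, n, e. do 3 (split; [assumption|]). split; [|do 3 (split; [assumption|])].
    - apply functional_extensionality; intros m. unfold u, fadd, fscale. cring.
    - replace (C * (Nn * e + e) + (1 + 2 * radK p) * e * C) with (q * e) by (unfold q; ring).
      unfold e. apply Rmult_le_reg_r with (q + 1); [lra|]. field_simplify; [|lra]. nra. }
  split.
  - apply (cptR_limit _ (C * D' + (1 + 2 * radK p) * D * C)).
    { apply opb_sub; apply opb_comp; assumption. }
    intros eps He. destruct (Hsplit eps He) as (f & u & n & e & Hf & [F1 _] & Hu & Ehu & He0 & Hue & Hn & Hle).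
    destruct (psi_opb u Hu) as [Du HDu].
    pose proof (psi_lin C1 f u Hf Hu) as HL. rewrite <- Ehu in HL.
    assert (Hcut : cptR p (fun x => psi u (hd n x))).
    { apply (cptR_maskR (psi u) Du _ n HDu).
      - intros c; destruct (c <? n)%nat; rewrite ?Rabs_R0, ?Rabs_R1; lra.
      - intros c Hc. destruct (Nat.ltb_spec c n); [lia|reflexivity]. }
    eexists. split.
    + apply (cptR_add _ _ F1 (cptR_compl V _ C HV (cptR_add _ _ HL Hcut))).
    + eapply opb_ext; [|eapply opb_mono; [|exact Hle]].
      2:{ apply (opb_sub (fun x => V (psi u (tl n x))) (fun x => etaf u (V x))); [apply opb_comp; assumption|].
          apply opb_comp; [apply etaf_opb; [lra|assumption]|assumption]. }
      intros x Hx. cbv beta.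
      assert (Ee : etaf h (V x) = xadd (xscale C1 (etaf f (V x))) (etaf u (V x))) by (rewrite Ehu; apply etaf_lin).
      assert (Eu : psi u x = xadd (psi u (hd n x)) (psi u (tl n x))).
      { rewrite <- (lin_add _ (opb_lin _ _ HDu)) by auto. now rewrite hd_tl. }
      rewrite Ee, (lin_add _ Vl), (lin_sub _ Vl), (lin_add _ Vl), (lin_scale _ Vl), Eu, (lin_add _ Vl)
        by auto using inlp_add, inlp_scale, inlp_sub, psi_inlp. xext.
  - apply (cptR_limit _ (D' * C + C * ((1 + 2 * radK p) * D))).
    { apply opb_sub; apply opb_comp; assumption. }
    intros eps He. destruct (Hsplit eps He) as (f & u & n & e & Hf & [_ F2] & Hu & Ehu & He0 & Hue & Hn & Hle).
    destruct (psi_opb u Hu) as [Du HDu].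
    pose proof (psi_lin C1 f u Hf Hu) as HL. rewrite <- Ehu in HL.
    assert (Hcut : cptR p (fun x => psi u (hd n x))).
    { apply (cptR_maskR (psi u) Du _ n HDu).
      - intros c; destruct (c <? n)%nat; rewrite ?Rabs_R0, ?Rabs_R1; lra.
      - intros c Hc. destruct (Nat.ltb_spec c n); [lia|reflexivity]. }
    eexists. split.
    + apply (cptR_add _ _ F2 (cptR_compr _ W C HW (cptR_add _ _ HL Hcut))).
    + eapply opb_ext; [|eapply opb_mono; [|exact Hle]].
      2:{ replace (C * (Nn * e + e) + (1 + 2 * radK p) * e * C)
            with ((Nn * e + e) * C + C * ((1 + 2 * radK p) * e)) by ring.
          apply (opb_sub (fun x => psi u (tl n (W x))) (fun x => W (etaf u x))).
          - apply (opb_comp (fun x => psi u (tl n x)) W); assumption.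
          - apply opb_comp; [assumption|apply etaf_opb; [lra|assumption]]. }
      intros x Hx. cbv beta.
      assert (Ee : etaf h x = xadd (xscale C1 (etaf f x)) (etaf u x)) by (rewrite Ehu; apply etaf_lin).
      assert (Eu : psi u (W x) = xadd (psi u (hd n (W x))) (psi u (tl n (W x)))).
      { rewrite <- (lin_add _ (opb_lin _ _ HDu)) by auto. now rewrite hd_tl. }
      rewrite Ee, (lin_add _ Wl), (lin_scale _ Wl), Eu by auto using inlp_scale, etaf_inlp. xext.
Qed.

(** The relations are linear in the function and stable under uniform limits, and by [approx_osc]
    combinations of the [hseq] come arbitrarily close to [h]. *)
Lemma good_all : (forall s, good (hseq s)) -> forall h, cont d M h -> good h.
Proof.
  intros Hs h Hh. apply good_limit; [assumption|]. intros e He.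
  destruct (osc_small h e Hh He) as [k0 Hk0]. set (k := max 2 k0).
  exists (flin M (N k) (fun i => h (ctr k i)) (fun i => fmul M (G k i) (G k i))).
  assert (Hc : forall i, cont d M (fmul M (G k i) (G k i))) by (intros; apply cont_mul; auto; apply Hgc).
  split; [now apply cont_flin|]. split.
  - apply good_flin; [auto|]. intros i _.
    (* [hseq] enumerates the squares from stage 2 on, hence the shift by 2. *)
    replace (fmul M (G k i) (G k i)) with (hseq (to_nat ((k - 2)%nat, i))); [apply Hs|].
    unfold hseq. rewrite cancel_of_to. cbn [fst snd].
    replace (k - 2 + 2)%nat with k by (unfold k; lia). reflexivity.
  - intros m. eapply Rle_trans; [apply approx_osc; [assumption|unfold k; lia]|]. apply Hk0. unfold k; lia.
Qed.

End Intertwining.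

(** [W] is replaced by Z W with Z the inverse of 1 + R0. As Z - 1 = - R0 Z is compact, the
    intertwining relations survive, and the bound doubles from [3 * B] to [6 * B]. *)
Theorem psi_split : exists V W : Op,
  opb p V B /\ opb p W (6 * B) /\ (forall x, inlp p x -> W (V x) = x) /\
  forall h, cont d M h ->
    cptR p (fun x => xsub (V (psi h x)) (etaf h (V x))) /\
    cptR p (fun x => xsub (psi h (W x)) (W (etaf h x))).
Proof.
  destruct psi_dilation as (V & W & HV & HW & HR & HRc & Hs).
  pose proof map_norm_ge1 as HN1.
  assert (HB0 : 0 <= B) by (unfold B; nra).
  set (R0 := fun x => xsub (W (V x)) x) in *.
  destruct (neumann R0 HR) as (Z & HZ & HZ1 & HZ2).
  assert (Hall : forall h, cont d M h -> good V W h).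
  { apply (good_all V W (3 * B)); [eapply opb_mono; [exact HV|lra]|assumption|]. exact Hs. }
  assert (HWi : forall x, inlp p x -> inlp p (W x)) by (intros; eapply opb_inlp; eauto).
  assert (HVi : forall x, inlp p x -> inlp p (V x)) by (intros; eapply opb_inlp; eauto).
  assert (HZi : forall x, inlp p x -> inlp p (Z x)) by (intros; eapply opb_inlp; eauto).
  assert (HRi : forall x, inlp p x -> inlp p (R0 x)) by (intros; eapply opb_inlp; eauto).
  assert (HZc : cptR p (fun x => xsub (Z x) x)).
  { eapply cptR_ext; [|apply (cptR_scale Cm1), (cptR_compr R0 Z 2 HZ HRc)].
    intros x Hx. cbv beta. rewrite <- (HZ2 x Hx) at 3. xext. }
  exists V, (fun x => Z (W x)). split; [assumption|]. split; [|split].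
  - replace (6 * B) with (2 * (3 * B)) by ring. now apply opb_comp.
  - intros x Hx. rewrite <- (HZ1 x Hx) at 2. f_equal. unfold R0. xext.
  - intros h Hh. destruct (Hall h Hh) as [G1 G2]. split; [exact G1|].
    destruct (psi_opb h Hh) as [D HD].
    destruct (cont_bounded d M Hcpt h Hh) as (E & HE & HEm).
    eapply cptR_ext; [|apply (cptR_add _ _ (cptR_compl Z _ 2 HZ G2)
      (cptR_compr _ W _ HW (cptR_sub _ _ (cptR_compl (psi h) _ D HD HZc) (cptR_compr _ (psi h) D HD HZc))))].
    intros x Hx. cbv beta.
    rewrite (lin_sub _ (opb_lin _ _ HZ)) by (auto using psi_inlp, etaf_inlp).
    rewrite (lin_sub _ (opb_lin _ _ HD)) by auto. xext.
Qed.

End Psi.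
End Calkin.

(** * Direct sums *)

(** (c / (a + b))^p <= c / (a + b) for c between 0 and a + b; apply this to [a] and [b]. It bounds
    the norm of the direct sum by the sum of the norms. *)
Lemma rpow_superadd p a b : 1 < p -> 0 <= a -> 0 <= b -> rpow a p + rpow b p <= rpow (a + b) p.
Proof.
  intros Hp Ha Hb. destruct (Req_dec (a + b) 0) as [E|E].
  { replace a with 0 by lra. replace b with 0 by lra. rewrite Rplus_0_r, !rpow_0. lra. }
  assert (Hs : 0 < a + b) by lra.
  assert (Hi : 0 < / (a + b)) by now apply Rinv_0_lt_compat.
  assert (G : forall c, 0 <= c <= a + b -> rpow c p <= rpow (a + b) p * (c / (a + b))).
  { intros c Hc. replace c with ((a + b) * (c / (a + b))) at 1 by (field; lra).
    assert (0 <= c / (a + b)) by (apply Rmult_le_pos; lra).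
    rewrite rpow_mul by lra. apply Rmult_le_compat_l; [apply rpow_ge0|].
    apply rpow_le_base; [lra|]. split; [assumption|].
    apply Rmult_le_reg_r with (a + b); [assumption|]. unfold Rdiv. rewrite Rmult_assoc, Rinv_l; lra. }
  pose proof (G a ltac:(lra)). pose proof (G b ltac:(lra)).
  replace (rpow (a + b) p) with (rpow (a + b) p * (a / (a + b)) + rpow (a + b) p * (b / (a + b)))
    by (field; lra). lra.
Qed.

Section DirectSum.
Context {p : R} {hp : Exponent p}.

Let p0 : 0 < p := exponent_gt0.
Let pn : p <> 0 := exponent_neq0.

Lemma nrm2_fst (z : seqC * seqC) : nrm (lp p) (fst z) <= nrm (lp2 p) z.
Proof.
  change (nrm (lp2 p) z) with (rpow (rpow (nrm (lp p) (fst z)) p + rpow (nrm (lp p) (snd z)) p) (/ p)).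
  rewrite <- (rpow_inv_r (nrm (lp p) (fst z)) p) at 1 by auto using nrm_ge0.
  apply rpow_le; [now apply Rinv_0_lt_compat|].
  pose proof (rpow_ge0 (nrm (lp p) (fst z)) p). pose proof (rpow_ge0 (nrm (lp p) (snd z)) p). lra.
Qed.

Lemma nrm2_snd (z : seqC * seqC) : nrm (lp p) (snd z) <= nrm (lp2 p) z.
Proof.
  change (nrm (lp2 p) z) with (rpow (rpow (nrm (lp p) (fst z)) p + rpow (nrm (lp p) (snd z)) p) (/ p)).
  rewrite <- (rpow_inv_r (nrm (lp p) (snd z)) p) at 1 by auto using nrm_ge0.
  apply rpow_le; [now apply Rinv_0_lt_compat|].
  pose proof (rpow_ge0 (nrm (lp p) (fst z)) p). pose proof (rpow_ge0 (nrm (lp p) (snd z)) p). lra.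
Qed.

Lemma nrm2_le (z : seqC * seqC) : nrm (lp2 p) z <= nrm (lp p) (fst z) + nrm (lp p) (snd z).
Proof.
  change (nrm (lp2 p) z) with (rpow (rpow (nrm (lp p) (fst z)) p + rpow (nrm (lp p) (snd z)) p) (/ p)).
  assert (H1 := nrm_ge0 (p := p) (fst z)). assert (H2 := nrm_ge0 (p := p) (snd z)).
  rewrite <- (rpow_inv_r (nrm (lp p) (fst z) + nrm (lp p) (snd z)) p) by (auto; lra).
  apply rpow_le; [now apply Rinv_0_lt_compat|].
  pose proof (rpow_ge0 (nrm (lp p) (fst z)) p). pose proof (rpow_ge0 (nrm (lp p) (snd z)) p).
  split; [lra|]. now apply rpow_superadd.
Qed.

Lemma nrm2_ge0 (z : seqC * seqC) : 0 <= nrm (lp2 p) z.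
Proof. apply rpow_ge0. Qed.

Lemma opb_nrm T C x : opb p T C -> mem (lp p) x -> nrm (lp p) (T x) <= C * nrm (lp p) x.
Proof. intros HT Hx. apply lpB_mem, (opb_bd _ _ _ _ HT), mem_lpB, Hx. Qed.

Lemma row_op (S1 S2 : Op) C1 C2 : opb p S1 C1 -> opb p S2 C2 ->
  let S := fun z => xadd (S1 (fst z)) (S2 (snd z)) in
  bounded_op (lp2 p) (lp p) S /\ opnorm (lp2 p) (lp p) S <= C1 + C2.
Proof.
  intros H1 H2 S.
  assert (Hn : forall z, mem (lp2 p) z -> nrm (lp p) (S z) <= (C1 + C2) * nrm (lp2 p) z).
  { intros z [Hz1 Hz2].
    assert (L : lpB p (S z) (C1 * nrm (lp p) (fst z) + C2 * nrm (lp p) (snd z))).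
    { apply lpB_add; [apply (opb_bd _ _ _ _ H1)|apply (opb_bd _ _ _ _ H2)]; now apply mem_lpB. }
    eapply Rle_trans; [apply (lpB_mem _ _ L)|]. rewrite Rmult_plus_distr_r.
    apply Rplus_le_compat; apply Rmult_le_compat_l; auto using nrm2_fst, nrm2_snd;
      [apply (opb_ge0 _ _ H1)|apply (opb_ge0 _ _ H2)]. }
  pose proof (opb_ge0 _ _ H1). pose proof (opb_ge0 _ _ H2).
  split; [split; [|split]|].
  - intros z [Hz1 Hz2]. apply mem_inlp, inlp_add; (eapply opb_inlp; [eassumption|now apply mem_inlp]).
  - intros a z z' [Hz1 Hz2] [Hz1' Hz2'].
    change (xadd (S1 (xadd (xscale a (fst z)) (fst z'))) (S2 (xadd (xscale a (snd z)) (snd z'))) =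
      xadd (xscale a (S z)) (S z')).
    rewrite (opb_lin _ _ H1), (opb_lin _ _ H2) by now apply mem_inlp. unfold S. xext.
  - exists (C1 + C2). exact Hn.
  - apply supR_le; [lra|]. intros y (z & Hz & Hz1 & ->). eapply Rle_trans; [now apply Hn|].
    pose proof (nrm2_ge0 z). nra.
Qed.

Lemma column_op (S1 S2 : Op) C1 C2 : opb p S1 C1 -> opb p S2 C2 ->
  let S := fun x => (S1 x, S2 x) in
  bounded_op (lp p) (lp2 p) S /\ opnorm (lp p) (lp2 p) S <= C1 + C2.
Proof.
  intros H1 H2 S.
  assert (Hn : forall x, mem (lp p) x -> nrm (lp2 p) (S x) <= (C1 + C2) * nrm (lp p) x).
  { intros x Hx. eapply Rle_trans; [apply nrm2_le|]. unfold S. cbn [fst snd]. rewrite Rmult_plus_distr_r.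
    apply Rplus_le_compat; now apply opb_nrm. }
  pose proof (opb_ge0 _ _ H1). pose proof (opb_ge0 _ _ H2).
  split; [split; [|split]|].
  - intros x Hx. apply mem_inlp in Hx. split; apply mem_inlp;
      [exact (opb_inlp _ _ _ H1 Hx)|exact (opb_inlp _ _ _ H2 Hx)].
  - intros a x x' Hx Hx'.
    change ((S1 (xadd (xscale a x) x'), S2 (xadd (xscale a x) x')) =
      (xadd (xscale a (S1 x)) (S1 x'), xadd (xscale a (S2 x)) (S2 x'))).
    now rewrite (opb_lin _ _ H1), (opb_lin _ _ H2) by now apply mem_inlp.
  - exists (C1 + C2). exact Hn.
  - apply supR_le; [lra|]. intros y (x & Hx & Hx1 & ->). eapply Rle_trans; [now apply Hn|].
    pose proof (nrm_ge0 (p := p) x). nra.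
Qed.

Lemma opnorm2_ge0 S C : bounded_op (lp p) (lp2 p) S -> (forall x, mem (lp p) x -> nrm (lp p) x <= 1 ->
  nrm (lp2 p) (S x) <= C) -> 0 <= opnorm (lp p) (lp2 p) S.
Proof.
  intros _ HC. eapply Rle_trans; [apply (nrm2_ge0 (S xzero))|].
  destruct (lpB_mem xzero 1 (lpB_zero (p := p) 1 Rle_0_1)) as [H1 H2].
  apply (supR_ub _ C); [|exists xzero; auto].
  intros y (x & Hx & Hx1 & ->). auto.
Qed.

Lemma opnorm_col_ge0 (S1 S2 : Op) C1 C2 : opb p S1 C1 -> opb p S2 C2 ->
  0 <= opnorm (lp p) (lp2 p) (fun x => (S1 x, S2 x)).
Proof.
  intros H1 H2. apply (opnorm2_ge0 _ (C1 + C2)); [apply (column_op S1 S2 C1 C2 H1 H2)|].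
  intros x Hx Hx1. eapply Rle_trans; [apply nrm2_le|]. cbn [fst snd].
  pose proof (opb_nrm S1 C1 x H1 Hx). pose proof (opb_nrm S2 C2 x H2 Hx).
  pose proof (opb_ge0 _ _ H1). pose proof (opb_ge0 _ _ H2). pose proof (nrm_ge0 (p := p) x). nra.
Qed.

End DirectSum.

(** * Absorption of [psi] by eta *)

Section Absorption.
Context {p : R} {hp : Exponent p}.
Variables (d : nat) (M : Pt -> Prop).
Hypothesis Hcpt : seq_compact d M.
Variable x0 : {x : Pt | M x}.
Variables (N : nat -> nat) (ctr : nat -> nat -> {x : Pt | M x}).

Let eta : Fn M -> Op := etaf M x0 N ctr.

Lemma eta_mul g h x : eta (fmul M g h) x = eta g (eta h x).
Proof.
  unfold eta, etaf, etaop. rewrite push_pull, etaI_mul. reflexivity.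
Qed.

Lemma eta_one x : eta (fone M) x = x.
Proof. unfold eta, etaf, etaop, fone. rewrite etaI_one. apply pull_push. Qed.

Lemma eta_opb h : cont d M h -> opb p (eta h) ((1 + 2 * radK p) * supnorm M h).
Proof.
  intros Hh. apply etaf_opb.
  - eapply (supnorm_ge0 d); eauto. exists (proj1_sig x0). apply proj2_sig.
  - intros m. now apply (supnorm_ub d).
Qed.

Lemma eta_unital_hom : unital_hom p d M eta.
Proof.
  split; [|split; [|split]].
  - intros h Hh. apply Bp_opb. eexists. now apply eta_opb.
  - intros a g h Hg Hh x _. apply (etaf_lin M x0 N ctr a g h x).
  - intros g h Hg Hh x _. apply eta_mul.
  - intros x _. apply eta_one.
Qed.

Variable psi : Fn M -> Op.
Hypothesis Hpsi : forall h, cont d M h -> exists C, opb p (psi h) C.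
Variables (V W : Op) (CV CW : R).
Hypothesis HV : opb p V CV.
Hypothesis HW : opb p W CW.
Hypothesis HWV : forall x, inlp p x -> W (V x) = x.
Hypothesis HDV : forall h, cont d M h -> cptR p (fun x => xsub (V (psi h x)) (eta h (V x))).
Hypothesis HDW : forall h, cont d M h -> cptR p (fun x => xsub (psi h (W x)) (W (eta h x))).

Definition cop (x : seqC) : seqC := xsub x (V (W x)).
(** The first term compresses eta to the range of 1 - V W; the second is an exact copy of eta on the
    range of V. This copy supplies both the lower bound and the second summand of eta (+) eta. *)
Definition psim (h : Fn M) : Op := fun x => xadd (cop (eta h (cop x))) (V (eta h (W x))).

Let Vl := opb_lin _ _ HV.
Let Wl := opb_lin _ _ HW.
Lemma V_inlp x : inlp p x -> inlp p (V x). Proof. intros; eapply opb_inlp; eauto. Qed.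
Lemma W_inlp x : inlp p x -> inlp p (W x). Proof. intros; eapply opb_inlp; eauto. Qed.

Lemma cop_opb : opb p cop (1 + CV * CW).
Proof. apply (opb_sub (fun x => x)); [apply opb_id|now apply opb_comp]. Qed.

Let Ql := opb_lin _ _ cop_opb.
Lemma cop_inlp x : inlp p x -> inlp p (cop x). Proof. intros; eapply opb_inlp; [apply cop_opb|auto]. Qed.

Lemma eta_inlp h x : cont d M h -> inlp p x -> inlp p (eta h x).
Proof. intros Hh. apply (opb_inlp _ _ _ (eta_opb h Hh)). Qed.

Let El h (Hh : cont d M h) := opb_lin _ _ (eta_opb h Hh).

Lemma W_cop x : inlp p x -> W (cop x) = xzero.
Proof.
  intros Hx. unfold cop. rewrite (lin_sub _ Wl) by auto using V_inlp, W_inlp. rewrite HWV by auto using W_inlp. xext.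
Qed.

Lemma cop_V x : inlp p x -> cop (V x) = xzero.
Proof. intros Hx. unfold cop. rewrite HWV by assumption. xext. Qed.

Lemma cop_cop x : inlp p x -> cop (cop x) = cop x.
Proof.
  intros Hx. unfold cop at 1. rewrite W_cop, (lin_zero _ Vl) by assumption. xext.
Qed.

Lemma psim_opb h C : cont d M h -> opb p (eta h) C ->
  opb p (psim h) ((1 + CV * CW) * (C * (1 + CV * CW)) + CV * (C * CW)).
Proof.
  intros Hh HC. pose proof cop_opb as HQ. apply opb_add.
  - apply (opb_comp cop (fun x => eta h (cop x))); [assumption|]. now apply opb_comp.
  - apply (opb_comp V (fun x => eta h (W x))); [assumption|]. now apply opb_comp.
Qed.

Lemma cop_psim h x : cont d M h -> inlp p x -> cop (psim h x) = cop (eta h (cop x)).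
Proof.
  intros Hh Hx. unfold psim.
  rewrite (lin_add _ Ql) by auto using cop_inlp, eta_inlp, V_inlp, W_inlp.
  rewrite cop_cop, cop_V by auto using cop_inlp, eta_inlp, V_inlp, W_inlp. xext.
Qed.

Lemma W_psim h x : cont d M h -> inlp p x -> W (psim h x) = eta h (W x).
Proof.
  intros Hh Hx. unfold psim.
  rewrite (lin_add _ Wl) by auto using cop_inlp, eta_inlp, V_inlp, W_inlp.
  rewrite W_cop, HWV by auto using cop_inlp, eta_inlp, V_inlp, W_inlp. xext.
Qed.

(** With Q = [cop], the failure of multiplicativity is Q eta(g) V W eta(h) Q. It is compact because
    W eta(h) Q equals psi(h) W Q modulo compacts, and W Q = 0. *)
Lemma psim_mul g h : cont d M g -> cont d M h ->
  cptR p (fun x => xsub (psim (fmul M g h) x) (psim g (psim h x))).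
Proof.
  intros Hg Hh.
  assert (HK : cptR p (fun x => cop (eta g (V (xsub (psi h (W (cop x))) (W (eta h (cop x)))))))).
  { apply (cptR_compl cop _ _ cop_opb), (cptR_compl (eta g) _ _ (eta_opb g Hg)), (cptR_compl V _ _ HV).
    apply (cptR_compr (fun x => xsub (psi h (W x)) (W (eta h x))) cop _ cop_opb), HDW, Hh. }
  eapply cptR_ext; [|apply (cptR_scale Cm1 _ HK)]. intros x Hx. cbv beta.
  destruct (Hpsi h Hh) as [D HD].
  rewrite W_cop, (lin_zero _ (opb_lin _ _ HD)) by assumption.
  unfold psim at 2. rewrite cop_psim, W_psim by assumption.
  unfold psim. rewrite !eta_mul.
  set (y := eta h (cop x)). assert (Hy : inlp p y) by (apply eta_inlp; auto using cop_inlp).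
  replace (xsub xzero (W y)) with (xscale Cm1 (W y)) by xext.
  rewrite (lin_scale _ Vl), (lin_scale _ (El g Hg)), (lin_scale _ Ql) by auto using W_inlp, V_inlp, eta_inlp.
  assert (E : cop (eta g (cop y)) = xsub (cop (eta g y)) (cop (eta g (V (W y))))).
  { unfold cop at 2. rewrite (lin_sub _ (El g Hg)), (lin_sub _ Ql) by auto using W_inlp, V_inlp, eta_inlp. reflexivity. }
  rewrite E. xext.
Qed.

Lemma psim_unital_hom : calk_unital_hom p d M psim.
Proof.
  split; [|split; [|split]].
  - intros h Hh. apply Bp_opb. eexists. apply psim_opb; [assumption|now apply eta_opb].
  - intros a g h Hg Hh. apply (cptR_Kp (p := p)). apply (cptR_ext (fun _ => xzero)); [|apply cptR_zero].
    intros x Hx.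
    change (xzero = xsub (psim (fadd M (fscale M a g) h) x) (xadd (xscale a (psim g x)) (psim h x))).
    unfold psim, eta. rewrite !(etaf_lin M x0 N ctr). fold eta.
    rewrite Ql, Vl by auto using cop_inlp, eta_inlp, V_inlp, W_inlp. xext.
  - intros g h Hg Hh. apply (cptR_Kp (p := p)). now apply psim_mul.
  - apply (cptR_Kp (p := p)). apply (cptR_ext (fun _ => xzero)); [|apply cptR_zero].
    intros x Hx. change (xzero = xsub (psim (fone M) x) x).
    unfold psim. rewrite !eta_one, cop_cop by assumption. unfold cop. xext.
Qed.

(* Conjugating by [V] and [W] recovers eta from psim. *)
Lemma psim_bounded_below c : 0 < c -> (forall h, cont d M h -> c * supnorm M h <= calknorm p (eta h)) ->
  calk_bounded_below p d M psim.
Proof.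
  intros Hc Hlow. pose proof (radK_ge0 p) as HK.
  pose proof (opb_ge0 _ _ HV) as HV0. pose proof (opb_ge0 _ _ HW) as HW0.
  set (Q := 1 + CV * CW). assert (HQ : 1 <= Q) by (unfold Q; nra).
  exists (c / Q), (Q * ((1 + 2 * radK p) * Q) + CV * ((1 + 2 * radK p) * CW)).
  split; [apply Rdiv_lt_0_compat; lra|]. split.
  { assert (0 < Q * ((1 + 2 * radK p) * Q)) by (repeat apply Rmult_lt_0_compat; lra).
    assert (0 <= CV * ((1 + 2 * radK p) * CW)) by (repeat apply Rmult_le_pos; lra). lra. }
  intros h Hh. split.
  - assert (Ob : exists C, opb p (psim h) C) by (eexists; apply psim_opb; [assumption|now apply eta_opb]).
    assert (H : calknorm p (eta h) <= Q * calknorm p (psim h)).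
    { apply le_epsilon; intros e He.
      destruct (calknorm_approx (psim h) (e / Q) Ob) as (K & HK' & HKb); [apply Rdiv_lt_0_compat; lra|].
      pose proof (calknorm_ge0 (psim h) Ob) as Hn0.
      assert (He' : 0 < e / Q) by (apply Rdiv_lt_0_compat; lra).
      apply Rle_trans with (CW * ((calknorm p (psim h) + e / Q) * CV)).
      - apply (calknorm_le (eta h) (fun x => W (K (V x)))).
        + eexists; now apply eta_opb.
        + apply (cptR_compl W _ CW HW). now apply (cptR_compr K V CV HV).
        + eapply opb_ext; [|apply (opb_comp W _ _ _ HW (opb_comp _ V _ _ HKb HV))].
          intros x Hx. cbv beta. destruct HK' as [[D HD] _]. destruct Ob as [C HC].
          rewrite (lin_add _ Wl) by (eapply opb_inlp; [eassumption|auto using V_inlp]).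
          rewrite W_psim, HWV by auto using V_inlp. reflexivity.
      - replace (CW * ((calknorm p (psim h) + e / Q) * CV)) with (CV * CW * (calknorm p (psim h) + e / Q)) by ring.
        apply Rle_trans with (Q * (calknorm p (psim h) + e / Q)).
        + apply Rmult_le_compat_r; [lra|]. unfold Q. lra.
        + right. field. lra. }
    specialize (Hlow h Hh). apply Rmult_le_reg_l with Q; [lra|].
    replace (Q * (c / Q * supnorm M h)) with (c * supnorm M h) by (field; lra). lra.
  - eapply Rle_trans; [apply (calknorm_opb (psim h)), psim_opb; [assumption|now apply eta_opb]|].
    fold Q. right. ring.
Qed.

(** The row (V, 1 - V W) is written into the even copies and the row (0, W) into the odd ones; with
    l^p identified with its double in this way, eta (+) eta becomes eta. *)
Definition Sop (z : seqC * seqC) : seqC :=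
  xadd (spread 0 (V (fst z))) (xadd (spread 0 (cop (snd z))) (spread 1 (W (snd z)))).
Definition Sinv (x : seqC) : seqC * seqC :=
  (W (half 0 x), xadd (cop (half 0 x)) (V (half 1 x))).

Lemma Sop_parts : opb p (fun x => spread 0 (V x)) (1 * CV) /\
  opb p (fun y => xadd (spread 0 (cop y)) (spread 1 (W y))) (1 * (1 + CV * CW) + 1 * CW).
Proof.
  split.
  - apply opb_comp; [apply opb_spread; lia|assumption].
  - apply opb_add; (apply opb_comp; [apply opb_spread; lia|]); [apply cop_opb|assumption].
Qed.

Lemma Sinv_parts : opb p (fun x => W (half 0 x)) (CW * 1) /\
  opb p (fun x => xadd (cop (half 0 x)) (V (half 1 x))) ((1 + CV * CW) * 1 + CV * 1).
Proof.
  split; [apply opb_comp; [assumption|apply opb_half]|].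
  apply opb_add; (apply opb_comp; [|apply opb_half]); [apply cop_opb|assumption].
Qed.

Lemma half_inlp b x : inlp p x -> inlp p (half b x).
Proof. intros; eapply opb_inlp; [apply opb_half|auto]. Qed.

Lemma spread_inlp b x : (b < 2)%nat -> inlp p x -> inlp p (spread b x).
Proof. intros; eapply opb_inlp; [now apply opb_spread|auto]. Qed.

Lemma half_parts b b' x y : (b < 2)%nat -> (b' < 2)%nat -> b <> b' -> inlp p x -> inlp p y ->
  half b (xadd (spread b x) (spread b' y)) = x.
Proof.
  intros Hb Hb' Hne Hx Hy. rewrite (lin_add _ (opb_lin _ _ (opb_half b))) by auto using spread_inlp.
  rewrite half_spread, half_spread_ne by assumption. xext.
Qed.

Lemma Sop_alt z : inlp p (fst z) -> inlp p (snd z) ->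
  Sop z = xadd (spread 0 (xadd (V (fst z)) (cop (snd z)))) (spread 1 (W (snd z))).
Proof.
  destruct z as [x y]; cbn [fst snd]. intros H1 H2. unfold Sop; cbn [fst snd].
  rewrite (lin_add (spread 0) (opb_lin (p := p) _ _ (opb_spread 0 ltac:(lia)))) by auto using V_inlp, cop_inlp.
  xext.
Qed.

Lemma S_invertible : invertible_pair (lp2 p) (lp p) Sop Sinv.
Proof.
  destruct Sop_parts as [P1 P2]. destruct Sinv_parts as [P3 P4].
  split; [exact (proj1 (row_op _ _ _ _ P1 P2))|].
  split; [exact (proj1 (column_op _ _ _ _ P3 P4))|]. split.
  - intros [x y] [Hx Hy]. apply (mem_inlp (p := p)) in Hx, Hy. cbn [fst snd] in Hx, Hy. unfold Sinv.
    rewrite Sop_alt by assumption. cbn [fst snd].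
    assert (E0 : half 0 (xadd (spread 0 (xadd (V x) (cop y))) (spread 1 (W y))) = xadd (V x) (cop y)).
    { apply half_parts; auto using inlp_add, V_inlp, cop_inlp, W_inlp; lia. }
    assert (E1 : half 1 (xadd (spread 0 (xadd (V x) (cop y))) (spread 1 (W y))) = W y).
    { replace (xadd (spread 0 (xadd (V x) (cop y))) (spread 1 (W y)))
        with (xadd (spread 1 (W y)) (spread 0 (xadd (V x) (cop y)))) by xext.
      apply half_parts; auto using inlp_add, V_inlp, cop_inlp, W_inlp; lia. }
    rewrite E0, E1. f_equal.
    + rewrite (lin_add _ Wl), HWV, W_cop by auto using V_inlp, cop_inlp. xext.
    + rewrite (lin_add _ Ql), cop_V, cop_cop by auto using V_inlp, cop_inlp. unfold cop. xext.
  - intros x Hx. apply (mem_inlp (p := p)) in Hx. rewrite Sop_alt; unfold Sinv; cbn [fst snd];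
      auto using inlp_add, V_inlp, cop_inlp, W_inlp, half_inlp.
    rewrite (lin_add _ Ql), (lin_add _ Wl), cop_cop, cop_V, W_cop, HWV by auto using V_inlp, cop_inlp, half_inlp.
    transitivity (xadd (spread 0 (half 0 x)) (spread 1 (half 1 x))); [|apply spread_half].
    f_equal; f_equal; unfold cop; xext.
Qed.

Lemma S_opnorms : opnorm (lp2 p) (lp p) Sop * opnorm (lp p) (lp2 p) Sinv <=
  (CV + (1 + CV * CW) + CW) * (CW + (1 + CV * CW) + CV).
Proof.
  destruct Sop_parts as [P1 P2]. destruct Sinv_parts as [P3 P4].
  pose proof (proj2 (row_op _ _ _ _ P1 P2)) as N1. pose proof (proj2 (column_op _ _ _ _ P3 P4)) as N2.
  pose proof (opnorm_col_ge0 _ _ _ _ P3 P4) as N3.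
  pose proof (opb_ge0 _ _ HV). pose proof (opb_ge0 _ _ HW).
  apply Rle_trans with ((CV + (1 + CV * CW) + CW) * opnorm (lp p) (lp2 p) Sinv).
  - apply Rmult_le_compat_r; [exact N3|]. eapply Rle_trans; [exact N1|]. lra.
  - apply Rmult_le_compat_l; [nra|]. eapply Rle_trans; [exact N2|]. lra.
Qed.

(** Only the even block carries an error: the odd block is W psim V = eta exactly. *)
Lemma S_conjugates h : cont d M h ->
  cptR p (fun x => xsub (eta h x) (Sop (opsum (psi h) (psim h) (Sinv x)))).
Proof.
  intros Hh. destruct (Hpsi h Hh) as [D HD].
  assert (Hpi : forall x, inlp p x -> inlp p (psi h x)) by (intros; eapply opb_inlp; eauto).
  assert (Hmi : forall x, inlp p x -> inlp p (psim h x)).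
  { intros x Hx. unfold psim. auto using inlp_add, cop_inlp, eta_inlp, V_inlp, W_inlp. }
  (* Expand Q eta Q with Q = 1 - V W, and use eta V = V psi and W eta = psi W modulo compacts
     together with W V = 1: what remains of it is eta - V psi W. *)
  assert (HK : cptR p (fun a => xsub (eta h a) (xadd (V (psi h (W a))) (cop (eta h (cop a)))))).
  { pose proof (HDV h Hh) as D1. pose proof (HDW h Hh) as D2.
    pose proof (cptR_compr _ W CW HW D1) as D1W.
    eapply cptR_ext; [|apply (cptR_sub _ _ (cptR_compl V _ CV HV (cptR_compl W _ CW HW D1W))
      (cptR_add _ _ (cptR_compl V _ CV HV D2) D1W))].
    intros a Ha. cbv beta.
    rewrite !(lin_sub _ Wl) by auto using V_inlp, W_inlp, eta_inlp.
    rewrite HWV by auto using W_inlp.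
    rewrite !(lin_sub _ Vl) by auto using V_inlp, W_inlp, eta_inlp.
    assert (E : cop (eta h (cop a)) = xsub (xsub (eta h a) (eta h (V (W a))))
       (xsub (V (W (eta h a))) (V (W (eta h (V (W a))))))).
    { unfold cop at 2. rewrite (lin_sub _ (El h Hh)) by auto using V_inlp, W_inlp. unfold cop.
      rewrite (lin_sub _ Wl), (lin_sub _ Vl) by auto using V_inlp, W_inlp, eta_inlp. reflexivity. }
    rewrite E. xext. }
  pose proof (opb_spread (p := p) 0 ltac:(lia)) as O0. pose proof (opb_spread (p := p) 1 ltac:(lia)) as O1.
  eapply cptR_ext; [|apply (cptR_compl (spread 0) _ 1 O0 (cptR_compr _ (half 0) 1 (opb_half 0) HK))].
  intros x Hx. cbv beta. unfold opsum. rewrite Sop_alt by (unfold Sinv; cbn [fst snd]; auto using inlp_add, V_inlp, cop_inlp, W_inlp, half_inlp).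
  unfold Sinv; cbn [fst snd].
  assert (Hy : inlp p (xadd (cop (half 0 x)) (V (half 1 x)))) by auto using inlp_add, V_inlp, cop_inlp, half_inlp.
  rewrite cop_psim, W_psim by assumption.
  rewrite (lin_add _ Ql), (lin_add _ Wl), cop_cop, cop_V, W_cop, HWV by auto using V_inlp, cop_inlp, half_inlp.
  replace (xadd (cop (half 0 x)) xzero) with (cop (half 0 x)) by xext.
  replace (xadd xzero (half 1 x)) with (half 1 x) by xext.
  assert (E : eta h x = xadd (spread 0 (eta h (half 0 x))) (spread 1 (eta h (half 1 x)))).
  { rewrite <- (spread_half (eta h x)). unfold eta, etaf. now rewrite !half_etaop. }
  rewrite E, (lin_sub _ (opb_lin _ _ O0)) by auto 10 using inlp_add, V_inlp, cop_inlp, eta_inlp, W_inlp, half_inlp. xext.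
Qed.

End Absorption.

(** * Assembling the theorem *)

Lemma fine_partitions d M (x0 : {x : Pt | M x}) : seq_compact d M -> (1 <= d)%nat ->
  exists (N : nat -> nat) (g : nat -> nat -> {x : Pt | M x} -> R) (ctr : nat -> nat -> {x : Pt | M x}),
    (forall k, (k < 2)%nat -> N k = 1%nat) /\
    (forall k i, cont d M (fun m => RtoC (g k i m))) /\ (forall k i m, 0 <= g k i m) /\
    (forall k m, (2 <= k)%nat -> lsum (seq 0 (N k)) (fun i => g k i m * g k i m) = 1) /\
    (forall k m, (2 <= k)%nat -> lsum (seq 0 (N k)) (fun i => g k i m) <= 2 ^ d) /\
    (forall k i m, (2 <= k)%nat -> g k i m <> 0 ->
      dist d (proj1_sig (ctr k i)) (proj1_sig m) <= / (INR k + 1)).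
Proof.
  intros Hc Hd.
  assert (Hk : forall k, 0 < / (INR k + 1)).
  { intros k. pose proof (pos_INR k). apply Rinv_0_lt_compat; lra. }
  pose (pt := {x : Pt | M x}).
  assert (P : forall k, exists t : nat * (nat -> pt -> R) * (nat -> pt),
    (forall i, cont d M (fun m => RtoC (snd (fst t) i m))) /\ (forall i m, 0 <= snd (fst t) i m) /\
    (forall m, lsum (seq 0 (fst (fst t))) (fun i => snd (fst t) i m * snd (fst t) i m) = 1) /\
    (forall m, lsum (seq 0 (fst (fst t))) (fun i => snd (fst t) i m) <= 2 ^ d) /\
    (forall i m, snd (fst t) i m <> 0 -> dist d (proj1_sig (snd t i)) (proj1_sig m) <= / (INR k + 1))).
  { intros k. destruct (partition_of_unity d M Hc x0 _ Hd (Hk k)) as (n & g & ctr & H).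
    exists (n, g, ctr). exact H. }
  pose (t := fun k => proj1_sig (constructive_indefinite_description _ (P k))).
  pose proof (fun k => proj2_sig (constructive_indefinite_description _ (P k))) as Ht.
  fold t in Ht. change (forall k, (forall i, cont d M (fun m => RtoC (snd (fst (t k)) i m))) /\
    (forall i m, 0 <= snd (fst (t k)) i m) /\
    (forall m, lsum (seq 0 (fst (fst (t k)))) (fun i => snd (fst (t k)) i m * snd (fst (t k)) i m) = 1) /\
    (forall m, lsum (seq 0 (fst (fst (t k)))) (fun i => snd (fst (t k)) i m) <= 2 ^ d) /\
    (forall i m, snd (fst (t k)) i m <> 0 ->
      dist d (proj1_sig (snd (t k) i)) (proj1_sig m) <= / (INR k + 1))) in Ht.
  (* Stages 0 and 1 keep a single function, as the identity stages of the dilation demand. The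
     choice does not involve [psi], so a single eta serves all of them. *)
  exists (fun k => if (k <? 2)%nat then 1%nat else fst (fst (t k))),
    (fun k => snd (fst (t k))), (fun k => snd (t k)).
  split; [|split; [|split; [|split; [|split]]]].
  - intros k H. destruct (Nat.ltb_spec k 2); [reflexivity|lia].
  - intros k. apply Ht.
  - intros k. apply Ht.
  - intros k m H. destruct (Nat.ltb_spec k 2); [lia|]. apply Ht.
  - intros k m H. destruct (Nat.ltb_spec k 2); [lia|]. apply Ht.
  - intros k i m _. apply Ht.
Qed.

Lemma inv_small eps : 0 < eps -> exists k0 : nat, forall k, (k0 <= k)%nat -> / (INR k + 1) <= eps.
Proof.
  intros He. destruct (INR_unbounded (/ eps)) as [k0 Hk0]. exists k0. intros k Hk.
  apply le_INR in Hk. rewrite <- (Rinv_inv eps). pose proof (Rinv_0_lt_compat _ He).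
  apply Rinv_le_contravar; lra.
Qed.

(** Some g_i is nonzero at [m], so a centre lies near [m]; the value of [h] at this centre is an
    eigenvalue of eta that compact perturbations cannot remove. *)
Lemma eta_calknorm_ge {p : R} {hp : Exponent p} d M (x0 : {x : Pt | M x}) N
  (g : nat -> nat -> {x : Pt | M x} -> R) (ctr : nat -> nat -> {x : Pt | M x}) :
  seq_compact d M -> (1 <= d)%nat ->
  (forall k m, (2 <= k)%nat -> lsum (seq 0 (N k)) (fun i => g k i m * g k i m) = 1) ->
  (forall k i m, (2 <= k)%nat -> g k i m <> 0 ->
    dist d (proj1_sig (ctr k i)) (proj1_sig m) <= / (INR k + 1)) ->
  forall h, cont d M h -> supnorm M h <= calknorm p (etaf M x0 N ctr h).
Proof.
  intros Hc Hd H1 H3 h Hh. pose proof (eta_opb d M Hc x0 N ctr h Hh) as OE.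
  apply supnorm_le; [apply calknorm_ge0; now eexists; exact OE|]. intros m.
  apply le_epsilon; intros eps He.
  destruct (osc_small d M Hd Hc (fun k => / (INR k + 1)) inv_small h eps Hh He) as [k0 Hk0].
  set (k := max 2 k0). specialize (Hk0 k ltac:(unfold k; lia)).
  assert (Hk : (2 <= k)%nat) by (unfold k; lia).
  assert (exists i, (i < N k)%nat /\ g k i m <> 0) as (i & Hi & Hne).
  { apply NNPP; intros Hn. pose proof (H1 k m Hk) as E.
    rewrite (lsum_ext _ _ (fun _ => 0)) in E; [rewrite lsum_zero in E; lra|].
    intros i Hi. apply in_seq in Hi. destruct (Req_dec (g k i m) 0) as [->|Hne]; [ring|].
    exfalso; apply Hn. exists i. split; [lia|assumption]. }
  pose proof (osc_ub d M Hc (fun k => / (INR k + 1)) h k (ctr k i) m Hh (H3 k i m Hk Hne)) as Ho.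
  pose proof (etaop_calknorm_ge N (fun k i => h (ctr k i)) (h x0) k i _ OE Hi) as Hcal.
  assert (Cnorm (h m) <= Cnorm (h (ctr k i)) + Cnorm (Csub (h (ctr k i)) (h m))).
  { eapply Rle_trans; [|apply Cnorm_sub]. right. f_equal. ring. }
  unfold etaf. cbv beta in Hcal. lra.
Qed.

(** Splitting the copies by parity is the similarity; each of the two maps has norm at most 1 + 1,
    whence the 4. *)
Lemma eta_similar {p : R} {hp : Exponent p} d M (x0 : {x : Pt | M x}) N ctr lam : 4 <= lam ->
  similar lam d M (lp p) (lp2 p) (etaf M x0 N ctr)
    (fun h => opsum (etaf M x0 N ctr h) (etaf M x0 N ctr h)).
Proof.
  intros Hlam.
  assert (O0 := opb_half (p := p) 0). assert (O1 := opb_half (p := p) 1).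
  assert (P0 := opb_spread (p := p) 0 ltac:(lia)). assert (P1 := opb_spread (p := p) 1 ltac:(lia)).
  destruct (column_op _ _ _ _ O0 O1) as [C1 C2]. destruct (row_op _ _ _ _ P0 P1) as [R1 R2].
  pose proof (opnorm_col_ge0 _ _ _ _ O0 O1) as C3.
  exists (fun x => (half 0 x, half 1 x)), (fun z => xadd (spread 0 (fst z)) (spread 1 (snd z))).
  split; [|split].
  - split; [exact C1|]. split; [exact R1|]. split.
    + intros x _. apply spread_half.
    + intros [x y] [Hx Hy]. apply (mem_inlp (p := p)) in Hx, Hy. cbn [fst snd] in *. f_equal.
      * apply (half_parts (p := p)); auto.
      * replace (xadd (spread 0 x) (spread 1 y)) with (xadd (spread 1 y) (spread 0 x)) by xext.
        apply (half_parts (p := p)); auto.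
  - eapply Rle_trans; [apply Rmult_le_compat_l; [exact C3|exact R2]|].
    eapply Rle_trans; [apply Rmult_le_compat_r; [lra|exact C2]|]. lra.
  - intros h _ [x y] [Hx Hy]. apply (mem_inlp (p := p)) in Hx, Hy. cbn [fst snd] in *.
    unfold opsum. cbn [fst snd]. unfold etaf. rewrite !half_etaop. f_equal; f_equal.
    + symmetry. apply (half_parts (p := p)); auto.
    + symmetry. replace (xadd (spread 0 x) (spread 1 y)) with (xadd (spread 1 y) (spread 0 x)) by xext.
      apply (half_parts (p := p)); auto.
Qed.

(** Each of the two equal factors is at most 14 B^2 since B >= 1, and (14 B^2)^2 = 3136 (D N)^4
    because B = 2 D N. As D N >= 1, the fourth power is at most the twelfth. *)
Lemma constant_bound n d (N B lam : R) : 1 <= N -> n = (12 * d)%nat -> B = 2 * 2 ^ d * N -> 3136 <= lam ->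
  (B + (1 + B * (6 * B)) + 6 * B) * (6 * B + (1 + B * (6 * B)) + B) <= 2 ^ n * N ^ 12 * lam.
Proof.
  intros HN -> HB Hlam. set (D := 2 ^ d) in *.
  assert (HD : 1 <= D) by (apply pow_R1_Rle; lra).
  assert (HDN : 1 <= D * N) by nra.
  replace (2 ^ (12 * d)) with (D ^ 12) by (unfold D; rewrite <- pow_mult; f_equal; lia).
  rewrite <- Rpow_mult_distr.
  assert (HB1 : 1 <= B) by (rewrite HB; nra).
  assert (H1 : B + (1 + B * (6 * B)) + 6 * B <= 14 * (B * B)) by nra.
  apply Rle_trans with (14 * (B * B) * (14 * (B * B))).
  { apply Rmult_le_compat; nra. }
  replace (14 * (B * B) * (14 * (B * B))) with (3136 * (D * N) ^ 4) by (rewrite HB; ring).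
  assert (H4 : (D * N) ^ 4 <= (D * N) ^ 12) by (apply Rle_pow; [assumption|lia]).
  assert (0 < (D * N) ^ 4) by (apply pow_lt; lra).
  rewrite Rmult_comm. apply Rmult_le_compat; lra.
Qed.

Theorem theorem6p13 :
  forall p : R, 1 < p ->
  exists lam : R, 1 <= lam /\
  forall (d : nat) (M : Pt -> Prop),
    (1 <= d)%nat -> in_Rd d M -> (exists x, M x) -> seq_compact d M ->
    exists eta : Fn M -> Op,
      (* eta is a unital isomorphism C(M) -> B(l^p) *)
      unital_hom p d M eta /\
      (* (i) *)
      (forall h, cont d M h ->
         / lam * supnorm M h <= opnorm (lp p) (lp p) (eta h) /\
         opnorm (lp p) (lp p) (eta h) <= lam * supnorm M h) /\
      (* (ii) *)
      similar lam d M (lp p) (lp2 p) eta (fun h => opsum (eta h) (eta h)) /\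
      (* (iii) *)
      calk_bounded_below p d M eta /\
      (* (iv) *)
      (forall psi : Fn M -> Op,
         calk_unital_hom p d M psi -> calk_bounded p d M psi ->
         exists (S : seqC * seqC -> seqC) (Si : seqC -> seqC * seqC) (psim : Fn M -> Op),
           invertible_pair (lp2 p) (lp p) S Si /\
           (calk_unital_hom p d M psim /\ calk_bounded_below p d M psim) /\
           opnorm (lp2 p) (lp p) S * opnorm (lp p) (lp2 p) Si
             <= 2 ^ (12 * d) * calk_map_norm p d M psi ^ 12 * lam /\
           (forall h, cont d M h ->
              Kp p (opsub p (eta h) (fun x => S (opsum (psi h) (psim h) (Si x)))))).
Proof.
  intros p Hp. pose (hp := Hp : Exponent p). pose proof (radK_ge0 p) as HK.
  (* 3136 comes from [constant_bound] and [1 + 2 * radK p] from the bound on eta; the sum dominates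
     both, exceeds the 4 of [eta_similar], and depends on [p] only. *)
  exists (3136 + 2 * radK p). set (lam := 3136 + 2 * radK p). split; [unfold lam; lra|].
  intros d M Hd _ [x Hx] Hc.
  set (x0 := exist _ x Hx : {x : Pt | M x}).
  destruct (fine_partitions d M x0 Hc Hd) as (N & g & ctr & G1 & G2 & G3 & G4 & G5 & G6).
  exists (etaf M x0 N ctr).
  assert (Hlow : forall h, cont d M h -> supnorm M h <= calknorm p (etaf M x0 N ctr h)).
  { apply (eta_calknorm_ge d M x0 N g ctr); assumption. }
  assert (Hn0 : forall h, cont d M h -> 0 <= supnorm M h).
  { intros h Hh. apply (supnorm_ge0 d); auto. now exists x. }
  split; [now apply eta_unital_hom|]. split; [|split; [|split]].
  - intros h Hh. pose proof (eta_opb d M Hc x0 N ctr h Hh) as OE. specialize (Hn0 h Hh). split.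
    + apply Rle_trans with (1 * supnorm M h).
      * apply Rmult_le_compat_r; [assumption|]. rewrite <- Rinv_1. apply Rinv_le_contravar; unfold lam; lra.
      * rewrite Rmult_1_l. eapply Rle_trans; [now apply Hlow|].
        apply calknorm_opb. eapply opb_opnorm; exact OE.
    + eapply Rle_trans; [apply (opnorm_le _ _ OE)|]. apply Rmult_le_compat_r; unfold lam; lra.
  - apply eta_similar. unfold lam; lra.
  - exists 1, (1 + 2 * radK p). split; [lra|]. split; [lra|]. intros h Hh. rewrite Rmult_1_l.
    split; [now apply Hlow|]. now apply calknorm_opb, (eta_opb d M Hc).
  - intros psi Hpsi Hb.
    destruct (psi_split d M psi Hd Hc x0 Hpsi Hb N g ctr (fun k => / (INR k + 1)) G1 G2 G3 G4 G5 G6 inv_small)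
      as (V & W & HV & HW & HWV & Hgood).
    set (B := 2 * 2 ^ d * calk_map_norm p d M psi) in HV, HW.
    exists (Sop V W), (Sinv V W), (psim M x0 N ctr V W).
    split; [now apply (S_invertible V W B (6 * B))|]. split; [split|split].
    + apply (psim_unital_hom d M Hc x0 N ctr psi (psi_opb d M psi Hpsi) V W B (6 * B)); auto.
      intros h Hh. now apply Hgood.
    + apply (psim_bounded_below d M Hc x0 N ctr V W B (6 * B) HV HW HWV 1); [lra|].
      intros h Hh. rewrite Rmult_1_l. now apply Hlow.
    + eapply Rle_trans; [now apply (S_opnorms V W B (6 * B))|].
      apply (constant_bound _ d); [now apply (map_norm_ge1 d M psi)|reflexivity|reflexivity|unfold lam; lra].
    + intros h Hh. apply (cptR_Kp (p := p)).
      apply (S_conjugates d M Hc x0 N ctr psi (psi_opb d M psi Hpsi) V W B (6 * B)); auto;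
        intros f Hf; now apply Hgood.
Qed.
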